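(* Let $(M,g,\mathcal F)$ and $(M',g',\mathcal F')$ be foliated Riemannian manifolds, let $\phi:(M,\mathcal F)\to(M',\mathcal F')$ be a smooth foliated map, and suppose that all leaves of $\mathcal F$ are compact. Let $\{\phi_t\}$ be a smooth foliated variation of $\phi$ supported in a compact domain $\Omega\subset M$, with normal variation vector field $V=\frac{d\phi_t}{dt}\big|_{t=0}$. Then $$\frac{d}{dt}E_B(\phi_t;\Omega)\Big|_{t=0}=-\int_\Omega\langle V,\tau_b(\phi)\rangle\,\frac{1}{vol_L}\,\mu_M ,$$ where $\langle\cdot,\cdot\rangle$ is the pull-back metric on $\phi^{-1}Q'$.
   Context: A foliated Riemannian manifold $(M,g,\mathcal F)$ is a smooth manifold with a foliation $\mathcal F$ of dimension $p$ and codimension $q$ and a bundle-like metric $g$ (so $\mathcal F$ is a Riemannian foliation). $L\subset TM$ is the tangent bundle of $\mathcal F$, $Q=TM/L$ the normal bundle, $\pi:TM\to Q$ the projection, and $\sigma:Q\to L^\perp$ the bundle map with $\pi\circ\sigma=\mathrm{id}$; $Q$ is identified with $L^\perp$ via $\sigma$, with metric $g_Q(s,t)=g(\sigma(s),\sigma(t))$. The transverse Levi-Civita connection $\nabla$ on $Q$ is given by $\nabla_Xs=\pi([X,\sigma(s)])$ for $X\in\Gamma L$ and $\nabla_Xs=\pi(\nabla^M_X\sigma(s))$ for $X\in\Gamma L^\perp$, where $\nabla^M$ is the Levi-Civita connection of $g$. Corresponding objects on $M'$ carry a prime. A local orthonormal basic frame $\{E_a\}_{a=1}^q$ of $Q$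 is a local orthonormal frame whose elements are projections $\pi(Y)$ of local vector fields $Y$ with $[Y,Z]\in\Gamma L$ for all $Z\in\Gamma L$. A smooth map $\phi:M\to M'$ is foliated if $d\phi(L)\subset L'$. Then $d_T\phi:=\pi'\circ d\phi\circ\sigma:Q\to Q'$ is a section of $Q^*\otimes\phi^{-1}Q'$. Let $\nabla^\phi$ be the pull-back to $\phi^{-1}Q'$ of the transverse Levi-Civita connection of $Q'$, and $\tilde\nabla$ the induced connection on $Q^*\otimes\phi^{-1}Q'$. The transversal tension field is $\tau_b(\phi)=\sum_{a=1}^q(\tilde\nabla_{E_a}d_T\phi)(E_a)\in\Gamma(\phi^{-1}Q')$. For $x\in M$, $vol_L(x)$ is the volume of the leaf of $\mathcal F$ through $x$; $\mu_M$ is the volume element of $M$. For a compact $\Omega\subset M$, the transversal energy of $\phi$ on $\Omega$ is $$E_B(\phi;\Omega)=\frac12\int_\Omega|d_T\phi|^2\frac1{vol_L}\mu_M,\qquad |d_T\phi|^2=\sum_a g_{Q'}(d_T\phi(E_a),d_T\phi(E_a)).$$ A foliated variation of $\phi$ with normal variation vector field $V\in\Gamma(\phi^{-1}Q')$ is a smooth 1-parameter family of foliated maps $\phi_t:M\to M'$ with $\phi_0=\phi$ and $\frac{d\phi_t}{dt}|_{t=0}=V$ (using $Q'\cong L'^\perp$). *)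

(* Defs.v *)
From HB Require Import structures.
From Stdlib Require Relation_Operators.
From mathcomp Require Import all_boot all_order all_algebra.
From mathcomp Require Import all_classical all_reals all_analysis.

Set Implicit Arguments.
Unset Strict Implicit.
Unset Printing Implicit Defensive.
Import Order.TTheory GRing.Theory Num.Theory.
Import numFieldNormedType.Exports.
Local Open Scope classical_set_scope.
Local Open Scope ring_scope.

(* Vectors are rows. R^(p+q) is split as (leaf coordinates, transverse
   coordinates), read off by lsubmx and rsubmx.  In a foliated chart the tangent
   bundle L of the foliation is {v | rsubmx v = 0}, the fibre of Q = TM/L is
   R^q, and the projection pi : TM -> Q is rsubmx.  Sections of bundles over a
   chart are functions of the coordinates u. *)

Section Smooth.
Context {R : realType} {n : nat} {W : normedModType R}.

Fixpoint iter_derive (s : seq 'rV[R]_n) (f : 'rV[R]_n -> W) : 'rV[R]_n -> W :=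
  if s is v :: s' then fun u => 'D_v (iter_derive s' f) u else f.

(* C^infinity on an open set U. *)
Definition smooth_on (U : set 'rV[R]_n) (f : 'rV[R]_n -> W) : Prop :=
  forall s u, U u -> differentiable (iter_derive s f) u.

End Smooth.

Section VectorFields.
Context {R : realType} {p q : nat}.
Implicit Types (U : set 'rV[R]_(p + q)) (X Y : 'rV[R]_(p + q) -> 'rV[R]_(p + q)).

Definition bracket X Y (u : 'rV[R]_(p + q)) : 'rV[R]_(p + q) :=
  'D_(X u) Y u - 'D_(Y u) X u.

Definition leafwise_field U X : Prop :=
  smooth_on U X /\ forall u, U u -> rsubmx (X u) = 0.

Definition foliate_field U Y : Prop :=
  smooth_on U Y /\
  forall Z, leafwise_field U Z -> forall u, U u -> rsubmx (bracket Y Z u) = 0.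

End VectorFields.

Section LocalGeometry.
Context {R : realType} {p q : nat}.
(* the matrix of the metric in a foliated chart *)
Variable G : 'rV[R]_(p + q) -> 'M[R]_(p + q).
Implicit Types (u v w : 'rV[R]_(p + q)) (X Y : 'rV[R]_(p + q) -> 'rV[R]_(p + q)).

Definition gdot u v w : R := (v *m G u *m w^T) 0 0.

(* sigma : Q -> L^perp; the leaf component is determined by orthogonality of
   the result to all (w, 0). *)
Definition sigma u (s : 'rV[R]_q) : 'rV[R]_(p + q) :=
  row_mx (- (s *m dlsubmx (G u) *m invmx (ulsubmx (G u)))) s.

Definition gQ u (s t : 'rV[R]_q) : R := gdot u (sigma u s) (sigma u t).

(* Christoffel symbols Gamma^k_ij X^i Y^j of the Levi-Civita connection. *)
Definition christoffel u v w : 'rV[R]_(p + q) :=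
  2^-1 *: ((\row_l ((w *m 'D_v G u) 0 l + (v *m 'D_w G u) 0 l
                    - (v *m 'D_(delta_mx 0 l) G u *m w^T) 0 0))
           *m invmx (G u)).

Definition levi_civita X Y u : 'rV[R]_(p + q) :=
  'D_(X u) Y u + christoffel u (X u) (Y u).

Definition normal_part X u : 'rV[R]_(p + q) := sigma u (rsubmx (X u)).
Definition leaf_part X u : 'rV[R]_(p + q) := X u - normal_part X u.

(* The transverse Levi-Civita connection: pi [X, sigma s] on Gamma L and
   pi (nabla^M_X (sigma s)) on Gamma L^perp, extended additively in X. *)
Definition nablaQ X (s : 'rV[R]_(p + q) -> 'rV[R]_q) u : 'rV[R]_q :=
  rsubmx (bracket (leaf_part X) (fun w => sigma w (s w)) u)
  + rsubmx (levi_civita (normal_part X) (fun w => sigma w (s w)) u).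

(* E is an orthonormal basic frame of Q in a neighbourhood of u, inside the
   chart domain D. *)
Definition basic_frame (D : set 'rV[R]_(p + q)) u
    (E : 'I_q -> 'rV[R]_(p + q) -> 'rV[R]_q) : Prop :=
  exists U : set 'rV[R]_(p + q), [/\ open U, U u, U `<=` D,
    forall a, exists2 Y, foliate_field U Y
                       & forall w, U w -> E a w = rsubmx (Y w)
  & forall a b w, U w -> gQ w (E a w) (E b w) = (a == b)%:R].

(* Reinhart's condition: g(Y, Z) is constant along the leaves for all foliate
   Y, Z orthogonal to the leaves. *)
Definition bundle_like (D : set 'rV[R]_(p + q)) : Prop :=
  forall (U : set 'rV[R]_(p + q)) X Y Z, open U -> U `<=` D ->
    leafwise_field U X -> foliate_field U Y -> foliate_field U Z ->
    (forall u w, U u -> rsubmx w = 0 -> gdot u (Y u) w = 0) ->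
    (forall u w, U u -> rsubmx w = 0 -> gdot u (Z u) w = 0) ->
    forall u, U u -> 'D_(X u) (fun w => gdot w (Y w) (Z w)) u = 0.

End LocalGeometry.

Section LocalMaps.
Context {R : realType} {p q p' q' : nat}.
Variables (G : 'rV[R]_(p + q) -> 'M[R]_(p + q))
          (G' : 'rV[R]_(p' + q') -> 'M[R]_(p' + q')).
(* coordinate expression of a foliated map *)
Variable f : 'rV[R]_(p + q) -> 'rV[R]_(p' + q').
Implicit Types (u : 'rV[R]_(p + q)) (X : 'rV[R]_(p + q) -> 'rV[R]_(p + q)).

Definition dT u (s : 'rV[R]_q) : 'rV[R]_q' := rsubmx ('D_(sigma G u s) f u).

(* The pull-back connection: for s = sum_b s^b (e_b o f), with e_b the
   coordinate frame of Q', nabla_X s = sum_b X(s^b) e_b + s^b nabla'_{df X} e_b. *)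
Definition nabla_pb X (s : 'rV[R]_(p + q) -> 'rV[R]_q') u : 'rV[R]_q' :=
  'D_(X u) s u + nablaQ G' (cst ('D_(X u) f u)) (cst (s u)) (f u).

Definition nabla_dT X (s : 'rV[R]_(p + q) -> 'rV[R]_q) u : 'rV[R]_q' :=
  nabla_pb X (fun w => dT w (s w)) u - dT u (nablaQ G X s u).

Definition tension_in (E : 'I_q -> 'rV[R]_(p + q) -> 'rV[R]_q) u : 'rV[R]_q' :=
  \sum_a nabla_dT (fun w => sigma G w (E a w)) (E a) u.

Definition dT_sqnorm_in (E : 'I_q -> 'rV[R]_(p + q) -> 'rV[R]_q) u : R :=
  \sum_a gQ G' (f u) (dT u (E a u)) (dT u (E a u)).

End LocalMaps.

(* The smooth structure and the foliation (dimension p, codimension q) are both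
   given by an atlas of foliated charts: transition maps are smooth and their
   differentials preserve {v | rsubmx v = 0}.  chart_at selects a chart around
   each point, in which fibres of bundles at that point are read. *)
Record foliatedManifold (R : realType) (p q : nat) := FoliatedManifold {
  carrier :> ptopologicalType;
  carrier_hausdorff : hausdorff_space carrier;
  carrier_countable : @second_countable carrier;
  chart : Type;
  dom : chart -> set carrier;
  coord : chart -> carrier -> 'rV[R]_(p + q);
  icoord : chart -> 'rV[R]_(p + q) -> carrier;
  chart_at : carrier -> chart;
  dom_chart_at : forall x, dom (chart_at x) x;
  dom_open : forall i, open (dom i);
  cod_open : forall i, open (coord i @` dom i);
  coordK : forall i x, dom i x -> icoord i (coord i x) = x;
  coord_continuous : forall i x, dom i x -> {for x, continuous (coord i)};
  icoord_continuous : forall i u, (coord i @` dom i) u ->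
    {for u, continuous (icoord i)};
  transition_smooth : forall i j,
    smooth_on [set u | (coord i @` dom i) u /\ dom j (icoord i u)]
              (coord j \o icoord i);
  transition_foliated : forall i j u (v : 'rV[R]_(p + q)),
    (coord i @` dom i) u -> dom j (icoord i u) -> rsubmx v = 0 ->
    rsubmx ('D_v (coord j \o icoord i) u) = 0
}.

Arguments dom {R p q} _ _ _.
Arguments coord {R p q} _ _ _.
Arguments icoord {R p q} _ _ _.
Arguments chart_at {R p q} _ _.

Definition cod (R : realType) (p q : nat) (M : foliatedManifold R p q)
  (i : chart M) : set 'rV[R]_(p + q) := coord M i @` dom M i.
Arguments cod {R p q} _ _ _.

Record bundleLikeMetric (R : realType) (p q : nat) (M : foliatedManifold R p q) :=
  BundleLikeMetric {
  gmx :> chart M -> 'rV[R]_(p + q) -> 'M[R]_(p + q);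
  gmx_smooth : forall i, smooth_on (cod M i) (gmx i);
  gmx_sym : forall i u, cod M i u -> (gmx i u)^T = gmx i u;
  gmx_pos : forall i u v, cod M i u -> v != 0 -> 0 < gdot (gmx i) u v v;
  gmx_transition : forall i j u v w, cod M i u -> dom M j (icoord M i u) ->
    gdot (gmx i) u v w =
    gdot (gmx j) (coord M j (icoord M i u))
         ('D_v (coord M j \o icoord M i) u) ('D_w (coord M j \o icoord M i) u);
  gmx_bundle_like : forall i, bundle_like (gmx i) (cod M i)
}.

Section Volume.
Context {R : realType}.

(* Lebesgue integral over R^n of a nonnegative Borel function, as an iterated
   integral (Tonelli). *)
Fixpoint lebesgue_rV (n : nat) : ('rV[R]_n -> \bar R) -> \bar R :=
  match n return ('rV[R]_n -> \bar R) -> \bar R with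
  | 0%N => fun f => f 0
  | m.+1 => fun f => (\int[@lebesgue_measure R]_t
      lebesgue_rV (fun y : 'rV[R]_m => f (row_mx (t%:M : 'rV[R]_1) y)))%E
  end.

(* The Riemannian d-volume of B, from local parametrizations e j, injective on
   the open sets D j, with volume densities h j: the supremum over finite
   disjoint families of Borel pieces of B, each covered by a parametrization.
   On the Borel sets of a second countable manifold this is the Riemannian
   measure. *)
Definition riemannian_volume (T J : Type) (d : nat) (D : J -> set 'rV[R]_d)
    (e : J -> 'rV[R]_d -> T) (h : J -> 'rV[R]_d -> R) (B : set T) : \bar R :=
  ereal_sup [set r | exists (n : nat) (j : 'I_n -> J) (A : 'I_n -> set 'rV[R]_d),
    [/\ forall k, <<s @open 'rV[R]_d >> (A k),
        forall k, A k `<=` D (j k),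
        forall k, e (j k) @` A k `<=` B,
        trivIset setT (fun k => e (j k) @` A k)
      & r = (\sum_(k < n)
              lebesgue_rV (fun u => (h (j k) u * \1_(A k) u)%:E))%E]].

Context {p q : nat} (M : foliatedManifold R p q) (g : bundleLikeMetric M).

Definition borel_of : measurableType _ := g_sigma_algebraType (@open M).

Definition mu_M : set borel_of -> \bar R :=
  @riemannian_volume M (chart M) (p + q) (cod M) (icoord M)
    (fun i u => Num.sqrt (\det (g i u))).

(* x and y lie on the same plaque of a chart. *)
Definition same_plaque (x y : M) : Prop :=
  exists (i : chart M) (c : 'rV[R]_q) (C : set 'rV[R]_(p + q)),
    [/\ dom M i x, dom M i y, connected C, C `<=` cod M i
      & [/\ forall u, C u -> rsubmx u = c, C (coord M i x) & C (coord M i y)]].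

Definition leaf (x : M) : set M :=
  [set y | Relation_Operators.clos_refl_trans M same_plaque x y].

(* Leaf-direction slices {(a, c)} of the charts, with the induced metric. *)
Definition vol_L (x : M) : \bar R :=
  @riemannian_volume M (chart M * 'rV[R]_q) p
    (fun ic => [set a | cod M ic.1 (row_mx a ic.2)])
    (fun ic a => icoord M ic.1 (row_mx a ic.2))
    (fun ic a => Num.sqrt (\det (ulsubmx (g ic.1 (row_mx a ic.2)))))
    (leaf x).

(* a chosen local orthonormal basic frame around x, in the chart chart_at x *)
Definition frame (x : M) : 'I_q -> 'rV[R]_(p + q) -> 'rV[R]_q :=
  get (basic_frame (g (chart_at M x)) (cod M (chart_at M x))
                   (coord M (chart_at M x) x)).

End Volume.

Section Maps.
Context {R : realType} {p q p' q' : nat}.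
Variables (M : foliatedManifold R p q) (M' : foliatedManifold R p' q').

Definition local_expr (phi : M -> M') (i : chart M) (j : chart M') :=
  fun u => coord M' j (phi (icoord M i u)).

Definition smooth_map (phi : M -> M') : Prop :=
  continuous phi /\
  forall i j, smooth_on [set u | cod M i u /\ dom M' j (phi (icoord M i u))]
                        (local_expr phi i j).

Definition foliated_map (phi : M -> M') : Prop :=
  forall i j u (v : 'rV[R]_(p + q)),
    cod M i u -> dom M' j (phi (icoord M i u)) -> rsubmx v = 0 ->
    rsubmx ('D_v (local_expr phi i j) u) = 0.

(* joint smoothness in (t, x), for |t| < eps *)
Definition smooth_family (eps : R) (Phi : R -> M -> M') : Prop :=
  (forall t x, `|t| < eps ->
    {for (t, x), continuous (fun z : R * M => Phi z.1 z.2)}) /\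
  forall i j, smooth_on
    [set w : 'rV[R]_(1 + (p + q)) | [/\ `|lsubmx w 0 0| < eps,
       cod M i (rsubmx w)
     & dom M' j (Phi (lsubmx w 0 0) (icoord M i (rsubmx w)))]]
    (fun w => coord M' j (Phi (lsubmx w 0 0) (icoord M i (rsubmx w)))).

Variables (g : bundleLikeMetric M) (g' : bundleLikeMetric M').

(* The metric of M' and the expression of phi in the charts selected at x and
   phi x; elements of the fibre of phi^{-1}Q' at x are read in the latter. *)
Let G (x : M) := g (chart_at M x).
Let G' (phi : M -> M') (x : M) := g' (chart_at M' (phi x)).
Let pt (x : M) := coord M (chart_at M x) x.
Let expr (phi : M -> M') (x : M) :=
  local_expr phi (chart_at M x) (chart_at M' (phi x)).

Definition tau_b (phi : M -> M') (x : M) : 'rV[R]_q' :=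
  tension_in (G x) (G' phi x) (expr phi x) (frame g x) (pt x).

Definition dT_sqnorm (phi : M -> M') (x : M) : R :=
  dT_sqnorm_in (G x) (G' phi x) (expr phi x) (frame g x) (pt x).

Definition pb_metric (phi : M -> M') (x : M) (V W : 'rV[R]_q') : R :=
  gQ (G' phi x) (coord M' (chart_at M' (phi x)) (phi x)) V W.

Definition E_B (phi : M -> M') (Omega : set M) : R :=
  2^-1 * fine (\int[mu_M g]_(x in (Omega : set (borel_of M)))
                 (dT_sqnorm phi x * (fine (vol_L g x))^-1)%:E)%E.

(* V = d(phi_t)/dt at t = 0, with V x in Q' identified with L'^perp by sigma'. *)
Definition foliated_variation (phi : M -> M') (V : M -> 'rV[R]_q')
    (eps : R) (Phi : R -> M -> M') : Prop :=
  [/\ 0 < eps, smooth_family eps Phi,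
      forall t, `|t| < eps -> foliated_map (Phi t),
      forall x, Phi 0 x = phi x
    & forall x, let j := chart_at M' (phi x) in
        is_derive (0 : R) 1 (fun t => coord M' j (Phi t x))
          (sigma (g' j) (coord M' j (phi x)) (V x))].

Definition supported_in (phi : M -> M') (eps : R) (Phi : R -> M -> M')
    (Omega : set M) : Prop :=
  forall t x, `|t| < eps -> ~ Omega x -> Phi t x = phi x.

End Maps.

(* Main.v *)
(* The derivative at t = 0 of the energy density |d_T phi_t|^2 is 2 (D - <V, tau_b>), where D is the transverse divergence
   of the basic field X dual to s |-> <V, d_T phi(s)>; hence it suffices that D / vol_L has integral 0. The field X vanishes
   outside Omega and is constant along plaques, so it has a local flow on the transversals of a countable family of foliated
   boxes, finitely many of which cover Omega. By uniqueness of integral curves this flow preserves the relation of lying on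
   the same leaf; it multiplies the transverse Riemannian measure by 1 + s D + O(s^2). Give a point of a transversal the
   weight a = (volume of its plaque) / vol_L; over a leaf of finite volume the weights add up to 1. Holonomy preserves the
   transverse measure, so mass transport along the leaves bounds the integral of a by that of a (1 + s D + K s^2) for all
   small s of either sign. Hence a D has integral 0, and so has D / vol_L. Leaves of infinite volume get the weight 0, as
   [fine +oo = 0] and [0^-1 = 0]. *)
From HB Require Import structures.
From mathcomp Require Import all_boot all_order all_algebra perm.
From mathcomp Require Import all_classical all_reals all_analysis measurable_realfun.
From mathcomp Require Import ring lra.
Require Import Defs.
Set Implicit Arguments.
Unset Strict Implicit.
Unset Printing Implicit Defensive.
Import Order.TTheory GRing.Theory Num.Theory.
Import numFieldNormedType.Exports HBNNSimple.
Local Open Scope classical_set_scope.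
Local Open Scope ring_scope.

(** * Lebesgue measure on row vectors *)

(** The factor [1 / vol_L] is only known to be measurable, so the divergence cannot be integrated by
    parts against it. Instead the weight is moved by the flow and integrals are compared: an upper
    bound valid for both signs of the time forces the first-order term to vanish.

    Because one-sided bounds suffice, a one-sided change of variables suffices too. The flow is used
    as a Lipschitz map with a second-order estimate for the difference of two trajectories, which
    replaces its differentiability in the initial point.

    The flow lives on transversals because the dual field is only a section of Q. A leaf that leaves
    [Omega] consists of zeros of the field, so finitely many boxes and one common time are enough.

    In the statement, volumes are suprema over finite families of pieces, Lebesgue measure is an
    iterated integral, and densities are read in selected charts and frames. This is why Lebesgue
    measure on rows, the change of variables formula, countable decompositions of volumes and
    independence of charts all have to be established here. *)

Definition Borel (T : ptopologicalType) : measurableType _ := g_sigma_algebraType (@open T).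
Notation Bset A := (A : set (Borel _)).
Notation borel A := (measurable (Bset A)).

Lemma open_Borel (T : ptopologicalType) (A : set T) :
  open A -> borel A.
Proof. by move=> oA; apply: sub_sigma_algebra. Qed.

Lemma closed_Borel (T : ptopologicalType) (A : set T) :
  closed A -> borel A.
Proof.
move=> cA; rewrite -[A]setCK; apply: measurableC.
by apply: open_Borel; exact: closed_openC.
Qed.

Lemma open_preimage (T T' : topologicalType) (D : set T) (f : T -> T') (O : set T') :
  open D -> (forall x, D x -> {for x, continuous f}) -> open O ->
  open (D `&` f @^-1` O).
Proof.
move=> oD cf oO; rewrite openE => x [Dx Ofx]; apply: filterI.
  by apply: open_nbhs_nbhs; split.
by apply: (cf _ Dx); apply: open_nbhs_nbhs; split.
Qed.

Lemma continuous_Borel (T T' : ptopologicalType) (D : set T) (f : T -> T') :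
  open D -> (forall x, D x -> {for x, continuous f}) ->
  measurable_fun (Bset D) (f : Borel T -> Borel T').
Proof.
move=> oD cf; apply: (@measurability _ _ (Borel T) (Borel T') _ _ (@open T')) => //.
by move=> _ [W oO <-]; apply: open_Borel; exact: open_preimage.
Qed.

Lemma continuous_BorelR (R : realType) (T : ptopologicalType) (D : set T) (f : T -> R) :
  open D -> (forall x, D x -> {for x, continuous f}) ->
  measurable_fun (Bset D) (f : Borel T -> measurableTypeR R).
Proof.
move=> oD cf; apply: (@measurability _ _ (Borel T) (measurableTypeR R) _ _ _ (RGenOInfty.measurableE R)).
move=> _ [_ [x -> <-]]; apply: open_Borel; exact: open_preimage.
Qed.

Lemma BorelR_open (R : realType) (A : set R) : open A -> measurable (A : set (measurableTypeR R)).
Proof. exact: open_measurable. Qed.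

(** Rational centres and radii index a countable base, so preimages of open sets reduce to countable
    unions of preimages of balls. *)
Lemma open_rat_ball (R : realType) n (O : set 'rV[R]_n) : open O ->
  O = \bigcup_(i in [set i : 'rV[rat]_n * rat | ball (map_mx ratr i.1 : 'rV[R]_n) (ratr i.2) `<=` O])
        ball (map_mx ratr i.1 : 'rV[R]_n) (ratr i.2).
Proof.
move=> oO; apply/seteqP; split => [u Ou|u [i /=]]; last by move=> + bu; apply.
have /nbhs_ballP[e /= e0 eO] : nbhs u O by apply: open_nbhs_nbhs; split.
have [r /andP[r0 re]] : exists r : rat, 0 < (ratr r : R) < e / 2.
  have e4 : 0 < e / 4 by lra.
  have [||x [+ [r _ rx]]] := @dense_rat R (ball (e / 4) (e / 4)); rewrite -?rx.
  - by exists (e / 4); exact: ballxx.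
  - exact: ball_open.
  by rewrite /ball/= ltr_norml => H; exists r; lra.
have /choice[z zP] : forall i, exists z : rat, `|u 0 i - ratr z| < ratr r.
  move=> i; have [||x [+ [z _ zx]]] := @dense_rat R (ball (u 0 i) (ratr r)); rewrite -?zx.
  - by exists (u 0 i); exact: ballxx.
  - exact: ball_open.
  by exists z.
exists (\row_i z i, r); last first.
  by split => //= a b; rewrite !mxE /ball /= ord1 distrC zP.
move=> v [_ vz]; apply: eO; split => // a b; rewrite ord1 /ball /=.
have := vz 0 b; rewrite !mxE /ball /= => H1; have := zP b => H2.
have : `|u 0 b - v 0 b| <= `|u 0 b - ratr (z b)| + `|ratr (z b) - v 0 b|.
  by rewrite (le_trans _ (ler_normD _ _))// subrKA.
move=> ?; lra.
Qed.

Lemma measurable_bigcup_countType d (T : measurableType d) (I : countType) (P : set I) (F : I -> set T) :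
  (forall i, P i -> measurable (F i)) -> measurable (\bigcup_(i in P) F i).
Proof.
move=> mF; rewrite bigcup_mkcond; apply: countable_bigcupT_measurable => [|i].
  exact: countableP.
by case: ifPn => // /set_mem; exact: mF.
Qed.

Definition rcons_rV (R : realType) n (z : R * 'rV[R]_n) : 'rV[R]_n.+1 :=
  row_mx (z.1%:M : 'rV[R]_1) z.2.

(** For the sup norm a ball of [R^(n+1)] is an interval times a ball of [R^n], so open sets pull
    back to countable unions of measurable rectangles. This links the Borel algebra of rows to the
    product algebra of Tonelli's theorem. *)
Lemma measurable_rcons_rV (R : realType) n :
  measurable_fun setT (@rcons_rV R n : measurableTypeR R * Borel 'rV[R]_n -> Borel 'rV[R]_n.+1).
Proof.
apply: (@measurability _ _ _ (Borel 'rV[R]_n.+1) _ _ (@open 'rV[R]_n.+1)) => //.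
move=> _ [W oO <-]; rewrite setTI (open_rat_ball oO) preimage_bigcup.
apply: measurable_bigcup_countType => -[z r] /= _.
(* Being in a ball of rows includes the positivity of its radius, so a nonpositive rational radius
   gives the empty set. *)
case: (ltP 0 (ratr r : R)) => r0; last first.
  rewrite (_ : _ @^-1` _ = set0) //; apply/seteqP; split => // -[t y] /= [].
  by rewrite ltNge r0.
rewrite [X in measurable X](_ : _ = (ball (ratr (z 0 0) : R) (ratr r)) `*`
   (ball (map_mx ratr (rsubmx (z : 'rV_(1+n))) : 'rV[R]_n) (ratr r))).
  apply: measurableX; first by apply: BorelR_open; exact: ball_open.
  by apply: open_Borel; exact: ball_open.
apply/seteqP; split => [[t y]|[t y]] /=.
- move=> [_ H]; split.
  + have := H 0 0; rewrite /rcons_rV /= !mxE; case: splitP => // j _.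
    by rewrite ord1 !mxE.
  + split => // a b; have := H 0 (rshift 1 b); rewrite !mxE ord1 /=.
    case: splitP => j /=; first by case: j => -[].
    by move=> [/ord_inj ->].
- move=> [H1 [_ H2]]; split => // a b; rewrite ord1 !mxE /=; case: splitP => j jE.
    by rewrite ord1 mxE (_ : b = 0) ?mulr1n//; apply/val_inj; rewrite /= jE ord1.
  have := H2 0 j; rewrite !mxE; congr ball; congr (ratr (z _ _)); exact/val_inj.
Qed.

Lemma rcons_rVK (R : realType) n (u : 'rV[R]_n.+1) :
  rcons_rV (u 0 0, rsubmx (u : 'rV_(1 + n))) = u.
Proof.
apply: etrans (@hsubmxK _ 1 1 n u); congr (@row_mx R 1 1 n _ _).
by apply/rowP => i; rewrite !ord1 !mxE mulr1n; congr (u _ _); exact/val_inj.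
Qed.

Lemma rV0_all (R : realType) (u : 'rV[R]_0) : u = 0.
Proof. by apply/rowP => -[]. Qed.

Definition cube (R : realType) n (c : 'rV[R]_n) (l : R) : set 'rV[R]_n :=
  [set u | forall i, c 0 i <= u 0 i < c 0 i + l].

Lemma coord_cont (R : realType) n (i : 'I_n) : continuous (fun u : 'rV[R]_n => u 0 i).
Proof. exact: (@matrix_normedtype.coord_continuous R 1 n 0 i). Qed.

Lemma mx_continuous (R : realType) (T : topologicalType) m n (f : T -> 'M[R]_(m, n)) x :
  (forall i j, {for x, continuous (fun y => f y i j)}) -> {for x, continuous f}.
Proof.
move=> cf A [P HP sA].
have : \forall y \near x, forall ij : 'I_m * 'I_n, P ij.1 ij.2 (f y ij.1 ij.2).
  by apply: filter_forall => -[i j]; exact: (cf i j _ (HP i j)).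
by apply: filterS => y H; apply: sA => i j; exact: (H (i, j)).
Qed.

Lemma continuous_sum (R : realType) (V : normedModType R) (T : topologicalType) (I : Type) (r : seq I)
    (P : pred I) (f : I -> T -> V) x :
  (forall i, {for x, continuous (f i)}) -> {for x, continuous (fun y => \sum_(i <- r | P i) f i y)}.
Proof.
move=> cf; elim: r => [|a r IH].
  rewrite (_ : (fun y => _) = cst 0); first exact: cst_continuous.
  by apply/funext => y; rewrite big_nil.
case: (boolP (P a)) => Pa; last first.
  rewrite (_ : (fun y => _) = (fun y => \sum_(i <- r | P i) f i y))//.
  by apply/funext => y; rewrite big_cons (negbTE Pa).
rewrite (_ : (fun y => _) = (f a + fun y => \sum_(i <- r | P i) f i y)); last first.
  by apply/funext => y; rewrite big_cons Pa.
by apply: continuousD => //; exact: cf.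
Qed.

Lemma addr_cont (R : realType) (V : normedModType R) (b : V) : continuous (fun u : V => u + b).
Proof. by move=> u; apply: (@continuousD _ _ _ id (cst b)); [exact: cvg_id|exact: cst_continuous]. Qed.

Lemma measurable_coord (R : realType) n (i : 'I_n) :
  measurable_fun setT (fun u : Borel 'rV[R]_n => u 0 i : measurableTypeR R).
Proof. by apply: continuous_BorelR => [|u _]; [exact: openT|exact: coord_cont]. Qed.

Lemma measurable_cube (R : realType) n (c : 'rV[R]_n) l : borel (cube c l).
Proof.
rewrite (_ : cube c l = \bigcap_(i in [set: 'I_n]) ((fun u : Borel 'rV[R]_n => u 0 i : measurableTypeR R) @^-1` `[c 0 i, c 0 i + l[)).
  apply: fin_bigcap_measurable => // i _; rewrite -[X in measurable X]setTI.
  by apply: measurable_coord => //; exact: measurable_itv.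
apply/seteqP; split => [u H i _ /=|u H i]; first by rewrite in_itv /=; exact: H.
by have := H i I; rewrite /= in_itv.
Qed.

Lemma bigcup_cube (R : realType) n : \bigcup_k cube (const_mx (- k%:R) : 'rV[R]_n) (k%:R *+ 2) = setT.
Proof.
apply/seteqP; split => // u _.
exists (Num.truncn (`|u|)).+1 => // i; rewrite !mxE.
have := truncnS_gt (`|u|); set k := _.+1%:R => uk.
have : `|u 0 i| <= `|u|.
  rewrite /Num.norm/= mx_normrE; apply/bigmax_geP; right.
  by exists (0, i).
rewrite ler_norml; lra.
Qed.

Lemma cubeS (R : realType) n (c : 'rV[R]_n.+1) l (t : R) (y : 'rV[R]_n) :
  cube c l (rcons_rV (t, y)) <-> `[c 0 0, c 0 0 + l[%classic t /\ cube (rsubmx (c : 'rV_(1 + n))) l y.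
Proof.
rewrite /= in_itv /=; split => [H|[H1 H2] i].
  split.
    by have := H 0; rewrite /rcons_rV /= !mxE; case: splitP => // j _; rewrite ord1 mxE mulr1n.
  move=> i; have := H (rshift 1 i); rewrite /rcons_rV /= !mxE.
  case: splitP => j /=; first by case: j => -[].
  by move=> [/ord_inj <-].
rewrite /rcons_rV mxE; case: splitP => j jE.
  by rewrite ord1 mxE mulr1n (_ : i = 0)//; apply/val_inj; rewrite /= jE ord1.
have := H2 j; rewrite !mxE; suff -> : rshift 1 j = i by []. exact/val_inj.
Qed.

Definition pushm d d' (T1 : measurableType d) (T2 : measurableType d') (R : realType)
  (m : {measure set T1 -> \bar R}) (f : T1 -> T2) (mf : measurable_fun setT f) :
  {measure set T2 -> \bar R} :=
  measure_function_pushforward__canonical__measure_function_Measure m mf.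

Lemma pushmE d d' (T1 : measurableType d) (T2 : measurableType d') (R : realType)
  (m : {measure set T1 -> \bar R}) (f : T1 -> T2) (mf : measurable_fun setT f) A :
  pushm m mf A = m (f @^-1` A).
Proof. by []. Qed.

Lemma ge0_integral_pushm d d' (T1 : measurableType d) (T2 : measurableType d') (R : realType)
  (m : {measure set T1 -> \bar R}) (f : T1 -> T2) (mf : measurable_fun setT f) (g : T2 -> \bar R) :
  measurable_fun setT g -> (forall x, 0 <= g x)%E ->
  (\int[pushm m mf]_y g y = \int[m]_x g (f x))%E.
Proof. by move=> mg g0; rewrite (ge0_integral_pushforward mf). Qed.

(** An alias of [mu] to which sigma-finiteness, proved as a proposition, is attached as a structure;
    the product measure of the next dimension asks for the structure. *)
Section with_sigma_finite.
Context d (T : measurableType d) (R : realType) (mu : {measure set T -> \bar R}).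
Definition with_sigma_finite (sf : sigma_finite setT mu) : set T -> \bar R := mu.
Variable sf : sigma_finite setT mu.
HB.instance Definition _ := Measure.on (with_sigma_finite sf).
HB.instance Definition _ :=
  @Measure_isSigmaFinite.Build _ _ _ (with_sigma_finite sf) sf.
End with_sigma_finite.

(** The measure is built by recursion: a Dirac mass in dimension 0, then the image under [rcons_rV]
    of the product with Lebesgue measure on the line, whose integral Tonelli's theorem computes. The
    volume of cubes travels with the induction because it yields sigma-finiteness, which Tonelli's
    theorem consumes at the next dimension. *)
Lemma lebesgue_rV_measure (R : realType) n :
  exists mu : {sigma_finite_measure set (Borel 'rV[R]_n) -> \bar R},
    (forall f : 'rV[R]_n -> \bar R, measurable_fun setT (f : Borel 'rV[R]_n -> \bar R) ->
      (forall u, 0 <= f u)%E -> lebesgue_rV f = (\int[mu]_u f u)%E) /\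
    (forall c l, 0 <= l -> mu (cube c l) = (l ^+ n)%:E).
Proof.
elim: n => [|n [mu [IH muc]]].
  exists (dirac (0 : Borel 'rV[R]_0)); split => [f mf f0|c l l0].
    by rewrite /= integral_dirac// diracT mul1e.
  by rewrite /= diracE mem_set ?expr0// => -[].
pose m := pushm (lebesgue_measure \x mu)%E (@measurable_rcons_rV R n).
have mc c l : 0 <= l -> m (cube c l) = (l ^+ n.+1)%:E.
  move=> l0; rewrite /m pushmE.
  rewrite (_ : _ @^-1` _ = `[c 0 0, c 0 0 + l[%classic `*` cube (rsubmx (c : 'rV_(1 + n))) l); last first.
    by apply/seteqP; split => -[t y] /cubeS.
  apply: etrans (@product_measure1E _ _ (measurableTypeR R) (Borel 'rV[R]_n) R lebesgue_measure mu _ _ _ _) _.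
  - exact: measurable_itv.
  - exact: measurable_cube.
  have e1 : lebesgue_measure (`[c 0 0, c 0 0 + l[%classic : set (measurableTypeR R)) = l%:E.
    rewrite lebesgue_measure_itv/= lte_fin ltrDl; case: ltP => l1.
      by rewrite -EFinB addrAC subrr add0r.
    by congr EFin; apply/eqP; rewrite eq_le l1 l0.
  by rewrite muc// [X in (X * _)%E]e1 -EFinM exprS.
have sf : sigma_finite setT m.
  exists (fun k => cube (const_mx (- k%:R)) (k%:R *+ 2)); first by rewrite bigcup_cube.
  move=> k; split; first exact: measurable_cube.
  by rewrite mc ?ltry// mulrn_wge0.
exists (with_sigma_finite sf); split => // f mf f0 /=.
rewrite -[RHS]/(\int[m]_u f u)%E ge0_integral_pushm//.
have mfr := measurableT_comp mf (@measurable_rcons_rV R n).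
rewrite (@fubini_tonelli1 _ _ (measurableTypeR R) (Borel 'rV[R]_n) R lebesgue_measure mu (fun z => f (rcons_rV z)))//.
apply: eq_integral => t _; rewrite IH//.
exact: (measurable_fun_pair2 t mfr).
Qed.

Definition lam (R : realType) n : {sigma_finite_measure set (Borel 'rV[R]_n) -> \bar R} :=
  projT1 (cid (@lebesgue_rV_measure R n)).

Lemma lebesgue_rVE (R : realType) n (f : 'rV[R]_n -> \bar R) :
  measurable_fun setT (f : Borel 'rV[R]_n -> \bar R) -> (forall u, 0 <= f u)%E ->
  lebesgue_rV f = (\int[lam R n]_u f u)%E.
Proof. by rewrite /lam; case: cid => mu [/= H _]; exact: H. Qed.

Lemma lam_cube (R : realType) n (c : 'rV[R]_n) l : 0 <= l -> lam R n (cube c l) = (l ^+ n)%:E.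
Proof. by rewrite /lam; case: cid => mu [/= _ H]; exact: H. Qed.

Lemma lam_recl (R : realType) n (f : 'rV[R]_n.+1 -> \bar R) :
  measurable_fun setT (f : Borel 'rV[R]_n.+1 -> \bar R) -> (forall u, 0 <= f u)%E ->
  (\int[lam R n.+1]_u f u = \int[lebesgue_measure \x lam R n]_z f (rcons_rV z))%E.
Proof.
move=> mf f0; rewrite -lebesgue_rVE//=.
have mfr := measurableT_comp mf (@measurable_rcons_rV R n).
rewrite (@fubini_tonelli1 _ _ (measurableTypeR R) (Borel 'rV[R]_n) R lebesgue_measure (lam R n) (fun z => f (rcons_rV z)))//.
apply: eq_integral => t _; rewrite lebesgue_rVE//.
exact: (measurable_fun_pair2 t mfr).
Qed.

(** Lebesgue measure is determined by its values on half-open intervals, and there it is compared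
    with [|a|] times the image measure. For negative [a] the preimage of an interval is closed at
    the other end, which does not change its length. *)
Lemma lebesgue_affine (R : realType) (a b : R) (g : R -> \bar R) : a != 0 ->
  measurable_fun setT (g : measurableTypeR R -> \bar R) -> (forall t, 0 <= g t)%E ->
  ((`|a|)%:E * \int[lebesgue_measure]_t g ((t : R) * a + b)%R = \int[lebesgue_measure]_t g t)%E.
Proof.
move=> a0 mg g0.
have mf : measurable_fun setT (fun t : measurableTypeR R => t * a + b : measurableTypeR R).
  by apply: measurable_funD => //; apply: measurable_funM.
pose m := mscale (NngNum (normr_ge0 a)) (pushm lebesgue_measure mf).
have mitv x y (i : interval R) : (fun t => t * a + b) @^-1` `]x, y] = [set` i] ->
    m `]x, y]%classic = ((`|a|)%:E * (if i.1 < i.2 then (i.2 : \bar R) - i.1 else 0))%E.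
  by move=> e; rewrite -lebesgue_measure_itv -e.
have mE : forall X, measurable X -> lebesgue_measure X = m X.
  apply: lebesgue_measure_unique => _ [[x y] _ <-] /=.
  apply: (etrans (lebesgue_measure_itv _)) => /=.
  have [xy|yx] := ltP x y; last first.
    rewrite lte_fin ltNge yx/= set_itv_ge ?bnd_simp -?leNgt//.
  rewrite lte_fin xy.
  have [a1|a1] := ltP 0 a.
    apply: (etrans _ (esym (mitv _ _ `](x - b) / a, (y - b) / a] _))); last first.
      by apply/seteqP; split => t /=; rewrite !in_itv/= ltr_pdivrMr// ler_pdivlMr//; lra.
    rewrite /= lte_fin ltr_pM2r ?invr_gt0// ltrD2r xy -EFinB -EFinM gtr0_norm//.
    congr EFin; field => //.
  have {}a1 : a < 0 by rewrite lt_neqAle a0.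
  apply: (etrans _ (esym (mitv _ _ `[(y - b) / a, (x - b) / a[ _))); last first.
    by apply/seteqP; split => t /=; rewrite !in_itv/= ltr_ndivlMr// ler_ndivrMr//; lra.
  rewrite /= lte_fin ltr_nM2r ?invr_lt0// ltrD2r xy -EFinB -EFinM ltr0_norm//.
  congr EFin; field => //.
rewrite [RHS](eq_measure_integral m) => [|X mX _]; last exact: mE.
by rewrite ge0_integral_mscale// ge0_integral_pushm.
Qed.

(** * Linear changes of variables *)

Section linear_change.
Variable R : realType.

Definition bfun n (f : 'rV[R]_n -> \bar R) :=
  measurable_fun setT (f : Borel 'rV[R]_n -> \bar R) /\ (forall u, 0 <= f u)%E.

Lemma bfun_cont n m (f : 'rV[R]_m -> \bar R) (h : 'rV[R]_n -> 'rV[R]_m) :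
  continuous h -> bfun f -> bfun (f \o h).
Proof.
move=> ch [mf f0]; split => [|u]; last exact: f0.
by apply: measurableT_comp mf _; apply: continuous_Borel => [|u _]; [exact: openT|exact: ch].
Qed.

Lemma rcons_rVD n (z : R * 'rV[R]_n) (u : 'rV[R]_n.+1) :
  rcons_rV z + u = rcons_rV (z.1 * 1 + u 0 0, z.2 + rsubmx (u : 'rV_(1 + n))).
Proof.
apply: (etrans (congr1 (fun v => _ + v) (esym (rcons_rVK u)))).
apply: etrans (@add_row_mx R 1 1 n _ _ _ _) _; congr (@row_mx R 1 1 n _ _).
by rewrite /= mulr1 -raddfD.
Qed.

Lemma bfun_pair2 n (f : 'rV[R]_n.+1 -> \bar R) t : bfun f -> bfun (fun y => f (rcons_rV (t, y))).
Proof.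
move=> [mf f0]; split => [|y]; last exact: f0.
exact: (measurable_fun_pair2 t (measurableT_comp mf (@measurable_rcons_rV R n))).
Qed.

Lemma bfun_pair1 n (f : 'rV[R]_n.+1 -> \bar R) y : bfun f ->
  measurable_fun setT (fun t : measurableTypeR R => f (rcons_rV (t, y))).
Proof.
move=> [mf f0].
have mm := measurableT_comp mf (@measurable_rcons_rV R n).
exact: (@measurable_fun_pair1 _ _ _ (measurableTypeR R) (Borel 'rV[R]_n) _ _ y mm).
Qed.

Lemma lam_rec12 n (f : 'rV[R]_n.+1 -> \bar R) : bfun f ->
  (\int[lam R n.+1]_u f u = \int[lebesgue_measure]_t \int[lam R n]_y f (rcons_rV (t, y)))%E.
Proof.
move=> [mf f0]; rewrite lam_recl//.
apply: (@fubini_tonelli1 _ _ (measurableTypeR R) (Borel 'rV[R]_n) R lebesgue_measure (lam R n) (fun z => f (rcons_rV z))) => //.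
exact: (measurableT_comp mf (@measurable_rcons_rV R n)).
Qed.

Lemma lam_rec21 n (f : 'rV[R]_n.+1 -> \bar R) : bfun f ->
  (\int[lam R n.+1]_u f u = \int[lam R n]_y \int[lebesgue_measure]_t f (rcons_rV (t, y)))%E.
Proof.
move=> [mf f0]; rewrite lam_recl//.
apply: (@fubini_tonelli2 _ _ (measurableTypeR R) (Borel 'rV[R]_n) R lebesgue_measure (lam R n) (fun z => f (rcons_rV z))) => //.
exact: (measurableT_comp mf (@measurable_rcons_rV R n)).
Qed.

Lemma bfun_fubini n (f : 'rV[R]_n.+1 -> \bar R) : bfun f ->
  measurable_fun setT (fun t : measurableTypeR R => \int[lam R n]_y f (rcons_rV (t, y)))%E.
Proof.
move=> [mf f0].
apply: (@measurable_fun_fubini_tonelli_F _ _ (measurableTypeR R) (Borel 'rV[R]_n) R (lam R n) (fun z => f (rcons_rV z))) => //.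
exact: (measurableT_comp mf (@measurable_rcons_rV R n)).
Qed.

Lemma lam_shift n (b : 'rV[R]_n) (f : 'rV[R]_n -> \bar R) : bfun f ->
  (\int[lam R n]_u f ((u : 'rV[R]_n) + b)%R = \int[lam R n]_u f u)%E.
Proof.
elim: n b f => [|n IH] b f bf.
  by apply: eq_integral => u _; rewrite (rV0_all u) (rV0_all b) (rV0_all (0 + 0)).
have cs : continuous (fun u : 'rV[R]_n.+1 => u + b) by exact: addr_cont.
rewrite (lam_rec12 (bfun_cont cs bf)) (lam_rec12 bf) /=.
transitivity (\int[lebesgue_measure]_t \int[lam R n]_y f (rcons_rV (((t : R) * 1 + b 0 0)%R, y)))%E.
  apply: eq_integral => t _.
  rewrite -(IH (rsubmx (b : 'rV_(1 + n))) (fun y => f (rcons_rV (t * 1 + b 0 0, y)))); last exact: bfun_pair2.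
  by apply: eq_integral => y _; rewrite rcons_rVD.
rewrite -[RHS](@lebesgue_affine R 1 (b 0 0))//.
- by rewrite normr1 mul1e.
- exact: bfun_fubini.
- by move=> t; apply: integral_ge0 => y _; exact: bf.2.
Qed.

(** The change of variables formula for one matrix, isolated because it is stable under products and
    can thus be checked on elementary factors. *)
Definition lin_scales n (A : 'M[R]_n) := forall f, bfun f ->
  ((`|\det A|)%:E * \int[lam R n]_u f ((u : 'rV[R]_n) *m A)%R = \int[lam R n]_u f u)%E.

Lemma mulmxr_cont m n (A : 'M[R]_(m, n)) : continuous (fun u : 'rV[R]_m => u *m A).
Proof.
move=> u; apply: mx_continuous => i j; rewrite ord1.
rewrite (_ : (fun y : 'rV[R]_m => _) = fun y : 'rV[R]_m => \sum_k y 0 k * A k j); last first.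
  by apply/funext => y; rewrite mxE.
apply: continuous_sum => k; apply: (@continuousM _ _ (fun y : 'rV[R]_m => y 0 k) (cst (A k j))).
  exact: coord_cont.
exact: cst_continuous.
Qed.

Lemma lin_scalesM n (A B : 'M[R]_n) : lin_scales A -> lin_scales B -> lin_scales (A *m B).
Proof.
move=> hA hB f bf; rewrite det_mulmx normrM mulrC EFinM -muleA -[RHS]hB//.
have bg := bfun_cont (@mulmxr_cont _ _ B) bf.
congr (_ * _)%E; rewrite -[RHS](hA _ bg)//; congr (_ * _)%E.
by apply: eq_integral => u _ /=; rewrite mulmxA.
Qed.

Lemma rcons_rV_mul n (z : R * 'rV[R]_n) (a : R) (b : 'rV[R]_n) (c : 'cV[R]_n) (S : 'M[R]_n) :
  rcons_rV z *m (block_mx (a%:M : 'M[R]_1) b c S : 'M[R]_(1 + n)) =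
  rcons_rV (z.1 * a + (z.2 *m c) 0 0, z.1 *: b + z.2 *m S).
Proof.
apply: etrans (@mul_row_block R 1 1 n 1 n _ _ _ _ _ _) _.
congr (@row_mx R 1 1 n _ _) => /=; last by rewrite mul_scalar_mx.
by rewrite -scalar_mxM raddfD/= -mx11_scalar.
Qed.

(** For a fixed first coordinate [t] the shear translates the remaining coordinates, so these are
    integrated first. The lower shear translates [t] instead, which asks for the opposite order of
    integration. *)
Lemma lin_scales_upper n (b : 'rV[R]_n) :
  lin_scales (block_mx (1%:M : 'M[R]_1) b 0 1%:M : 'M[R]_(1 + n)).
Proof.
move=> f bf; rewrite det_ublock !det1 mul1r normr1 mul1e.
rewrite (lam_rec12 (bfun_cont (@mulmxr_cont _ _ _) bf)) (lam_rec12 bf) /=.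
apply: eq_integral => t _; rewrite -[RHS](lam_shift (t *: b))//; last exact: bfun_pair2.
apply: eq_integral => y _; rewrite rcons_rV_mul/= mulr1 mulmx0 mxE addr0 mulmx1.
by rewrite addrC.
Qed.

Lemma lin_scales_lower n (c : 'cV[R]_n) :
  lin_scales (block_mx (1%:M : 'M[R]_1) 0 c 1%:M : 'M[R]_(1 + n)).
Proof.
move=> f bf; rewrite det_lblock !det1 mul1r normr1 mul1e.
rewrite (lam_rec21 (bfun_cont (@mulmxr_cont _ _ _) bf)) (lam_rec21 bf) /=.
apply: eq_integral => y _.
rewrite -[RHS](@lebesgue_affine R 1 ((y *m c) 0 0))//; last 2 first.
- exact: bfun_pair1.
- by move=> t; exact: bf.2.
rewrite normr1 mul1e.
by apply: eq_integral => t _; rewrite rcons_rV_mul/= mulmx1 scaler0 add0r.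
Qed.

Lemma lin_scales_diag n (a : R) (S : 'M[R]_n) : a != 0 -> lin_scales S ->
  lin_scales (block_mx (a%:M : 'M[R]_1) 0 0 S : 'M[R]_(1 + n)).
Proof.
move=> a0 hS f bf; rewrite det_ublock det_scalar1 normrM EFinM -muleA.
rewrite (lam_rec12 (bfun_cont (@mulmxr_cont _ _ _) bf)) (lam_rec12 bf) /=.
rewrite -[RHS](@lebesgue_affine R a 0)//; last 2 first.
- exact: bfun_fubini.
- by move=> t; apply: integral_ge0 => y _; exact: bf.2.
congr (_ * _)%E; rewrite -ge0_integralZl//; last 2 first.
- exact: bfun_fubini (bfun_cont (@mulmxr_cont _ _ (block_mx (a%:M : 'M[R]_1) 0 0 S : 'M[R]_(1 + n))) bf).
- by move=> t _; apply: integral_ge0 => y _; exact: bf.2.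
apply: eq_integral => t _; rewrite -[RHS]hS; last exact: bfun_pair2.
congr (_ * _)%E; apply: eq_integral => y _; rewrite rcons_rV_mul/=.
by rewrite mulmx0 mxE scaler0 add0r.
Qed.

(** Gaussian elimination in block form: a matrix with nonzero corner entry is a lower shear times a
    block diagonal matrix times an upper shear, and the Schur complement on the diagonal is
    invertible of smaller size. *)
Lemma lin_scales_unit n (A : 'M[R]_n) : A \in unitmx -> lin_scales A.
Proof.
elim: n A => [|n IH] A Au.
  move=> f bf; rewrite det_mx00 normr1 mul1e; apply: eq_integral => u _.
  by rewrite (rV0_all u) mul0mx.
have pivot (B : 'M[R]_(1 + n)) : B \in unitmx -> B 0 0 != 0 -> lin_scales B.
  move=> Bu B0; set a := B 0 0.
  pose b := ursubmx B; pose c := dlsubmx B; pose D := drsubmx B.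
  have ulE : ulsubmx B = a%:M.
    by rewrite [LHS]mx11_scalar mxE mxE; congr (B _ _)%:M; exact/val_inj.
  pose S := D - a^-1 *: (c *m b).
  have BE : B = block_mx 1%:M 0 (a^-1 *: c) 1%:M *m (block_mx a%:M 0 0 S *m block_mx 1%:M (a^-1 *: b) 0 1%:M).
    rewrite !mulmx_block !(mul1mx, mulmx1, mul0mx, mulmx0, addr0, add0r).
    rewrite -[LHS]submxK ulE -!/b -!/c -!/D; congr block_mx.
    - by rewrite mul_scalar_mx scalerA mulfV// scale1r.
    - by rewrite mul_mx_scalar scalerA mulfV// scale1r.
    - by rewrite mul_scalar_mx scalerA mulfV// scale1r -scalemxAl /S addrC subrK.
  have Su : S \in unitmx.
    move: Bu; rewrite BE !unitmx_mul => /andP[_ /andP[+ _]].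
    by rewrite !unitmxE det_ublock unitrM => /andP[_].
  rewrite BE; apply: lin_scalesM; first exact: lin_scales_lower.
  apply: lin_scalesM; last exact: lin_scales_upper.
  by apply: lin_scales_diag => //; exact: IH.
have [A0|A0] := eqVneq ((A : 'M[R]_(1 + n)) 0 0) 0; last exact: pivot.
have [k Ak] : exists k : 'I_n, (A : 'M[R]_(1 + n)) (rshift 1 k) 0 != 0.
  apply/existsP; apply: contraT => /existsPn H.
  suff : A *m delta_mx 0 (0 : 'I_1) = 0.
    move=> /(congr1 (fun B => invmx A *m B)); rewrite mulKmx// mulmx0 => /matrixP/(_ 0 0).
    by rewrite !mxE !eqxx => /eqP; rewrite oner_eq0.
  rewrite -colE; apply/colP => i; rewrite !mxE.
  have [->//|i0] := eqVneq i 0.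
  have [j ->] : exists j : 'I_n, i = rshift 1 j.
    case: (splitP (i : 'I_(1 + n))) => j ij; last by exists j; exact/val_inj.
    by move/eqP: i0; case; apply/val_inj; rewrite /= ij ord1.
  by apply/eqP; rewrite -[_ == _]negbK; exact: H.
(* Adding row [k] to the first row puts a nonzero entry in the corner; the inverse shear [U (- b)]
   is of a kind already treated. *)
pose b : 'rV[R]_n := delta_mx 0 k.
pose U b : 'M[R]_(1 + n) := block_mx (1%:M : 'M[R]_1) b 0 1%:M.
have UK : U (- b) *m U b = 1%:M.
  rewrite /U mulmx_block !(mul1mx, mulmx1, mul0mx, mulmx0, addr0, add0r).
  by rewrite subrr -scalar_mx_block.
have -> : A = U (- b) *m (U b *m A) by rewrite mulmxA UK mul1mx.
apply: lin_scalesM; first exact: lin_scales_upper.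
apply: pivot.
  rewrite unitmx_mul Au andbT unitmxE det_ublock !det1 mul1r unitr1//.
have -> : (U b *m A) 0 0 = (A : 'M[R]_(1 + n)) (rshift 1 k) 0.
  have z : (0 : 'I_(1 + n)) = lshift n 0 by exact/val_inj.
  rewrite mxE (@big_split_ord _ _ _ 1 n) big_ord1 /= /U -z A0 mulr0 add0r.
  rewrite (bigD1 k)//= {1}z block_mxEur mxE !eqxx mul1r big1 ?addr0// => j jk.
  by rewrite z block_mxEur mxE (negbTE jk) mul0r.
exact: Ak.
Qed.

Lemma lam_linear_image n (A : 'M[R]_n) (b : 'rV[R]_n) (X : set 'rV[R]_n) :
  A \in unitmx -> borel X ->
  borel ((fun u => u *m A + b) @` X) /\
  lam R n ((fun u => u *m A + b) @` X) = ((`|\det A|)%:E * lam R n X)%E.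
Proof.
move=> Au mX; set Y := _ @` _.
have YE : Y = (fun u => (u - b) *m invmx A) @^-1` X.
  apply/seteqP; split => [_ [u Xu <-] /=|u /= Xu]; first by rewrite addrK mulmxK.
  by exists ((u - b) *m invmx A) => //; rewrite mulmxKV// subrK.
have cg : continuous (fun u : 'rV[R]_n => (u - b) *m invmx A).
  move=> u; apply: (@continuous_comp _ _ _ (fun u : 'rV[R]_n => u - b) (fun u => u *m invmx A)); last exact: mulmxr_cont.
  exact: addr_cont.
have mY : borel Y.
  have mg := continuous_Borel openT (fun u _ => cg u).
  by rewrite YE -[X in measurable X]setTI; exact: (mg measurableT _ mX).
split => //.
have ind (Z : set 'rV[R]_n) : borel Z -> bfun (fun u => (\1_Z u)%:E).
  by move=> mZ; split => [|u]; [apply/measurable_EFinP; exact: measurable_indic|rewrite lee_fin].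
rewrite -[Y in LHS]setIT -(integral_indic _ _ mY)//.
rewrite -(lin_scales_unit Au (ind _ mY)) -[X in RHS]setIT -(integral_indic _ _ mX)//.
congr (_ * _)%E.
pose g := (fun u : 'rV[R]_n => (\1_X ((u - b *m invmx A)%R))%:E : \bar R).
transitivity (\int[lam R n]_u g u)%E.
  apply: eq_integral => u _; rewrite /g !indicE.
  suff -> : (u *m A \in Y) = (u - b *m invmx A \in X) by [].
  by apply/idP/idP; rewrite !inE YE /= mulmxBl mulmxK.
by apply: (lam_shift (- (b *m invmx A)) (ind _ mX)).
Qed.

End linear_change.

Lemma ecvg_gt (R : realType) (u : (\bar R)^nat) (l a : \bar R) : u @ \oo --> l -> (a < l)%E ->
  exists k, (a < u k)%E.
Proof.
move=> cu al; have : nbhs l [set y | (a < y)%E].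
  by apply: open_nbhs_nbhs; split => //; exact: open_ereal_gt_ereal.
by move=> /cu[k _ H]; exists k; exact: (H k (leqnn k)).
Qed.

Lemma ecvg_lt (R : realType) (u : (\bar R)^nat) (l a : \bar R) : u @ \oo --> l -> (l < a)%E ->
  exists k, (u k < a)%E.
Proof.
move=> cu al; have : nbhs l [set y | (y < a)%E].
  by apply: open_nbhs_nbhs; split => //; exact: open_ereal_lt_ereal.
by move=> /cu[k _ H]; exists k; exact: (H k (leqnn k)).
Qed.

(** * Measures with a density and regularity of finite measures *)

Section mdens.
Context d (T : measurableType d) (R : realType) (mu : {measure set T -> \bar R}) (f : T -> R).

Definition mdens (mf : measurable_fun setT f) (f0 : forall x, 0 <= f x) (A : set T) : \bar R :=
  (\int[mu]_(x in A) (f x)%:E)%E.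

Variables (mf : measurable_fun setT f) (f0 : forall x, 0 <= f x).
Let mEf : measurable_fun setT (EFin \o f). Proof. exact/measurable_EFinP. Qed.

Let mdens_0 : mdens mf f0 set0 = 0%E. Proof. exact: integral_set0. Qed.
Let mdens_ge0 A : (0 <= mdens mf f0 A)%E. Proof. by apply: integral_ge0 => x _; rewrite lee_fin. Qed.
Let mdens_add : semi_sigma_additive (mdens mf f0).
Proof.
move=> F mF tF mUF; rewrite /mdens ge0_integral_bigcup//; last 2 first.
- exact: measurable_funS mEf.
- by move=> x _; rewrite lee_fin.
by apply: is_cvg_nneseries => n _ _; apply: integral_ge0 => x _; rewrite lee_fin.
Qed.
HB.instance Definition _ := isMeasure.Build _ _ _ (mdens mf f0) mdens_0 mdens_ge0 mdens_add.

Lemma integral_mdens_nnsfun (h : {nnsfun T >-> R}) :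
  (\int[mdens mf f0]_x (h x)%:E = \int[mu]_x ((h x)%:E * (f x)%:E))%E.
Proof.
under [LHS]eq_integral do rewrite fimfunE -fsumEFin//.
rewrite ge0_integral_fsum//; last 2 first.
- by move=> r; apply/measurable_EFinP; apply: measurable_funM.
- by move=> r x _; rewrite EFinM nnfun_muleindic_ge0.
transitivity (\int[mu]_x (\sum_(r \in range h) (r * \1_(h @^-1` [set r]) x)%:E * (f x)%:E))%E; last first.
  apply: eq_integral => x _; rewrite fimfunE -fsumEFin// ge0_mule_fsuml// => r.
  by rewrite EFinM nnfun_muleindic_ge0.
rewrite ge0_integral_fsum//; last 2 first.
- move=> r; apply: emeasurable_funM => //; apply/measurable_EFinP; exact: measurable_funM.
- by move=> r x _; apply: mule_ge0; [rewrite EFinM nnfun_muleindic_ge0|rewrite lee_fin].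
apply: eq_fsbigr => r _.
have [r0|r0] := ltP r 0.
  rewrite preimage_nnfun0//; rewrite !integral0_eq// => x _; by rewrite indic0 mulr0 ?mul0e.
under eq_integral do rewrite EFinM.
rewrite ge0_integralZl//; last by apply/measurable_EFinP.
under [RHS]eq_integral do rewrite EFinM -muleA.
rewrite [RHS]ge0_integralZl//; last 2 first.
- by apply: emeasurable_funM => //; apply/measurable_EFinP.
- by move=> x _; rewrite mule_ge0// lee_fin.
congr (_ * _)%E; rewrite integral_indic// setIT /= /mdens integral_mkcond.
apply: eq_integral => x _; rewrite patchE indicE; case: ifPn => _; by rewrite ?mul1e ?mul0e.
Qed.

Lemma integral_mdens (g : T -> \bar R) : measurable_fun setT g -> (forall x, 0 <= g x)%E ->
  (\int[mdens mf f0]_x g x = \int[mu]_x (g x * (f x)%:E))%E.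
Proof.
move=> mg g0; pose h := nnsfun_approx measurableT mg.
have hcv x : (fun k => (h k x)%:E) @ \oo --> g x by exact: cvg_nnsfun_approx.
have hnd x : {homo (fun n => (h n x)%:E) : m n / (m <= n)%N >-> (m <= n)%E}.
  by move=> m n mn; rewrite lee_fin; exact/lefP/nd_nnsfun_approx.
rewrite -(eq_integral _ _ (fun x _ => cvg_lim (@ereal_hausdorff R) (hcv x))).
rewrite monotone_convergence//; last 2 first.
- by move=> k; apply/measurable_EFinP.
- by move=> k x _; rewrite lee_fin.
under eq_fun do rewrite integral_mdens_nnsfun.
rewrite -monotone_convergence//; last 3 first.
- by move=> k; apply: emeasurable_funM => //; apply/measurable_EFinP.
- by move=> k x _; rewrite mule_ge0// lee_fin.
- by move=> x _ m k mk; rewrite lee_wpmul2r ?lee_fin// -lee_fin hnd.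
by apply: eq_integral => x _; apply/cvg_lim => //; apply: cvgeZr.
Qed.
End mdens.

(** Both integrals are suprema over the same simple functions, on which the inequality holds term by
    term. *)
Lemma le_measure_integral d (T : measurableType d) (R : realType)
    (s t : {measure set T -> \bar R}) (f : T -> \bar R) :
  (forall A, measurable A -> s A <= t A)%E -> (forall x, 0 <= f x)%E ->
  (\int[s]_x f x <= \int[t]_x f x)%E.
Proof.
move=> st f0; rewrite !ge0_integralTE//; apply: ge_ereal_sup => _ [h hf <-].
apply: (@le_trans _ _ (sintegral t (h : T -> R))); last by apply: ereal_sup_ubound; exists h.
rewrite !sintegralE; apply: lee_fsum => // r rr.
have [r0|r0] := leP 0 r; first by rewrite lee_wpmul2l// st.
by rewrite preimage_nnfun0// !measure0.
Qed.

Section regularity.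
Context (R : realType) (n : nat) (mu : {measure set (Borel 'rV[R]_n) -> \bar R}).
Local Notation V := 'rV[R]_n.
Hypothesis mufin : (mu setT < +oo)%E.

Definition regular (A : set V) := borel A /\ forall e : R, 0 < e ->
  exists F O : set V, [/\ closed F, open O, F `<=` A, A `<=` O & (mu (O `\` F) < e%:E)%E].

Lemma measure_lty (A : set V) : borel A -> (mu A < +oo)%E.
Proof. by move=> mA; apply: le_lt_trans mufin; apply: le_measure; rewrite ?inE. Qed.

Lemma regular_open (A : set V) : open A -> regular A.
Proof.
move=> oA; split; first exact: open_Borel.
move=> e e0.
(* [F k] collects the points at distance at least [1 / (k + 1)] from the complement of [A]; these
   closed sets increase to the open set [A]. *)
pose F k := ~` [set x : V | exists2 y, ~ A y & `|x - y| < k.+1%:R^-1].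
have cF k : closed (F k).
  rewrite /F -openC setCK openE => x [y Ay xy].
  have d0 : 0 < k.+1%:R^-1 - `|x - y| by rewrite subr_gt0.
  apply/nbhs_ballP; exists (k.+1%:R^-1 - `|x - y|) => //= z; rewrite -ball_normE /= => xz.
  exists y => //; rewrite (_ : z - y = (z - x) + (x - y)); last by rewrite addrA subrK.
  by rewrite (le_lt_trans (ler_normD _ _))// -ltrBrDr distrC.
have FA : \bigcup_k F k = A.
  apply/seteqP; split => [x [k _ Fx]|x Ax].
    apply: contrapT => nAx; apply: Fx; exists x => //; rewrite subrr normr0 invr_gt0//.
  have /nbhs_ballP[d /= d0 dA] : nbhs x A by apply: open_nbhs_nbhs; split.
  exists (Num.truncn d^-1) => // -[y nAy xy]; apply: nAy; apply: dA.
  rewrite -ball_normE /=; apply: lt_trans xy _.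
  by rewrite invf_plt ?posrE// truncnS_gt.
have mF k : borel (F k) by apply: closed_Borel.
have mA : borel A by apply: open_Borel.
have cvF : (mu \o F) x @[x --> \oo] --> mu A.
  rewrite -FA; apply: nondecreasing_cvg_mu => //; first by rewrite FA.
  move=> i j ij; apply/subsetPset => x Fx [y Ay xy]; apply: Fx; exists y => //.
  by apply: lt_le_trans xy _; rewrite lef_pV2 ?posrE// ler_nat.
have muA := measure_lty mA.
have fA : mu A \is a fin_num by rewrite ge0_fin_numE.
have [k Hk] : exists k, (mu A - e%:E < mu (F k))%E.
  have lt1 : (mu A - e%:E < mu A)%E by rewrite lte_subel_addr// lteDl.
  exact: ecvg_gt cvF lt1.
exists (F k), A; split => //; first by rewrite -FA; exact: bigcup_sup.
rewrite measureD//.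
have FkA : F k `<=` A by rewrite -FA; exact: bigcup_sup.
rewrite (setIidr FkA); have fF : mu (F k) \is a fin_num by rewrite ge0_fin_numE// measure_lty.
by rewrite lteBlDr// -lteBlDl// addeC.
Qed.

Lemma regularC (A : set V) : regular A -> regular (~` A).
Proof.
move=> [mA rA]; split; first exact: measurableC.
move=> e e0; have [F [W [cF oO FA AO mFO]]] := rA e e0.
exists (~` W), (~` F); split.
- exact: open_closedC.
- exact: closed_openC.
- exact: subsetC.
- exact: subsetC.
- by rewrite setDE setCK setIC -setDE.
Qed.

(** An infinite union of closed sets need not be closed. The errors of the pieces add up to at most
    [e / 2], and the gap between [e / 2] and [e] allows the closed sets to be truncated to finitely
    many by continuity from above, where finiteness of [mu] enters. *)
Lemma regular_bigcup (A : (set V)^nat) : (forall k, regular (A k)) -> regular (\bigcup_k A k).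
Proof.
move=> rA; have mA k : borel (A k) by have [] := rA k.
have mU : borel (\bigcup_k A k) by apply: bigcupT_measurable.
split => // e e0; have e2 : 0 < e / 2 by rewrite divr_gt0.
have /choice[F /choice[W FW]] : forall k, exists F W : set V,
   [/\ closed F, open W, F `<=` A k, A k `<=` W & (mu (W `\` F) < (e / 2 / (2 ^ k.+1)%:R)%:E)%E].
  by move=> k; have [_ +] := rA k; apply; rewrite divr_gt0// ltr0n expn_gt0.
have mF k : borel (F k) by have [? _ _ _ _] := FW k; exact: closed_Borel.
have mW k : borel (W k) by have [_ ? _ _ _] := FW k; exact: open_Borel.
pose G m := \big[setU/set0]_(k < m) F k.
have mG m : borel (G m) by apply: bigsetU_measurable.
pose OO := \bigcup_k W k.
have mOO : borel OO by apply: bigcupT_measurable.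
have GE m : G m = \bigcup_(k < m) F k by rewrite /G -bigcup_mkord.
have GF : \bigcup_m G m = \bigcup_k F k.
  apply/seteqP; split => [x [m _]|x [k _ Fk]]; first by rewrite GE => -[k _ Fk]; exists k.
  by exists k.+1 => //; rewrite GE; exists k => /=.
have cvG : (mu \o (fun m => OO `\` G m)) x @[x --> \oo] --> mu (OO `\` \bigcup_k F k).
  have -> : OO `\` \bigcup_k F k = \bigcap_m (OO `\` G m).
    apply/seteqP; split => [x [Wx nF] m _|x H].
      by split => //; rewrite GE => -[k _ Fk]; apply: nF; exists k.
    split; first by have [] := H 0%N I.
    by move=> [k _ Fk]; have [_] := H k.+1 I; apply; rewrite GE; exists k => /=.
  apply: nonincreasing_cvg_mu => //.
  - by apply: measure_lty; exact: measurableD.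
  - by move=> m; exact: measurableD.
  - by apply: bigcapT_measurable => m; exact: measurableD.
  - move=> i j ij; apply/subsetPset => x [Wx nG]; split => // Gx; apply: nG.
    by move: Gx; rewrite !GE => -[k /= ki Fk]; exists k => //=; exact: leq_trans ij.
have lt1 : (mu (OO `\` \bigcup_k F k) < e%:E)%E.
  apply: (@le_lt_trans _ _ (\sum_(0 <= k <oo) mu (W k `\` F k))%E).
    apply: measure_sigma_subadditive.
    - by move=> k; exact: measurableD.
    - by apply: measurableD => //; exact: bigcupT_measurable.
    - by move=> x [[k _ Wk] nF]; exists k => //; split => // Fk; apply: nF; exists k.
  apply: (@le_lt_trans _ _ (e / 2)%:E); last by rewrite lte_fin; lra.
  apply: le_trans (epsilon_trick0 xpredT (ltW e2)).
  by apply: lee_nneseries => // k _; have [_ _ _ _ /ltW] := FW k.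
have [m Hm] : exists m, (mu (OO `\` G m) < e%:E)%E.
  exact: ecvg_lt cvG lt1.
exists (G m), OO; split => //.
- by apply: closed_bigsetU => k _; have [] := FW k.
- by apply: bigcup_open => k _; have [] := FW k.
- by rewrite GE => x [k _ Fk]; exists k => //; have [_ _ + _ _] := FW k; apply.
- by apply: subset_bigcup => k _; have [_ _ _ + _] := FW k; apply.
Qed.

Lemma measurable_regular (A : set V) : borel A -> regular A.
Proof.
apply: smallest_sub; last by move=> B; exact: regular_open.
split; first by apply: regular_open; exact: open0.
- by move=> B rB; rewrite setTD; exact: regularC.
- exact: regular_bigcup.
Qed.

End regularity.

(** * Comparison of measures on cubes *)

Section dyadic.
Context (R : realType) (n : nat).
Local Notation V := 'rV[R]_n.
Implicit Types (c u : V) (l : R).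

(** Half-open cubes tile the space, while nested closed cubes have a common point; the comparison
    needs both kinds. *)
Definition ccube c l : set V := [set u | forall i, c 0 i <= u 0 i <= c 0 i + l].

Definition half c l (b : {ffun 'I_n -> bool}) : V := \row_i (c 0 i + if b i then l / 2 else 0).

Lemma cube_half c l : cube c l = \bigcup_b cube (half c l b) (l / 2).
Proof.
apply/seteqP; split => [u H|u [b _ H] i]; last by have := H i; rewrite mxE; case: (b i); lra.
exists [ffun i => c 0 i + l / 2 <= u 0 i] => // i; rewrite mxE ffunE; have := H i.
by case: ifPn; rewrite ?ltNge -?ltNge; lra.
Qed.

Lemma ccube_half c l b : 0 <= l -> ccube (half c l b) (l / 2) `<=` ccube c l.
Proof. by move=> l0 u H i; have := H i; rewrite mxE; case: (b i); lra. Qed.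

Lemma trivIset_half c l : trivIset setT (fun b => cube (half c l b) (l / 2)).
Proof.
apply/trivIsetP => b b' _ _ bb; apply/seteqP; split => // u [H1 H2].
have /eqP := bb; apply; apply/ffunP => i; have := H1 i; have := H2 i; rewrite !mxE.
by case: (b i); case: (b' i) => //; lra.
Qed.

Definition dyad (k : nat) (z : 'rV[int]_n) : V := \row_i ((z 0 i)%:~R / 2 ^+ k).
Definition dyad_of (k : nat) u : 'rV[int]_n := \row_i Num.floor (u 0 i * 2 ^+ k).
Local Notation l_ k := ((2 ^+ k)^-1 : R).

Lemma scale_half_open (p a x : R) : 0 < p -> (a / p <= x < a / p + p^-1) = (a <= x * p < a + 1).
Proof.
by move=> p0; rewrite ler_pdivrMr// -{2}[p^-1]mul1r -mulrDl ltr_pdivlMr.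
Qed.

Lemma scale_closed (p a x : R) : 0 < p -> (a / p <= x <= a / p + p^-1) = (a <= x * p <= a + 1).
Proof.
by move=> p0; rewrite ler_pdivrMr// -{2}[p^-1]mul1r -mulrDl ler_pdivlMr.
Qed.

Lemma l_gt0 k : 0 < l_ k. Proof. by rewrite invr_gt0 exprn_gt0. Qed.

Lemma cube_dyad k z u : cube (dyad k z) (l_ k) u <-> z = dyad_of k u.
Proof.
have e0 := l_gt0 k; have p0 : 0 < (2 ^+ k : R) by rewrite exprn_gt0.
split => [H|-> i]; last first.
  by rewrite !mxE scale_half_open// -intrD1; exact: floor_itv.
apply/rowP => i; rewrite mxE; apply/esym/floor_def; have := H i.
by rewrite !mxE scale_half_open// intrD.
Qed.

(** An inner approximation of [U] by whole cubes of one generation. Asking for the closed cube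
    inside [U] makes the local hypotheses, stated for closed cubes, applicable to each of them. *)
Definition dyad_in (k : nat) (U : set V) := [set u | ccube (dyad k (dyad_of k u)) (l_ k) `<=` U].

Lemma dyad_inE k U : dyad_in k U =
  \bigcup_(z in [set z | ccube (dyad k z) (l_ k) `<=` U]) cube (dyad k z) (l_ k).
Proof.
apply/seteqP; split => [u Hu|u [z /= Hz /cube_dyad zu]]; last by rewrite /dyad_in /= -zu.
by exists (dyad_of k u) => //; apply/cube_dyad.
Qed.

Lemma measurable_dyad_in k U : borel (dyad_in k U).
Proof. by rewrite dyad_inE; apply: measurable_bigcup_countType => z _; exact: measurable_cube. Qed.

Lemma dyad_in_nd U : {homo dyad_in^~ U : i j / (i <= j)%N >-> i `<=` j}.
Proof.
apply: homo_leq => [A //|A B C AB BC|k]; first exact: subset_trans BC.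
move=> u Hu; apply: subset_trans Hu => v Hv i.
have := Hv i; rewrite !mxE exprS; set p := 2 ^+ k; set x := u 0 i => H.
have p0 : 0 < p by rewrite exprn_gt0.
have /andP[F1 F2] := floor_itv (x * p); have /andP[G1 G2] := floor_itv (x * (2 * p)).
set a := Num.floor (x * p) in F1 F2 *; set b := Num.floor (x * (2 * p)) in G1 G2 H.
have ab : (2 * a <= b)%R.
  by rewrite /b floor_ge_int intrM; move: F1; nra.
have ba : (b <= 2 * a + 1)%R.
  by rewrite -ltzD1 /b floor_lt_int; move: F2; rewrite !intrD intrM; nra.
move: ab ba; rewrite -(ler_int R) -[(b <= _)%R](ler_int R) !intrD !intrM => ab ba.
move: H; rewrite scale_closed ?mulr_gt0// scale_closed//.
by move=> /andP[H1 H2]; apply/andP; split; nra.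
Qed.

Lemma bigcup_dyad_in U : open U -> \bigcup_k dyad_in k U = U.
Proof.
move=> oU; apply/seteqP; split => [u [k _]|u Uu].
  apply => i; have /cube_dyad/(_ i) := erefl (dyad_of k u); lra.
have /nbhs_ballP[e /= e0 eU] : nbhs u U by apply: open_nbhs_nbhs; split.
have [k ke] : exists k, l_ k < e.
  exists (Num.truncn e^-1); rewrite invf_plt ?posrE ?exprn_gt0//.
  apply: lt_le_trans (truncnS_gt _) _; rewrite -natrX ler_nat.
  exact: ltn_expl.
exists k => // v Hv; apply: eU; split => // a i; rewrite ord1 /ball /=.
have /cube_dyad/(_ i) := erefl (dyad_of k u); have := Hv i; rewrite ltr_norml; lra.
Qed.

Variables (s t : {measure set (Borel V) -> \bar R}).

Lemma le_measure_open U : open U ->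
  (forall c l, 0 < l -> ccube c l `<=` U -> (s (cube c l) <= t (cube c l))%E) ->
  (s U <= t U)%E.
Proof.
move=> oU st.
have mD k := measurable_dyad_in k U.
have cv (m : {measure set (Borel V) -> \bar R}) : (m \o (dyad_in^~ U)) x @[x --> \oo] --> m U.
  rewrite -[in X in _ --> m X](bigcup_dyad_in oU); apply: nondecreasing_cvg_mu => //.
    by rewrite bigcup_dyad_in//; exact: open_Borel.
  by move=> i j ij; apply/subsetPset; exact: dyad_in_nd.
rewrite -(cvg_lim (@ereal_hausdorff R) (cv s)) -(cvg_lim (@ereal_hausdorff R) (cv t)).
apply: lee_lim; [by apply/cvg_ex; eexists; exact: cv| by apply/cvg_ex; eexists; exact: cv|].
apply: nearW => k /=; rewrite dyad_inE.
(* The disjoint dyadic cubes are numbered through the countable type of integer vectors; codes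
   without an admissible cube get the empty set. *)
pose F (i : nat) : set V := if @pickle_inv 'rV[int]_n i is Some z then
   if `[< ccube (dyad k z) (l_ k) `<=` U >] then cube (dyad k z) (l_ k) else set0 else set0.
have mF i : borel (F i).
  by rewrite /F; case: pickle_inv => // z; case: ifP => // _; exact: measurable_cube.
rewrite (_ : \bigcup_(z in _) _ = \bigcup_i F i); last first.
  apply/seteqP; split => [u [z /= Hz uz]|u [i _]].
    by exists (pickle z) => //; rewrite /F pickleK_inv; case: asboolP.
  rewrite /F; case: pickle_inv => // z; case: asboolP => // Hz uz; by exists z.
have tF : trivIset setT F.
  apply/trivIsetP => i j _ _ ij; apply/seteqP; split => // u; rewrite /F.
  have := @pickle_invK 'rV[int]_n i; have := @pickle_invK 'rV[int]_n j.
  case: (@pickle_inv 'rV[int]_n j) => [w|]; case: (@pickle_inv 'rV[int]_n i) => [z|] /= wj zi; try by case.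
  move=> [].
  case: asboolP => // _ /cube_dyad zu; case: asboolP => // _ /cube_dyad wu.
  by move/eqP: ij; apply; rewrite -zi -wj zu wu.
rewrite !measure_semi_bigcup//; [|exact: bigcupT_measurable..].
apply: lee_nneseries => // i _; rewrite /F; case: pickle_inv => [z|]; last by rewrite !measure0.
case: asboolP => [Hz|]; last by rewrite !measure0.
by apply: st => //; exact: l_gt0.
Qed.

(* bisection: a cube violating the inequality contains arbitrarily small such cubes around one point *)
Lemma le_measure_cube U c0 l0 : open U -> 0 < l0 -> ccube c0 l0 `<=` U ->
  (forall u, U u -> exists2 r, 0 < r & forall c l, 0 < l < r -> ccube c l u ->
     (s (cube c l) <= t (cube c l))%E) ->
  (s (cube c0 l0) <= t (cube c0 l0))%E.
Proof.
move=> oU l00 cU loc; rewrite leNgt; apply/negP => bad0.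
pose bad c l := (t (cube c l) < s (cube c l))%E.
have split_bad c l : bad c l -> exists b, bad (half c l b) (l / 2).
  move=> bcl; apply: contrapT => /forallNP H; move: bcl; apply/negP; rewrite -leNgt.
  rewrite cube_half !measure_fin_bigcup//; try exact: trivIset_half; try exact: finite_finset; try by move=> b _; exact: measurable_cube.
  by apply: lee_fsum => [|b _]; [exact: finite_finset|rewrite leNgt; apply/negP; exact: H].
have [f Hf] : {f : V -> R -> {ffun 'I_n -> bool} | forall c l, bad c l -> bad (half c l (f c l)) (l / 2)}.
  apply: cid; have /choice[f Hf] : forall cl : V * R, exists b, bad cl.1 cl.2 -> bad (half cl.1 cl.2 b) (cl.2 / 2).
    move=> [c l] /=; have [/split_bad[b Hb]|nb] := pselect (bad c l); first by exists b.
    by exists [ffun=> false].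
  by exists (fun c l => f (c, l)) => c l; exact: (Hf (c, l)).
pose cl k := iter k (fun z : V * R => (half z.1 z.2 (f z.1 z.2), z.2 / 2)) (c0, l0).
pose c_ k := (cl k).1; pose e_ k := (cl k).2.
have eE k : e_ k = l0 / 2 ^+ k.
  by elim: k => [|k IH]; rewrite /e_ /cl /= ?expr0 ?divr1// -/(cl k) -/(e_ k) IH exprSr invfM mulrA.
have e0 k : 0 < e_ k by rewrite eE divr_gt0// exprn_gt0.
have badk k : bad (c_ k) (e_ k) by elim: k => [//|k IH]; exact: Hf.
have nest k : ccube (c_ k.+1) (e_ k.+1) `<=` ccube (c_ k) (e_ k) by apply: ccube_half; exact: (ltW (e0 k)).
have cself k : ccube (c_ k) (e_ k) (c_ k) by move=> i; have := e0 k; lra.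
have nests k m : ccube (c_ (k + m)%N) (e_ (k + m)%N) `<=` ccube (c_ k) (e_ k).
  elim: m => [|m IH]; first by rewrite addn0.
  by rewrite addnS; apply: subset_trans IH; exact: nest.
have cin k m : ccube (c_ k) (e_ k) (c_ (k + m)%N) by apply: nests; exact: cself.
have cm k m i : c_ m 0 i <= c_ k 0 i + e_ k.
  have [km|mk] := leqP k m.
    by have := cin k (m - k)%N i; rewrite subnKC//; lra.
  have := cin m (k - m)%N i; rewrite subnKC ?(ltnW mk)//; have := e0 k; lra.
(* The common point of the nested closed cubes, obtained as the supremum of their lower corners. *)
pose u : V := \row_i sup [set c_ k 0 i | k in setT].
have uin k : ccube (c_ k) (e_ k) u.
  move=> i; rewrite mxE; apply/andP; split.
    apply: sup_upper_bound; last by exists k.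
    by split; [exists (c_ 0%N 0 i); exists 0%N|exists (c_ 0%N 0 i + e_ 0%N) => _ [m _ <-]].
  by apply: ge_sup; [exists (c_ 0%N 0 i); exists 0%N|move=> _ [m _ <-]].
have [r r0 Hr] := loc u (cU _ (uin 0%N)).
have [k kr] : exists k, e_ k < r.
  exists (Num.truncn (l0 / r)); rewrite eE ltr_pdivrMr ?exprn_gt0// mulrC -ltr_pdivrMr//.
  apply: lt_le_trans (truncnS_gt _) _; rewrite -natrX ler_nat.
  exact: ltn_expl.
have := badk k; rewrite /bad ltNge Hr//; by rewrite e0.
Qed.
End dyadic.

Lemma measurable_indicR (R : realType) n (U : set 'rV[R]_n) (f : 'rV[R]_n -> R) : open U ->
  (forall u, U u -> {for u, continuous f}) ->
  measurable_fun setT (f \* \1_U : Borel 'rV[R]_n -> R).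
Proof.
move=> oU cf; rewrite -patch_indic; apply/(measurable_restrictT _ _).1; first exact: open_Borel.
exact: continuous_BorelR.
Qed.

(** * Domination by a density, and changes of variables *)

Section density_bound.
Context (R : realType) (n : nat).
Local Notation V := 'rV[R]_n.
Variables (U : set V) (rho : V -> R) (s : {measure set (Borel V) -> \bar R}).
Hypotheses (oU : open U) (crho : forall u, U u -> {for u, continuous rho})
  (rho0 : forall u, U u -> 0 <= rho u) (sU : s (~` U) = 0%E).
Hypothesis loc : forall u, U u -> forall e : R, 0 < e -> exists2 r, 0 < r & forall c l, 0 < l < r ->
   ccube c l u -> (s (cube c l) <= ((rho u + e) * l ^+ n)%:E)%E.

Let rho1 := (rho \* \1_U : V -> R).
Let rho1_ge0 u : 0 <= rho1 u.
Proof. by rewrite /rho1 /= indicE; case: (boolP (_ \in _)) => [/set_mem/rho0|_]; rewrite ?mulr1 ?mulr0. Qed.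
Let mrho1 : measurable_fun setT (rho1 : Borel V -> R).
Proof. exact: measurable_indicR. Qed.

Let rhoe e := fun u => (rho1 u + e)%R.
Let mrhoe e : measurable_fun setT (rhoe e : Borel V -> R).
Proof. by apply: measurable_funD. Qed.

Let open_step (e : R) (e0 : forall u, 0 <= rhoe e u) (W : set V) : 0 < e -> open W -> W `<=` U ->
  (s W <= mdens (lam R n) (mrhoe e) e0 W)%E.
Proof.
move=> ep oW WU; apply: le_measure_open => // c l l0 cW.
apply: (le_measure_cube oU l0); first exact: subset_trans WU.
move=> u Uu; have e2 : 0 < e / 2 by lra.
have [r r0 Hr] := loc Uu e2.
have /nbhs_ballP[d /= d0 Hd] : \forall v \near u, U v /\ rho u - e / 2 < rho v.
  apply: filterI; first by apply: open_nbhs_nbhs; split.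
  have : nbhs (rho u) [set y | rho u - e / 2 < y].
    by apply: open_nbhs_nbhs; split; [exact: open_gt|rewrite /=; lra].
  by move=> /(crho Uu).
exists (Num.min r d); first by rewrite lt_min r0.
move=> c' l' /andP[l'0]; rewrite lt_min => /andP[l'r l'd] cu.
apply: (le_trans (Hr c' l' _ cu)); first by rewrite l'0.
rewrite EFinM -(lam_cube c' (ltW l'0)) /= /mdens -[X in (_ <= X)%E]/(\int[lam R n]_(x in cube c' l') (rhoe e x)%:E)%E.
rewrite -integral_cst//; last exact: measurable_cube.
apply: ge0_le_integral => //.
- exact: measurable_cube.
- by move=> v _; rewrite lee_fin addr_ge0 ?rho0// ltW.
- by apply/measurable_EFinP; apply: measurable_funS (mrhoe e).
move=> v cv; rewrite lee_fin /rhoe /rho1 /=.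
have [Uv rv] : U v /\ rho u - e / 2 < rho v.
  apply: Hd; split => // a i; rewrite ord1 /ball /=.
  have := cu i; have := cv i; rewrite ltr_norml; lra.
by rewrite indicE mem_set// mulr1; lra.
Qed.

(** On open sets the bound with [rho + e] follows from cubes. To reach a Borel set, outer regularity
    is applied not to [s] but to the measure [t] of density [rho1 + e] on [Uk k], which is finite:
    an open set that is only slightly too large for [t] transfers the bound. Then [e] tends to 0 and
    [k] to infinity. *)
Lemma density_bound A : borel A -> (s A <= mdens (lam R n) mrho1 rho1_ge0 A)%E.
Proof.
move=> mA; have mU : borel U by exact: open_Borel.
have -> : s A = s (A `&` U).
  apply/eqP; rewrite eq_le; apply/andP; split; last first.
    by apply: le_measure; rewrite ?inE//; exact: measurableI.
  have -> : s A = (s (A `&` U) + s (A `&` ~` U))%E.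
    rewrite -measureU//; first by rewrite -setIUr setUv setIT.
    - exact: measurableI.
    - by apply: measurableI => //; exact: measurableC.
    - by rewrite setIACA setICr setI0.
  rewrite (_ : s (A `&` ~` U) = 0%E) ?adde0//.
  apply/eqP; rewrite eq_le measure_ge0 andbT -sU; apply: le_measure; rewrite ?inE//.
    by apply: measurableI => //; exact: measurableC.
  exact: measurableC.
apply: (@le_trans _ _ (mdens (lam R n) mrho1 rho1_ge0 (A `&` U))); last first.
  by apply: le_measure; rewrite ?inE//; exact: measurableI.
(* Points and [rho] are both bounded on [Uk k], so a measure with density [rho1 + e] is finite
   there, as regularity requires. *)
pose Uk (k : nat) := U `&` [set u : V | `|u| < k%:R /\ rho u < k%:R].
have oUk k : open (Uk k).
  rewrite /Uk openE => u [Uu [uk rk]]; apply: filterI; first by apply: open_nbhs_nbhs; split.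
  apply: filterI.
    have : nbhs `|u| [set y : R | y < k%:R] by apply: open_nbhs_nbhs; split => //; exact: open_lt.
    by move=> /norm_continuous.
  have : nbhs (rho u) [set y : R | y < k%:R] by apply: open_nbhs_nbhs; split => //; exact: open_lt.
  by move=> /(crho Uu).
pose Ak k := A `&` Uk k.
have mAk k : borel (Ak k) by apply: measurableI => //; exact: open_Borel.
have AkU : \bigcup_k Ak k = A `&` U.
  apply/seteqP; split => [u [k _ [Au [Uu _]]] //|u [Au Uu]].
  exists (maxn (Num.truncn `|u|).+1 (Num.truncn (rho u)).+1) => //; split=> //; split => //; split.
    by apply: lt_le_trans (truncnS_gt _) _; rewrite ler_nat leq_maxl.
  by apply: lt_le_trans (truncnS_gt _) _; rewrite ler_nat leq_maxr.
have ndAk : {homo Ak : i j / (i <= j)%N >-> (i <= j)%O}.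
  move=> i j ij; apply/subsetPset => u [Au [Uu [ui ri]]]; split => //; split => //.
  by split; [apply: lt_le_trans ui _|apply: lt_le_trans ri _]; rewrite ler_nat.
have cv (m : {measure set (Borel V) -> \bar R}) : (m \o Ak) x @[x --> \oo] --> m (A `&` U).
  rewrite -AkU; apply: nondecreasing_cvg_mu => //; rewrite AkU; exact: measurableI.
rewrite -(cvg_lim (@ereal_hausdorff R) (cv s)) -(cvg_lim (@ereal_hausdorff R) (cv (mdens (lam R n) mrho1 rho1_ge0))).
apply: lee_lim; [by apply/cvg_ex; eexists; exact: cv| by apply/cvg_ex; eexists; exact: cv|].
apply: nearW => k /=.
have Uklam : (lam R n (Uk k) <= (((k%:R *+ 2) ^+ n)%:E : \bar R))%E.
  rewrite -(lam_cube (const_mx (- k%:R)) (mulrn_wge0 2 (ler0n R k))).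
  apply: le_measure; rewrite ?inE; [exact: open_Borel|exact: measurable_cube|].
  move=> u [_ [uk _]] i; rewrite !mxE.
  have : `|u 0 i| <= `|u|.
    rewrite [X in _ <= X]/Num.norm/= mx_normrE; apply/bigmax_geP; right.
    by exists (0, i).
  rewrite ler_norml; lra.
set L := (k%:R *+ 2) ^+ n in Uklam.
have stepe (e : R) : 0 < e -> (s (Ak k) <= mdens (lam R n) mrho1 rho1_ge0 (Ak k) + (e * L)%:E)%E.
  move=> e0; pose g := ((fun u => rho1 u + e) \* \1_(Uk k) : V -> R).
  have g0 u : 0 <= g u by rewrite /g /= mulr_ge0// addr_ge0// ltW.
  have mg : measurable_fun setT (g : Borel V -> R).
    apply: measurable_funM; first exact: mrhoe.
    by apply: measurable_indic; exact: open_Borel.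
  pose t := mdens (lam R n) mg g0.
  have tE B : borel B -> B `<=` Uk k -> t B = (\int[lam R n]_(u in B) (rho1 u + e)%:E)%E.
    move=> mB BU; apply: eq_integral => u; rewrite inE => /BU Bu.
    by rewrite /g /= indicE mem_set ?mulr1.
  have tI B : borel B -> t B = t (B `&` Uk k).
    move=> mB; rewrite /t /mdens [LHS]integral_mkcond [RHS]integral_mkcond.
    apply: eq_integral => u _; rewrite !patchE in_setI; case: (u \in B) => //=.
    by rewrite /g /= indicE; case: (u \in Uk k); rewrite ?mulr0.
  have tle B : borel B -> B `<=` Uk k ->
      (t B <= mdens (lam R n) mrho1 rho1_ge0 B + (e * L)%:E)%E.
    move=> mB BU; rewrite tE//.
    under eq_integral do rewrite EFinD.
    rewrite ge0_integralD//; last 3 first.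
    - by move=> u _; rewrite lee_fin.
    - by apply/measurable_EFinP; apply: measurable_funS mrho1.
    - by move=> u _; rewrite lee_fin ltW.
    rewrite leeD2l// integral_cst// EFinM lee_wpmul2l ?lee_fin ?(ltW e0)//.
    by apply: le_trans Uklam; apply: le_measure; rewrite ?inE//; exact: open_Borel.
  have tfin : (t setT < +oo)%E.
    rewrite tI// setTI; apply: (@le_lt_trans _ _ (((k%:R + e) * L)%:E)); last by rewrite ltry.
    rewrite tE//; last exact: open_Borel.
    apply: (@le_trans _ _ (\int[lam R n]_(u in Uk k) (k%:R + e)%:E)%E).
      apply: ge0_le_integral => //.
      - exact: open_Borel.
      - by move=> u _; rewrite lee_fin addr_ge0// ltW.
      - by apply/measurable_EFinP; apply: measurable_funS (mrhoe e).
      - by move=> u [Uu [_ rk]]; rewrite lee_fin lerD2r /rho1 /= indicE mem_set// mulr1 ltW.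
    rewrite integral_cst//; last exact: open_Borel.
    by rewrite EFinM lee_wpmul2l// lee_fin addr_ge0// ltW.
  apply/lee_addgt0Pr => d d0.
  have [_ /(_ d d0)[F [W [cF oW FA AW tWF]]]] := measurable_regular tfin (mAk k).
  have mW : borel W by exact: open_Borel.
  have mF : borel F by exact: closed_Borel.
  apply: (@le_trans _ _ (s (W `&` Uk k))).
    apply: le_measure; rewrite ?inE//; first by apply: measurableI => //; exact: open_Borel.
    by move=> u Au; split; [exact: AW|case: Au].
  have rhoe0 u : 0 <= rhoe e u by rewrite addr_ge0// ltW.
  apply: (le_trans (open_step rhoe0 e0 (openI oW (oUk k)) _)); first by move=> u [_ []].
  rewrite -[X in (X <= _)%E]/(\int[lam R n]_(x in W `&` Uk k) (rho1 x + e)%:E)%E.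
  rewrite -tE; [|by apply: measurableI => //; exact: open_Borel|by move=> u []].
  rewrite -tI//.
  have -> : t W = (t (W `\` F) + t F)%E.
    rewrite -measureU//; first by rewrite setUC setDUK//; apply: subset_trans AW.
    - exact: measurableD.
    - by apply/seteqP; split => // u [[]].
  rewrite addeC; apply: leeD; last exact: ltW.
  apply: le_trans (tle _ (mAk k) _); last by move=> u [].
  by apply: le_measure; rewrite ?inE.
apply/lee_addgt0Pr => d d0.
have L0 : 0 <= L by rewrite exprn_ge0// mulrn_wge0.
have dL : 0 < d / (L + 1) by rewrite divr_gt0//; lra.
apply: le_trans (stepe _ dL) _; rewrite leeD2l// lee_fin mulrAC ler_pdivrMr; nra.
Qed.

End density_bound.

Lemma norm_coord (R : realType) n (u : 'rV[R]_n) i : `|u 0 i| <= `|u|.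
Proof.
rewrite [X in _ <= X]/Num.norm/= mx_normrE; apply/bigmax_geP; right.
by exists (0, i).
Qed.

Lemma norm_le (R : realType) n (u : 'rV[R]_n) (a : R) : 0 <= a -> (forall i, `|u 0 i| <= a) -> `|u| <= a.
Proof.
move=> a0 H; rewrite [X in X <= _]/Num.norm/= mx_normrE; apply/bigmax_leP; split => // -[i j] _ /=.
by rewrite ord1.
Qed.

Section change_of_variables.
Context (R : realType) (n : nat).
Local Notation W := 'rV[R]_n.
Variables (U V : set W) (f g : W -> W) (B : W -> 'M[R]_n) (kap : R) (rho : W -> R).
Hypotheses (oU : open U) (oV : open V) (cf : forall u, U u -> {for u, continuous f})
  (cg : forall v, V v -> {for v, continuous g})
  (fV : forall u, U u -> V (f u)) (gU : forall v, V v -> U (g v))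
  (fK : forall u, U u -> g (f u) = u) (gK : forall v, V v -> f (g v) = v).
Hypotheses (kap0 : 0 <= kap) (Bu : forall u, U u -> B u \in unitmx)
  (rhoE : forall u, U u -> rho u = `|\det (B u)|^-1 * (1 + 2 * kap) ^+ n)
  (crho : forall u, U u -> {for u, continuous rho}).
Hypothesis loc : forall u, U u -> forall e : R, 0 < e -> exists2 r, 0 < r & forall v, U v -> `|v - u| < r ->
  `|(f v - f u) *m B u - (v - u)| <= (kap + e) * `|v - u|.

Let mg : measurable_fun setT (g \_ V : Borel W -> Borel W).
Proof. by apply/(measurable_restrictT _ _).1; [exact: open_Borel|exact: continuous_Borel]. Qed.

Let m1V : measurable_fun setT (\1_V : Borel W -> R).
Proof. by apply: measurable_indic; exact: open_Borel. Qed.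
Let ge1V u : 0 <= (\1_V u : R). Proof. by rewrite indicE. Qed.
Let lamV : {measure set (Borel W) -> \bar R} := mdens (lam R n) m1V ge1V.
Let s : {measure set (Borel W) -> \bar R} := pushm lamV mg.

Let sE A : borel A -> s A = lam R n ([set v | V v /\ A (g v)]).
Proof.
move=> mA; rewrite /s pushmE /lamV /= /mdens.
have mgA : borel ((g \_ V) @^-1` A).
  by rewrite -[X in measurable X]setTI; exact: mg.
rewrite integral_indic//; last exact: open_Borel.
congr (lam R n _); apply/seteqP; split => v /=.
  by move=> [Vv]; rewrite patchE mem_set.
by move=> [Vv Agv]; rewrite patchE mem_set.
Qed.

(** No derivative of [f] is involved: [B u] is the inverse of some linear map that approximates [f]
    at [u] up to the relative error [kap]. The image of a cube of side [l] therefore lies in an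
    affine image, under [invmx (B u)], of a cube of side close to [(1 + 2 * kap) * l]; this is the
    origin of the factor in [rhoE]. *)
Lemma cov_cube u (Uu : U u) (e : R) : 0 < e -> exists2 r, 0 < r & forall c l, 0 < l < r ->
  ccube c l u -> (s (cube c l) <= ((rho u + e) * l ^+ n)%:E)%E.
Proof.
move=> e0; set D := `|\det (B u)|^-1.
have D0 : 0 <= D by rewrite invr_ge0.
have [d d0 Hd] : exists2 d : R, 0 < d & D * (1 + 2 * kap + 3 * d) ^+ n <= rho u + e.
  have cF : continuous (fun x : R => D * (1 + 2 * kap + 3 * x) ^+ n).
    move=> x; apply: (@continuousM R R (cst D) (fun x => (1 + 2 * kap + 3 * x) ^+ n)).
      exact: cst_continuous.
    apply: (@continuous_comp _ _ _ (fun x : R => 1 + 2 * kap + 3 * x) (fun y : R => y ^+ n)); last exact: exprn_continuous.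
    apply: (@continuousD R R R (cst (1 + 2 * kap)) (fun x => 3 * x)); first exact: cst_continuous.
    by apply: (@continuousM R R (cst 3) id); [exact: cst_continuous|exact: cvg_id].
  have := cF 0 [set y | y < rho u + e]; rewrite /= mulr0 addr0 -rhoE// => /(_ _)/nbhs_ballP[|r /= r0 Hr].
    by apply: open_nbhs_nbhs; split; [exact: open_lt|rewrite /= ltrDl].
  exists (r / 2); first lra.
  by apply: ltW; apply: (Hr (r / 2)); rewrite /ball /= sub0r normrN gtr0_norm; lra.
have [r r0 Hr] := loc Uu d0.
exists r => // c l /andP[l0 lr] cu.
rewrite sE; last exact: measurable_cube.
set X := [set v | _].
(* Since [u] and [g v] lie in one cube of side [l], the sup-norm error is at most [(kap + d) * l].
   The cube is moved back by this amount and enlarged by twice as much; the remaining [d * l] is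
   slack. *)
pose c' := c - u - const_mx ((kap + d) * l).
pose l' := (1 + 2 * kap + 3 * d) * l.
have l'0 : 0 <= l' by rewrite mulr_ge0 ?(ltW l0)//; have := kap0; lra.
have Bi : invmx (B u) \in unitmx by rewrite unitmx_inv Bu.
have [mY lY] := lam_linear_image (f u) Bi (measurable_cube c' l').
have mX : borel X.
  rewrite (_ : X = V `&` (g \_ V) @^-1` cube c l).
    apply: measurableI; first exact: open_Borel.
    by rewrite -[X in measurable X]setTI; apply: mg => //; exact: measurable_cube.
  by apply/seteqP; split => v /= [Vv]; rewrite patchE mem_set.
apply: (@le_trans _ _ (lam R n ((fun v => v *m invmx (B u) + f u) @` cube c' l'))).
  apply: le_measure; rewrite ?inE// => v [Vv cgv].
  exists ((v - f u) *m B u); last by rewrite mulmxK ?Bu// subrK.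
  have gu : `|g v - u| <= l.
    apply: norm_le; first exact: ltW.
    by move=> i; have := cgv i; have := cu i; rewrite !mxE ler_norml; lra.
  have := Hr (g v) (gU Vv) (le_lt_trans gu lr); rewrite gK// => H i.
  have H1 : `|((v - f u) *m B u - (g v - u)) 0 i| <= (kap + d) * l.
    apply: le_trans (norm_coord _ _) _; apply: (le_trans H).
    by rewrite ler_wpM2l//; have := kap0; lra.
  move: H1; set w := (v - f u) *m B u; rewrite !mxE; have := cgv i; set y := w 0 i => G.
  rewrite ler_norml /l' => /andP[H1 H2]; have dl : 0 < d * l by rewrite mulr_gt0.
  apply/andP; split; first lra.
  rewrite !mulrDl !mul1r; lra.
rewrite lY lam_cube// -EFinM lee_fin det_inv normfV -/D /l' exprMn mulrA ler_wpM2r//.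
by rewrite exprn_ge0// ltW.
Qed.

(** The image under [g] of Lebesgue measure on [V] is dominated by the density [rho], by the
    estimate on cubes; [F \o f] is integrated against both. Flows enter through this one-sided form,
    with [kap] of second order in time. *)
Lemma cov_upper (F : W -> \bar R) : measurable_fun (Bset V) F -> (forall v, V v -> 0 <= F v)%E ->
  (\int[lam R n]_(v in V) F v <= \int[lam R n]_(u in U) (F (f u) * (rho u)%:E))%E.
Proof.
move=> mF F0.
have rho0 u : U u -> 0 <= rho u.
  by move=> Uu; rewrite rhoE//; apply: mulr_ge0; [rewrite invr_ge0|apply: exprn_ge0; have := kap0; lra].
have sU : s (~` U) = 0%E.
  rewrite sE; last by apply: measurableC; exact: open_Borel.
  by rewrite (_ : [set v | _] = set0) ?measure0//; apply/seteqP; split => // v [/gU].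
pose rho1 := rho \* \1_U.
have rho1_ge0 u : 0 <= rho1 u.
  by rewrite /rho1 /= indicE; case: (boolP (_ \in _)) => [/set_mem/rho0|_]; rewrite ?mulr1 ?mulr0.
have mrho1 : measurable_fun setT (rho1 : Borel W -> R) by exact: measurable_indicR.
pose t : {measure set (Borel W) -> \bar R} := mdens (lam R n) mrho1 rho1_ge0.
have st A : borel A -> (s A <= t A)%E.
  move=> mA; apply: le_trans (density_bound oU crho rho0 sU cov_cube mA) _.
  by rewrite le_eqVlt; apply/orP; left; apply/eqP; apply: eq_integral.
pose h : W -> \bar R := (F \o f) \_ U.
have mh : measurable_fun setT (h : Borel W -> \bar R).
  apply/(measurable_restrictT _ _).1; first exact: open_Borel.
  apply: (measurable_comp (open_Borel oV) _ mF); first by move=> _ [u Uu <-]; exact: fV.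
  exact: continuous_Borel.
have h0 u : (0 <= h u)%E.
  by rewrite /h patchE; case: ifPn => // /set_mem Uu; apply: F0; exact: fV.
have := le_measure_integral st h0.
rewrite ge0_integral_pushm// [X in (X <= _)%E]integral_mdens//; last first.
  exact: (measurableT_comp mh mg).
rewrite [X in (_ <= X)%E]integral_mdens//.
have -> : (\int[lam R n]_x (h ((g \_ V) x) * (\1_V x)%:E) = \int[lam R n]_(v in V) F v)%E.
  rewrite [RHS]integral_mkcond; apply: eq_integral => v _.
  rewrite !patchE indicE; case: ifPn => [/set_mem Vv|_]; last by rewrite mule0.
  by rewrite mule1 /h patchE mem_set/= ?gK//; exact: gU.
rewrite [X in (_ <= X)%E](_ : _ = \int[lam R n]_(u in U) (F (f u) * (rho u)%:E))%E//.
rewrite [RHS]integral_mkcond; apply: eq_integral => u _.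
rewrite /h /rho1 !patchE /= indicE; case: ifPn => _; by rewrite ?mulr1// mul0e.
Qed.

End change_of_variables.

(** * Differential calculus *)

Section diff_basic.
Context {R : realType} {V W : normedModType R}.
Implicit Types (f g : V -> W) (u : V).

Lemma diff_epsP f u (L : {linear V -> W}) :
  f \o shift u = cst (f u) + L +o_ 0 id <->
  (forall e : R, 0 < e -> exists2 r : R, 0 < r & forall v, `|v - u| < r ->
     `|f v - f u - L (v - u)| <= e * `|v - u|).
Proof.
split => [/eqaddoP H e e0|H].
  have /nbhs_ballP[r /= r0 Hr] := H e e0; exists r => // v vu.
  have := Hr (v - u); rewrite /= -ball_normE /= sub0r normrN => /(_ vu).
  by rewrite !fctE /shift /= subrK opprD addrA.
apply/eqaddoP => e e0; have [r r0 Hr] := H e e0.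
apply/nbhs_ballP; exists r => //= h; rewrite -ball_normE /= sub0r normrN => hr.
by have := Hr (h + u); rewrite addrK => /(_ hr); rewrite !fctE /shift /= opprD addrA.
Qed.

Lemma differentiable_of f u (L : {linear V -> W}) : continuous L ->
  (forall e : R, 0 < e -> exists2 r : R, 0 < r & forall v, `|v - u| < r ->
     `|f v - f u - L (v - u)| <= e * `|v - u|) ->
  differentiable f u /\ 'd f u = L :> (V -> W).
Proof.
move=> cL /diff_epsP H; have e := diff_unique cL H.
by split => //; apply/diff_locallyP; rewrite e.
Qed.

Lemma diff_eps f u : differentiable f u -> forall e : R, 0 < e -> exists2 r : R, 0 < r & forall v, `|v - u| < r ->
     `|f v - f u - 'd f u (v - u)| <= e * `|v - u|.
Proof. by move=> /diff_locally/diff_epsP. Qed.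

Lemma differentiable_near f g u : (\forall v \near u, f v = g v) -> differentiable f u -> differentiable g u.
Proof.
move=> fg df; suff [] : differentiable g u /\ 'd g u = 'd f u :> (V -> W) by [].
apply: differentiable_of; first exact: diff_continuous.
move=> e e0; have [r r0 Hr] := diff_eps df e0; have fgu := nbhs_singleton fg.
move: fg => /nbhs_ballP[d /= d0 Hd]; exists (Num.min r d); first by rewrite lt_min r0.
move=> v; rewrite lt_min => /andP[vr vd].
have <- : f v = g v by apply: Hd; rewrite -ball_normE /= distrC.
by rewrite -fgu; exact: Hr.
Qed.

Lemma diff_near_eq f g u v : (\forall v \near u, f v = g v) -> 'D_v f u = 'D_v g u.
Proof. by move=> fg; apply: near_eq_derive. Qed.

Lemma derive_open_eq (U : set V) f g u v : open U -> U u -> (forall v, U v -> f v = g v) -> 'D_v f u = 'D_v g u.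
Proof.
move=> oU Uu fg; apply: diff_near_eq; apply: filterS fg _; exact: open_nbhs_nbhs.
Qed.

Lemma differentiable_open_eq (U : set V) f g u : open U -> U u -> (forall v, U v -> f v = g v) ->
  differentiable f u -> differentiable g u.
Proof.
move=> oU Uu fg; apply: differentiable_near; apply: filterS fg _; exact: open_nbhs_nbhs.
Qed.

Lemma deriveDv f u v w : differentiable f u -> 'D_(v + w) f u = 'D_v f u + 'D_w f u.
Proof. by move=> df; rewrite !deriveE// linearD. Qed.

Lemma deriveZv f u (k : R) v : differentiable f u -> 'D_(k *: v) f u = k *: 'D_v f u.
Proof. by move=> df; rewrite !deriveE// linearZ. Qed.

End diff_basic.

Lemma derive_chain (R : realType) (V1 V2 V3 : normedModType R) (f : V1 -> V2) (g : V2 -> V3) u v :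
  differentiable f u -> differentiable g (f u) -> 'D_v (g \o f) u = 'D_('D_v f u) g (f u).
Proof.
move=> df dg; rewrite deriveE; last exact: differentiable_comp.
by rewrite diff_comp// !deriveE.
Qed.

Section matrix_valued.
Context {R : realType} {V : normedModType R} {m n : nat}.
Implicit Types (f : V -> 'M[R]_(m, n)) (u : V).

Lemma differentiable_mx f u : (forall i j, differentiable (fun x => f x i j) u) -> differentiable f u.
Proof.
move=> df; rewrite (_ : f = \sum_i \sum_j (fun x => f x i j *: delta_mx i j)); last first.
  apply/funext => x; rewrite [LHS]matrix_sum_delta fct_sumE; apply: eq_bigr => i _.
  by rewrite fct_sumE.
by do 2 (apply: differentiable_sum => ?); apply: differentiableZl.
Qed.

Lemma differentiable_entry f u i j : differentiable f u -> differentiable (fun x => f x i j) u.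
Proof.
move=> df; exact: (differentiable_comp df (differentiable_coord (f u) i j)).
Qed.

Lemma derive_entry f u v i j : differentiable f u -> ('D_v f u) i j = 'D_v (fun x => f x i j) u.
Proof. by move=> df; rewrite derive_mx ?mxE//; exact: diff_derivable. Qed.

End matrix_valued.

Section ck.
Context {R : realType} {n : nat}.
Local Notation V := 'rV[R]_n.

Section general.
Context {W : normedModType R}.
Implicit Types (f g : V -> W) (U : set V).

(** All iterated directional derivatives up to order [k] are differentiable on [U]; thus [ck 0] is
    already differentiability. Splitting [smooth_on] by order lets the closure properties be proved
    by induction on [k]. *)
Fixpoint ck (k : nat) U f : Prop :=
  (forall u, U u -> differentiable f u) /\
  if k is k'.+1 then forall v, ck k' U (fun u => 'D_v f u) else True.

Lemma ck_diff k U f u : ck k U f -> U u -> differentiable f u.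
Proof. by case: k => [|k] [df _]; exact: df. Qed.

Lemma ck_cont k U f u : ck k U f -> U u -> {for u, continuous f}.
Proof. by move=> /ck_diff H /H; exact: differentiable_continuous. Qed.

Lemma ckS k U f : ck k.+1 U f -> ck k U f.
Proof. by elim: k f => [|k IH] f [df H]; split => // v; apply: IH; exact: H. Qed.

Lemma ck_derive k U f v : ck k.+1 U f -> ck k U (fun u => 'D_v f u).
Proof. by case=> _ H; exact: H. Qed.

Lemma ck_sub k U U' f : U' `<=` U -> ck k U f -> ck k U' f.
Proof.
move=> UU; elim: k f => [|k IH] f [df H]; split => //; try by move=> u /UU; exact: df.
by move=> v; apply: IH; exact: H.
Qed.

Lemma ck_ext k U f g : open U -> (forall u, U u -> f u = g u) -> ck k U f -> ck k U g.
Proof.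
move=> oU; elim: k f g => [|k IH] f g fg [df H]; split => //.
- by move=> u Uu; apply: differentiable_open_eq fg (df u Uu).
- by move=> u Uu; apply: differentiable_open_eq fg (df u Uu).
- move=> v; apply: IH (H v) => u Uu; exact: derive_open_eq fg.
Qed.

Lemma smooth_ck U f : smooth_on U f -> forall k, ck k U f.
Proof.
move=> sf k; elim: k f sf => [|k IH] f sf; split => //; try by move=> u Uu; exact: (sf [::] u Uu).
move=> v; apply: IH => s u Uu; have := sf (rcons s v) u Uu.
suff -> : iter_derive (rcons s v) f = iter_derive s (fun u => 'D_v f u) by [].
by elim: s {u Uu} => //= w s ->.
Qed.

Lemma ck_smooth U f : (forall k, ck k U f) -> smooth_on U f.
Proof.
move=> cf s; elim/last_ind: s f cf => [|s v IH] f cf u Uu; first exact: (ck_diff (cf 0%N) Uu).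
have -> : iter_derive (rcons s v) f = iter_derive s (fun u => 'D_v f u).
  by elim: s {IH} => //= w s ->.
by apply: IH => // k; exact: ck_derive (cf k.+1).
Qed.

Lemma ck_cst k U (a : W) : ck k U (cst a).
Proof.
elim: k a => [|k IH] a; split => //; try by move=> u _; exact: differentiable_cst.
by move=> v; rewrite (_ : (fun u => _) = cst 0)//; apply/funext => u; rewrite derive_cst.
Qed.

Lemma ckD k U f g : open U -> ck k U f -> ck k U g -> ck k U (fun u => f u + g u).
Proof.
move=> oU; elim: k f g => [|k IH] f g [df Hf] [dg Hg]; split => //.
- by move=> u Uu; apply: differentiableD; [exact: df|exact: dg].
- by move=> u Uu; apply: differentiableD; [exact: df|exact: dg].
- move=> v; apply: ck_ext (IH _ _ (Hf v) (Hg v)) => // u Uu.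
  by rewrite deriveD//; apply: diff_derivable; [exact: df|exact: dg].
Qed.

Lemma ckZ k U (a : R) f : open U -> ck k U f -> ck k U (fun u => a *: f u).
Proof.
move=> oU; elim: k f => [|k IH] f [df Hf]; split => //.
- by move=> u Uu; apply: differentiableZ; exact: df.
- by move=> u Uu; apply: differentiableZ; exact: df.
- move=> v; apply: ck_ext (IH _ (Hf v)) => // u Uu.
  by rewrite deriveZ//; apply: diff_derivable; exact: df.
Qed.

Lemma ckN k U f : open U -> ck k U f -> ck k U (fun u => - f u).
Proof.
by move=> oU /(ckZ (-1) oU); apply: ck_ext => // u _; rewrite scaleN1r.
Qed.

Lemma ck_sum k U (I : Type) (r : seq I) (P : pred I) (f : I -> V -> W) : open U ->
  (forall i, ck k U (f i)) -> ck k U (fun u => \sum_(i <- r | P i) f i u).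
Proof.
move=> oU cf; elim: r => [|a r IH].
  by rewrite (_ : (fun u => _) = cst 0); [exact: ck_cst|apply/funext => u; rewrite big_nil].
have [Pa|Pa] := boolP (P a).
  rewrite (_ : (fun u => _) = fun u => f a u + \sum_(i <- r | P i) f i u); first exact: ckD.
  by apply/funext => u; rewrite big_cons Pa.
by rewrite (_ : (fun u => _) = fun u => \sum_(i <- r | P i) f i u)//; apply/funext => u; rewrite big_cons (negbTE Pa).
Qed.
End general.

Section real.
Implicit Types (f g : V -> R) (U : set V).

Lemma ckM k U f g : open U -> ck k U f -> ck k U g -> ck k U (fun u => f u * g u).
Proof.
move=> oU; elim: k f g => [|k IH] f g cf cg; split => //.
- by move=> u Uu; apply: differentiableM; [exact: ck_diff cf _|exact: ck_diff cg _].
- by move=> u Uu; apply: differentiableM; [exact: ck_diff cf _|exact: ck_diff cg _].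
- move=> v; apply: (@ck_ext _ k U (fun u => f u * 'D_v g u + g u * 'D_v f u)) => //.
    move=> u Uu; have := @deriveM _ _ f g u v; rewrite /GRing.mul /= => -> //.
    - by apply: diff_derivable; exact: ck_diff cf _.
    - by apply: diff_derivable; exact: ck_diff cg _.
  by apply: ckD => //; apply: IH; (exact: ckS || exact: ck_derive).
Qed.

Lemma ckV k U f : open U -> (forall u, U u -> f u != 0) -> ck k U f -> ck k U (fun u => (f u)^-1).
Proof.
move=> oU f0; elim: k f f0 => [|k IH] f f0 cf; split => //.
- by move=> u Uu; apply: differentiableV; [exact: ck_diff cf _|exact: f0].
- by move=> u Uu; apply: differentiableV; [exact: ck_diff cf _|exact: f0].
- move=> v; apply: (@ck_ext _ k U (fun u => - ('D_v f u * ((f u)^-1 * (f u)^-1)))) => //.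
    move=> u Uu; rewrite deriveV ?f0//; last by apply: diff_derivable; exact: ck_diff cf _.
    by rewrite /GRing.scale /= mulNr mulrC expr2 invfM.
  apply: ckN => //; apply: ckM => //; first exact: ck_derive.
  by apply: ckM => //; apply: IH => //; exact: ckS.
Qed.

Lemma differentiable_sqrt f u : 0 < f u -> differentiable f u ->
  differentiable (fun x => Num.sqrt (f x)) u /\
  forall v, 'D_v (fun x => Num.sqrt (f x)) u = 'D_v f u * (2 * Num.sqrt (f u))^-1.
Proof.
move=> fu df; have [ds es] := is_derive1_sqrt fu.
have dsq : differentiable (@Num.sqrt R) (f u) by apply/derivable1_diffP.
split; first exact: (differentiable_comp df dsq).
move=> v; rewrite -[LHS]/('D_v (@Num.sqrt R \o f) u) derive_chain// -[X in 'D_X _ _]mulr1.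
by rewrite -/(_ *: (1 : R)) deriveZv// es.
Qed.

Lemma ck_sqrt k U f : open U -> (forall u, U u -> 0 < f u) -> ck k U f -> ck k U (fun u => Num.sqrt (f u)).
Proof.
move=> oU f0; elim: k f f0 => [|k IH] f f0 cf; split => //.
- by move=> u Uu; have [] := differentiable_sqrt (f0 u Uu) (ck_diff cf Uu).
- by move=> u Uu; have [] := differentiable_sqrt (f0 u Uu) (ck_diff cf Uu).
- move=> v; apply: (@ck_ext _ k U (fun u => 'D_v f u * (2 * Num.sqrt (f u))^-1)) => //.
    by move=> u Uu; have [_ ->] := differentiable_sqrt (f0 u Uu) (ck_diff cf Uu).
  apply: ckM => //; first exact: ck_derive.
  apply: ckV => // [u Uu|]; first by rewrite mulf_neq0// sqrtr_eq0 -ltNge f0.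
  by apply: ckM; [|exact: ck_cst|apply: IH => //; exact: ckS].
Qed.

Lemma ck_coord k U i : ck k U (fun u : V => u 0 i).
Proof.
have d u : differentiable (fun u : V => u 0 i) u by exact: differentiable_coord.
case: k => [|k]; split => // v.
rewrite (_ : (fun u => _) = cst (v 0 i)); first exact: ck_cst.
apply/funext => u; rewrite -derive_entry//.
by rewrite derive_id.
Qed.

End real.

Section matrices.
Context {m l : nat}.
Implicit Types (f : V -> 'M[R]_(m, l)) (U : set V).

Lemma ck_entry k U f i j : open U -> ck k U f -> ck k U (fun u => f u i j).
Proof.
move=> oU; elim: k f => [|k IH] f [df Hf]; split => //.
- by move=> u Uu; apply: differentiable_entry; exact: df.
- by move=> u Uu; apply: differentiable_entry; exact: df.
- move=> v; apply: ck_ext (IH _ (Hf v)) => // u Uu; rewrite derive_entry//; exact: df.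
Qed.

Lemma ck_mx k U f : open U -> (forall i j, ck k U (fun u => f u i j)) -> ck k U f.
Proof.
move=> oU; elim: k f => [|k IH] f cf; split => //.
- by move=> u Uu; apply: differentiable_mx => i j; exact: ck_diff (cf i j) Uu.
- by move=> u Uu; apply: differentiable_mx => i j; exact: ck_diff (cf i j) Uu.
- move=> v; apply: IH => i j; apply: ck_ext (ck_derive v (cf i j)) => // u Uu.
  by rewrite derive_entry//; apply: differentiable_mx => a b; exact: ck_diff (cf a b) Uu.
Qed.

End matrices.

Lemma ck_id k U : open U -> ck k U (fun u : V => u).
Proof. by move=> oU; apply: ck_mx => // i j; rewrite ord1; exact: ck_coord. Qed.

Lemma ck_mulmx k m l r U (f : V -> 'M[R]_(m, l)) (g : V -> 'M[R]_(l, r)) : open U ->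
  ck k U f -> ck k U g -> ck k U (fun u => f u *m g u).
Proof.
move=> oU cf cg; apply: ck_mx => // i j.
rewrite (_ : (fun u => _) = fun u => \sum_a f u i a * g u a j); last first.
  by apply/funext => u; rewrite mxE.
by apply: ck_sum => // a; apply: ckM => //; exact: ck_entry.
Qed.

Lemma ck_tr k m l U (f : V -> 'M[R]_(m, l)) : open U -> ck k U f -> ck k U (fun u => (f u)^T).
Proof.
move=> oU cf; apply: ck_mx => // i j; rewrite (_ : (fun u => _) = fun u => f u j i); first exact: ck_entry.
by apply/funext => u; rewrite mxE.
Qed.

Lemma ck_prod k (I : Type) (r : seq I) (U : set V) (f : I -> V -> R) : open U ->
  (forall i, ck k U (f i)) -> ck k U (fun u => \prod_(i <- r) f i u).
Proof.
move=> oU cf; elim: r => [|a r IH].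
  by rewrite (_ : (fun u => _) = cst 1); [exact: ck_cst|apply/funext => u; rewrite big_nil].
rewrite (_ : (fun u => _) = fun u => f a u * \prod_(i <- r) f i u); first exact: ckM.
by apply/funext => u; rewrite big_cons.
Qed.

Lemma ck_det k m U (f : V -> 'M[R]_m) : open U -> ck k U f -> ck k U (fun u => \det (f u)).
Proof.
move=> oU cf; apply: ck_sum => // s; apply: ckM => //; first exact: ck_cst.
by apply: ck_prod => // i; exact: ck_entry.
Qed.

Lemma ck_adj k m U (f : V -> 'M[R]_m) : open U -> ck k U f -> ck k U (fun u => \adj (f u)).
Proof.
move=> oU cf; apply: ck_mx => // i j.
rewrite (_ : (fun u => _) = fun u => (-1) ^+ (j + i) * \det (row' j (col' i (f u)))); last first.
  by apply/funext => u; rewrite mxE.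
apply: ckM => //; first exact: ck_cst.
apply: ck_det => //; apply: ck_mx => // a b.
rewrite (_ : (fun u => _) = fun u => f u (lift j a) (lift i b)); first exact: ck_entry.
by apply/funext => u; rewrite !mxE.
Qed.

Lemma ck_scale k m l U (a : V -> R) (f : V -> 'M[R]_(m, l)) : open U ->
  ck k U a -> ck k U f -> ck k U (fun u => a u *: f u).
Proof.
move=> oU ca cf; apply: ck_mx => // i j; rewrite (_ : (fun u => _) = fun u => a u * f u i j).
  by apply: ckM => //; exact: ck_entry.
by apply/funext => u; rewrite mxE.
Qed.

Lemma ck_invmx k m U (f : V -> 'M[R]_m) : open U -> (forall u, U u -> f u \in unitmx) ->
  ck k U f -> ck k U (fun u => invmx (f u)).
Proof.
move=> oU fu cf; apply: (@ck_ext _ k U (fun u => (\det (f u))^-1 *: \adj (f u))) => //.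
  by move=> u Uu; rewrite /invmx fu.
apply: ck_scale => //; last exact: ck_adj.
by apply: ckV => //; [move=> u /fu; rewrite unitmxE unitfE|exact: ck_det].
Qed.

Lemma ck_row_mx k m n1 n2 U (a : V -> 'M[R]_(m, n1)) (b : V -> 'M[R]_(m, n2)) : open U ->
  ck k U a -> ck k U b -> ck k U (fun u => row_mx (a u) (b u)).
Proof.
move=> oU ca cb; apply: ck_mx => // i j.
case: (split_ordP j) => j' ->.
- by under eq_fun do rewrite row_mxEl; exact: ck_entry.
- by under eq_fun do rewrite row_mxEr; exact: ck_entry.
Qed.

Lemma ck_lsubmx k m n1 n2 U (f : V -> 'M[R]_(m, n1 + n2)) : open U -> ck k U f -> ck k U (fun u => lsubmx (f u)).
Proof. by move=> oU cf; apply: ck_mx => // i j; under eq_fun do rewrite mxE; exact: ck_entry. Qed.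

Lemma ck_rsubmx k m n1 n2 U (f : V -> 'M[R]_(m, n1 + n2)) : open U -> ck k U f -> ck k U (fun u => rsubmx (f u)).
Proof. by move=> oU cf; apply: ck_mx => // i j; under eq_fun do rewrite mxE; exact: ck_entry. Qed.

Lemma ck_usubmx k m1 m2 l U (f : V -> 'M[R]_(m1 + m2, l)) : open U -> ck k U f -> ck k U (fun u => usubmx (f u)).
Proof. by move=> oU cf; apply: ck_mx => // i j; under eq_fun do rewrite mxE; exact: ck_entry. Qed.

Lemma ck_dsubmx k m1 m2 l U (f : V -> 'M[R]_(m1 + m2, l)) : open U -> ck k U f -> ck k U (fun u => dsubmx (f u)).
Proof. by move=> oU cf; apply: ck_mx => // i j; under eq_fun do rewrite mxE; exact: ck_entry. Qed.

End ck.

Lemma row_sum_coord (R : realType) n (v : 'rV[R]_n) : v = \sum_i v 0 i *: delta_mx 0 i.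
Proof. exact: row_sum_delta. Qed.

Lemma mulmx_inj (R : realType) n m (A B : 'M[R]_(n, m)) : (forall v : 'rV[R]_n, v *m A = v *m B) -> A = B.
Proof. by move=> H; apply/row_matrixP => i; rewrite !rowE. Qed.

Lemma jacobian_unique (R : realType) n m (f : 'rV[R]_n -> 'rV[R]_m) u A : differentiable f u ->
  (forall v, 'D_v f u = v *m A) -> 'J f u = A.
Proof. by move=> df H; apply: mulmx_inj => v; rewrite -deriveEjacobian. Qed.

Lemma derive_sum_coord (R : realType) n (W : normedModType R) (f : 'rV[R]_n -> W) u v : differentiable f u ->
  'D_v f u = \sum_i v 0 i *: 'D_(delta_mx 0 i) f u.
Proof.
move=> df; rewrite {1}(row_sum_delta v) deriveE// linear_sum; apply: eq_bigr => i _.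
by rewrite linearZ deriveE.
Qed.

Section ck_comp.
Context {R : realType} {n m : nat}.

(** The chain rule in coordinates writes a derivative of the composite as a sum of products in which
    the outer function is replaced by its partial derivatives, so the induction on the order passes
    through all outer functions. *)
Lemma ck_comp k (U : set 'rV[R]_n) (V : set 'rV[R]_m) (f : 'rV[R]_n -> 'rV[R]_m) (g : 'rV[R]_m -> R) :
  open U -> (forall u, U u -> V (f u)) -> ck k U f -> ck k V g -> ck k U (fun u => g (f u)).
Proof.
move=> oU UV; elim: k g => [|k IH] g cf cg; split => //.
- by move=> u Uu; exact: (differentiable_comp (ck_diff cf Uu) (ck_diff cg (UV _ Uu))).
- by move=> u Uu; exact: (differentiable_comp (ck_diff cf Uu) (ck_diff cg (UV _ Uu))).
- move=> v; apply: (@ck_ext _ _ _ k U (fun u => \sum_i 'D_v f u 0 i * 'D_(delta_mx 0 i) g (f u))) => //.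
    move=> u Uu; have df := ck_diff cf Uu; have dg := ck_diff cg (UV _ Uu).
    by apply: etrans _ (esym (derive_chain v df dg)); rewrite (derive_sum_coord _ dg).
  apply: ck_sum => // i; apply: ckM => //.
    by apply: ck_entry => //; exact: ck_derive.
  exact: (IH (fun y => 'D_(delta_mx 0 i) g y) (ckS cf) (ck_derive _ cg)).
Qed.

Lemma ck_comp_mx k a b (U : set 'rV[R]_n) (V : set 'rV[R]_m) (f : 'rV[R]_n -> 'rV[R]_m) (g : 'rV[R]_m -> 'M[R]_(a, b)) :
  open U -> open V -> (forall u, U u -> V (f u)) -> ck k U f -> ck k V g -> ck k U (fun u => g (f u)).
Proof.
move=> oU oV UV cf cg; apply: ck_mx => // i j.
exact: (@ck_comp k U V f (fun v => g v i j) oU UV cf (ck_entry i j oV cg)).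
Qed.

Lemma jacobianE (f : 'rV[R]_n -> 'rV[R]_m) u : differentiable f u ->
  'J f u = \matrix_(i, j) ('D_(delta_mx 0 i) f u) 0 j.
Proof.
move=> df; apply/matrixP => i j; by rewrite [RHS]mxE deriveEjacobian// -rowE [RHS]mxE.
Qed.

Lemma ck_jacobian k U (f : 'rV[R]_n -> 'rV[R]_m) : open U -> ck k.+1 U f -> ck k U (jacobian f).
Proof.
move=> oU cf; apply: ck_mx => // i j.
apply: (@ck_ext _ _ _ k U (fun u => ('D_(delta_mx 0 i) f u) 0 j)) => //.
  by move=> u Uu; rewrite jacobianE ?mxE//; exact: ck_diff cf Uu.
by apply: ck_entry => //; exact: ck_derive.
Qed.

Lemma jacobian_eps (f : 'rV[R]_n -> 'rV[R]_m) u : differentiable f u -> forall e : R, 0 < e ->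
  exists2 r : R, 0 < r & forall v, `|v - u| < r -> `|f v - f u - (v - u) *m 'J f u| <= e * `|v - u|.
Proof.
move=> df e e0; have [r r0 Hr] := diff_eps df e0; exists r => // v vr.
by have := Hr v vr; rewrite -deriveE// deriveEjacobian.
Qed.

Lemma jacobian_chain l (f : 'rV[R]_n -> 'rV[R]_m) (g : 'rV[R]_m -> 'rV[R]_l) u :
  differentiable f u -> differentiable g (f u) -> 'J (g \o f) u = 'J f u *m 'J g (f u).
Proof.
move=> df dg; apply: jacobian_unique; first exact: differentiable_comp.
by move=> v; rewrite derive_chain// !deriveEjacobian// mulmxA.
Qed.

Lemma jacobian_near (f g : 'rV[R]_n -> 'rV[R]_m) u : (\forall v \near u, f v = g v) ->
  differentiable f u -> 'J f u = 'J g u.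
Proof.
move=> fg df; have dg := differentiable_near fg df.
by apply: jacobian_unique => // v; rewrite (diff_near_eq v fg) deriveEjacobian.
Qed.

End ck_comp.

Lemma jacobian_id (R : realType) n (u : 'rV[R]_n) : 'J id u = 1%:M.
Proof.
apply: jacobian_unique; first by have [] : is_diff u (@id 'rV[R]_n) id by exact: is_diff_id.
by move=> v; rewrite derive_id mulmx1.
Qed.

Lemma mulmx_norm_le (R : realType) (a b : nat) (A : 'M[R]_(a, b)) (v : 'rV[R]_a) : `|v *m A| <= a%:R * `|A| * `|v|.
Proof.
apply: norm_le; first by rewrite !mulr_ge0.
move=> j; rewrite mxE; apply: le_trans (ler_norm_sum _ _ _) _.
apply: (@le_trans _ _ (\sum_(i < a) `|v| * `|A|)).
  apply: ler_sum => i _; rewrite normrM ler_pM//; first exact: norm_coord.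
  by rewrite [X in _ <= X]/Num.norm/= mx_normrE; apply/bigmax_geP; right; exists (i, j).
have -> : \sum_(i < a) `|v| * `|A| = a%:R * `|A| * `|v| by rewrite sumr_const card_ord -mulr_natl; ring.
exact: lexx.
Qed.

Lemma mulmx_norm (R : realType) n m (A : 'M[R]_(n, m)) : exists2 C : R, 0 < C & forall v : 'rV[R]_n, `|v *m A| <= C * `|v|.
Proof.
exists (n%:R * `|A| + 1); first by rewrite ltr_wpDl// mulr_ge0.
by move=> v; apply: le_trans (mulmx_norm_le A v) _; apply: ler_wpM2r => //; rewrite lerDl.
Qed.

Lemma ball_segment (R : realType) (V : normedModType R) (u0 x y : V) (r s : R) : ball u0 r x -> ball u0 r y -> 0 <= s <= 1 -> ball u0 r (x + s *: (y - x)).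
Proof.
move=> xB yB s01; have -> : x + s *: (y - x) = (1 - s) *: x + s *: y.
  by rewrite scalerBr scalerBl scale1r addrA addrAC.
move: xB yB; rewrite -ball_normE /= => xB yB.
have -> : u0 - ((1 - s) *: x + s *: y) = (1 - s) *: (u0 - x) + s *: (u0 - y).
  rewrite !scalerBr opprD addrACA -scalerDl subrK scale1r; congr (_ + _).
apply: le_lt_trans (ler_normD _ _) _; rewrite !normrZ (ger0_norm (_ : 0 <= 1 - s)); last lra.
rewrite ger0_norm; last by case/andP: s01.
have [->|s0] := eqVneq s 0; first by rewrite subr0 mul1r mul0r addr0.
have : s * `|u0 - y| < s * r by rewrite ltr_pM2l// lt_neqAle eq_sym s0; case/andP: s01.
have : (1 - s) * `|u0 - x| <= (1 - s) * r by apply: ler_wpM2l; [lra|exact: ltW].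
lra.
Qed.

Section cov_smooth.
Context (R : realType) (n : nat).
Local Notation W := 'rV[R]_n.
Variables (U V : set W) (f g : W -> W).

Lemma jacobian_inv : open U -> (forall u, U u -> differentiable f u) -> (forall u, U u -> differentiable g (f u)) ->
  (forall u, U u -> g (f u) = u) -> forall u, U u -> 'J f u *m 'J g (f u) = 1%:M.
Proof.
move=> oU df dg fK u Uu; rewrite -jacobian_chain//; [|exact: df|exact: dg].
rewrite -[RHS](jacobian_id u); apply/esym/jacobian_near; last by have [] : is_diff u (@id W) id by exact: is_diff_id.
by have : nbhs u U; [exact: open_nbhs_nbhs|apply: filterS => v /fK].
Qed.

Definition diffeo := [/\ open U, open V, ck 1 U f, ck 1 V g &
  [/\ forall u, U u -> V (f u), forall v, V v -> U (g v),
   forall u, U u -> g (f u) = u & forall v, V v -> f (g v) = v]].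
End cov_smooth.

Lemma diffeo_sym (R : realType) n (U V : set 'rV[R]_n) f g : diffeo U V f g -> diffeo V U g f.
Proof. by case=> oU oV cf cg [fV gU fK gK]. Qed.

Section change_of_variables.
Context (R : realType) (n : nat).
Local Notation W := 'rV[R]_n.

Lemma diffeo_jac (U V : set W) f g u : diffeo U V f g -> U u -> 'J f u *m 'J g (f u) = 1%:M.
Proof.
move=> [oU oV cf cg [fV gU fK gK]] Uu; apply: (jacobian_inv oU) => // v Uv; first exact: ck_diff cf Uv.
exact: ck_diff cg (fV _ Uv).
Qed.

(** The inverse Jacobian serves as [B u]; with a genuine derivative the tolerance [kap] can be 0. *)
Lemma diffeo_cov_le (U V : set W) f g (F : W -> \bar R) : diffeo U V f g ->
  measurable_fun (Bset V) F -> (forall v, V v -> 0 <= F v)%E ->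
  (\int[lam R n]_(v in V) F v <= \int[lam R n]_(u in U) (F (f u) * (`|\det ('J f u)|)%:E))%E.
Proof.
move=> dfg mF F0; have [oU oV cf cg [fV gU fK gK]] := dfg.
have JJ u := @diffeo_jac U V f g u dfg.
have Ju u : U u -> 'J g (f u) \in unitmx by move=> Uu; have /mulmx1_unit[] := JJ u Uu.
apply: (@cov_upper R n U V f g (fun u => 'J g (f u)) 0) => //.
- by move=> u Uu; exact: ck_cont cf Uu.
- by move=> v Vv; exact: ck_cont cg Vv.
- move=> u Uu; rewrite mulr0 addr0 expr1n mulr1 -normfV; congr (`| _ |).
  have := congr1 determinant (JJ u Uu); rewrite det_mulmx det1 => H.
  by rewrite -[LHS]mulr1 -(@divff _ (\det ('J g (f u)))) ?mulrA ?H ?div1r// -unitfE -unitmxE Ju.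
- move=> u Uu; apply: continuous_comp; last exact: norm_continuous.
  exact: (ck_cont (ck_det oU (ck_jacobian oU cf)) Uu).
- move=> u Uu e e0; have [C C0 HC] := mulmx_norm ('J g (f u)).
  have eC : 0 < e / C by rewrite divr_gt0.
  have [r r0 Hr] := jacobian_eps (ck_diff cf Uu) eC; exists r => // v Uv vr.
  have -> : (f v - f u) *m 'J g (f u) - (v - u) = (f v - f u - (v - u) *m 'J f u) *m 'J g (f u).
    by rewrite [RHS]mulmxBl -[in RHS]mulmxA JJ// mulmx1.
  apply: (le_trans (HC _)); rewrite add0r -ler_pdivlMl// mulrA [C^-1 * e]mulrC; exact: Hr.
Qed.

(** The opposite inequality is the upper bound for the inverse map, applied to the integrand
    multiplied by the Jacobian factor; the two determinants cancel. *)
Lemma diffeo_cov (U V : set W) f g (F : W -> \bar R) : diffeo U V f g ->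
  measurable_fun (Bset V) F -> (forall v, V v -> 0 <= F v)%E ->
  (\int[lam R n]_(v in V) F v = \int[lam R n]_(u in U) (F (f u) * (`|\det ('J f u)|)%:E))%E.
Proof.
move=> dfg mF F0; have dgf := diffeo_sym dfg.
have [oU oV cf cg [fV gU fK gK]] := dfg.
apply/eqP; rewrite eq_le (diffeo_cov_le dfg)//=.
have mFf : measurable_fun (Bset U) (fun u => F (f u) * (`|\det ('J f u)|)%:E)%E.
  apply: emeasurable_funM.
    apply: (measurable_comp (open_Borel oV) _ mF); first by move=> _ [u Uu <-]; exact: fV.
    by apply: continuous_Borel => // u Uu; exact: ck_cont cf Uu.
  apply/measurable_EFinP; apply: continuous_BorelR => // u Uu.
  apply: continuous_comp; last exact: norm_continuous.
  exact: (ck_cont (ck_det oU (ck_jacobian oU cf)) Uu).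
apply: le_trans (diffeo_cov_le dgf mFf _) _; first by move=> u Uu; rewrite mule_ge0 ?F0 ?lee_fin//; exact: fV.
rewrite le_eqVlt; apply/orP; left; apply/eqP; apply: eq_integral => v; rewrite inE => Vv.
have JJ : 'J f (g v) *m 'J g v = 1%:M by have := diffeo_jac dfg (gU v Vv); rewrite gK.
have DD : `|\det ('J f (g v))| * `|\det ('J g v)| = 1.
  by rewrite -normrM -det_mulmx JJ det1 normr1.
have gen (x : \bar R) (a b : R) : a * b = 1 -> (x * a%:E * b%:E = x)%E.
  by move=> ab; rewrite -muleA -EFinM ab mule1.
apply: (etrans (gen _ _ _ DD)); by rewrite gK.
Qed.

End change_of_variables.

Lemma lam0 (R : realType) (f : 'rV[R]_0 -> \bar R) : bfun f -> (\int[lam R 0]_u f u = f 0%R)%E.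
Proof. by move=> [mf f0]; rewrite -lebesgue_rVE. Qed.

(** Associativity of concatenation. The splittings [1 + p + q] and [1 + (p + q)] give convertible
    dimensions but different block decompositions, so the entries are compared case by case. *)
Lemma rcons_row_mx (R : realType) p q (t : R) (a : 'rV[R]_p) (c : 'rV[R]_q) :
  row_mx (rcons_rV (t, a)) c = rcons_rV (t, row_mx a c) :> 'rV[R]_(p + q).+1.
Proof.
apply/rowP => i; rewrite /rcons_rV /=.
have [i0|i0] := posnP (val i).
  have El : i = lshift q (lshift p (0 : 'I_1)) :> 'I_(1 + p + q) by exact: val_inj.
  have Er : i = lshift (p + q) (0 : 'I_1) by exact: val_inj.
  apply: (etrans (congr1 (@row_mx R 1 (1 + p) q (row_mx t%:M a) c 0) El)).
  apply: (etrans _ (esym (congr1 (@row_mx R 1 1 (p + q) t%:M (row_mx a c) 0) Er))).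
  by rewrite !row_mxEl.
have jl : (i.-1 < p + q)%N by case: i i0 => -[|k]// kl _.
pose j := Ordinal jl.
have ij : i = rshift 1 j by apply: val_inj => /=; rewrite add1n prednK.
apply: (etrans _ (esym (congr1 (@row_mx R 1 1 (p + q) t%:M (row_mx a c) 0) ij))).
rewrite row_mxEr; have [k jk|k jk] := fintype.splitP j.
  have -> : j = lshift q k by exact: val_inj.
  have El : i = lshift q (rshift 1 k) :> 'I_(1 + p + q) by apply: val_inj; rewrite ij /= -jk.
  apply: (etrans (congr1 (@row_mx R 1 (1 + p) q (row_mx t%:M a) c 0) El)).
  by rewrite !row_mxEl row_mxEr.
have -> : j = rshift p k by exact: val_inj.
have El : i = rshift (1 + p) k :> 'I_(1 + p + q) by apply: val_inj; rewrite ij /= -addnA -jk.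
apply: (etrans (congr1 (@row_mx R 1 (1 + p) q (row_mx t%:M a) c 0) El)).
by rewrite !row_mxEr.
Qed.

Lemma bfun_int (R : realType) n (f : 'rV[R]_n.+1 -> \bar R) : bfun f ->
  bfun (fun y => \int[lebesgue_measure]_t f (rcons_rV (t, y)))%E.
Proof.
move=> [mf f0]; split; last by move=> u; exact: integral_ge0.
apply: (@measurable_fun_fubini_tonelli_G _ _ (measurableTypeR R) (Borel 'rV[R]_n) R lebesgue_measure (fun z => f (rcons_rV z))) => //.
exact: (measurableT_comp mf (@measurable_rcons_rV R n)).
Qed.

Lemma continuous_row_mxl (R : realType) p q (c : 'rV[R]_q) : continuous (fun a : 'rV[R]_p => row_mx a c).
Proof.
move=> a; apply: mx_continuous => i j; rewrite ord1; case: (fintype.splitP j) => k jk.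
  rewrite (_ : (fun y : 'rV[R]_p => _) = (fun y : 'rV[R]_p => y 0 k)); first exact: coord_cont.
  by apply/funext => y; rewrite (_ : j = lshift q k) ?row_mxEl//; exact: val_inj.
rewrite (_ : (fun y : 'rV[R]_p => _) = (fun y : 'rV[R]_p => c 0 k)); first exact: cst_continuous.
by apply/funext => y; rewrite (_ : j = rshift p k) ?row_mxEr//; exact: val_inj.
Qed.

Lemma continuous_row_mxr (R : realType) p q (a : 'rV[R]_p) : continuous (fun c : 'rV[R]_q => row_mx a c).
Proof.
move=> c; apply: mx_continuous => i j; rewrite ord1; case: (fintype.splitP j) => k jk.
  rewrite (_ : (fun y : 'rV[R]_q => _) = (fun y : 'rV[R]_q => a 0 k)); first exact: cst_continuous.
  by apply/funext => y; rewrite (_ : j = lshift q k) ?row_mxEl//; exact: val_inj.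
rewrite (_ : (fun y : 'rV[R]_q => _) = (fun y : 'rV[R]_q => y 0 k)); first exact: coord_cont.
by apply/funext => y; rewrite (_ : j = rshift p k) ?row_mxEr//; exact: val_inj.
Qed.

(** Tonelli's theorem for leaf and transverse coordinates, by induction on [p]: the recursive
    definition of the measure peels off the first coordinate, which is a leaf coordinate. *)
Lemma lam_split (R : realType) p q (f : 'rV[R]_(p + q) -> \bar R) : bfun f ->
  bfun (fun c : 'rV[R]_q => \int[lam R p]_a f (row_mx a c))%E /\
  (\int[lam R (p + q)]_u f u = \int[lam R q]_c \int[lam R p]_a f (row_mx a c))%E.
Proof.
elim: p f => [|p IH] f bf.
  have E c : (\int[lam R 0]_a f (row_mx a c) = f c)%E.
    rewrite (lam0 (f := fun a => f (row_mx a c))).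
      congr f; apply/rowP => i; have Ei : i = rshift 0 i by exact: val_inj.
      by apply: (etrans (congr1 (@row_mx R 1 0 q 0 c 0) Ei)); rewrite row_mxEr.
    by apply: (bfun_cont (h := fun a : 'rV[R]_0 => row_mx a c)) bf; exact: continuous_row_mxl.
  rewrite (_ : (fun c => _) = f); last exact/funext.
  by split => //; apply: eq_integral => c _; rewrite E.
have [b1 E1] := IH _ (bfun_int bf).
have E c : (\int[lam R p.+1]_a f (row_mx a c) = \int[lam R p]_a \int[lebesgue_measure]_t f (rcons_rV (t, row_mx a c)))%E.
  rewrite (lam_rec21 (f := fun a => f (row_mx a c))).
    by apply: eq_integral => a _; apply: eq_integral => t _; rewrite rcons_row_mx.
  by apply: (bfun_cont (h := fun a : 'rV[R]_p.+1 => row_mx a c : 'rV[R]_(p.+1 + q))) bf; exact: continuous_row_mxl.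
split; first by rewrite (_ : (fun c => _) = (fun c => \int[lam R p]_a \int[lebesgue_measure]_t f (rcons_rV (t, row_mx a c)))%E)//; exact/funext.
rewrite (lam_rec21 bf) E1; apply: eq_integral => c _; exact/esym/E.
Qed.

(** * Riemannian volume computed from an atlas *)

Section atlas_volume.
Context (R : realType) (T J : Type) (d : nat).
Local Notation V := 'rV[R]_d.
Variables (D : J -> set V) (e : J -> V -> T) (h : J -> V -> R) (t : J -> J -> V -> V).
Hypotheses (oD : forall j, open (D j)) (ch : forall j u, D j u -> {for u, continuous (h j)})
  (h0 : forall j u, D j u -> 0 <= h j u)
  (e_inj : forall j u v, D j u -> D j v -> e j u = e j v -> u = v).

Let hD j := (h j \* \1_(D j) : V -> R).
Let mhD j : measurable_fun setT (hD j : Borel V -> R).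
Proof. by apply: measurable_indicR => // u; exact: ch. Qed.
Let hD0 j u : 0 <= hD j u.
Proof. by rewrite /hD /= indicE; case: (boolP (_ \in _)) => [/set_mem/h0|_]; rewrite ?mulr1 ?mulr0. Qed.

Definition chart_vol j : {measure set (Borel V) -> \bar R} := mdens (lam R d) (@mhD j) (@hD0 j).

Lemma chart_volE j A : borel A -> A `<=` D j ->
  lebesgue_rV (fun u => (h j u * \1_A u)%:E) = chart_vol j A.
Proof.
move=> mA AD.
have E u : (h j u * \1_A u)%:E = ((EFin \o hD j) \_ A) u.
  rewrite patchE indicE; case: ifPn => [/set_mem/AD Du|_]; last by rewrite mulr0.
  by rewrite /hD /= indicE mem_set.
rewrite (_ : (fun u => _) = (EFin \o hD j) \_ A); last exact/funext.
rewrite lebesgue_rVE; first by rewrite [RHS]integral_mkcond.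
  apply/(measurable_restrictT _ _).1 => //.
  by apply: (@measurable_funS _ _ _ _ setT) => //; exact/measurable_EFinP.
by move=> u; rewrite patchE; case: ifPn => // _; rewrite lee_fin.
Qed.

Let chart_vol_int j A : A `<=` D j -> chart_vol j A = (\int[lam R d]_(u in A) (h j u)%:E)%E.
Proof.
by move=> AD; apply: eq_integral => u /set_mem Au; rewrite /hD /= indicE mem_set ?mulr1//; exact: AD.
Qed.

Let O j l := [set u | D j u /\ (e l @` D l) (e j u)].
Hypotheses (oO : forall j l, open (O j l)) (ct : forall j l, ck 1 (O j l) (t j l))
  (tD : forall j l u, O j l u -> D l (t j l u)) (tE : forall j l u, O j l u -> e l (t j l u) = e j u)
  (ht : forall j l u, O j l u -> h j u = `|\det ('J (t j l) u)| * h l (t j l u)).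

Let tO j l u : O j l u -> O l j (t j l u).
Proof. by move=> Ou; split; [exact: tD|exists u; [case: Ou|rewrite tE]]. Qed.
Let tK j l u : O j l u -> t l j (t j l u) = u.
Proof.
move=> Ou; apply: (@e_inj j); [exact/tD/tO|by case: Ou|].
by rewrite !tE//; exact: tO.
Qed.
Let dfg j l : diffeo (O j l) (O l j) (t j l) (t l j).
Proof. by split => //; split; [exact: tO|exact: tO|exact: tK|exact: tK]. Qed.

Lemma atlas_mtrans j l A : borel A -> A `<=` D j ->
  borel ([set u | D l u /\ (e j @` A) (e l u)]).
Proof.
move=> mA AD; rewrite (_ : [set u | _] = O l j `&` t l j @^-1` A).
  have mt : measurable_fun (O l j : set (Borel V)) (t l j : Borel V -> Borel V).
    by apply: continuous_Borel => // u Ou; exact: ck_cont (ct _ _) Ou.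
  by apply: mt => //; exact: open_Borel.
apply/seteqP; split => [u [Du [v Av vu]]|u [[Du Ou] Atu]].
  have Ou : O l j u by split => //; exists v => //; exact: AD.
  split => //=; rewrite (_ : t l j u = v)//; apply: (@e_inj j); [exact: tD|exact: AD|].
  by rewrite tE.
by split => //; exists (t l j u) => //; rewrite tE.
Qed.

(** Both volumes are integrals over the overlap of the two parametrizations, where the change of
    variables formula meets the transformation rule [ht] of the densities. *)
Lemma atlas_vtrans j l A A' : borel A -> borel A' ->
  A `<=` D j -> A' `<=` D l -> e j @` A = e l @` A' -> chart_vol j A = chart_vol l A'.
Proof.
move=> mA mA' AD AD' AA'.
have AO : A `<=` O j l.
  move=> u Au; split; first exact: AD.
  have : (e j @` A) (e j u) by exists u.
  by rewrite AA' => -[v Av <-]; exists v => //; exact: AD'.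
have AO' : A' `<=` O l j.
  move=> u Au; split; first exact: AD'.
  have : (e l @` A') (e l u) by exists u.
  by rewrite -AA' => -[v Av <-]; exists v => //; exact: AD.
have tA u : O j l u -> (t j l u \in A') = (u \in A).
  move=> Ou; apply/idP/idP => /set_mem H; apply/mem_set.
    have : (e l @` A') (e l (t j l u)) by exists (t j l u).
    by rewrite -AA' tE// => -[v Av] /(e_inj (AD _ Av) (proj1 Ou)) <-.
  have : (e j @` A) (e j u) by exists u.
  by rewrite AA' -(tE Ou) => -[v Av] /(e_inj (AD' _ Av) (tD Ou)) <-.
have mh k B : borel B -> B `<=` D k -> measurable_fun (Bset B) (fun u => (h k u)%:E).
  move=> mB BD; apply: (@measurable_funS _ _ _ _ (D k : set (Borel V))) => //; first exact: open_Borel.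
  by apply/measurable_EFinP; apply: continuous_BorelR => // u Du; exact: ch.
have sub k B C : B `<=` C -> (\int[lam R d]_(u in B) (h k u)%:E = \int[lam R d]_(u in C) ((fun u => (h k u)%:E) \_ B) u)%E.
  by move=> BC; rewrite -integral_mkcondr setIidr.
rewrite !chart_vol_int// (sub _ _ _ AO) (sub _ _ _ AO') (diffeo_cov (dfg j l)).
- apply: eq_integral => u /set_mem Ou; rewrite !patchE tA//; case: ifP => _; last by rewrite mul0e.
  by rewrite -EFinM mulrC -ht.
- apply: (@measurable_funS _ _ _ _ setT) => //.
  by apply/(measurable_restrictT _ _).1 => //; exact: mh.
- by move=> v Ov; rewrite patchE; case: ifP => // /set_mem/AD' Dv; rewrite lee_fin h0.
Qed.

(** Partial sums of the series are competitors for the supremum. Conversely a competing finite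
    family is cut along the pieces of the decomposition, and each fragment has the same volume in
    either parametrization. *)
Lemma atlas_volume (B : set T) (j_ : nat -> J) (A_ : nat -> set V) :
  (forall m, borel (A_ m)) -> (forall m, A_ m `<=` D (j_ m)) ->
  B = \bigcup_m (e (j_ m) @` A_ m) -> trivIset setT (fun m => e (j_ m) @` A_ m) ->
  riemannian_volume D e h B = (\sum_(0 <= m <oo) \int[lam R d]_(u in A_ m) (h (j_ m) u)%:E)%E.
Proof.
move=> mA AD BE tA; under eq_eseriesr => m _ do rewrite -chart_vol_int//.
 apply/eqP; rewrite eq_le; apply/andP; split; last first.
  apply: lime_le; first by apply: is_cvg_nneseries.
  apply: nearW => n; rewrite big_mkord; apply: ereal_sup_ubound.
  exists n, (fun k => j_ k), (fun k => A_ k); split => //.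
  - by move=> k; exact: mA.
  - by move=> k _ [u Au <-]; rewrite BE; exists (k : nat) => //; exists u.
  - apply/trivIsetP => a b _ _ ab; move/trivIsetP : tA; apply => //.
  - by apply: eq_bigr => k _; rewrite chart_volE.
apply: ge_ereal_sup => _ [n [j [A [mAk AkD AkB tAk ->]]]].
(* The fragments of the common refinement, seen in the parametrization of the decomposition as [C]
   and in that of the competitor as [C']. *)
pose C m k := A_ m `&` [set u | D (j_ m) u /\ (e (j k) @` A k) (e (j_ m) u)].
pose C' m k := A k `&` [set u | D (j k) u /\ (e (j_ m) @` A_ m) (e (j k) u)].
have mC m k : borel (C m k).
  by apply: (@measurableI _ (Borel V)); [exact: mA|apply: atlas_mtrans; [exact: mAk|exact: AkD]].
have mC' m k : borel (C' m k).
  by apply: (@measurableI _ (Borel V)); [exact: mAk|apply: atlas_mtrans; [exact: mA|exact: AD]].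
have CC' m k : chart_vol (j k) (C' m k) = chart_vol (j_ m) (C m k).
  apply: atlas_vtrans => //; first by move=> u [/AkD].
    by move=> u [/AD].
  apply/seteqP; split => [_ [u [Au [Du [v Av vu]]] <-]|_ [u [Au [Du [v Av vu]]] <-]].
    by exists v; [split => //; split; [exact: AD|exists u]|].
  by exists v; [split => //; split; [exact: AkD|exists u]|].
have AkE k : A k = \bigcup_m C' m k.
  apply/seteqP; split => [u Au|u [m _ []]//].
  have : B (e (j k) u) by apply: (AkB k); exists u.
  by rewrite BE => -[m _ H]; exists m => //; split => //; split => //; exact: AkD.
have tC' k : trivIset setT (C'^~ k).
  apply/trivIsetP => a b _ _ ab; apply/seteqP; split => // u [[_ [_ H1]] [_ [_ H2]]].
  by move/eqP: ab; apply; apply: tA => //; exists (e (j k) u).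
rewrite (eq_bigr (fun k => \sum_(0 <= m <oo) chart_vol (j_ m) (C m k))%E); last first.
  move=> k _; rewrite (chart_volE (mAk k) (AkD k)); transitivity (chart_vol (j k) (\bigcup_m C' m k)); first by rewrite -AkE.
  rewrite measure_semi_bigcup//; [|exact: bigcupT_measurable].
  by apply: eq_eseriesr => m _; exact: CC'.
rewrite -nneseries_sum//.
apply: lee_nneseries => [m _ _|m _]; first exact: sume_ge0.
have tC : trivIset setT (C m).
  apply/trivIsetP => a b _ _ ab; apply/seteqP; split => // u [[_ [_ H1]] [_ [_ H2]]].
  by move/eqP: ab; apply; apply: tAk => //; exists (e (j_ m) u).
have mB : borel (\big[setU/set0]_(k < n) C m k) by apply: bigsetU_measurable.
rewrite -(measure_semi_additive_ord (chart_vol (j_ m)))//.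
apply: le_measure; rewrite ?inE//.
apply: (big_ind (fun X : set V => X `<=` A_ m)) => //; first by move=> X Y; rewrite subUset.
by move=> k _ u [].
Qed.

End atlas_volume.

Lemma antiderivative (R : realType) (g : R -> R) : continuous g ->
  exists G : R -> R, G 0 = 0 /\ forall s : R, -1 < s < 1 -> is_derive s (1 : R) G (g s).
Proof.
(* Integrating from -2 places all of [(-1, 1)], and the base point 0, in the interior of [[-2, 2]],
   where the fundamental theorem applies. *)
move=> cg; pose F := fun x => (\int[lebesgue_measure]_(t in `[(-2)%R, x]) (g t))%R.
exists (fun x => F x - F 0); split; first by rewrite subrr.
move=> s /andP[s1 s2].
have [dF dFE] : derivable F s 1 /\ F^`()%classic s = g s.
  apply: (@continuous_FTC1_closed R g (-2) s 2) => //; try lra.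
  - apply: continuous_compact_integrable; first exact: segment_compact.
    exact: continuous_subspaceT.
  - exact: cg.
have := @is_deriveB R R R F (cst (F 0)) s 1 (g s) 0; rewrite subr0; apply.
split; first exact: dF.
by rewrite -dFE derive1E.
Qed.

(** * Ordinary differential equations *)

Section mvt.
Context {R : realType} {n : nat}.
Local Notation V := 'rV[R]_n.

(** The norm is the sup norm, so the scalar mean value theorem in each coordinate already gives the
    vector estimate. *)
Lemma curve_mvt (y : R -> V) (dy : R -> V) (a b B : R) : 0 <= B -> a <= b ->
  (forall s, a <= s <= b -> is_derive s (1 : R) y (dy s)) -> (forall s, a <= s <= b -> `|dy s| <= B) ->
  `|y b - y a| <= B * (b - a).
Proof.
move=> B0 ab dy_ HB; have [->|ab'] := eqVneq a b; first by rewrite !subrr normr0 mulr0.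
have {}ab : a < b by rewrite lt_neqAle ab'.
apply: norm_le; first by rewrite mulr_ge0// subr_ge0 ltW.
move=> i; rewrite mxE [X in _ + X]mxE.
have di (s : R) : a <= s <= b -> is_derive s (1 : R) (fun s : R => y s 0 i) (dy s 0 i).
  move=> /dy_[ders <-]; split; first by move/derivable_mxP: ders; exact.
  by rewrite derive_mx// mxE.
have [||c cab ->] := @MVT R (fun s => y s 0 i) (fun s => dy s 0 i) a b ab.
- by move=> x; rewrite in_itv => /andP[xa xb]; apply: di; rewrite !ltW.
- apply: derivable_within_continuous => x; rewrite in_itv => xab.
  by case: (di x xab).
rewrite normrM [X in _ * X]ger0_norm; last by rewrite subr_ge0 ltW.
apply: ler_wpM2r; first by rewrite subr_ge0 ltW.
apply: le_trans (norm_coord _ _) _; apply: HB.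
by move: cab; rewrite in_itv => /andP[xa xb]; rewrite !ltW.
Qed.

Lemma curve_mvtP (y : R -> V) (dy : R -> V) (r B : R) : 0 <= B ->
  (forall s, - r <= s <= r -> is_derive s (1 : R) y (dy s)) -> (forall s, - r <= s <= r -> `|dy s| <= B) ->
  forall s, - r <= s <= r -> `|y s - y 0| <= B * `|s|.
Proof.
move=> B0 H HB s sr; have [s0|s0] := leP 0 s.
  rewrite (ger0_norm s0); have := @curve_mvt y dy 0 s B B0 s0; rewrite subr0; apply.
  - by move=> t ts; apply: H; lra.
  - by move=> t ts; apply: HB; lra.
rewrite (ltr0_norm s0) distrC -[- s]add0r; apply: (@curve_mvt y dy s 0 B B0 (ltW s0)).
- by move=> t ts; apply: H; lra.
- by move=> t ts; apply: HB; lra.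
Qed.

Lemma curve_mvt0 (y : R -> V) (dy : R -> V) (r B : R) : 0 <= B ->
  (forall s, - r < s < r -> is_derive s (1 : R) y (dy s)) -> (forall s, - r < s < r -> `|dy s| <= B) ->
  forall s, - r < s < r -> `|y s - y 0| <= B * `|s|.
Proof.
move=> B0 H HB s sr.
have sub t : - `|s| <= t <= `|s| -> - r < t < r.
  by move: sr; case: (ger0P s) => _ /andP[h1 h2] /andP[h3 h4]; lra.
apply: (@curve_mvtP y dy `|s| B) => //; [by move=> t /sub/H|by move=> t /sub/HB|].
by rewrite -ler_norml.
Qed.

Lemma is_derive_entries (y : R -> V) (s : R) (l : V) :
  (forall i, is_derive s (1 : R) (fun t : R => y t 0 i) (l 0 i)) -> is_derive s (1 : R) y l.
Proof.
move=> H; have d : derivable y s 1 by apply/derivable_mxP => a i; rewrite ord1; case: (H i).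
split => //; rewrite derive_mx//; apply/rowP => i; rewrite mxE.
by case: (H i).
Qed.

End mvt.

Lemma is_derive_entry (R : realType) n (y : R -> 'rV[R]_n) (s : R) l i : is_derive s (1 : R) y l ->
  is_derive s (1 : R) (fun t : R => y t 0 i) (l 0 i).
Proof.
move=> [ders <-]; split; first by move/derivable_mxP: ders; exact.
by rewrite derive_mx// mxE.
Qed.

Section clampR.
Context {R : realType}.
Variable (d : R).
Hypothesis d0 : 0 < d.
(** The retraction of the line onto [[-d, d]], written with absolute values so that continuity and
    the Lipschitz constant 1 are immediate. *)
Definition clampR (s : R) := (`|s + d| - `|s - d|) / 2.
Lemma clampRP s : - d <= clampR s <= d.
Proof.
rewrite /clampR; have := d0; case: (ger0P (s + d)) => h; case: (ger0P (s - d)) => h'; lra.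
Qed.
Lemma clampR_id s : - d <= s <= d -> clampR s = s.
Proof.
by move=> h; rewrite /clampR; have := d0; case: (ger0P (s + d)) => h1; case: (ger0P (s - d)) => h2; lra.
Qed.
Lemma clampR_cont : continuous clampR.
Proof.
have cn b : continuous (fun s : R => `|s + b|).
  move=> s; apply: (@continuous_comp _ _ _ (fun s : R => s + b) Num.norm); last exact: norm_continuous.
  exact: addr_cont.
move=> s; apply: (@continuousM R R (fun s => `|s + d| - `|s - d|) (cst 2^-1)); last exact: cst_continuous.
by apply: (@continuousB R R R (fun s => `|s + d|) (fun s => `|s - d|)); exact: cn.
Qed.
Lemma clampR_lip x y : `|clampR x - clampR y| <= `|x - y|.
Proof.
rewrite /clampR; have := d0; case: (ger0P (x + d)) => h1; case: (ger0P (x - d)) => h2;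
 case: (ger0P (y + d)) => h3; case: (ger0P (y - d)) => h4; rewrite ler_norml;
 case: (ger0P (x - y)) => h5; lra.
Qed.
End clampR.

Section geometric.
Context {R : realType}.

Lemma half_pow_small (B e : R) : 0 < e -> exists k, B / 2 ^+ k < e.
Proof.
move=> e0; exists (Num.bound (B / e)).
rewrite ltr_pdivrMr ?exprn_gt0// mulrC -ltr_pdivrMr//.
apply: le_lt_trans (ler_norm _) _; apply: lt_le_trans (archi_boundP (normr_ge0 _)) _.
rewrite (_ : Num.bound `|B / e| = Num.bound (B / e)); last by rewrite /Num.bound normr_id.
by rewrite -natrX ler_nat ltnW// ltn_expl.
Qed.

Lemma half_pow_le (x y B : R) : (forall k, x <= y + B / 2 ^+ k) -> x <= y.
Proof.
move=> H; apply/ler_addgt0Pr => e e0; have [k ke] := half_pow_small B e0.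
by apply: le_trans (H k) _; rewrite lerD2l ltW.
Qed.

(** The intervals around [u k] of radius [2 * B / 2 ^+ k] are nested, and the supremum of their
    lower ends lies in all of them. This is completeness together with the explicit rate that the
    Picard iteration uses. *)
Lemma half_pow_lim (u : nat -> R) (B : R) : (forall k, `|u k.+1 - u k| <= B / 2 ^+ k) ->
  exists l, forall k, `|u k - l| <= 2 * B / 2 ^+ k.
Proof.
move=> H; have B0 : 0 <= B by have := H 0; rewrite expr0 divr1; apply: le_trans.
pose e k := 2 * B / 2 ^+ k.
have eS k : e k.+1 = B / 2 ^+ k by rewrite /e exprS; field; rewrite lt0r_neq0// exprn_gt0.
have eE k : e k = 2 * (B / 2 ^+ k) by rewrite /e mulrA.
have lo k : u k - e k <= u k.+1 - e k.+1.
  by have := H k; rewrite ler_norml eS (eE k) => /andP[h1 h2]; lra.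
have hi k : u k.+1 + e k.+1 <= u k + e k.
  by have := H k; rewrite ler_norml eS (eE k) => /andP[h1 h2]; lra.
have e0 k : 0 <= e k by rewrite divr_ge0 ?exprn_ge0// mulr_ge0.
have lo2 k m : u k - e k <= u (k + m)%N - e (k + m)%N.
  by elim: m => [|m IH]; rewrite ?addn0// addnS (le_trans IH).
have hi2 k m : u (k + m)%N + e (k + m)%N <= u k + e k.
  by elim: m => [|m IH]; rewrite ?addn0// addnS (le_trans _ IH).
have lh k m : u k - e k <= u m + e m.
  apply: le_trans (lo2 k m) _; rewrite addnC; apply: le_trans (hi2 m k).
  by have := e0 (m + k)%N; lra.
have ub m : ubound (range (fun k => u k - e k)) (u m + e m) by move=> _ [k _ <-].
exists (sup (range (fun k => u k - e k))) => k; rewrite -/(e k) ler_norml.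
have h1 : u k - e k <= sup (range (fun k => u k - e k)).
  by apply: ub_le_sup; [exists (u k + e k)|exists k].
have h2 : sup (range (fun k => u k - e k)) <= u k + e k.
  by apply: ge_sup; [exists (u 0%N - e 0%N), 0%N|].
by lra.
Qed.
End geometric.

Section picard.
Context {R : realType} {n : nat}.
Local Notation V := 'rV[R]_n.
Variables (Z : V -> V) (L M d : R).
Hypotheses (L0 : 0 <= L) (M0 : 0 <= M) (d0 : 0 < d) (d1 : d < 1) (Ld : L * d <= 1 / 2)
  (lipZ : forall x y, `|Z x - Z y| <= L * `|x - y|) (bndZ : forall x, `|Z x| <= M).

Let contZ : continuous Z.
Proof.
move=> x A /nbhs_ballP[e /= e0 eA]; apply/nbhs_ballP.
have L1 : 0 < L + 1 by have := L0; lra.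
exists (e / (L + 1)) => /= [|y]; first by rewrite divr_gt0.
rewrite -ball_normE /= ltr_pdivlMr// => xy; apply: eA; rewrite -ball_normE /=.
apply: le_lt_trans (lipZ _ _) _; apply: le_lt_trans xy; have := normr_ge0 (x - y); nra.
Qed.

(** One Picard iteration. The antiderivatives are only controlled on [(-1, 1)]; composing them with
    [clampR d], where [d < 1], keeps the new curve continuous on the whole line, so that iteration
    is possible. *)
Let step c (y : R -> V) : continuous y -> exists w : R -> V, continuous w /\ w 0 = c /\
  forall s, - d < s < d -> is_derive s (1 : R) w (Z (y s)).
Proof.
move=> cy.
have /choice[G HG] : forall i : 'I_n, exists G : R -> R, G 0 = 0 /\
    forall s : R, -1 < s < 1 -> is_derive s (1 : R) G (Z (y s) 0 i).
  move=> i; apply: antiderivative => s.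
  apply: (@continuous_comp _ _ _ (Z \o y) (fun v : V => v 0 i)); last exact: coord_cont.
  by apply: continuous_comp; [exact: cy|exact: contZ].
exists (fun s => \row_i (c 0 i + G i (clampR d s))); split; [|split].
- move=> s; apply: mx_continuous => a i; rewrite ord1.
  rewrite (_ : (fun s => _) = (fun s => c 0 i + G i (clampR d s))); last by apply/funext => t; rewrite mxE.
  apply: (@continuousD R R R (cst (c 0 i)) (G i \o clampR d)); first exact: cst_continuous.
  apply: continuous_comp; first exact: clampR_cont.
  apply: differentiable_continuous; apply/derivable1_diffP.
  have [_ /(_ (clampR d s))[]//] := HG i.
  by have := clampRP d0 s; have := d1; lra.
- apply/rowP => i; rewrite mxE (clampR_id d0) ?(HG i).1 ?addr0//; have := d0; lra.
- move=> s sd; apply: is_derive_entries => i.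
  have sd1 : -1 < s < 1 by have := d1; lra.
  have H : is_derive s (1 : R) (fun t : R => c 0 i + G i t) (Z (y s) 0 i).
    have := @is_deriveD R R R (cst (c 0 i)) (G i) s 1 0 (Z (y s) 0 i) (is_derive_cst _ _ _) ((HG i).2 s sd1).
    by rewrite add0r.
  apply: near_eq_is_derive H.
  near=> t; rewrite mxE (clampR_id d0)//; apply/andP; split; apply: ltW; near: t.
    by apply: lt_nbhsr; case/andP: sd.
  by apply: lt_nbhsl; case/andP: sd.
Unshelve. all: by end_near. Qed.

(* two Picard iterates, compared on [-r, r] *)
Let step_close (w w' y y' : R -> V) (r B : R) : 0 <= B -> r <= d ->
  (forall s, - r < s < r -> is_derive s (1 : R) w (Z (y s))) ->
  (forall s, - r < s < r -> is_derive s (1 : R) w' (Z (y' s))) ->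
  (forall s, - r < s < r -> `|y s - y' s| <= B) ->
  forall s, - r < s < r -> `|(w s - w' s) - (w 0 - w' 0)| <= B / 2.
Proof.
move=> B0 rd dw dw' yB s sd.
have dd t : - r < t < r -> is_derive t (1 : R) (w \- w') (Z (y t) - Z (y' t)).
  by move=> td; apply: is_deriveB; [exact: dw|exact: dw'].
have bd t : - r < t < r -> `|Z (y t) - Z (y' t)| <= L * B.
  by move=> /yB H; apply: le_trans (lipZ _ _) _; rewrite ler_wpM2l.
have LB : 0 <= L * B by rewrite mulr_ge0.
apply: le_trans (curve_mvt0 LB dd bd sd) _.
have s1 : `|s| <= d by move/andP: sd => [h1 h2]; rewrite ler_norml; lra.
have := Ld; have := normr_ge0 s; nra.
Qed.

(** The condition on [L * d] makes every iteration halve the distance between consecutive curves,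
    starting from [M * d]. The limit is first obtained pointwise; that it solves the equation
    follows from one further iteration. *)
Lemma picard c : exists y : R -> V, y 0 = c /\ forall s, - (d / 2) < s < d / 2 -> is_derive s (1 : R) y (Z (y s)).
Proof.
have /choice[F HF] : forall y : {y : R -> V | continuous y}, exists w : {y : R -> V | continuous y},
    projT1 w 0 = c /\ forall s, - d < s < d -> is_derive s (1 : R) (projT1 w) (Z (projT1 y s)).
  by move=> [y cy]; have [w [cw H]] := step c cy; exists (exist _ w cw).
pose y_ k := iter k F (exist _ (cst c) (@cst_continuous _ _ c)).
have B0 : 0 <= M * d by rewrite mulr_ge0// ltW.
have y0 k : projT1 (y_ k) 0 = c by case: k => //= k; exact: (HF _).1.
have dist k s : - d < s < d -> `|projT1 (y_ k.+1) s - projT1 (y_ k) s| <= M * d / 2 ^+ k.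
  elim: k s => [|k IH] s sd.
    rewrite expr0 divr1 /=; have [h1 h2] := HF (exist _ (cst c) (@cst_continuous _ _ c)).
    have := curve_mvt0 M0 h2 (fun s _ => bndZ _) sd; rewrite h1 => /le_trans; apply.
    by rewrite ler_wpM2l// ler_norml; move/andP: sd => [h3 h4]; lra.
  have := @step_close _ _ _ _ d (M * d / 2 ^+ k) _ (lexx d) (HF (y_ k.+1)).2 (HF (y_ k)).2 IH s sd.
  rewrite -[F (y_ k.+1)]/(y_ k.+2) -[F (y_ k)]/(y_ k.+1) !y0 subrr subr0 => /(_ _)/le_trans; apply.
    by rewrite divr_ge0// exprn_ge0.
  by rewrite exprS invfM mulrA mulrAC.
have lim s : exists l : V, - d < s < d -> forall k, `|projT1 (y_ k) s - l| <= 2 * (M * d) / 2 ^+ k.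
  have [sd|] := boolP (- d < s < d); last by exists 0.
  have /choice[l Hl] : forall i, exists l, forall k, `|projT1 (y_ k) s 0 i - l| <= 2 * (M * d) / 2 ^+ k.
    move=> i; apply: half_pow_lim => k; apply: le_trans (dist k s sd).
    by have := norm_coord (projT1 (y_ k.+1) s - projT1 (y_ k) s) i; rewrite !mxE.
  exists (\row_i l i) => _ k; apply: norm_le => [|i]; last by rewrite !mxE.
  by rewrite divr_ge0 ?exprn_ge0// mulr_ge0.
have {lim} [Y HY] := choice lim.
have h0 : 0 < d / 2 by rewrite divr_gt0.
have cl s : - d < clampR (d / 2) s < d by have := clampRP h0 s; have := d0; lra.
(* The iterates converge on [(-d, d)] only. Freezing the limit outside [[-d/2, d/2]] makes it
   continuous on the line, as [step] requires; this costs half of the interval. *)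
pose y := Y \o clampR (d / 2).
have cy : continuous y.
  move=> s; apply/cvgrPdist_lt => e e0.
  have [k ke] : exists k, 2 * (M * d) / 2 ^+ k < e / 3 by apply: half_pow_small; rewrite divr_gt0.
  have e3 : 0 < e / 3 by rewrite divr_gt0.
  have ck : continuous (projT1 (y_ k) \o clampR (d / 2)).
    by move=> t; apply: continuous_comp; [exact: clampR_cont|exact: (projT2 (y_ k))].
  have /cvgrPdist_lt/(_ _ e3) := ck s; apply: filterS => t /= H.
  have h1 := HY _ (cl s) k; have h2 := HY _ (cl t) k; move: h1 h2 H; rewrite /y /=.
  set a := sval _ _; set b := sval _ _; set a' := Y _; set b' := Y _ => h1 h2 H.
  rewrite (_ : a' - b' = (a - b) - (a - a') + (b - b')); last by apply/rowP => i; rewrite !mxE; ring.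
  apply: le_lt_trans (ler_normD _ _) _.
  have := ler_normB (a - b) (a - a'); lra.
(* The iteration applied to the limit: [w] is differentiable by construction and coincides with [y]
   on the half interval, hence solves the equation there. *)
have [w [cw [w0 dw]]] := step c cy.
have wE s : - (d / 2) < s < d / 2 -> w s = y s.
  move=> sd; have sd' : - d < s < d by have := d0; lra.
  apply/eqP; rewrite -subr_eq0 -normr_eq0 eq_le normr_ge0 andbT.
  apply: (@half_pow_le _ _ _ (2 * (2 * (M * d)))) => k; rewrite add0r.
  have ycl t : - (d / 2) < t < d / 2 -> y t = Y t.
    by move=> td; rewrite /y /= clampR_id//; lra.
  have hd : d / 2 <= d by have := d0; lra.
  have H1 : `|(w s - projT1 (y_ k.+1) s) - (w 0 - projT1 (y_ k.+1) 0)| <= 2 * (M * d) / 2 ^+ k / 2.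
    apply: (@step_close _ _ y (projT1 (y_ k)) (d / 2)) => //.
    - by rewrite divr_ge0 ?exprn_ge0// mulr_ge0.
    - by move=> t td; apply: dw; have := d0; lra.
    - by move=> t td; apply: (HF (y_ k)).2; have := d0; lra.
    - move=> t td; rewrite ycl// distrC; apply: HY; have := d0; lra.
  rewrite w0 y0 subrr subr0 in H1.
  have H2 := HY s sd' k.+1; rewrite -ycl// in H2.
  have E : 2 * (M * d) / 2 ^+ k.+1 = 2 * (M * d) / 2 ^+ k / 2.
    by rewrite exprS invfM [LHS]mulrA [RHS]mulrAC.
  rewrite E in H2; have := ler_distD (projT1 (y_ k.+1) s) (w s) (y s).
  have -> : 2 * (2 * (M * d)) / 2 ^+ k = 2 * (2 * (M * d) / 2 ^+ k) by rewrite !mulrA.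
  have : 0 <= 2 * (M * d) / 2 ^+ k by rewrite divr_ge0 ?exprn_ge0// mulr_ge0.
  lra.
exists w; split => // s sd; rewrite wE//; apply: dw; have := d0; lra.
Qed.

End picard.

Section stability.
Context {R : realType} {n : nat}.
Local Notation V := 'rV[R]_n.

(** A bootstrap in place of Gronwall's inequality: the crude error [2 * M * r] is halved each time
    the current bound is inserted into the mean value estimate, because [L * r] is at most [1/2]. *)
Lemma ode_stable (y z dy dz : R -> V) (L M r : R) : 0 <= L -> 0 <= M -> L * r <= 1 / 2 ->
  (forall s, - r < s < r -> is_derive s (1 : R) y (dy s)) ->
  (forall s, - r < s < r -> is_derive s (1 : R) z (dz s)) ->
  (forall s, - r < s < r -> `|dy s| <= M) -> (forall s, - r < s < r -> `|dz s| <= M) ->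
  (forall s, - r < s < r -> `|dy s - dz s| <= L * `|y s - z s|) ->
  forall s, - r < s < r -> `|y s - z s| <= 2 * `|y 0 - z 0|.
Proof.
move=> L0 M0 Lr Hy Hz By Bz HL.
have dd t : - r < t < r -> is_derive t (1 : R) (y \- z) (dy t - dz t).
  by move=> td; apply: is_deriveB; [exact: Hy|exact: Hz].
pose B := 2 * M * r.
have H k s : - r < s < r -> `|y s - z s| <= 2 * `|y 0 - z 0| + B / 2 ^+ k.
  move=> sr; have r0 : 0 < r by move/andP: sr => []; lra.
  have B0 : 0 <= B by rewrite !mulr_ge0// ltW.
  have s1 : `|s| <= r by move/andP: sr => [h1 h2]; rewrite ler_norml; lra.
  have M2 : 0 <= 2 * M by rewrite mulr_ge0.
  elim: k s sr s1 => [|k IH] s sr s1.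
    have Bd t : - r < t < r -> `|dy t - dz t| <= 2 * M.
      by move=> tr; have := ler_normB (dy t) (dz t); have := By t tr; have := Bz t tr; lra.
    have := curve_mvt0 M2 dd Bd sr => /=.
    have := ler_distD (y 0 - z 0) (y s - z s) 0; rewrite !subr0 expr0 divr1.
    have := normr_ge0 (y 0 - z 0); have := normr_ge0 s; rewrite /B; nra.
  pose C := 2 * `|y 0 - z 0| + B / 2 ^+ k.
  have B2 : 0 <= B / 2 ^+ k by rewrite divr_ge0// exprn_ge0.
  have C0 : 0 <= C by apply: addr_ge0 => //; rewrite mulr_ge0.
  have Bd t : - r < t < r -> `|dy t - dz t| <= L * C.
    move=> tr; apply: le_trans (HL t tr) _; rewrite ler_wpM2l// IH//.
    by move/andP: tr => [h1 h2]; rewrite ler_norml; lra.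
  have := curve_mvt0 (mulr_ge0 L0 C0) dd Bd sr => /=.
  have := ler_distD (y 0 - z 0) (y s - z s) 0; rewrite !subr0.
  have -> : B / 2 ^+ k.+1 = B / 2 ^+ k / 2 by rewrite exprS invfM mulrA mulrAC.
  have : L * C * `|s| <= C / 2.
    by apply: (@le_trans _ _ (C * (L * r))); [rewrite [L * C]mulrC -mulrA ler_wpM2l// ler_wpM2l|nra].
  by rewrite /C; lra.
by move=> s sr; apply: (@half_pow_le _ _ _ B) => k; exact: H.
Qed.

Lemma taylor2 (y dy ddy : R -> V) (B r : R) : 0 <= B ->
  (forall s, - r < s < r -> is_derive s (1 : R) y (dy s)) ->
  (forall s, - r < s < r -> is_derive s (1 : R) dy (ddy s)) ->
  (forall s, - r < s < r -> `|ddy s| <= B) ->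
  forall s, - r < s < r -> `|y s - y 0 - s *: dy 0| <= B * s ^+ 2.
Proof.
move=> B0 Hy Hdy HB s sr.
have s0 : 0 <= `|s| by [].
have sub t : - `|s| <= t <= `|s| -> - r < t < r.
  by move: sr; case: (ger0P s) => _ /andP[h1 h2] /andP[h3 h4]; lra.
have Bd t : - `|s| <= t <= `|s| -> `|dy t - dy 0| <= B * `|s|.
  move=> ts; apply: le_trans (curve_mvt0 B0 Hdy HB (sub t ts)) _.
  by rewrite ler_wpM2l// ler_norml.
have dl t : is_derive t (1 : R) (fun t : R => t *: dy 0) (dy 0).
  apply: is_derive_entries => i; rewrite (_ : (fun t => _) = (fun t : R => t * dy 0 0 i)).
    by apply: (is_derive_eq (@is_deriveM R R id (cst (dy 0 0 i)) t 1 1 0 (is_derive_id _ _) (is_derive_cst _ _ _)));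
      rewrite scaler0 add0r /GRing.scale /= mulr1.
  by apply/funext => u; rewrite mxE.
have dd t : - r < t < r -> is_derive t (1 : R) (fun t : R => y t - t *: dy 0) (dy t - dy 0).
  by move=> tr; exact: (@is_deriveB R R V y (fun t : R => t *: dy 0) t 1 _ _ (Hy t tr) (dl t)).
have sP : - `|s| <= s <= `|s| by rewrite -ler_norml.
have := @curve_mvtP R n (fun t => y t - t *: dy 0) (fun t => dy t - dy 0) `|s| (B * `|s|) (mulr_ge0 B0 s0)
  (fun t ts => dd t (sub t ts)) Bd s sP.
rewrite scale0r subr0 addrAC => /le_trans; apply.
by rewrite -mulrA -normrM -expr2 ger0_norm// sqr_ge0.
Qed.

(** [W] is the acceleration field, the derivative of [Z] along itself. The difference of two
    trajectories has second derivative [W (psi s v) - W (psi s u)], which stability bounds by a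
    multiple of [|v - u|]; Taylor's formula follows. The factor [|v - u|] in the error makes the
    estimate a substitute for differentiating the flow in its initial point. *)
Lemma ode_second (Z W : V -> V) (U : set V) (L M L2 r : R) (psi : R -> V -> V) :
  0 <= L -> 0 <= M -> 0 <= L2 -> L * r <= 1 / 2 ->
  (forall x y, `|Z x - Z y| <= L * `|x - y|) -> (forall x, `|Z x| <= M) ->
  (forall x y, U x -> U y -> `|W x - W y| <= L2 * `|x - y|) ->
  (forall c, psi 0 c = c) ->
  (forall c s, - r < s < r -> is_derive s (1 : R) (psi ^~ c) (Z (psi s c))) ->
  (forall (y : R -> V) s, U (y s) -> is_derive s (1 : R) y (Z (y s)) -> is_derive s (1 : R) (Z \o y) (W (y s))) ->
  forall u v, (forall s, - r < s < r -> U (psi s u)) -> (forall s, - r < s < r -> U (psi s v)) ->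
  forall s, - r < s < r -> `|(psi s v - psi s u) - (v - u) - s *: (Z v - Z u)| <= (2 * L2 * `|v - u|) * s ^+ 2.
Proof.
move=> L0 M0 L20 Lr lipZ bZ lipW p0 dp dW u v Uu Uv s sr.
have stab t : - r < t < r -> `|psi t v - psi t u| <= 2 * `|v - u|.
  move=> tr; have := @ode_stable (psi ^~ v) (psi ^~ u) _ _ L M r L0 M0 Lr (dp v) (dp u) (fun s _ => bZ _)
    (fun s _ => bZ _) (fun s _ => lipZ _ _) t tr.
  by rewrite !p0.
have := @taylor2 (psi ^~ v \- psi ^~ u) (fun s => Z (psi s v) - Z (psi s u))
  (fun s => W (psi s v) - W (psi s u)) (2 * L2 * `|v - u|) r.
rewrite /= !p0; apply => //.
- by rewrite !mulr_ge0.
- by move=> t tr; apply: is_deriveB; exact: dp.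
- by move=> t tr; apply: is_deriveB; apply: (dW (psi ^~ _)); [exact: Uv|exact: dp|exact: Uu|exact: dp].
- move=> t tr; apply: le_trans (lipW _ _ (Uv t tr) (Uu t tr)) _.
  by rewrite [2 * L2]mulrC -mulrA ler_wpM2l//; exact: stab.
Qed.

(** Shifting time by [s] gives a second solution through [psi s c]; stability with equal initial
    points identifies the two. The interval is halved so that [t + s] stays admissible. *)
Lemma flow_inverse (Z : V -> V) (L M r : R) (psi : R -> V -> V) :
  0 <= L -> 0 <= M -> L * r <= 1 / 2 ->
  (forall x y, `|Z x - Z y| <= L * `|x - y|) -> (forall x, `|Z x| <= M) ->
  (forall c, psi 0 c = c) ->
  (forall c s, - r < s < r -> is_derive s (1 : R) (psi ^~ c) (Z (psi s c))) ->
  forall c s, - (r / 2) < s < r / 2 -> psi (- s) (psi s c) = c.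
Proof.
move=> L0 M0 Lr lipZ bZ p0 dp c s sr.
have r0 : 0 < r by lra.
have dz t : - (r / 2) < t < r / 2 -> is_derive t (1 : R) (fun t : R => psi (t + s) c) (Z (psi (t + s) c)).
  move=> tr; have ts : - r < t + s < r by lra.
  apply: is_derive_entries => i; rewrite -[X in is_derive _ _ _ X]mulr1.
  apply: (@is_derive1_comp _ (fun t => psi t c 0 i) (shift s)); first exact: is_derive_entry (dp c _ ts).
  exact: is_derive_shift.
have dy t : - (r / 2) < t < r / 2 -> is_derive t (1 : R) (psi ^~ (psi s c)) (Z (psi t (psi s c))).
  by move=> tr; apply: dp; lra.
have Lr2 : L * (r / 2) <= 1 / 2 by rewrite mulrA; lra.
have := @ode_stable (fun t => psi t (psi s c)) (fun t => psi (t + s) c) _ _ L M (r / 2) L0 M0 Lr2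
  dy dz (fun s _ => bZ _) (fun s _ => bZ _) (fun s _ => lipZ _ _) (- s).
rewrite p0 add0r subrr normr0 mulr0 addNr p0 => /(_ _)H.
by apply/eqP; rewrite -subr_eq0 -normr_le0; apply: H; lra.
Qed.

End stability.

Section line.
Context {R : realType} {V W : normedModType R}.

Lemma is_derive_line (f : V -> W) (u v : V) (s : R) : derivable f (u + s *: v) v ->
  is_derive s (1 : R) (fun s : R => f (u + s *: v)) ('D_v f (u + s *: v)).
Proof.
have E : (fun h : R => h^-1 *: (((fun s : R => f (u + s *: v)) \o shift s) (h *: (1 : R)) - f (u + s *: v)))
  = (fun h : R => h^-1 *: ((f \o shift (u + s *: v)) (h *: v) - f (u + s *: v))).
  by apply/funext => h /=; rewrite /shift /= [h *: 1]mulr1 scalerDl addrCA.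
by move=> df; split; [rewrite /derivable E|rewrite /derive E].
Qed.

Lemma is_derive_shift_comp (f : V -> W) (x b v : V) : derivable f (x + b) v ->
  is_derive x v (f \o shift b) ('D_v f (x + b)).
Proof.
have E : (fun h : R => h^-1 *: (((f \o shift b) \o shift x) (h *: v) - f (x + b)))
  = (fun h : R => h^-1 *: ((f \o shift (x + b)) (h *: v) - f (x + b))).
  by apply/funext => h /=; rewrite /shift /= addrA.
by move=> df; split; [rewrite /derivable E|rewrite /derive E].
Qed.

End line.

Section schwarz.
Context {R : realType} {V : normedModType R}.

Let mvt_line (f : V -> R) (u v : V) (t : R) : 0 < t ->
  (forall s, 0 <= s <= t -> derivable f (u + s *: v) v) ->
  exists2 s, 0 < s < t & f (u + t *: v) - f u = t * 'D_v f (u + s *: v).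
Proof.
move=> t0 df; have [||s sI] := @MVT R (fun s => f (u + s *: v)) (fun s => 'D_v f (u + s *: v)) 0 t t0.
- by move=> s; rewrite in_itv /= => /andP[s0 s1]; apply: is_derive_line; apply: df; rewrite !ltW.
- apply: derivable_within_continuous => s; rewrite in_itv /= => sI.
  by have [] := is_derive_line (df s sI).
rewrite scale0r addr0 subr0 mulrC => E; exists s => //; by move: sI; rewrite in_itv.
Qed.

(* both mixed derivatives are the limit of the same second difference quotient *)
Let second_difference (f : V -> R) u v w : (\forall x \near u, differentiable f x) ->
  differentiable ('D_v f : V -> R) u ->
  forall e : R, 0 < e -> \forall t \near (0 : R)^'+,
    `|f (u + t *: w + t *: v) - f (u + t *: w) - (f (u + t *: v) - f u) - t ^+ 2 * 'D_w ('D_v f) u| <= e * t ^+ 2.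
Proof.
move=> df ddf e e0.
pose K := 2 * (`|v| + `|w|) + 1.
have K0 : 0 < K by rewrite ltr_wpDl// mulr_ge0// addr_ge0.
have [r r0 Hr] := diff_eps ddf (divr_gt0 e0 K0).
have [r' r'0 Hr'] : exists2 r' : R, 0 < r' & forall x, `|x - u| < r' -> differentiable f x.
  by move/nbhs_ballP: df => [r' /= r'0 H]; exists r' => // x xr; apply: H; rewrite -ball_normE /= distrC.
near=> t.
have t0 : 0 < t by near: t; exact: nbhs_right_gt.
have tK : t * K < Num.min r r'.
  by rewrite -ltr_pdivlMr//; near: t; apply: nbhs_right_lt; rewrite divr_gt0// lt_min r0.
have small a b : 0 <= a <= t -> 0 <= b <= t -> `|u + a *: w + b *: v - u| < Num.min r r'.
  move=> /andP[a0 at_] /andP[b0 bt]; apply: le_lt_trans tK.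
  rewrite addrAC [_ - u]addrAC subrr add0r.
  apply: le_trans (ler_normD _ _) _; rewrite !normrZ !ger0_norm//.
  have := normr_ge0 v; have := normr_ge0 w; rewrite /K; nra.
have small' a b : 0 <= a <= t -> 0 <= b <= t -> `|u + a *: w + b *: v - u| < r /\ `|u + a *: w + b *: v - u| < r'.
  by move=> ha hb; have := small a b ha hb; rewrite lt_min => /andP.
pose g x := f (x + t *: w) - f x.
have dg s : 0 <= s <= t -> derivable f (u + s *: v + t *: w) v /\ derivable f (u + s *: v) v.
  move=> st; split; apply/diff_derivable; apply: Hr'.
    by rewrite (addrAC u); apply: (small' t s _ st).2; rewrite lexx ltW.
  by have := (small' 0 s _ st).2; rewrite scale0r addr0; apply; rewrite lexx ltW.
have dgE s : 0 <= s <= t -> is_derive (u + s *: v) v g ('D_v f (u + s *: v + t *: w) - 'D_v f (u + s *: v)).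
  move=> st; have [d1 d2] := dg s st.
  apply: (@is_deriveB R V R (f \o shift (t *: w)) f (u + s *: v) v); last exact: DeriveDef.
  exact: is_derive_shift_comp.
have [s s1 E] := @mvt_line g u v t t0 (fun s st => @ex_derive _ _ _ _ _ _ _ (dgE s st)).
have st : 0 <= s <= t by move/andP: s1 => [? ?]; rewrite !ltW.
have Dg := @derive_val _ _ _ _ _ _ _ (dgE s st).
have -> : f (u + t *: w + t *: v) - f (u + t *: w) - (f (u + t *: v) - f u) = g (u + t *: v) - g u.
  by rewrite /g [u + t *: v + _]addrAC; ring.
rewrite E Dg.
have t00 : 0 <= t <= t by rewrite lexx ltW.
have z0 : 0 <= (0 : R) <= t by rewrite lexx ltW.
have := Hr (u + s *: v + t *: w); rewrite [u + s *: v + _]addrAC => /(_ (small' t s t00 st).1) H1.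
have := Hr (u + s *: v); have := (small' 0 s z0 st).1; rewrite scale0r addr0 => h0 /(_ h0) H2.
have lin : 'd ('D_v f) u (u + t *: w + s *: v - u) = t * 'D_w ('D_v f) u + s * 'D_v ('D_v f) u.
  by rewrite addrAC [_ - u]addrAC subrr add0r linearD !linearZ /= !deriveE.
have lin2 : 'd ('D_v f) u (u + s *: v - u) = s * 'D_v ('D_v f) u.
  by rewrite addrAC subrr add0r linearZ /= deriveE.
rewrite lin in H1; rewrite lin2 in H2.
set A := 'D_v f (u + t *: w + s *: v) in H1 *; set B := 'D_v f (u + s *: v) in H2 *; set C := 'D_v f u in H1 H2 *.
set P := 'D_w _ u in H1 *; set Q := 'D_v _ u in H1 H2.
have -> : t * (A - B) - t ^+ 2 * P = t * ((A - C - (t * P + s * Q)) - (B - C - s * Q)) by ring.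
rewrite normrM (ger0_norm (ltW t0)) expr2 mulrCA ler_pM2l//.
apply: le_trans (ler_normB _ _) _; apply: le_trans (lerD H1 H2) _.
rewrite -mulrDr mulrAC -mulrA ler_wpM2l//; first exact: ltW.
rewrite ler_pdivrMr//.
have n1 : `|u + t *: w + s *: v - u| <= t * (`|w| + `|v|).
  rewrite addrAC [_ - u]addrAC subrr add0r; apply: le_trans (ler_normD _ _) _; rewrite !normrZ (ger0_norm (ltW t0)).
  rewrite ger0_norm; last by case/andP: st.
  by rewrite mulrDr lerD2l ler_wpM2r//; case/andP: st.
have n2 : `|u + s *: v - u| <= t * `|v|.
  rewrite addrAC subrr add0r normrZ ger0_norm; last by case/andP: st.
  by rewrite ler_wpM2r//; case/andP: st.
apply: le_trans (lerD n1 n2) _; rewrite -mulrDr ler_wpM2l ?ltW//.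
by rewrite /K; move: (normr_ge0 v) (normr_ge0 w); clear; lra.
Unshelve. all: by end_near. Qed.

Lemma derive_comm (f : V -> R) u v w : (\forall x \near u, differentiable f x) ->
  differentiable ('D_v f : V -> R) u -> differentiable ('D_w f : V -> R) u ->
  'D_w ('D_v f) u = 'D_v ('D_w f) u.
Proof.
move=> df dv dw; apply/eqP; rewrite -subr_eq0 -normr_eq0 eq_le normr_ge0 andbT.
apply/ler_addgt0Pr => e e0; rewrite add0r.
have e2 : 0 < e / 2 by rewrite divr_gt0.
have S1 := second_difference w df dv e2; have S2 := second_difference v df dw e2.
have [t [[H1 H2] t0]] := filter_ex (filterI (filterI S1 S2) (nbhs_right_gt (0 : R))).
have t2 : 0 < t ^+ 2 by rewrite exprn_gt0.
rewrite -(ler_pM2l t2) -{1}(ger0_norm (ltW t2)) -normrM.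
rewrite [u + t *: v + t *: w]addrAC in H2.
set A := f _ in H1 H2; set B := f (u + t *: w) in H1 H2; set C := f (u + t *: v) in H1 H2.
move: ('D_w ('D_v f) u) ('D_v ('D_w f) u) (f u) A B C H1 H2 => P Q F A B C H1 H2.
have -> : t ^+ 2 * (P - Q) = (A - C - (B - F) - t ^+ 2 * Q) - (A - B - (C - F) - t ^+ 2 * P) by ring.
apply: le_trans (ler_normB _ _) _; apply: le_trans (lerD H2 H1) _.
by rewrite -mulrDl -splitr mulrC.
Qed.

End schwarz.

(** * Local transverse geometry *)

Section posdef.
Context {R : realType}.

Definition posdef n (M : 'M[R]_n) := M^T = M /\ forall v : 'rV_n, v != 0 -> 0 < (v *m M *m v^T) 0 0.

(** The rows are the lifts of the transverse coordinate vectors that are orthogonal to the leaf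
    directions, that is, the matrix of [sigma]. Their Gram matrix [schur] is the transverse metric,
    and it is the Schur complement of the leaf block. *)
Definition hlift p q (M : 'M[R]_(p + q)) : 'M[R]_(q, p + q) :=
  row_mx (- (dlsubmx M *m invmx (ulsubmx M))) 1%:M.
Definition schur p q (M : 'M[R]_(p + q)) : 'M[R]_q := hlift M *m M *m (hlift M)^T.

Lemma posdef_cong m n (M : 'M[R]_n) (B : 'M[R]_(m, n)) : posdef M ->
  (forall s : 'rV_m, s *m B = 0 -> s = 0) -> posdef (B *m M *m B^T).
Proof.
move=> [sM pM] iB; split; first by rewrite !trmx_mul trmxK sM mulmxA.
move=> v v0; have := pM (v *m B); rewrite trmx_mul !mulmxA; apply.
by apply: contra v0 => /eqP/iB ->.
Qed.

Lemma row0_cong p q k (a : 'M[R]_(k, p)) (M : 'M[R]_(p + q)) :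
  row_mx a 0 *m M *m (row_mx a 0)^T = a *m ulsubmx M *m a^T.
Proof. by rewrite -{1}(submxK M) mul_row_block tr_row_mx mul_row_col !mul0mx !addr0 trmx0 mulmx0 addr0. Qed.

Lemma posdef_ul p q (M : 'M[R]_(p + q)) : posdef M -> posdef (ulsubmx M).
Proof.
move=> pM; have -> : ulsubmx M = row_mx 1%:M 0 *m M *m (row_mx 1%:M 0)^T.
  by rewrite row0_cong trmx1 mul1mx mulmx1.
by apply: posdef_cong => // s; rewrite mul_mx_row mulmx1 mulmx0 => /(congr1 lsubmx); rewrite row_mxKl linear0.
Qed.

Lemma rsubmx_hlift p q (M : 'M[R]_(p + q)) (s : 'rV[R]_q) : rsubmx (s *m hlift M) = s.
Proof. by rewrite /hlift mul_mx_row row_mxKr mulmx1. Qed.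

Lemma posdef_schur p q (M : 'M[R]_(p + q)) : posdef M -> posdef (schur M).
Proof. by move=> pM; apply: posdef_cong => // s /(congr1 rsubmx); rewrite rsubmx_hlift linear0. Qed.

Lemma hlift_mul p q (M : 'M[R]_(p + q)) : ulsubmx M \in unitmx -> hlift M *m M = row_mx 0 (schur M).
Proof.
move=> Mu; have H : lsubmx (hlift M *m M) = 0.
  rewrite -{2}(submxK M) /hlift mul_row_block row_mxKl mul1mx mulNmx mulmxKV// addNr.
  by rewrite /dlsubmx.
rewrite -[LHS]hsubmxK H; congr row_mx.
rewrite /schur -[hlift M *m M in RHS]hsubmxK H {2}/hlift tr_row_mx mul_row_col trmx1 mulmx1 mul0mx add0r.
by [].
Qed.

Lemma hlift_mulT p q (M : 'M[R]_(p + q)) : posdef M -> ulsubmx M \in unitmx ->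
  M *m (hlift M)^T = col_mx 0 (schur M).
Proof.
move=> pM Mu; rewrite -{1}pM.1 -trmx_mul hlift_mul// tr_row_mx trmx0.
by rewrite (posdef_schur pM).1.
Qed.

(** A unipotent congruence makes [M] block diagonal. Geometrically, Riemannian volume is leaf volume
    times transverse volume. *)
Lemma det_schur p q (M : 'M[R]_(p + q)) : posdef M -> ulsubmx M \in unitmx ->
  \det M = \det (ulsubmx M) * \det (schur M).
Proof.
move=> pM Mu; pose N : 'M[R]_(p + q) := block_mx 1%:M 0 (- (dlsubmx M *m invmx (ulsubmx M))) 1%:M.
have NE : N = col_mx (row_mx 1%:M 0) (hlift M) by [].
have dN : \det N = 1 by rewrite det_lblock !det1 mulr1.
transitivity (\det (N *m M *m N^T)); first by rewrite !det_mulmx det_tr dN mulr1 mul1r.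
suff -> : N *m M *m N^T = block_mx (ulsubmx M) 0 0 (schur M) by rewrite det_ublock.
rewrite NE mul_col_mx tr_col_mx mul_col_row -/(schur M) -[_ *m (hlift M)^T]mulmxA hlift_mulT//.
rewrite hlift_mul// row0_cong trmx1 mul1mx mulmx1.
by rewrite tr_row_mx trmx0 trmx1 !mul_row_col !mulmx0 !mul0mx !addr0.
Qed.

Lemma posdef_det n (M : 'M[R]_n) : posdef M -> 0 < \det M.
Proof.
elim: n M => [|n IH] M pM; first by rewrite det_mx00.
have [_ /(_ 1)] := @posdef_ul 1 n M pM; rewrite oner_neq0 => /(_ isT); rewrite trmx1 mul1mx mulmx1 => h.
have u : ulsubmx (M : 'M[R]_(1 + n)) \in unitmx by rewrite unitmxE det_mx11 unitfE gt_eqF.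
rewrite (@det_schur 1 n M pM u) det_mx11 mulr_gt0//; apply: IH.
exact: (@posdef_schur 1 n M pM).
Qed.

Lemma posdef_unit n (M : 'M[R]_n) : posdef M -> M \in unitmx.
Proof. by move=> /posdef_det h; rewrite unitmxE unitfE gt_eqF. Qed.

(** An inverse Cholesky factor by recursion on the Schur complement; its rows are orthonormal for
    [M]. Only square roots and inverses of positive pivots occur, so it depends smoothly on [M] and
    is a function of [M] alone, which later makes the frame basic. *)
Fixpoint icholesky n : 'M[R]_n -> 'M[R]_n :=
  match n with
  | 0 => fun=> 0
  | n'.+1 => fun M => col_mx (row_mx ((Num.sqrt ((M : 'M[R]_(1 + n')) 0 0))^-1)%:M 0)
                       (icholesky (schur (M : 'M[R]_(1 + n'))) *m hlift (M : 'M[R]_(1 + n')))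
  end.

Lemma posdef_00 n (M : 'M[R]_(1 + n)) : posdef M -> 0 < M 0 0.
Proof.
move=> pM; have [_ /(_ 1)] := @posdef_ul 1 n M pM; rewrite oner_neq0 => /(_ isT).
rewrite trmx1 mul1mx mulmx1 !mxE.
by rewrite (_ : lshift n 0 = 0)//; apply: val_inj.
Qed.

Lemma icholeskyP n (M : 'M[R]_n) : posdef M -> icholesky M *m M *m (icholesky M)^T = 1%:M.
Proof.
elim: n M => [|n IH] M pM; first by apply/matrixP => -[].
have u := posdef_unit (@posdef_ul 1 n M pM).
rewrite /=; have sP := @posdef_schur 1 n M pM; have h0 := @posdef_00 n M pM.
set a := (Num.sqrt _)^-1; set C := icholesky _.
pose P1 : 'M[R]_(1, 1 + n) := row_mx a%:M 0; pose P2 := C *m @hlift 1 n M.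
have P11 : P1 *m M *m P1^T = 1%:M.
  rewrite /P1 (@row0_cong 1 n 1 a%:M M).
  rewrite tr_scalar_mx mul_scalar_mx mul_mx_scalar; apply/matrixP => i j; rewrite !ord1 !mxE.
  rewrite (_ : lshift n 0 = 0); last exact: val_inj.
  have s0 : Num.sqrt (M 0 0) != 0 by rewrite gt_eqF// sqrtr_gt0.
  by rewrite mulrA -{1}(sqr_sqrtr (ltW h0)) /a expr2 eqxx/=; field.
have MH := @hlift_mulT 1 n M pM u.
have P12 : P1 *m M *m P2^T = 0.
  by rewrite /P2 trmx_mul mulmxA -(mulmxA P1 M) MH /P1 mul_row_col mulmx0 mul0mx addr0 mul0mx.
have P21 : P2 *m M *m P1^T = 0.
  by apply: trmx_inj; rewrite trmx0 -P12 (trmx_mul (P2 *m M)) (trmx_mul P2) trmxK pM.1 mulmxA.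
have P22 : P2 *m M *m P2^T = 1%:M.
  by rewrite /P2 trmx_mul !mulmxA -(mulmxA C (@hlift 1 n M) M) -(mulmxA C _ (_^T)); exact: (IH _ sP).
have E : (col_mx P1 P2 : 'M[R]_(1 + n, 1 + n)) *m (M : 'M[R]_(1 + n, 1 + n)) *m (col_mx P1 P2)^T = 1%:M.
  by rewrite mul_col_mx tr_col_mx mul_col_row P11 P12 P21 P22 -scalar_mx_block.
exact: E.
Qed.

End posdef.

Section derive_mx.
Context {R : realType} {V : normedModType R}.

Lemma differentiable_mulmx a b c (A : V -> 'M[R]_(a, b)) (B : V -> 'M[R]_(b, c)) u :
  differentiable A u -> differentiable B u -> differentiable (fun u => A u *m B u) u.
Proof.
move=> dA dB; apply: differentiable_mx => i j.
rewrite (_ : (fun x => _) = \sum_k (fun x => A x i k * B x k j)).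
  apply: differentiable_sum => k; apply: differentiableM; exact: differentiable_entry.
by apply/funext => x; rewrite mxE fct_sumE.
Qed.

Lemma derive_mulmx a b c (A : V -> 'M[R]_(a, b)) (B : V -> 'M[R]_(b, c)) u v :
  differentiable A u -> differentiable B u ->
  'D_v (fun u => A u *m B u) u = 'D_v A u *m B u + A u *m 'D_v B u.
Proof.
move=> dA dB; apply/matrixP => i j; rewrite derive_entry; last exact: differentiable_mulmx.
rewrite (_ : (fun x => _) = \sum_k (fun x => A x i k * B x k j)); last first.
  by apply/funext => x; rewrite mxE fct_sumE.
rewrite derive_sum; last first.
  by move=> k; apply/diff_derivable/differentiableM; exact: differentiable_entry.
rewrite !mxE -big_split /=; apply: eq_bigr => k _.
rewrite deriveM; [|exact/diff_derivable/differentiable_entry..].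
rewrite (derive_entry v i k dA) (derive_entry v k j dB) addrC; congr (_ + _); exact: mulrC.
Qed.

Lemma differentiable_trmx a b (A : V -> 'M[R]_(a, b)) u :
  differentiable A u -> differentiable (fun u => (A u)^T) u.
Proof.
move=> dA; apply: differentiable_mx => i j; rewrite (_ : (fun x => _) = fun x => A x j i).
  exact: differentiable_entry.
by apply/funext => x; rewrite mxE.
Qed.

Lemma derive_trmx a b (A : V -> 'M[R]_(a, b)) u v : differentiable A u ->
  'D_v (fun u => (A u)^T) u = ('D_v A u)^T.
Proof.
move=> dA; apply/matrixP => i j; rewrite (derive_entry v i j (differentiable_trmx dA)) mxE (derive_entry v j i dA).
by rewrite (_ : (fun x => (A x)^T i j) = fun x => A x j i)//; apply/funext => x; rewrite mxE.
Qed.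

Lemma derive_mxsub a b a' b' (h : 'I_a' -> 'I_a) (k : 'I_b' -> 'I_b) (A : V -> 'M[R]_(a, b)) u v : differentiable A u ->
  differentiable (fun u => mxsub h k (A u)) u /\ 'D_v (fun u => mxsub h k (A u)) u = mxsub h k ('D_v A u).
Proof.
move=> dA; have d : differentiable (fun u => mxsub h k (A u)) u.
  apply: differentiable_mx => i j; rewrite (_ : (fun x => _) = fun x => A x (h i) (k j)).
    exact: differentiable_entry.
  by apply/funext => x; rewrite mxE.
split => //; apply/matrixP => i j; rewrite (derive_entry v i j d) mxE (derive_entry v (h i) (k j) dA).
by rewrite (_ : (fun x => mxsub h k (A x) i j) = fun x => A x (h i) (k j))//; apply/funext => x; rewrite mxE.
Qed.

Lemma derive_rsubmx a b1 b2 (A : V -> 'M[R]_(a, b1 + b2)) u v : differentiable A u ->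
  'D_v (fun u => rsubmx (A u)) u = rsubmx ('D_v A u).
Proof.
move=> dA; have [_] := derive_mxsub (id : 'I_a -> 'I_a) (@rshift b1 b2) v dA.
by under eq_fun do rewrite -rsubmxEsub; rewrite -rsubmxEsub.
Qed.

Lemma differentiable_rsubmx a b1 b2 (A : V -> 'M[R]_(a, b1 + b2)) u : differentiable A u ->
  differentiable (fun u => rsubmx (A u)) u.
Proof.
move=> dA; have [] := derive_mxsub (id : 'I_a -> 'I_a) (@rshift b1 b2) 0 dA.
by under eq_fun do rewrite -rsubmxEsub.
Qed.

End derive_mx.

Lemma row_lin3 (R : realType) n (A B : 'rV[R]_n) (c : 'I_n -> R) :
  \row_l (A 0 l + B 0 l - c l) = A + B - \row_l c l.
Proof. by apply/rowP => l; rewrite !mxE. Qed.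

Section metric.
Context {R : realType} {p q : nat}.
Local Notation V := 'rV[R]_(p + q).
Variables (D : set V) (G : V -> 'M[R]_(p + q)).
Hypotheses (oD : open D) (sG : forall k, ck k D G) (pG : forall u, D u -> posdef (G u)).

Definition gam (u : V) := schur (G u).
Definition hl (u : V) := hlift (G u).

Lemma gam_pos u : D u -> posdef (gam u).
Proof. by move=> /pG/posdef_schur. Qed.

Lemma ul_unit u : D u -> ulsubmx (G u) \in unitmx.
Proof. by move=> /pG/posdef_ul/posdef_unit. Qed.

Lemma sigmaE u s : sigma G u s = s *m hl u.
Proof. by rewrite /sigma /hl /hlift mul_mx_row mulmx1 mulmxN mulmxA. Qed.

Lemma gQE u s t : gQ G u s t = (s *m gam u *m t^T) 0 0.
Proof. by rewrite /gQ /gdot !sigmaE /gam /schur trmx_mul !mulmxA. Qed.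

Lemma ck_hl k : ck k D hl.
Proof.
apply: ck_row_mx => //; last exact: ck_cst.
apply: ckN => //; apply: ck_mulmx => //.
  by apply: ck_lsubmx => //; apply: ck_dsubmx.
apply: ck_invmx => //; first exact: ul_unit.
by apply: ck_lsubmx => //; apply: ck_usubmx.
Qed.

Lemma ck_gam k : ck k D gam.
Proof.
apply: ck_mulmx => //; first by apply: ck_mulmx => //; exact: ck_hl.
by apply: ck_tr => //; exact: ck_hl.
Qed.

Lemma dG u : D u -> differentiable G u. Proof. exact: ck_diff (sG 0). Qed.
Lemma dgam u : D u -> differentiable gam u. Proof. exact: ck_diff (ck_gam 0). Qed.
Lemma dhl u : D u -> differentiable hl u. Proof. exact: ck_diff (ck_hl 0). Qed.

Lemma derive_hl u v : D u -> rsubmx ('D_v hl u) = 0.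
Proof.
move=> Du; rewrite -derive_rsubmx; last exact: dhl.
by rewrite (_ : (fun u => _) = cst 1%:M) ?derive_cst//; apply/funext => x; rewrite /hl /hlift row_mxKr.
Qed.

(** In the product rule the terms with a derivative of [hl] vanish: that derivative has only leaf
    components, while [hl] times [G] has only transverse ones. *)
Lemma derive_gam u v : D u -> 'D_v gam u = hl u *m 'D_v G u *m (hl u)^T.
Proof.
move=> Du; have dH := dhl Du; have dG' := dG Du.
have dHT := differentiable_trmx dH; have dHG := differentiable_mulmx dH dG'.
rewrite [LHS](@derive_mulmx _ _ _ _ _ (fun u => hl u *m G u) (fun u => (hl u)^T))// derive_mulmx// derive_trmx//.
have E : 'D_v hl u = row_mx (lsubmx ('D_v hl u)) 0 by rewrite -[LHS]hsubmxK derive_hl.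
rewrite mulmxDl -[X in X + _ + _]mulmxA /hl hlift_mulT; [|exact: pG|exact: ul_unit].
rewrite -/(hl u) hlift_mul; last exact: ul_unit.
by rewrite E tr_row_mx !mul_row_col trmx0 !(mul0mx, mulmx0) !addr0 add0r.
Qed.

(* the symbols of the transverse connection *)
Definition tsym u (s r : 'rV[R]_q) : 'rV[R]_q :=
  2^-1 *: ((r *m 'D_(s *m hl u) gam u + s *m 'D_(r *m hl u) gam u
    - \row_k (s *m 'D_(delta_mx 0 k *m hl u) gam u *m r^T) 0 0) *m invmx (gam u)).

Lemma rsubmx_invmx u (y : V) : D u -> rsubmx (y *m invmx (G u)) = y *m (hl u)^T *m invmx (gam u).
Proof.
move=> Du; set z := y *m _; have -> : y = z *m G u.
  by rewrite mulmxKV//; apply: posdef_unit; exact: pG.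
rewrite -[z *m _ *m _]mulmxA /hl hlift_mulT; [|exact: pG|exact: ul_unit].
rewrite -{2}(hsubmxK z) mul_row_col mulmx0 add0r mulmxK//.
by apply: posdef_unit; exact: gam_pos.
Qed.

Lemma sum_derive_coord u (a b w : V) : D u ->
  \sum_l w 0 l * (a *m 'D_(delta_mx 0 l) G u *m b^T) 0 0 = (a *m 'D_w G u *m b^T) 0 0.
Proof.
move=> Du; rewrite [in RHS](derive_sum_coord w (dG Du)) mulmx_sumr mulmx_suml summxE.
by apply: eq_bigr => l _; rewrite -scalemxAr -scalemxAl [in RHS]mxE.
Qed.

(** Projecting after [invmx (G u)] amounts to contracting with the lifts and then applying
    [invmx (gam u)]. Derivatives of [G] between lifts are derivatives of [gam], so the Koszul
    expression of the full metric turns into that of the transverse metric. *)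
Lemma christoffel_tsym u s r : D u -> rsubmx (christoffel G u (s *m hl u) (r *m hl u)) = tsym u s r.
Proof.
move=> Du; rewrite /christoffel linearZ /= rsubmx_invmx//; congr (_ *: (_ *m _)).
pose A := r *m hl u *m 'D_(s *m hl u) G u; pose B := s *m hl u *m 'D_(r *m hl u) G u.
pose c l := (s *m hl u *m 'D_(delta_mx 0 l) G u *m (r *m hl u)^T) 0 0.
have -> : (\row_l (A 0 l + B 0 l - c l)) = A + B - \row_l c l by exact: row_lin3.
rewrite mulmxBl mulmxDl /A /B !derive_gam// !mulmxA; congr (_ - _).
apply/rowP => k; rewrite [LHS]mxE [RHS]mxE derive_gam// !mulmxA.
have -> : s *m hl u *m 'D_(delta_mx 0 k *m hl u) G u *m (hl u)^T *m r^T =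
   s *m hl u *m 'D_(delta_mx 0 k *m hl u) G u *m (r *m hl u)^T by rewrite trmx_mul mulmxA.
rewrite -sum_derive_coord//; apply: eq_bigr => l _; rewrite -rowE [in RHS]mxE [X in X * _]mxE [X in _ * X]mxE.
by rewrite mulrC.
Qed.

Lemma ck_col_mx k m1 m2 n (U : set V) (a : V -> 'M[R]_(m1, n)) (b : V -> 'M[R]_(m2, n)) : open U ->
  ck k U a -> ck k U b -> ck k U (fun u => col_mx (a u) (b u)).
Proof.
move=> oU ca cb; apply: (ck_ext oU _ (ck_tr oU (ck_row_mx oU (ck_tr oU ca) (ck_tr oU cb)))) => u _.
by rewrite tr_row_mx !trmxK.
Qed.

Lemma ck_icholesky k n (U : set V) (M : V -> 'M[R]_n) : open U -> (forall u, U u -> posdef (M u)) ->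
  (forall k, ck k U M) -> ck k U (fun u => icholesky (M u)).
Proof.
move=> oU; elim: n M => [|n IH] M pM cM; first exact: ck_cst.
have u0 u : U u -> ulsubmx (M u : 'M[R]_(1 + n)) \in unitmx.
  by move=> /pM H; exact: posdef_unit (@posdef_ul _ 1 n _ H).
have cH l : ck l U (fun u => @hlift R 1 n (M u)).
  apply: ck_row_mx => //; last exact: ck_cst.
  apply: ckN => //; apply: ck_mulmx => //.
    by apply: ck_lsubmx => //; exact: (@ck_dsubmx R _ l 1 n (1 + n) U M).
  apply: ck_invmx => //.
  by apply: ck_lsubmx => //; exact: (@ck_usubmx R _ l 1 n (1 + n) U M).
have cS l : ck l U (fun u => schur (M u : 'M[R]_(1 + n))).
  apply: ck_mulmx => //; last by apply: ck_tr => //; exact: cH.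
  by apply: ck_mulmx.
have c00 : ck k U (fun u => (Num.sqrt ((M u : 'M[R]_(1 + n)) 0 0))^-1).
  apply: ckV => //.
    by move=> u /pM/(@posdef_00 _ n) h; rewrite gt_eqF// sqrtr_gt0.
  apply: ck_sqrt => //; first by move=> u /pM/(@posdef_00 _ n).
  exact: (@ck_entry R _ (1 + n) (1 + n) k U M).
rewrite /=; apply: ck_mx => // i j.
have c1 : ck k U (fun u => row_mx ((Num.sqrt ((M u : 'M[R]_(1 + n)) 0 0))^-1)%:M 0 : 'M[R]_(1, 1 + n)).
  apply: ck_row_mx => //; last exact: ck_cst.
  apply: ck_mx => // i' j'; rewrite !ord1; apply: ck_ext c00 => // u _.
  by rewrite mxE eqxx.
have c2 : ck k U (fun u => icholesky (schur (M u : 'M[R]_(1 + n))) *m @hlift R 1 n (M u)).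
  apply: ck_mulmx => //; apply: (IH (fun u => schur (M u : 'M[R]_(1 + n)))) => // u /pM H.
  exact: (@posdef_schur _ 1 n _ H).
exact: (ck_entry i j oU (ck_col_mx oU c1 c2)).
Qed.

End metric.

#[local] Opaque derive.

Lemma addr_cancel4 (V : zmodType) (A B C D : V) : A + B + C + (- A - D) = B + C - D.
Proof. by rewrite -(addrA A) addrACA subrr add0r. Qed.

Lemma half_entry (R : realType) (A B : 'M[R]_1) : (2^-1 *: (A + A - B)) 0 0 = A 0 0 - 2^-1 * B 0 0.
Proof. by rewrite !mxE; move: (A 0 0) (B 0 0) => a b; lra. Qed.

Lemma derive_dir0 (R : realType) (V W : normedModType R) (f : V -> W) u : differentiable f u -> 'D_0 f u = 0.
Proof. by move=> df; rewrite deriveE// linear0. Qed.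

Lemma dot_sym (R : realType) n (g : 'M[R]_n) (a b : 'rV[R]_n) : g^T = g ->
  (b *m g *m a^T) 0 0 = (a *m g *m b^T) 0 0.
Proof.
move=> sg; have scT (N : 'M[R]_1) : N 0 0 = N^T 0 0 by rewrite mxE.
by rewrite [LHS]scT !trmx_mul trmxK sg mulmxA.
Qed.

(** The pointwise identity for one frame vector [y], with derivatives abstracted: [T] and [W] are
    the transverse Jacobians of the map and of the velocity, [b] is the transverse velocity, [X] the
    dual field with Jacobian [J], and [P] the derivative of [T] along the lift of [y]. [Q] and [Q']
    are derivatives of the source metric along [y] and [X], [S] and [S'] of the target metric along
    [y *m T] and [b]. The second hypothesis is the derivative of the duality relation, the last two
    are Koszul formulas. *)
Lemma variation_algebra (R : realType) q q' (y X ts : 'rV[R]_q) (b ts' : 'rV[R]_q') (g J Q Q' : 'M[R]_q)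
    (g' S S' : 'M[R]_q') (T P W : 'M[R]_(q, q')) :
  S^T = S -> Q^T = Q ->
  y *m J *m g + X *m Q = y *m W *m g' *m T^T + b *m S *m T^T + b *m g' *m P^T ->
  (b *m g' *m ts'^T) 0 0 = (y *m T *m S *m b^T) 0 0 - 2^-1 * (y *m T *m S' *m (y *m T)^T) 0 0 ->
  (b *m g' *m (ts *m T)^T) 0 0 = (y *m Q *m X^T) 0 0 - 2^-1 * (y *m Q' *m y^T) 0 0 ->
  (y *m (W *m g' *m T^T) *m y^T) 0 0 + 2^-1 * (y *m (T *m S' *m T^T) *m y^T) 0 0
  + (b *m g' *m (y *m P + ts' - ts *m T)^T) 0 0
  = (y *m (J *m g) *m y^T) 0 0 + 2^-1 * (y *m Q' *m y^T) 0 0.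
Proof.
move=> sS sQ /(congr1 (fun N => (N *m y^T) 0 0)) key e1 e2.
have scT (N : 'M[R]_1) : N 0 0 = N^T 0 0 by rewrite mxE.
have e3 : (X *m Q *m y^T) 0 0 = (y *m Q *m X^T) 0 0 by rewrite scT !trmx_mul trmxK sQ mulmxA.
have e4 : (b *m S *m T^T *m y^T) 0 0 = (y *m T *m S *m b^T) 0 0.
  by rewrite scT !trmx_mul !trmxK sS !mulmxA.
have D1 (A B : 'M[R]_1) : (A + B) 0 0 = A 0 0 + B 0 0 by rewrite mxE.
have D2 (A B : 'M[R]_1) : (A - B) 0 0 = A 0 0 - B 0 0 by rewrite !mxE.
have e5 : b *m g' *m (y *m P + ts' - ts *m T)^T =
    b *m g' *m P^T *m y^T + b *m g' *m ts'^T - b *m g' *m (ts *m T)^T.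
  have -> : (y *m P + ts' - ts *m T)^T = P^T *m y^T + ts'^T - (ts *m T)^T.
    by apply/matrixP => i j; rewrite -trmx_mul !mxE.
  by rewrite mulmxBr mulmxDr !mulmxA.
rewrite e5 D2 D1 e1 e2 (trmx_mul y) !mulmxA.
move: key; rewrite !mulmxDl !D1 e3 e4.
move: ((y *m J *m g *m y^T) 0 0) ((y *m Q *m X^T) 0 0) ((y *m W *m g' *m T^T *m y^T) 0 0)
  ((y *m T *m S *m b^T) 0 0) ((b *m g' *m P^T *m y^T) 0 0) ((y *m T *m S' *m T^T *m y^T) 0 0)
  ((y *m Q' *m y^T) 0 0).
by clear; move=> *; lra.
Qed.

Section connection.
Context {R : realType} {p q : nat}.
Local Notation V := 'rV[R]_(p + q).
Variables (D : set V) (G : V -> 'M[R]_(p + q)).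
Hypotheses (oD : open D) (sG : forall k, ck k D G) (pG : forall u, D u -> posdef (G u)).

Lemma differentiable_sigma u (s : V -> 'rV[R]_q) : D u -> differentiable s u ->
  differentiable (fun w => sigma G w (s w)) u.
Proof.
move=> Du ds; rewrite (_ : (fun w => _) = fun w => s w *m hl G w).
  by apply: differentiable_mulmx => //; exact: (dhl oD sG pG).
by apply/funext => w; rewrite sigmaE.
Qed.

Lemma rsubmx_sigma u s : rsubmx (sigma G u s) = s.
Proof. by rewrite sigmaE rsubmx_hlift. Qed.

Lemma rsubmx_derive_sigma u (s : V -> 'rV[R]_q) v : D u -> differentiable s u ->
  rsubmx ('D_v (fun w => sigma G w (s w)) u) = 'D_v s u.
Proof.
move=> Du ds; rewrite -derive_rsubmx; last exact: differentiable_sigma.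
by under eq_fun do rewrite rsubmx_sigma.
Qed.

(** A lifted section has no leaf part, so the bracket term of the definition drops and only the
    Levi-Civita term contributes. *)
Lemma nablaQ_normal (s0 s : V -> 'rV[R]_q) u : D u -> differentiable s u ->
  nablaQ G (fun w => sigma G w (s0 w)) s u =
  'D_(sigma G u (s0 u)) s u + tsym G u (s0 u) (s u).
Proof.
move=> Du ds; rewrite /nablaQ.
have -> : leaf_part G (fun w => sigma G w (s0 w)) = cst 0.
  by apply/funext => w; rewrite /leaf_part /normal_part rsubmx_sigma subrr.
have dS := differentiable_sigma Du ds.
rewrite /bracket [X in rsubmx (X - _)]deriveE//= linear0 derive_cst subrr linear0 add0r.
rewrite /levi_civita /normal_part rsubmx_sigma linearD /= rsubmx_derive_sigma//; congr (_ + _).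
by rewrite !sigmaE (christoffel_tsym oD sG pG).
Qed.

(** For coefficients that are constant in the chart the bracket has no transverse part, since the
    transverse components of the lift and of the leaf part are constant. This is the form in which
    the pull-back connection meets the target. *)
Lemma nablaQ_cst (z : V) (s : 'rV[R]_q) u : D u ->
  nablaQ G (cst z) (cst s) u = tsym G u (rsubmx z) s.
Proof.
move=> Du; have dc : differentiable (cst s : V -> 'rV[R]_q) u by exact: differentiable_cst.
have Es v : rsubmx ('D_v (fun w => sigma G w (cst s w)) u) = 0.
  by rewrite (@rsubmx_derive_sigma u (cst s) v Du dc) derive_cst.
have dl : differentiable (leaf_part G (cst z)) u.
  apply: differentiableB; first exact: differentiable_cst.
  by apply: (@differentiable_sigma u (cst (rsubmx z)) Du); exact: differentiable_cst.
have El v : rsubmx ('D_v (leaf_part G (cst z)) u) = 0.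
  rewrite -(derive_rsubmx v dl) (_ : (fun w => rsubmx _) = cst 0) ?derive_cst//.
  by apply/funext => w; rewrite /leaf_part /normal_part linearB /= rsubmx_sigma subrr.
rewrite /nablaQ /bracket linearB /= Es El subrr add0r /levi_civita linearD /= Es add0r.
by rewrite /normal_part /= !sigmaE (christoffel_tsym oD sG pG).
Qed.

(** The Koszul formula with two equal arguments: the two symmetric terms merge and the third keeps
    its factor one half. *)
Lemma tsym_dot u s t : D u ->
  (tsym G u s s *m gam G u *m t^T) 0 0 =
  (s *m 'D_(s *m hl G u) (gam G) u *m t^T) 0 0 - 2^-1 * (s *m 'D_(t *m hl G u) (gam G) u *m s^T) 0 0.
Proof.
move=> Du; have gu : gam G u \in unitmx by apply: posdef_unit; exact: (gam_pos pG).
pose A := s *m 'D_(s *m hl G u) (gam G) u *m t^T; pose B := s *m 'D_(t *m hl G u) (gam G) u *m s^T.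
have EB : (\row_k (s *m 'D_(delta_mx 0 k *m hl G u) (gam G) u *m s^T) 0 0) *m t^T = B.
  apply/matrixP => i j; rewrite !ord1 [LHS]mxE /B.
  have -> : t *m hl G u = \sum_k t 0 k *: (delta_mx 0 k *m hl G u).
    by rewrite {1}(row_sum_coord t) mulmx_suml; apply: eq_bigr => k _; rewrite -scalemxAl.
  have dg := dgam oD sG pG Du.
  rewrite deriveE// linear_sum mulmx_sumr mulmx_suml summxE; apply: eq_bigr => k _.
  rewrite linearZ /= -scalemxAr -scalemxAl [RHS]mxE -deriveE//.
  by rewrite [X in X * _]mxE [X in _ * X = _]mxE mulrC.
have -> : tsym G u s s *m gam G u *m t^T = 2^-1 *: (A + A - B).
  by rewrite /tsym -!scalemxAl (mulmxKV gu) mulmxBl mulmxDl EB.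
exact: half_entry.
Qed.

End connection.

Section local_map.
Context {R : realType} {p q p' q' : nat}.
Local Notation V := 'rV[R]_(p + q).
Local Notation V' := 'rV[R]_(p' + q').

Definition TJ (f : V -> V') (u : V) : 'M[R]_(q, q') := drsubmx ('J f u).

Definition fol (U : set V) (f : V -> V') := forall u (v : V), U u -> rsubmx v = 0 -> rsubmx ('D_v f u) = 0.

Lemma rsub_derive (U : set V) (f : V -> V') u v : fol U f -> U u -> differentiable f u ->
  rsubmx ('D_v f u) = rsubmx v *m TJ f u.
Proof.
move=> ff Uu df; have {1}-> : v = row_mx (lsubmx v) 0 + row_mx 0 (rsubmx v).
  by rewrite add_row_mx addr0 add0r hsubmxK.
rewrite deriveDv// linearD /= ff ?row_mxKr// add0r deriveEjacobian//.
by rewrite -{1}(vsubmxK ('J f u)) mul_row_col mul0mx add0r /TJ /drsubmx mulmx_rsub.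
Qed.

Lemma dTE (G : V -> 'M[R]_(p + q)) (U : set V) (f : V -> V') u s : fol U f -> U u -> differentiable f u ->
  dT G f u s = s *m TJ f u.
Proof. by move=> ff Uu df; rewrite /dT (rsub_derive _ ff)// rsubmx_sigma. Qed.

Lemma ck_TJ k (U : set V) (f : V -> V') : open U -> ck k.+1 U f -> ck k U (TJ f).
Proof.
move=> oU cf; apply: ck_rsubmx => //; apply: ck_dsubmx => //; exact: ck_jacobian.
Qed.

Variables (U : set V) (G : V -> 'M[R]_(p + q)) (U' : set V') (G' : V' -> 'M[R]_(p' + q')) (f : V -> V').
Hypotheses (oU : open U) (sG : forall k, ck k U G) (pG : forall u, U u -> posdef (G u)).
Hypotheses (oU' : open U') (sG' : forall k, ck k U' G') (pG' : forall u, U' u -> posdef (G' u)).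
Hypotheses (sf : forall k, ck k U f) (ff : fol U f) (fU : forall u, U u -> U' (f u)).

Let df u : U u -> differentiable f u. Proof. exact: ck_diff (sf 0). Qed.

Lemma nabla_dT_normal (s : V -> 'rV[R]_q) u : U u -> differentiable s u ->
  nabla_dT G G' f (fun w => sigma G w (s w)) s u =
  s u *m 'D_(s u *m hl G u) (TJ f) u + tsym G' (f u) (s u *m TJ f u) (s u *m TJ f u)
  - tsym G u (s u) (s u) *m TJ f u.
Proof.
move=> Uu ds; rewrite /nabla_dT /nabla_pb (nablaQ_normal oU sG pG)// (nablaQ_cst oU' sG' pG')//; last exact: fU.
rewrite !(dTE _ _ ff Uu (df Uu)) (rsub_derive _ ff Uu (df Uu)).
rewrite rsubmx_sigma.
have -> : 'D_(sigma G u (s u)) (fun w => dT G f w (s w)) u = 'D_(sigma G u (s u)) (fun w => s w *m TJ f w) u.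
  by apply: (derive_open_eq _ oU Uu) => w Uw; rewrite (dTE _ _ ff)//; exact: df.
rewrite derive_mulmx//; last exact: ck_diff (ck_TJ oU (sf 1)) Uu.
rewrite mulmxDl opprD -!sigmaE.
exact: addr_cancel4.
Qed.

(** Orthonormality of the rows of [Em] means that [Em^T *m Em] is the inverse metric; sums over a
    frame thus become traces, which no longer see the frame. *)
Lemma frame_trace (E : 'I_q -> V -> 'rV[R]_q) u M : U u ->
  (forall a b, gQ G u (E a u) (E b u) = (a == b)%:R) ->
  \sum_a (E a u *m M *m (E a u)^T) 0 0 = \tr (invmx (gam G u) *m M).
Proof.
move=> Uu HE; pose Em : 'M[R]_q := \matrix_(a, j) E a u 0 j.
have rE a : row a Em = E a u by apply/rowP => j; rewrite !mxE.
have entry (N : 'M[R]_q) a b : (Em *m N *m Em^T) a b = (E a u *m N *m (E b u)^T) 0 0.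
  by rewrite -!rE !rowE trmx_mul trmx_delta !mulmxA -colE [RHS]mxE -!(mulmxA (delta_mx 0 a)) -rowE [RHS]mxE.
have H1 : Em *m gam G u *m Em^T = 1%:M.
  by apply/matrixP => a b; rewrite entry [RHS]mxE -HE; exact/esym/gQE.
have H2 : Em^T *m Em = invmx (gam G u).
  have H3 : gam G u *m Em^T *m Em = 1%:M by apply: mulmx1C; rewrite mulmxA.
  have gu : gam G u \in unitmx by apply: posdef_unit; exact: (gam_pos pG).
  by rewrite -[LHS]mul1mx -(mulVmx gu) -mulmxA (mulmxA (gam G u)) H3 mulmx1.
rewrite -H2 -mulmxA mxtrace_mulC; apply: eq_bigr => a _.
by rewrite -entry -mulmxA.
Qed.

Definition edens u := \tr (invmx (gam G u) *m (TJ f u *m gam G' (f u) *m (TJ f u)^T)).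

Lemma dT_sqnorm_inE (E : 'I_q -> V -> 'rV[R]_q) u : U u ->
  (forall a b, gQ G u (E a u) (E b u) = (a == b)%:R) ->
  dT_sqnorm_in G G' f E u = edens u.
Proof.
move=> Uu HE; rewrite /dT_sqnorm_in /edens -(frame_trace _ Uu HE); apply: eq_bigr => a _.
by rewrite gQE !(dTE _ _ ff Uu (df Uu)) trmx_mul !mulmxA.
Qed.

(** By symmetry of second derivatives, the leaf derivative of a transverse partial derivative is the
    transverse derivative of the leaf derivative, whose transverse component vanishes identically
    for a foliated map. *)
Lemma derive_TJ u (v : V) : U u -> rsubmx v = 0 -> 'D_v (TJ f) u = 0.
Proof.
move=> Uu v0; apply/matrixP => k l; rewrite [RHS]mxE.
rewrite derive_entry; last exact: ck_diff (ck_TJ oU (sf 1)) Uu.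
pose g x := f x 0 (rshift p' l).
have dg w : ck 3 U (fun x => 'D_w g x) by apply: ck_derive; apply: ck_entry.
have cg : ck 3 U g by apply: ck_entry.
have -> : 'D_v (fun x => TJ f x k l) u = 'D_v (fun x => 'D_(delta_mx 0 (rshift p k)) g x) u.
  apply: (derive_open_eq _ oU Uu) => x Ux; rewrite /TJ (jacobianE (df Ux)) !mxE derive_entry//; exact: df.
rewrite derive_comm; last 3 first.
- have : nbhs u U by exact: open_nbhs_nbhs.
  by apply: filterS => x Ux; exact: ck_diff cg Ux.
- exact: ck_diff (dg _) Uu.
- exact: ck_diff (dg _) Uu.
rewrite (@derive_open_eq _ _ _ U _ (cst 0) u _ oU Uu) ?derive_cst// => x Ux.
rewrite -derive_entry; last exact: df.
by have /rowP/(_ l) := ff Ux v0; rewrite !mxE.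
Qed.

Hypotheses (Hg : forall u v, U u -> rsubmx v = 0 -> 'D_v (gam G) u = 0).
Hypotheses (Hg' : forall u v, U' u -> rsubmx v = 0 -> 'D_v (gam G') u = 0).
Variable w : V -> V'.
Hypotheses (sw : forall k, ck k U w) (fw : fol U w).

Let dw u : U u -> differentiable w u. Proof. exact: ck_diff (sw 0). Qed.

(* the transverse field dual to V |-> <V, d_T f> *)
Definition xfield u : 'rV[R]_q :=
  rsubmx (w u) *m gam G' (f u) *m (TJ f u)^T *m invmx (gam G u).

Definition tdiv (X : V -> 'rV[R]_q) u : R := \tr (dsubmx ('J X u)) +
  2^-1 * \tr (invmx (gam G u) *m 'D_(X u *m hl G u) (gam G) u).

(* half the derivative of [edens] along the variation *)
Definition edens1 u : R := \tr (invmx (gam G u) *m (TJ w u *m gam G' (f u) *m (TJ f u)^T)) +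
  2^-1 * \tr (invmx (gam G u) *m (TJ f u *m 'D_(w u) (gam G') (f u) *m (TJ f u)^T)).

Let ck_gamf k : ck k U (fun u => gam G' (f u)).
Proof. exact: (ck_comp_mx oU oU' fU (sf k) (ck_gam oU' sG' pG' k)). Qed.

Let ck_num k : ck k U (fun u => rsubmx (w u) *m gam G' (f u) *m (TJ f u)^T).
Proof.
apply: ck_mulmx => //; last by apply: ck_tr => //; exact: ck_TJ.
by apply: ck_mulmx => //; exact: ck_rsubmx.
Qed.

Lemma ck_xfield k : ck k U xfield.
Proof.
apply: ck_mulmx; [exact: oU|exact: ck_num|]; apply: ck_invmx; [exact: oU| |exact: ck_gam].
by move=> u Uu; apply: posdef_unit; exact: (gam_pos pG).
Qed.

Let unit_gam u : U u -> gam G u \in unitmx.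
Proof. by move=> Uu; apply: posdef_unit; exact: (gam_pos pG). Qed.

Let derive_gam_lift y z : U' y -> 'D_z (gam G') y = 'D_(rsubmx z *m hl G' y) (gam G') y.
Proof.
move=> Uy; have dg := dgam oU' sG' pG' Uy.
rewrite -{1}(subrK (rsubmx z *m hl G' y) z) deriveDv// Hg' ?add0r//.
by rewrite linearB /= rsubmx_hlift subrr.
Qed.

Let derive_gamf u v : U u -> 'D_v (fun u => gam G' (f u)) u = 'D_((rsubmx v *m TJ f u) *m hl G' (f u)) (gam G') (f u).
Proof.
move=> Uu; have dg := dgam oU' sG' pG' (fU Uu).
apply: etrans (derive_chain v (df Uu) dg) _.
by rewrite (derive_gam_lift _ (fU Uu)) (rsub_derive _ ff Uu (df Uu)).
Qed.

(** The relation between [xfield] multiplied by [gam G] and its numerator is differentiated, which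
    avoids the derivative of an inverse matrix. *)
Lemma derive_xfield_gam u (v : V) : U u ->
  'D_v xfield u *m gam G u + xfield u *m 'D_v (gam G) u =
  (rsubmx v *m TJ w u) *m gam G' (f u) *m (TJ f u)^T
  + rsubmx (w u) *m 'D_(rsubmx v *m TJ f u *m hl G' (f u)) (gam G') (f u) *m (TJ f u)^T
  + rsubmx (w u) *m gam G' (f u) *m ('D_v (TJ f) u)^T.
Proof.
move=> Uu; have dT1 := ck_diff (ck_TJ oU (sf 1)) Uu.
have dr := differentiable_rsubmx (dw Uu); have dgf := ck_diff (ck_gamf 0) Uu.
rewrite -(derive_mulmx v (ck_diff (ck_xfield 0) Uu) (dgam oU sG pG Uu)).
have -> : 'D_v (fun u => xfield u *m gam G u) u = 'D_v (fun u => rsubmx (w u) *m gam G' (f u) *m (TJ f u)^T) u.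
  by apply: (derive_open_eq _ oU Uu) => x Ux; rewrite /xfield mulmxKV//; exact: unit_gam.
rewrite (derive_mulmx v (differentiable_mulmx dr dgf) (differentiable_trmx dT1)) (derive_mulmx v dr dgf).
by rewrite derive_trmx// derive_rsubmx ?mulmxDl; [rewrite (rsub_derive _ fw Uu (dw Uu)) derive_gamf|exact: dw].
Qed.

(** In leaf directions every term of [derive_xfield_gam] other than the first vanishes: the map and
    its velocity are foliated, the transverse metric is constant along plaques, and so is [TJ f].
    Hence the dual field is basic. *)
Lemma xfield_leaf u (v : V) : U u -> rsubmx v = 0 -> 'D_v xfield u = 0.
Proof.
move=> Uu v0; have K := derive_xfield_gam v Uu.
have D0 : 'D_(rsubmx v *m TJ f u *m hl G' (f u)) (gam G') (f u) = 0.
  by rewrite v0 !mul0mx; exact: derive_dir0 (dgam oU' sG' pG' (fU Uu)).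
rewrite D0 (derive_TJ Uu v0) (Hg Uu v0) v0 in K.
have {}K : 'D_v xfield u *m gam G u = 0.
  move: K; rewrite mulmx0 addr0 => ->.
  by rewrite !mul0mx mulmx0 mul0mx trmx0 mulmx0 !addr0.
by rewrite -[LHS](mulmxK (unit_gam Uu)) K mul0mx.
Qed.

Lemma derive_xfield u (v : V) : U u -> 'D_v xfield u = rsubmx v *m dsubmx ('J xfield u).
Proof.
move=> Uu; have dX := ck_diff (ck_xfield 0) Uu.
have {1}-> : v = row_mx (lsubmx v) 0 + row_mx 0 (rsubmx v).
  by rewrite add_row_mx addr0 add0r hsubmxK.
rewrite deriveDv// xfield_leaf ?row_mxKr// add0r deriveEjacobian//.
by rewrite -{1}(vsubmxK ('J xfield u)) mul_row_col mul0mx add0r.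
Qed.

(** All traces are rewritten as sums over the frame, after which the identity holds for each frame
    vector separately: the derivatives of the metrics inside the tension cancel against those in the
    energy and in the divergence. *)
Theorem first_variation (E : 'I_q -> V -> 'rV[R]_q) u : U u ->
  (forall a, differentiable (E a) u) ->
  (forall a b, gQ G u (E a u) (E b u) = (a == b)%:R) ->
  edens1 u + (rsubmx (w u) *m gam G' (f u) *m (tension_in G G' f E u)^T) 0 0 = tdiv xfield u.
Proof.
move=> Uu dE HE; have U'f := fU Uu; have dg := dgam oU sG pG Uu; have dg' := dgam oU' sG' pG' U'f.
have sg : (gam G u)^T = gam G u by case: (gam_pos pG Uu).
have sg' : (gam G' (f u))^T = gam G' (f u) by case: (gam_pos pG' U'f).
have sdg v : ('D_v (gam G) u)^T = 'D_v (gam G) u.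
  rewrite -derive_trmx//; apply: (derive_open_eq _ oU Uu) => x Ux; by case: (gam_pos pG Ux).
have sdg' v : ('D_v (gam G') (f u))^T = 'D_v (gam G') (f u).
  rewrite -derive_trmx//; apply: (derive_open_eq _ oU' U'f) => x Ux; by case: (gam_pos pG' Ux).
have Dw := derive_gam_lift (w u) U'f.
have trE (N : 'M[R]_q) : \tr N = \sum_a (E a u *m (N *m gam G u) *m (E a u)^T) 0 0.
  by rewrite (frame_trace (N *m gam G u) Uu HE) mxtrace_mulC (mulmxK (unit_gam Uu)).
rewrite /edens1 /tdiv Dw (trE (dsubmx _)) -!(frame_trace _ Uu HE).
set T := TJ f u; set b := rsubmx (w u); set g' := gam G' (f u); set X := xfield u; set J := dsubmx _.
have XgE : X *m gam G u = b *m g' *m T^T by exact: (mulmxKV (unit_gam Uu) _).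
rewrite /tension_in linear_sum /= mulmx_sumr summxE !mulr_sumr -!big_split /=; apply: eq_bigr => a _.
rewrite (nabla_dT_normal Uu (dE a)) -/T.
set y := E a u; set e := y *m hl G u.
have re : rsubmx e = y by rewrite rsubmx_hlift.
have key := derive_xfield_gam e Uu; rewrite (derive_xfield e Uu) re -/T -/b -/g' -/J -/X in key.
set P := 'D_e (TJ f) u; set Q := 'D_e (gam G) u; set S := 'D_(y *m T *m hl G' (f u)) (gam G') (f u).
set S' := 'D_(b *m hl G' (f u)) (gam G') (f u); set Q' := 'D_(X *m hl G u) (gam G) u.
rewrite -/S -/P -/Q in key.
have H1 : (b *m g' *m (tsym G' (f u) (y *m T) (y *m T))^T) 0 0 =
    (y *m T *m S *m b^T) 0 0 - 2^-1 * (y *m T *m S' *m (y *m T)^T) 0 0.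
  apply: etrans _ (tsym_dot oU' sG' pG' (y *m T) b U'f).
  exact: dot_sym.
have H2 : (b *m g' *m (tsym G u y y *m T)^T) 0 0 = (y *m Q *m X^T) 0 0 - 2^-1 * (y *m Q' *m y^T) 0 0.
  apply: etrans _ (tsym_dot oU sG pG y X Uu).
  by rewrite trmx_mul mulmxA -XgE; exact: dot_sym.
exact: (variation_algebra (sdg' _) (sdg _) key H1 H2).
Qed.

End local_map.

#[local] Opaque jacobian.

Lemma mul_row_entry (R : realType) m n (A : 'M[R]_(m, n)) N a b :
  (A *m N *m A^T) a b = (row a A *m N *m (row b A)^T) 0 0.
Proof. by rewrite !rowE trmx_mul trmx_delta !mulmxA -colE [RHS]mxE -!(mulmxA (delta_mx 0 a)) -rowE [RHS]mxE. Qed.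

Lemma delta_entry (R : realType) m n (A : 'M[R]_(m, n)) i j :
  ((delta_mx 0 i : 'rV[R]_m) *m A *m (delta_mx 0 j : 'rV[R]_n)^T) 0 0 = A i j.
Proof. by rewrite trmx_delta -rowE -colE !mxE. Qed.

Lemma derive_near0 (R : realType) (V W : normedModType R) (f : V -> W) c u v : (\forall x \near u, f x = c) -> 'D_v f u = 0.
Proof. by move=> fc; rewrite (@diff_near_eq _ _ _ f (cst c) u v fc) derive_cst. Qed.

Lemma derive_open0 (R : realType) (V W : normedModType R) (U : set V) (f : V -> W) c u v : open U -> U u ->
  (forall x, U x -> f x = c) -> 'D_v f u = 0.
Proof. by move=> oU Uu fc; apply: (@derive_near0 _ _ _ f c); apply: filterS fc _; exact: open_nbhs_nbhs. Qed.

Lemma invmx_congr (R : realType) n (S g : 'M[R]_n) : S \in unitmx -> g \in unitmx ->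
  invmx (S *m g *m S^T) = invmx S^T *m invmx g *m invmx S.
Proof.
move=> uS ug; have uA : S *m g *m S^T \in unitmx by rewrite !unitmx_mul uS ug unitmx_tr.
rewrite -[RHS](mulmxK uA) -[LHS]mul1mx; congr (_ *m _).
by rewrite !mulmxA (mulmxKV uS) (mulmxKV ug) mulVmx// unitmx_tr.
Qed.

Lemma sqrt_det_congr (R : realType) n (A g : 'M[R]_n) :
  Num.sqrt (\det (A *m g *m A^T)) = `|\det A| * Num.sqrt (\det g).
Proof.
rewrite !det_mulmx det_tr mulrAC -expr2 mulrC.
by rewrite [X in Num.sqrt X]mulrC sqrtrM ?sqr_ge0// sqrtr_sqr.
Qed.

(** The derivative [DS] of the transverse Jacobian enters the metric term twice, with weight one
    half each, and so contributes exactly the inhomogeneous term in the transformation of the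
    Jacobian of the field. *)
Lemma tdiv_algebra (R : realType) n (S g J J2 DS DH : 'M[R]_n) : S \in unitmx -> g \in unitmx ->
  S *m J2 = J *m S + DS ->
  \tr J + 2^-1 * \tr (invmx (S *m g *m S^T) *m (DS *m g *m S^T + S *m DH *m S^T + S *m g *m DS^T))
  = \tr J2 + 2^-1 * \tr (invmx g *m DH).
Proof.
move=> uS ug JE; have uT : S^T \in unitmx by rewrite unitmx_tr.
rewrite (invmx_congr uS ug).
have -> : J2 = invmx S *m J *m S + invmx S *m DS by rewrite -mulmxA -mulmxDr -JE mulKmx.
rewrite !mulmxDr !mxtraceD.
have -> : \tr (invmx S *m J *m S) = \tr J by rewrite mxtrace_mulC mulmxA mulmxV// mul1mx.
have -> : \tr (invmx S^T *m invmx g *m invmx S *m (DS *m g *m S^T)) = \tr (invmx S *m DS).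
  rewrite mulmxA mxtrace_mulC !mulmxA mulmxV// mul1mx mxtrace_mulC !mulmxA mulmxV// mul1mx.
  by [].
have -> : \tr (invmx S^T *m invmx g *m invmx S *m (S *m DH *m S^T)) = \tr (invmx g *m DH).
  by rewrite mulmxA mxtrace_mulC !mulmxA mulmxV// mul1mx (mulmxKV uS).
have -> : \tr (invmx S^T *m invmx g *m invmx S *m (S *m g *m DS^T)) = \tr (invmx S *m DS).
  rewrite !mulmxA (mulmxKV uS) (mulmxKV ug) -trmx_inv -trmx_mul mxtrace_tr mxtrace_mulC.
  by [].
by move: (\tr _) (\tr _) (\tr _) => a b c; lra.
Qed.

Section basic_frames.
Context {R : realType} {p q : nat}.
Local Notation V := 'rV[R]_(p + q).
Variables (D : set V) (G : V -> 'M[R]_(p + q)).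
Hypotheses (oD : open D) (sG : forall k, ck k D G) (pG : forall u, D u -> posdef (G u)).

Lemma foliate_of_leaf (U : set V) (Y : V -> V) : open U -> (forall k, ck k U Y) ->
  (forall u v, U u -> rsubmx v = 0 -> rsubmx ('D_v Y u) = 0) -> foliate_field U Y.
Proof.
move=> oU cY H; split; first exact: ck_smooth.
move=> Z [sZ Z0] u Uu; rewrite /bracket linearB /= (H u (Z u) Uu (Z0 u Uu)) subr0.
have dZ := ck_diff (smooth_ck sZ 0) Uu.
rewrite -(derive_rsubmx _ dZ); apply: (derive_open0 _ oU Uu) => x Ux; exact: Z0.
Qed.

(** The lifts of constant transverse vectors are foliate and orthogonal to the leaves; Reinhart's
    condition applied to pairs of them concerns exactly the entries of [gam]. *)
Lemma bundle_like_gam : bundle_like G D -> forall u v, D u -> rsubmx v = 0 -> 'D_v (gam G) u = 0.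
Proof.
move=> bG u v Du v0; have dg := dgam oD sG pG Du.
have cY s k : ck k D (fun w => sigma G w s).
  apply: (@ck_ext _ _ _ k D (fun w => s *m hl G w)) => //; first by move=> w _; rewrite sigmaE.
  by apply: ck_mulmx => //; [exact: ck_cst|exact: ck_hl].
have fY s : foliate_field D (fun w => sigma G w s).
  apply: foliate_of_leaf => // x z Dx z0.
  rewrite (@rsubmx_derive_sigma _ _ _ D G oD sG pG x (cst s) z Dx) ?derive_cst//; exact: differentiable_cst.
have orth s x (z : V) : D x -> rsubmx z = 0 -> gdot G x (sigma G x s) z = 0.
  move=> Dx z0; rewrite /gdot sigmaE -[s *m _ *m _]mulmxA /hl hlift_mul; last exact: (ul_unit pG Dx).
  by rewrite -[z]hsubmxK z0 tr_row_mx mul_mx_row mulmx0 mul_row_col mul0mx trmx0 mulmx0 addr0 mxE.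
have xv : leafwise_field D (cst v) by split => //; apply: ck_smooth => k; exact: ck_cst.
apply/matrixP => i j; rewrite [RHS]mxE derive_entry//.
have := bG D _ _ _ oD (fun x h => h) xv (fY (delta_mx 0 i)) (fY (delta_mx 0 j))
  (orth _) (orth _) u Du.
move=> <-; apply: (derive_open_eq _ oD Du) => x Dx.
exact/esym/(etrans (gQE _ _ _ _) (delta_entry _ _ _)).
Qed.

Lemma basic_frameP u E : basic_frame G D u E ->
  (forall a, differentiable (E a) u) /\ (forall a b, gQ G u (E a u) (E b u) = (a == b)%:R).
Proof.
move=> [U [oU Uu UD fE oE]]; split => [a|a b]; last exact: oE.
have [Y fY EY] := fE a.
apply: (@differentiable_open_eq _ _ _ U (fun w => rsubmx (Y w))) => //; first by move=> w Uw; rewrite EY.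
apply: differentiable_rsubmx; exact: ck_diff (smooth_ck fY.1 0) Uu.
Qed.

(** A ball is convex and has a full leaf-direction segment between any two of its points with the
    same transverse coordinate; the mean value theorem is applied on that segment. *)
Lemma plaque_const (W : normedModType R) (f : V -> R) (u0 : V) (r : R) :
  (forall u, ball u0 r u -> differentiable f u) ->
  (forall u v, ball u0 r u -> rsubmx v = 0 -> 'D_v f u = 0) ->
  forall x y, ball u0 r x -> ball u0 r y -> rsubmx x = rsubmx y -> f x = f y.
Proof.
move=> df Df x y xB yB xy; pose v := y - x.
have inB s : 0 <= s <= 1 -> ball u0 r (x + s *: v) by exact: ball_segment.
have v0 : rsubmx v = 0 by rewrite /v linearB /= xy subrr.
have dl (s : R) : 0 <= s <= 1 -> is_derive s (1 : R) (fun s : R => f (x + s *: v)) 0.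
  move=> s01; rewrite -(Df (x + s *: v) v (inB s s01) v0).
  apply: is_derive_line; apply/diff_derivable/df; exact: inB.
have [||c cI] := @MVT R (fun s : R => f (x + s *: v)) (cst 0) 0 1 ltr01.
- by move=> s; rewrite in_itv /= => /andP[s0 s1]; apply: dl; rewrite !ltW.
- apply: derivable_within_continuous => s; rewrite in_itv /= => sI.
  by case: (dl s sI).
rewrite /= mul0r scale1r scale0r addr0 /v [x + _]addrC subrK => /eqP; rewrite subr_eq0 => /eqP ->.
by [].
Qed.

(** The rows of [icholesky] of the transverse metric are orthonormal. On a ball the metric depends
    on the transverse coordinate only, hence so do the rows, and such sections come from foliate
    fields. *)
Lemma basic_frame_exists u : (forall u v, D u -> rsubmx v = 0 -> 'D_v (gam G) u = 0) -> D u ->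
  exists E, basic_frame G D u E.
Proof.
move=> Hg Du; have [r /= r0 rD] : exists2 r : R, 0 < r & ball u r `<=` D.
  by apply/nbhs_ballP; exact: open_nbhs_nbhs.
pose B := ball u r; have oB : open B by exact: ball_open.
have cg k : ck k B (gam G) by apply: (ck_sub rD); exact: ck_gam.
have pg x : B x -> posdef (gam G x) by move=> /rD; exact: gam_pos.
pose P x := icholesky (gam G x).
have cP k : ck k B P by apply: ck_icholesky => //.
have gc x y : B x -> B y -> rsubmx x = rsubmx y -> gam G x = gam G y.
  move=> Bx By xy; apply/matrixP => i j.
  apply: (@plaque_const V (fun x => gam G x i j) u r) => //.
  - by move=> z /rD Dz; apply: differentiable_entry; exact: (dgam oD sG pG Dz).
  - by move=> z v /rD Dz v0; rewrite -derive_entry; [rewrite Hg ?mxE|exact: (dgam oD sG pG Dz)].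
pose E a x := row a (P x).
pose Y a x : V := row_mx 0 (E a x).
have cE k a : ck k B (E a).
  apply: ck_mx => // i j; apply: (ck_ext oB _ (ck_entry a j oB (cP k))) => x _.
  by rewrite /E mxE.
have cY k a : ck k B (Y a) by apply: ck_row_mx => //; exact: ck_cst.
exists E; exists B; split => //; first exact: ballxx.
  move=> a; exists (Y a); last by move=> w _; rewrite /Y row_mxKr.
  apply: foliate_of_leaf => // x v Bx v0.
  rewrite -derive_rsubmx; last exact: ck_diff (cY 0 a) Bx.
  have -> : (fun w => rsubmx (Y a w)) = E a by apply/funext => w; rewrite /Y row_mxKr.
  have dE := ck_diff (cE 0 a) Bx.
  have := is_derive_line (u := x) (v := v) (s := 0) (f := E a); rewrite scale0r addr0.
  move=> /(_ (diff_derivable dE))[_ <-].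
  apply: (@derive_near0 _ _ _ _ (E a x)).
  have c0 : {for 0, continuous (fun s : R => x + s *: v)}.
    apply: (@continuousD R V R (cst x) (fun s : R => s *: v)); first exact: cst_continuous.
    by first [exact: (cvgZr_tmp cvg_id) | exact: (cvgZl_tmp cvg_id) | exact: (cvgZr cvg_id) | exact: (cvgZl cvg_id)].
  have N : nbhs ((fun s : R => x + s *: v) 0) B by rewrite scale0r addr0; exact: open_nbhs_nbhs.
  have {}N : nbhs (0 : R) ((fun s : R => x + s *: v) @^-1` B) by exact: c0.
  apply: filterS N => s /= Bs; rewrite /E /P (gc (x + s *: v) x)//.
  by rewrite linearD linearZ /= v0 scaler0 addr0.
move=> a b w Bw; rewrite gQE /E -mul_row_entry (icholeskyP (pg w Bw)) mxE.
by [].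
Qed.

End basic_frames.

(** * Change of foliated charts *)

Section transition.
Context {R : realType} {p q : nat}.
Local Notation V := 'rV[R]_(p + q).
Variables (U U2 : set V) (G H : V -> 'M[R]_(p + q)) (th : V -> V).
Hypotheses (oU : open U) (sG : forall k, ck k U G) (pG : forall u, U u -> posdef (G u)).
Hypotheses (oU2 : open U2) (sH : forall k, ck k U2 H) (pH : forall u, U2 u -> posdef (H u)).
Hypotheses (sth : forall k, ck k U th) (fth : fol U th) (thU : forall u, U u -> U2 (th u)).
Hypothesis GH : forall u v w, U u -> gdot G u v w = gdot H (th u) ('D_v th u) ('D_w th u).

Let dth u : U u -> differentiable th u. Proof. exact: ck_diff (sth 0). Qed.

Lemma GHJ u : U u -> G u = 'J th u *m H (th u) *m ('J th u)^T.
Proof.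
move=> Uu; apply/matrixP => i j; rewrite mul_row_entry -(delta_entry (G u)) !rowE.
by have := GH (delta_mx 0 i) (delta_mx 0 j) Uu; rewrite /gdot !deriveEjacobian; [|exact: dth..].
Qed.

Let Jblock u : U u -> 'J th u = block_mx (ulsubmx ('J th u)) 0 (dlsubmx ('J th u)) (TJ th u).
Proof.
move=> Uu; rewrite -[LHS]submxK; congr (block_mx _ _ _ _).
apply: mulmx_inj => v; rewrite mulmx0.
have := fth (v := row_mx v 0) Uu; rewrite row_mxKr => /(_ erefl).
rewrite deriveEjacobian; last exact: dth.
by rewrite -{1}(vsubmxK ('J th u)) mul_row_col mul0mx addr0 -mulmx_rsub.
Qed.

Let units u : U u -> ulsubmx ('J th u) \in unitmx /\ TJ th u \in unitmx.
Proof.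
move=> Uu; have := posdef_unit (pG Uu); rewrite (GHJ Uu) !unitmx_mul => /andP[/andP[+ _] _].
by rewrite {1}(Jblock Uu) !unitmxE det_lblock unitrM => /andP.
Qed.

Lemma TJ_unit u : U u -> TJ th u \in unitmx. Proof. by move=> /units[]. Qed.

(** The differential of the transition maps lifts to lifts. Indeed [Y] is orthogonal to the leaf
    directions for the second metric, because the Jacobian is block triangular, and its transverse
    part is [TJ th u]; these two properties determine it. *)
Lemma gam_transition u : U u -> gam G u = TJ th u *m gam H (th u) *m (TJ th u)^T.
Proof.
move=> Uu; have [uA uS] := units Uu; have JE := Jblock Uu.
set A := ulsubmx _ in uA JE; set C := dlsubmx _ in JE; set S := TJ th u in uS JE *.
pose Y := hl G u *m 'J th u; pose Z := Y *m H (th u).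
have ZE : Z *m ('J th u)^T = row_mx 0 (gam G u).
  by rewrite /Z /Y -!mulmxA (mulmxA ('J th u)) -(GHJ Uu) /hl hlift_mul//; exact: (ul_unit pG Uu).
have Z1 : lsubmx Z = 0.
  move: ZE; rewrite -{1}[Z]hsubmxK JE tr_block_mx mul_row_block trmx0 mulmx0 addr0 => /eq_row_mx[ZA _].
  by rewrite -[LHS](@mulmxK _ _ _ (A^T)) ?ZA ?mul0mx// unitmx_tr.
have gE : gam G u = rsubmx Z *m S^T.
  move: ZE; rewrite -{1}[Z]hsubmxK Z1 JE tr_block_mx mul_row_block => /eq_row_mx[_].
  by rewrite mul0mx add0r => <-.
have rY : rsubmx Y = S.
  rewrite /Y JE /hl /hlift mul_row_block row_mxKr mulmx0 mul1mx add0r.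
  by [].
have YE : Y = S *m hl H (th u).
  have uH := ul_unit pH (thU Uu).
  have E1 : lsubmx ((Y - S *m hl H (th u)) *m H (th u)) = 0.
    rewrite mulmxBl -(mulmxA S) /hl hlift_mul// linearB /= -/Z Z1 mul_mx_row row_mxKl mulmx0 subrr.
    by [].
  have E2 : rsubmx (Y - S *m hl H (th u)) = 0.
    by rewrite linearB /= rY /hl /hlift mul_mx_row row_mxKr mulmx1 subrr.
  have E3 : lsubmx (Y - S *m hl H (th u)) = 0.
    move: E1; rewrite -{1}[Y - _]hsubmxK E2 -{1}(submxK (H (th u))) mul_row_block !mul0mx !addr0 row_mxKl => E1.
    by rewrite -[LHS](mulmxK uH) E1 mul0mx.
  by apply/eqP; rewrite -subr_eq0 -[X in X == _]hsubmxK E2 E3 row_mx0.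
rewrite gE /Z YE -mulmxA /hl hlift_mul; last exact: (ul_unit pH (thU Uu)).
by rewrite mul_mx_row row_mxKr.
Qed.

Lemma ul_transition u : U u ->
  ulsubmx (G u) = ulsubmx ('J th u) *m ulsubmx (H (th u)) *m (ulsubmx ('J th u))^T.
Proof.
move=> Uu; rewrite {1}(GHJ Uu) {1 2}(Jblock Uu) -{1}(submxK (H (th u))) tr_block_mx !mulmx_block block_mxKul.
by rewrite !mul0mx !addr0 !trmx0 !mulmx0 addr0.
Qed.

Section transport_tdiv.
Hypotheses (Hg : forall u v, U u -> rsubmx v = 0 -> 'D_v (gam G) u = 0).
Hypotheses (Hh : forall u v, U2 u -> rsubmx v = 0 -> 'D_v (gam H) u = 0).
Variables (X X2 : V -> 'rV[R]_q).
Hypotheses (dX : forall u, U u -> differentiable X u) (dX2 : forall u, U2 u -> differentiable X2 u).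
Hypotheses (DX : forall u v, U u -> 'D_v X u = rsubmx v *m dsubmx ('J X u)).
Hypotheses (DX2 : forall u v, U2 u -> 'D_v X2 u = rsubmx v *m dsubmx ('J X2 u)).
Hypothesis XX : forall u, U u -> X2 (th u) = X u *m TJ th u.

(** Both sides are the transverse part of a second derivative of [th] in the directions [e] and
    [x]. *)
Lemma derive_TJ_comm u (e x : 'rV[R]_q) : U u ->
  x *m 'D_(row_mx 0 e) (TJ th) u = e *m 'D_(row_mx 0 x) (TJ th) u.
Proof.
move=> Uu; have dT := ck_diff (ck_TJ oU (sth 1)) Uu.
have E a b : a *m 'D_(row_mx 0 b) (TJ th) u = rsubmx ('D_(row_mx 0 b) (fun w => 'D_(row_mx 0 a) th w) u).
  have dd : differentiable (fun w => 'D_(row_mx 0 a) th w) u by exact: ck_diff (ck_derive _ (sth 1)) Uu.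
  rewrite -(derive_rsubmx _ dd).
  have -> : 'D_(row_mx 0 b) (fun w => rsubmx ('D_(row_mx 0 a) th w)) u = 'D_(row_mx 0 b) (fun w => cst a w *m TJ th w) u.
    by apply: (derive_open_eq _ oU Uu) => w Uw; rewrite (rsub_derive _ fth Uw (dth Uw)) row_mxKr.
  by rewrite (derive_mulmx _ (differentiable_cst _ _) dT) derive_cst mul0mx add0r.
suff EQ : 'D_(row_mx 0 e) (fun w => 'D_(row_mx 0 x) th w) u = 'D_(row_mx 0 x) (fun w => 'D_(row_mx 0 e) th w) u.
  exact: etrans (E x e) (etrans (congr1 (@rsubmx R 1 p q) EQ) (esym (E e x))).
clear E; apply/matrixP => z l; rewrite (ord1 z).
have dd a : differentiable (fun w => 'D_(row_mx 0 a) th w) u by exact: ck_diff (ck_derive _ (sth 1)) Uu.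
apply: etrans (derive_entry _ 0 l (dd _)) (etrans _ (esym (derive_entry _ 0 l (dd _)))).
have EE a b : 'D_(row_mx 0 b) (fun w => 'D_(row_mx 0 a) th w 0 l) u =
    'D_(row_mx 0 b) (fun w => 'D_(row_mx 0 a) (fun w => th w 0 l) w) u.
  by apply: (derive_open_eq _ oU Uu) => w Uw; rewrite (derive_entry _ _ _ (dth Uw)).
have cl : ck 2 U (fun w => th w 0 l) by apply: ck_entry.
have nU : \forall w \near u, differentiable (fun w => th w 0 l) w.
  have : nbhs u U by exact: open_nbhs_nbhs.
  by apply: filterS => w Uw; exact: ck_diff cl Uw.
have dl a : differentiable ('D_(row_mx 0 a) (fun w => th w 0 l) : V -> R) u by exact: ck_diff (ck_derive _ cl) Uu.
have K := derive_comm nU (dl x) (dl e).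
exact: etrans (EE x e) (etrans K (esym (EE e x))).
Qed.

Let lift_eq (K : V -> 'M[R]_(p + q)) (UK : set V) y x : open UK -> (forall k, ck k UK K) -> (forall u, UK u -> posdef (K u)) ->
  (forall u v, UK u -> rsubmx v = 0 -> 'D_v (gam K) u = 0) -> UK y ->
  'D_(x *m hl K y) (gam K) y = 'D_(row_mx 0 x) (gam K) y.
Proof.
move=> oK sK pK HK Uy; have dg := dgam oK sK pK Uy.
rewrite -{1}(subrK (row_mx 0 x) (x *m hl K y)) deriveDv// HK ?add0r//.
by rewrite linearB /= rsubmx_hlift row_mxKr subrr.
Qed.

(** Differentiating [XX] relates the Jacobians of the two fields, and differentiating
    [gam_transition] relates the derivatives of the metrics; [tdiv_algebra] combines them. Since
    [gam] is constant along plaques, the horizontal lift may be replaced by the coordinate vector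
    [row_mx 0 x]. *)
Lemma tdiv_transition u : U u -> tdiv G X u = tdiv H X2 (th u).
Proof.
move=> Uu; have U2u := thU Uu; have uS := TJ_unit Uu; have dT := ck_diff (ck_TJ oU (sth 1)) Uu.
have uh : gam H (th u) \in unitmx by apply: posdef_unit; exact: (gam_pos pH).
rewrite /tdiv (lift_eq _ oU sG pG Hg Uu) (lift_eq _ oU2 sH pH Hh U2u) (XX Uu).
have JE : TJ th u *m dsubmx ('J X2 (th u)) = dsubmx ('J X u) *m TJ th u + 'D_(row_mx 0 (X u)) (TJ th) u.
  apply: mulmx_inj => e; rewrite mulmxDr mulmxA.
  have K1 : 'D_(row_mx 0 e) (fun w => X2 (th w)) u = e *m TJ th u *m dsubmx ('J X2 (th u)).
    apply: etrans (derive_chain _ (dth Uu) (dX2 U2u)) _.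
    by rewrite (DX2 _ U2u) (rsub_derive _ fth Uu (dth Uu)) row_mxKr.
  rewrite -K1 (_ : 'D_(row_mx 0 e) _ u = 'D_(row_mx 0 e) (fun w => X w *m TJ th w) u); last first.
    by apply: (derive_open_eq _ oU Uu) => w Uw; rewrite XX.
  by rewrite (derive_mulmx _ (dX Uu) dT) (DX _ Uu) row_mxKr (derive_TJ_comm _ _ Uu) mulmxA.
have DgE : 'D_(row_mx 0 (X u)) (gam G) u = 'D_(row_mx 0 (X u)) (TJ th) u *m gam H (th u) *m (TJ th u)^T
    + TJ th u *m 'D_(row_mx 0 (X u *m TJ th u)) (gam H) (th u) *m (TJ th u)^T + TJ th u *m gam H (th u) *m ('D_(row_mx 0 (X u)) (TJ th) u)^T.
  have dh := dgam oU2 sH pH U2u.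
  have dgh : differentiable (fun w => gam H (th w)) u by exact: (differentiable_comp (dth Uu) dh).
  have Dgh : 'D_(row_mx 0 (X u)) (fun w => gam H (th w)) u = 'D_(row_mx 0 (X u *m TJ th u)) (gam H) (th u).
    apply: etrans (derive_chain _ (dth Uu) dh) _.
    rewrite -{1}(subrK (row_mx 0 (X u *m TJ th u)) ('D_(row_mx 0 (X u)) th u)) deriveDv// Hh ?add0r//.
    by rewrite linearB /= (rsub_derive _ fth Uu (dth Uu)) !row_mxKr subrr.
  rewrite (_ : 'D_(row_mx 0 (X u)) _ u = 'D_(row_mx 0 (X u)) (fun w => TJ th w *m gam H (th w) *m (TJ th w)^T) u); last first.
    by apply: (derive_open_eq _ oU Uu) => w Uw; exact: gam_transition.
  rewrite (derive_mulmx _ (differentiable_mulmx dT dgh) (differentiable_trmx dT)) (derive_mulmx _ dT dgh).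
  by rewrite (derive_trmx _ dT) Dgh mulmxDl.
rewrite DgE (gam_transition Uu) ; exact: (tdiv_algebra _ uS uh JE).
Qed.

End transport_tdiv.

End transition.

Lemma derive_comm_rV (R : realType) (V : normedModType R) n (f : V -> 'rV[R]_n) u v w :
  (\forall x \near u, differentiable f x) ->
  differentiable ('D_v f : V -> 'rV[R]_n) u -> differentiable ('D_w f : V -> 'rV[R]_n) u ->
  'D_w ('D_v f) u = 'D_v ('D_w f) u.
Proof.
move=> df dv dw; apply/matrixP => z l; rewrite (ord1 z).
have E a b : differentiable ('D_a f : V -> 'rV[R]_n) u ->
    ('D_b ('D_a f) u) 0 l = 'D_b ('D_a (fun x => f x 0 l) : V -> R) u /\
    differentiable ('D_a (fun x => f x 0 l) : V -> R) u.
  move=> da; rewrite (derive_entry _ 0 l da).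
  have eq_ : \forall x \near u, 'D_a f x 0 l = 'D_a (fun x => f x 0 l) x.
    by apply: filterS df => x dx; exact: derive_entry.
  split; first exact: diff_near_eq.
  by apply: (differentiable_near eq_); exact: differentiable_entry.
have [E1 d1] := E v w dv; have [E2 d2] := E w v dw.
apply: etrans E1 (etrans _ (esym E2)).
have nl : \forall x \near u, differentiable (fun x => f x 0 l) x.
  by apply: filterS df => x; exact: differentiable_entry.
exact: derive_comm nl d1 d2.
Qed.

Section TJ.
Context {R : realType} {p q p' q' : nat}.
Local Notation V := 'rV[R]_(p + q).
Local Notation V' := 'rV[R]_(p' + q').

Lemma mul_TJ (f : V -> V') u (e : 'rV[R]_q) : differentiable f u ->
  e *m TJ f u = rsubmx ('D_(row_mx 0 e) f u).
Proof.
move=> df; rewrite deriveEjacobian// /TJ /drsubmx -{2}(vsubmxK ('J f u)) mul_row_col mul0mx add0r.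
exact: mulmx_rsub.
Qed.

End TJ.

Lemma TJ_comp (R : realType) p q p' q' p2 q2 (f : 'rV[R]_(p + q) -> 'rV[R]_(p' + q')) (g : 'rV[R]_(p' + q') -> 'rV[R]_(p2 + q2))
    (U' : set 'rV[R]_(p' + q')) u :
  differentiable f u -> differentiable g (f u) -> fol U' g -> U' (f u) ->
  TJ (g \o f) u = TJ f u *m TJ g (f u).
Proof.
move=> df dg fg U'f; apply: mulmx_inj => e; rewrite mulmxA (mul_TJ e df).
have dgf : differentiable (g \o f) u by exact: differentiable_comp.
rewrite (mul_TJ e dgf) -(rsub_derive _ fg U'f dg); congr rsubmx.
exact: (derive_chain (row_mx 0 e) df dg).
Qed.

Lemma derive_row_mxr (R : realType) p q (a : 'rV[R]_p) (c w : 'rV[R]_q) : 'D_w (fun c => row_mx a c) c = row_mx 0 w.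
Proof.
have E : (fun c => row_mx a c) = fun c : 'rV[R]_q => row_mx a 0 + c *m (row_mx 0 1%:M : 'M[R]_(q, p + q)).
  by apply/funext => x; rewrite mul_mx_row mulmx0 mulmx1 add_row_mx addr0 add0r.
have di : differentiable (fun c : 'rV[R]_q => c) c by exact: (ck_diff (ck_id 0 openT)).
have dm : differentiable (fun c : 'rV[R]_q => c *m (row_mx 0 1%:M : 'M[R]_(q, p + q))) c.
  by apply: differentiable_mulmx => //; exact: differentiable_cst.
rewrite E deriveD; [|exact: derivable_cst|exact: diff_derivable].
rewrite derive_cst add0r.
have := @derive_mulmx R 'rV[R]_q _ _ _ (fun u : 'rV[R]_q => u) (cst (row_mx 0 1%:M : 'M[R]_(q, p + q))) c w.
move=> ->; [|exact: di|exact: differentiable_cst].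
by rewrite derive_cst mulmx0 addr0 derive_id mul_mx_row mulmx0 mulmx1.
Qed.

Lemma edens_algebra (R : realType) q q' (S g : 'M[R]_q) (S' g' : 'M[R]_q') (T1 T2 : 'M[R]_(q, q')) :
  S \in unitmx -> g \in unitmx -> T1 *m S' = S *m T2 ->
  \tr (invmx (S *m g *m S^T) *m (T1 *m (S' *m g' *m S'^T) *m T1^T)) = \tr (invmx g *m (T2 *m g' *m T2^T)).
Proof.
move=> uS ug TT; have uT : S^T \in unitmx by rewrite unitmx_tr.
have -> : T1 *m (S' *m g' *m S'^T) *m T1^T = S *m (T2 *m g' *m T2^T) *m S^T.
  by rewrite !mulmxA TT -mulmxA -trmx_mul TT trmx_mul !mulmxA.
rewrite (invmx_congr uS ug).
by rewrite -!mulmxA (mulKmx uS) mxtrace_mulC !mulmxA (mulmxK uT).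
Qed.

Lemma xfield_algebra (R : realType) q q' (S g : 'M[R]_q) (S' g' : 'M[R]_q') (T1 T2 : 'M[R]_(q, q')) (v : 'rV[R]_q') :
  S \in unitmx -> g \in unitmx -> T1 *m S' = S *m T2 ->
  v *m (S' *m g' *m S'^T) *m T1^T *m invmx (S *m g *m S^T) *m S = v *m S' *m g' *m T2^T *m invmx g.
Proof.
move=> uS ug TT; have uT : S^T \in unitmx by rewrite unitmx_tr.
rewrite (invmx_congr uS ug).
rewrite !mulmxA (mulmxKV uS); congr (_ *m _).
by rewrite -[_ *m S'^T *m _]mulmxA -trmx_mul TT trmx_mul mulmxA mulmxK.
Qed.

(** * One-parameter families of foliated maps *)

Section family.
Context {R : realType} {p q p' q' : nat}.
Local Notation V := 'rV[R]_(p + q).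
Local Notation V' := 'rV[R]_(p' + q').
Local Notation W := 'rV[R]_(1 + (p + q)).
Variables (U : set V) (G : V -> 'M[R]_(p + q)) (U' : set V') (G' : V' -> 'M[R]_(p' + q')) (Om : set W) (K : W -> V').
Hypotheses (oU : open U) (sG : forall k, ck k U G) (pG : forall u, U u -> posdef (G u)).
Hypotheses (oU' : open U') (sG' : forall k, ck k U' G') (pG' : forall u, U' u -> posdef (G' u)).
Hypotheses (oOm : open Om) (sK : forall k, ck k Om K).
Hypotheses (OU : forall w, Om w -> U (rsubmx w)) (KU : forall w, Om w -> U' (K w)).

Definition tp (t : R) (u : V) : W := row_mx (t%:M : 'M[R]_1) u.
Definition ddt : W := row_mx (1%:M : 'M[R]_1) 0.
Definition slice (t : R) (u : V) := K (tp t u).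
Definition velocity (t : R) (u : V) : V' := 'D_ddt K (tp t u).

Let dK w : Om w -> differentiable K w. Proof. exact: ck_diff (sK 0). Qed.

Lemma ck_tp k (A : set V) t : open A -> ck k A (tp t).
Proof. by move=> oA; apply: ck_row_mx => //; [exact: ck_cst|exact: ck_id]. Qed.

Lemma derive_tp t u v : 'D_v (tp t) u = row_mx 0 v.
Proof. exact: derive_row_mxr. Qed.

Lemma derive_slice (L : W -> V') t u v : differentiable L (tp t u) ->
  'D_v (fun x => L (tp t x)) u = 'D_(row_mx 0 v) L (tp t u).
Proof.
move=> dL; rewrite -(derive_tp t u v).
exact: (derive_chain v (ck_diff (ck_tp 0 t openT) I) dL).
Qed.

Lemma ck_slice k (L : W -> V') (A : set V) t : open A -> (forall u, A u -> Om (tp t u)) -> ck k Om L ->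
  ck k A (fun u => L (tp t u)).
Proof. by move=> oA AO cL; apply: (ck_comp_mx oA oOm AO (ck_tp k t oA) cL). Qed.

(** Time is the first coordinate: the inner [dsubmx] drops the time row, and what remains is the
    transverse block of the spatial Jacobian, as a function of time and position together. *)
Definition TK (w : W) : 'M[R]_(q, q') := drsubmx (dsubmx ('J K w) : 'M[R]_(p + q, p' + q')).

Lemma mul_TK w (e : 'rV[R]_q) : Om w -> e *m TK w = rsubmx ('D_(row_mx 0 (row_mx 0 e)) K w).
Proof.
move=> Ow; rewrite deriveEjacobian; last exact: dK.
rewrite -[in RHS](vsubmxK ('J K w)) mul_row_col mul0mx add0r /TK /drsubmx.
rewrite -[in RHS](vsubmxK (dsubmx ('J K w) : 'M[R]_(p + q, p' + q'))) mul_row_col mul0mx add0r.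
exact: mulmx_rsub.
Qed.

Lemma TK_slice t u : Om (tp t u) -> TJ (slice t) u = TK (tp t u).
Proof.
move=> Ow; apply: mulmx_inj => e; rewrite (mul_TK _ Ow) -(derive_slice _ (dK Ow)).
apply: mul_TJ; apply: (differentiable_comp (ck_diff (ck_tp 0 t openT) I)); exact: dK.
Qed.

Lemma ck_TK k : ck k Om TK.
Proof. by apply: ck_rsubmx => //; do 2 apply: ck_dsubmx => //; exact: ck_jacobian. Qed.

Definition ef (w : W) : R := \tr (invmx (gam G (rsubmx w)) *m (TK w *m gam G' (K w) *m (TK w)^T)).

Lemma ef_slice t u : Om (tp t u) -> ef (tp t u) = edens G G' (slice t) u.
Proof. by move=> Ow; rewrite /ef /edens TK_slice// /tp row_mxKr. Qed.

Let ck_gr k : ck k Om (fun w => gam G (rsubmx w)).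
Proof. by apply: (ck_comp_mx oOm oU OU _ (ck_gam oU sG pG k)); apply: ck_rsubmx => //; exact: ck_id. Qed.
Let ck_gK k : ck k Om (fun w => gam G' (K w)).
Proof. exact: (ck_comp_mx oOm oU' KU (sK k) (ck_gam oU' sG' pG' k)). Qed.
Let ck_ig k : ck k Om (fun w => invmx (gam G (rsubmx w))).
Proof. by apply: ck_invmx => // w /OU Uw; apply: posdef_unit; exact: (gam_pos pG). Qed.
Let ck_num k : ck k Om (fun w => TK w *m gam G' (K w) *m (TK w)^T).
Proof. by apply: ck_mulmx; [|apply: ck_mulmx => //; exact: ck_TK|apply: ck_tr => //; exact: ck_TK]. Qed.

Lemma ck_ef k : ck k Om ef.
Proof.
by apply: ck_sum => // i; apply: ck_entry => //; apply: ck_mulmx.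
Qed.

Lemma derive_trace (T : normedModType R) n (A : T -> 'M[R]_n) u v : differentiable A u ->
  'D_v (fun u => \tr (A u)) u = \tr ('D_v A u).
Proof.
move=> dA; rewrite (_ : (fun u => \tr (A u)) = \sum_i (fun u => A u i i)); last first.
  by apply/funext => x; rewrite fct_sumE.
rewrite derive_sum; last by move=> i; exact/diff_derivable/differentiable_entry.
by apply: eq_bigr => i _; rewrite (derive_entry v i i dA).
Qed.

Lemma mul_derive_TK w (e : 'rV[R]_q) z : Om w -> e *m 'D_z TK w = rsubmx ('D_z ('D_(row_mx 0 (row_mx 0 e)) K) w).
Proof.
move=> Ow; have dT := ck_diff (ck_TK 0) Ow.
have dd : differentiable ('D_(row_mx 0 (row_mx 0 e)) K : W -> V') w by exact: ck_diff (ck_derive _ (sK 1)) Ow.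
rewrite -(derive_rsubmx _ dd).
have <- : 'D_z (fun x => cst e x *m TK x) w = 'D_z (fun x => rsubmx ('D_(row_mx 0 (row_mx 0 e)) K x)) w.
  by apply: (derive_open_eq _ oOm Ow) => x Ox; exact: mul_TK.
by rewrite (derive_mulmx _ (differentiable_cst _ _) dT) derive_cst mul0mx add0r.
Qed.

Let comm w a b : Om w -> 'D_a ('D_b K) w = 'D_b ('D_a K) w.
Proof.
move=> Ow; apply: derive_comm_rV; [|exact: ck_diff (ck_derive _ (sK 1)) Ow..].
by apply: (filterS (fun x => @dK x)); exact: open_nbhs_nbhs.
Qed.

Let dvel t u : Om (tp t u) -> differentiable (velocity t) u.
Proof.
move=> Ow; apply: (@differentiable_comp _ _ _ _ (tp t) ('D_ddt K) u (ck_diff (ck_tp 0 t openT) I)).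
exact: ck_diff (ck_derive _ (sK 1)) Ow.
Qed.

Let vel_slice t u v : Om (tp t u) -> 'D_v (velocity t) u = 'D_(row_mx 0 v) ('D_ddt K) (tp t u).
Proof. by move=> Ow; apply: derive_slice; exact: ck_diff (ck_derive _ (sK 1)) Ow. Qed.

Lemma derive_TK_ddt t u : Om (tp t u) -> 'D_ddt TK (tp t u) = TJ (velocity t) u.
Proof.
move=> Ow; apply: mulmx_inj => e; rewrite (mul_derive_TK _ _ Ow) (comm _ _ Ow) (mul_TJ _ (dvel Ow)).
by rewrite (vel_slice _ Ow).
Qed.

(** The source metric does not depend on time. The two terms in which a transverse Jacobian is
    differentiated have equal traces by symmetry of the metrics, whence the factor 2. *)
Lemma derive_ef t u : Om (tp t u) -> 'D_ddt ef (tp t u) = 2 * edens1 G G' (slice t) (velocity t) u.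
Proof.
move=> Ow; have dT := ck_diff (ck_TK 0) Ow; have dgK := ck_diff (ck_gK 0) Ow; have di := ck_diff (ck_ig 0) Ow.
have dn := ck_diff (ck_num 0) Ow; have Uu := OU Ow; have U'K := KU Ow.
have dm := differentiable_mulmx di dn.
have Di : 'D_ddt (fun w => invmx (gam G (rsubmx w))) (tp t u) = 0.
  have di' : differentiable (fun x => invmx (gam G x)) (rsubmx (tp t u)).
    have H : ck 0 U (fun x => invmx (gam G x)).
      by apply: ck_invmx => //; [move=> x Ux; apply: posdef_unit; exact: (gam_pos pG)|exact: ck_gam].
    exact: ck_diff H Uu.
  have dr : differentiable (fun w : W => rsubmx w) (tp t u).
    by apply: differentiable_rsubmx; exact: (ck_diff (ck_id 0 openT)).
  apply: etrans (derive_chain ddt dr di') _.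
  rewrite (derive_rsubmx (A := fun w : W => w)); last exact: (ck_diff (ck_id 0 openT)).
  have -> : rsubmx ('D_ddt id (tp t u)) = 0 by rewrite derive_id /ddt row_mxKr.
  exact: derive_dir0.
have DgK : 'D_ddt (fun w => gam G' (K w)) (tp t u) = 'D_(velocity t u) (gam G') (slice t u).
  exact: (derive_chain ddt (dK Ow) (dgam oU' sG' pG' U'K)).
rewrite (derive_trace _ dm) (derive_mulmx _ di dn) Di mul0mx add0r.
rewrite (derive_mulmx _ (differentiable_mulmx dT dgK) (differentiable_trmx dT)) (derive_mulmx _ dT dgK).
rewrite (derive_trmx _ dT) DgK (derive_TK_ddt Ow) /edens1 (TK_slice Ow).
rewrite -/(slice t u) [rsubmx (tp t u)]row_mxKr.
rewrite /tp row_mxKr in Uu; have [sg _] := gam_pos pG Uu; have [sg' _] := gam_pos pG' U'K.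
rewrite -/(tp t u) -/(slice t u) in sg'.
move: (TJ (velocity t) u) (TK (tp t u)) ('D_(velocity t u) _ _) (gam G u) (gam G' _) sg sg' => A T S g g' sg sg'.
have -> : \tr (invmx g *m ((A *m g' + T *m S) *m T^T + T *m g' *m A^T)) =
  \tr (invmx g *m (A *m g' *m T^T)) + \tr (invmx g *m (T *m S *m T^T)) + \tr (invmx g *m (T *m g' *m A^T)).
  by rewrite mulmxDl !mulmxDr !mxtraceD.
have -> : \tr (invmx g *m (T *m g' *m A^T)) = \tr (invmx g *m (A *m g' *m T^T)).
  by rewrite -mxtrace_tr !trmx_mul trmxK sg' trmx_inv sg mxtrace_mulC !mulmxA.
by move: (\tr _) (\tr _) => a b; lra.
Qed.

(** Time and leaf derivatives commute, and the transverse part of the leaf derivative is 0 at all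
    times. The property is what makes the dual field basic. *)
Lemma fol_velocity (A : set V) t : open A -> (forall u, A u -> Om (tp t u)) ->
  (forall w v, Om w -> rsubmx v = 0 -> rsubmx ('D_(row_mx 0 v) K w) = 0) -> fol A (velocity t).
Proof.
move=> oA AO fK u v Au v0; have Ow := AO u Au.
rewrite (vel_slice _ Ow).
rewrite (comm _ _ Ow) -derive_rsubmx; last exact: ck_diff (ck_derive _ (sK 1)) Ow.
by apply: (derive_open0 _ oOm Ow) => w Ow'; exact: fK.
Qed.

End family.

(** * Flows of transverse fields *)

Section jacobi.
Context {R : realType} {V : normedModType R}.

Lemma derive_prod_ord n (f : 'I_n -> V -> R) u v : (forall i, differentiable (f i) u) ->
  differentiable (fun x => \prod_i f i x) u /\
  'D_v (fun x => \prod_i f i x) u = \sum_k \prod_i (if i == k then 'D_v (f i) u else f i u).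
Proof.
elim: n f => [|n IH] f df.
  rewrite big_ord0 (_ : (fun x => _) = cst 1); first by split; [exact: differentiable_cst|exact: derive_cst].
  by apply/funext => x; rewrite big_ord0.
have [dg Dg] := IH (fun i => f (lift ord0 i)) (fun i => df (lift ord0 i)).
have E : (fun x => \prod_i f i x) = (f ord0 * (fun x => \prod_i f (lift ord0 i) x))%R.
  by apply/funext => x; rewrite big_ord_recl.
rewrite E; split; first by apply: differentiableM => //; exact: df.
rewrite deriveM; [|exact/diff_derivable/df|exact/diff_derivable].
rewrite Dg big_ord_recl [in RHS]big_ord_recl eqxx addrC /GRing.scale /=; congr (_ + _).
  by rewrite mulrC; congr (_ * _); apply: eq_bigr => i _.
rewrite mulr_sumr; apply: eq_bigr => k _; rewrite [in RHS]big_ord_recl /=; congr (_ * _).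
Qed.

Lemma derive_big (W : normedModType R) (I : Type) (r : seq I) (P : pred I) (f : I -> V -> W) u v :
  (forall i, derivable (f i) u v) ->
  derivable (fun x => \sum_(i <- r | P i) f i x) u v /\
  'D_v (fun x => \sum_(i <- r | P i) f i x) u = \sum_(i <- r | P i) 'D_v (f i) u.
Proof.
move=> df; elim: r => [|i r [IH1 IH2]].
  rewrite (_ : (fun x => _) = cst 0); last by apply/funext => x; rewrite big_nil.
  by rewrite big_nil derive_cst; split => //; exact: derivable_cst.
case Pi : (P i).
  rewrite (_ : (fun x => _) = f i + fun x => \sum_(i <- r | P i) f i x); last first.
    by apply/funext => x; rewrite big_cons Pi.
  by rewrite big_cons Pi deriveD// IH2; split => //; exact: derivableD.
rewrite (_ : (fun x => _) = fun x => \sum_(i <- r | P i) f i x); last first.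
  by apply/funext => x; rewrite big_cons Pi.
by rewrite big_cons Pi.
Qed.

(** Jacobi's formula: the product rule yields determinants with one row differentiated, and each is
    expanded along that row. *)
Lemma derive_det n (A : V -> 'M[R]_n) u v : differentiable A u ->
  'D_v (fun x => \det (A x)) u = \tr (\adj (A u) *m 'D_v A u).
Proof.
move=> dA; have de i j : differentiable (fun x => A x i j) u by exact: differentiable_entry.
have P (s : {perm 'I_n}) := @derive_prod_ord n (fun i x => A x i (s i)) u v (fun i => de i (s i)).
transitivity (\sum_(s : {perm 'I_n}) (-1) ^+ s * 'D_v (fun x => \prod_i A x i (s i)) u).
  have dP (s : {perm 'I_n}) : derivable (fun x => (-1) ^+ s *: \prod_i A x i (s i)) u v.
    by apply: derivableZ; apply/diff_derivable; case: (P s).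
  have [_ ->] := derive_big (index_enum {perm 'I_n}) xpredT dP.
  apply: eq_bigr => s _.
  by have /= := @deriveZ R V R (fun x => \prod_i A x i (s i)) ((-1) ^+ s) u v (diff_derivable (P s).1).
pose M k := \matrix_(i, j) (if i == k then ('D_v A u) i j else A u i j).
transitivity (\sum_k \det (M k)).
  rewrite exchange_big /=; apply: eq_bigr => s _; rewrite (P s).2 mulr_sumr; apply: eq_bigr => k _.
  congr (_ * _); apply: eq_bigr => i _; rewrite mxE (derive_entry _ _ _ dA).
  by [].
rewrite mxtrace_mulC; apply: eq_bigr => k _; rewrite (expand_det_row _ k) mxE; apply: eq_bigr => j _.
rewrite !mxE eqxx /cofactor; congr (_ * (_ * \det _)).
by apply/matrixP => a b; rewrite !mxE eq_sym (negbTE (neq_lift _ _)).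
Qed.

End jacobi.

Section local_bounds.
Context {R : realType} {n m : nat}.
Local Notation V := 'rV[R]_n.

Lemma bounded_near_point (W : normedModType R) (T : topologicalType) (f : T -> W) (x : T) : {for x, continuous f} ->
  \forall y \near x, `|f y| <= `|f x| + 1.
Proof.
move=> cf; have /cvgrPdist_lt/(_ _ ltr01) := cf; apply: filterS => y H.
have := ler_normB (f x) (f x - f y); rewrite opprB addrC subrK => /le_trans; apply.
by rewrite lerD2l ltW.
Qed.

Lemma lipschitz_near (U : set V) (f : V -> 'rV[R]_m) u0 : open U -> ck 1 U f -> U u0 ->
  exists r L, [/\ 0 < r, 0 < L, ball u0 r `<=` U &
    (forall x y, ball u0 r x -> ball u0 r y -> `|f x - f y| <= L * `|x - y|) /\
    forall x, ball u0 r x -> `|f x| <= L].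
Proof.
move=> oU cf Uu0.
have cJ : {for u0, continuous (jacobian f)} by exact: ck_cont (ck_jacobian oU cf) Uu0.
have cf0 : {for u0, continuous f} by exact: ck_cont cf Uu0.
have nU : \forall u \near u0, U u by exact: open_nbhs_nbhs.
have N : \forall u \near u0, U u /\ (`|'J f u| <= `|'J f u0| + 1 /\ `|f u| <= `|f u0| + 1).
  exact: filterI nU (filterI (bounded_near_point cJ) (bounded_near_point cf0)).
move/nbhs_ballP : N => [r /= r0 rP].
pose L := n%:R * (`|'J f u0| + 1) + (`|f u0| + 1).
have L1 : 0 <= n%:R * (`|'J f u0| + 1) by rewrite mulr_ge0// addr_ge0.
have L2 : 0 < `|f u0| + 1 by rewrite ltr_wpDl.
exists r, L; split => //; first by rewrite ltr_wpDl.
  by move=> u /rP[].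
split=> [x y xB yB|x /rP[_ [_ H]]]; last by apply: le_trans H _; rewrite lerDr.
have d (s : R) : 0 <= s <= 1 -> is_derive s (1 : R) (fun s : R => f (y + s *: (x - y))) ('D_(x - y) f (y + s *: (x - y))).
  move=> s01; apply: is_derive_line; apply/diff_derivable.
  by have /rP[Us _] := ball_segment yB xB s01; exact: ck_diff cf Us.
have B0 : 0 <= n%:R * (`|'J f u0| + 1) * `|x - y| by rewrite mulr_ge0.
have := @curve_mvt R m (fun s => f (y + s *: (x - y))) _ 0 1 _ B0 ler01 d.
rewrite scale1r scale0r addr0 [y + _]addrC subrK subr0 mulr1 => /(_ _)/le_trans; apply.
  move=> s s01; have /rP[Us [Js _]] := ball_segment yB xB s01.
  rewrite deriveEjacobian; last exact: ck_diff cf Us.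
  apply: le_trans (mulmx_norm_le _ _) _; apply: ler_wpM2r => //; exact: ler_wpM2l.
by rewrite ler_wpM2r// lerDl ltW.
Qed.

End local_bounds.

Section clampV.
Context {R : realType} {n : nat}.
Local Notation V := 'rV[R]_n.
Variables (c0 : V) (r : R).
Hypothesis r0 : 0 < r.
(** The coordinatewise retraction onto a closed sup-norm ball. Composing a field that is Lipschitz
    on a ball with it gives a field that is bounded and Lipschitz everywhere and unchanged
    inside. *)
Definition clampV (u : V) : V := \row_i (c0 0 i + clampR r (u 0 i - c0 0 i)).

Lemma clampV_near u : `|clampV u - c0| <= r.
Proof.
apply: norm_le => [|i]; first exact: ltW.
rewrite !mxE addrAC subrr add0r ler_norml; exact: clampRP.
Qed.

Lemma clampV_id u : `|u - c0| <= r -> clampV u = u.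
Proof.
move=> ur; apply/rowP => i; rewrite mxE clampR_id// ?[c0 0 i + _]addrC ?subrK//.
have := norm_coord (u - c0) i; rewrite !mxE => /le_trans/(_ ur); by rewrite ler_norml.
Qed.

Lemma clampV_lip u v : `|clampV u - clampV v| <= `|u - v|.
Proof.
apply: norm_le => // i; rewrite !mxE opprD addrACA subrr add0r.
apply: le_trans (clampR_lip r0 _ _) _.
rewrite opprB addrA subrK; have := norm_coord (u - v) i; by rewrite !mxE.
Qed.
End clampV.

Section global_flow.
Context {R : realType} {n : nat}.
Local Notation V := 'rV[R]_n.

(** The curves are chosen separately for each starting point; stability makes the choice Lipschitz
    and yields the inverse. The interval shrinks to [d / 2] for the solution and to [d / 4] for the
    inverse, where times are added. *)
Lemma global_flow (Z : V -> V) (L M d : R) : 0 <= L -> 0 <= M -> 0 < d -> d < 1 -> L * d <= 1 / 2 ->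
  (forall x y, `|Z x - Z y| <= L * `|x - y|) -> (forall x, `|Z x| <= M) ->
  exists psi : R -> V -> V, [/\ forall c, psi 0 c = c,
    forall c s, - (d / 2) < s < d / 2 -> is_derive s (1 : R) (psi ^~ c) (Z (psi s c)),
    forall c s, - (d / 4) < s < d / 4 -> psi (- s) (psi s c) = c &
    (forall c s, - (d / 2) < s < d / 2 -> `|psi s c - c| <= M * `|s|) /\
    (forall u v s, - (d / 2) < s < d / 2 -> `|psi s u - psi s v| <= 2 * `|u - v|)].
Proof.
move=> L0 M0 d0 d1 Ld lZ bZ.
have /choice[y Hy] := @picard R n Z L M d L0 M0 d0 d1 Ld lZ bZ.
have p0 c : y c 0 = c by case: (Hy c).
have dp c s : - (d / 2) < s < d / 2 -> is_derive s (1 : R) (y c) (Z (y c s)) by case: (Hy c) => _; exact.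
have Ld2 : L * (d / 2) <= 1 / 2 by rewrite mulrA; have : 0 <= L * d; [rewrite mulr_ge0// ltW|lra].
exists (fun s c => y c s); split => //.
- move=> c s sd; apply: (@flow_inverse R n Z L M (d / 2) (fun s c => y c s)) => //; lra.
- split=> [c s sd|u v s sd].
    by have := @curve_mvt0 R n (y c) _ (d / 2) M M0 (dp c) (fun s _ => bZ _) s sd; rewrite p0.
  have := @ode_stable R n (y u) (y v) _ _ L M (d / 2) L0 M0 Ld2 (dp u) (dp v) (fun s _ => bZ _)
    (fun s _ => bZ _) (fun s _ => lZ _ _) s sd.
  by rewrite !p0.
Qed.

End global_flow.

Lemma taylor2R (R : realType) (y dy ddy : R -> R) (B r : R) : 0 <= B ->
  (forall s, - r < s < r -> is_derive s (1 : R) y (dy s)) ->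
  (forall s, - r < s < r -> is_derive s (1 : R) dy (ddy s)) ->
  (forall s, - r < s < r -> `|ddy s| <= B) ->
  forall s, - r < s < r -> `|y s - y 0 - s * dy 0| <= B * s ^+ 2.
Proof.
move=> B0 Hy Hdy HB s sr; pose c (f : R -> R) (s : R) : 'rV[R]_1 := \row_i f s.
have dc f df t : is_derive t (1 : R) f (df t) -> is_derive t (1 : R) (c f) (c df t).
  move=> H; apply: is_derive_entries => i; rewrite mxE (_ : (fun t => c f t 0 i) = f)//.
  by apply/funext => x; rewrite mxE.
have := @taylor2 R 1 (c y) (c dy) (c ddy) B r B0 (fun t tr => dc _ _ _ (Hy t tr)) (fun t tr => dc _ _ _ (Hdy t tr)) _ s sr.
move=> /(_ _)/(le_trans (norm_coord _ 0)); rewrite !mxE; apply => t tr.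
by apply: norm_le => // i; rewrite mxE HB.
Qed.

Section chain_curve.
Context {R : realType} {V W : normedModType R}.
Lemma is_derive_chain (y : R -> V) (f : V -> W) (s : R) dy : is_derive s (1 : R) y dy -> differentiable f (y s) ->
  is_derive s (1 : R) (f \o y) ('D_dy f (y s)).
Proof.
move=> [dy1 dy2] df; have dy' : differentiable y s by apply/derivable1_diffP.
split; first by apply/diff_derivable/differentiable_comp.
by apply: etrans (derive_chain (1 : R) dy' df) _; rewrite dy2.
Qed.
End chain_curve.

Lemma pow_bound (R : realType) n (b : R) : 0 <= b -> exists2 K, 0 <= K & forall x, 0 <= x <= b -> (1 + x) ^+ n <= 1 + K * x.
Proof.
move=> b0; elim: n => [|n [K K0 IH]]; first by exists 0 => // x _; rewrite expr0 mul0r addr0.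
exists (K + 1 + K * b); first by rewrite !addr_ge0// mulr_ge0.
move=> x xb; rewrite exprS; have x1 : 0 <= 1 + x by lra.
apply: le_trans (ler_wpM2l x1 (IH x xb)) _.
have : K * x * x <= K * b * x by case/andP: xb => x0 xb; rewrite -!mulrA [b * x]mulrC ler_wpM2l// ler_wpM2l.
nra.
Qed.

(** [A] is the density along the flow, [P] the determinant of the linearised flow, [D] the
    distortion factor of the change of variables. The product of their first-order bounds has linear
    coefficient [al + r * ta], the divergence, and an error uniform in the point. *)
Lemma three_bounds (R : realType) (L C : R) : 0 <= C -> 0 <= L -> exists2 K, 0 <= K &
  forall r al ta A P D s : R, `|r| <= L -> `|al| <= L -> `|ta| <= L -> `|s| <= 1 -> 0 <= A -> 0 <= P -> 0 <= D ->
  A <= r + s * al + C * s ^+ 2 -> P <= 1 + s * ta + C * s ^+ 2 -> D <= 1 + C * s ^+ 2 ->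
  A * P * D <= r + s * (al + r * ta) + K * s ^+ 2.
Proof.
move=> C0 L0; pose K1 := L ^+ 2 + C * L + C + 2 * (C * L) + C ^+ 2.
have CL : 0 <= C * L by rewrite mulr_ge0.
have K10 : 0 <= K1 by rewrite !addr_ge0 ?sqr_ge0// mulr_ge0.
exists (K1 + C * (2 * L + L ^+ 2 + K1)).
  by rewrite addr_ge0// mulr_ge0// !addr_ge0 ?sqr_ge0// mulr_ge0.
move=> r al ta A P D s; rewrite !ler_norml => /andP[r1 r2] /andP[a1 a2] /andP[t1 t2] /andP[s1 s2] A0 P0 D0 HA HP HD.
have s20 : 0 <= s ^+ 2 by exact: sqr_ge0.
have s21 : s ^+ 2 <= 1 by rewrite expr2; nra.
pose q := al * ta + C * r + C + s * (C * al + C * ta) + C ^+ 2 * s ^+ 2.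
have qK : q <= K1.
  have h1 : al * ta <= L ^+ 2 by rewrite expr2; nra.
  have h2 : C * r <= C * L by rewrite ler_wpM2l.
  have h3 : s * (C * al + C * ta) <= 2 * (C * L).
    have : C * al <= C * L by rewrite ler_wpM2l.
    have : C * ta <= C * L by rewrite ler_wpM2l.
    have : - (C * L) <= C * al by rewrite -mulrN ler_wpM2l.
    have : - (C * L) <= C * ta by rewrite -mulrN ler_wpM2l.
    move: (C * al) (C * ta) (C * L) CL => x y z z0 *; nra.
  have h4 : C ^+ 2 * s ^+ 2 <= C ^+ 2 by rewrite ler_piMr// sqr_ge0.
  by rewrite /q /K1; lra.
have AP : A * P <= r + s * (al + r * ta) + q * s ^+ 2.
  apply: le_trans (ler_pM A0 P0 HA HP) _; rewrite le_eqVlt; apply/orP; left; apply/eqP; rewrite /q; ring.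
have AP1 : A * P <= r + s * (al + r * ta) + K1 * s ^+ 2.
  by apply: le_trans AP _; rewrite lerD2l ler_wpM2r.
have AP2 : A * P <= 2 * L + L ^+ 2 + K1.
  apply: le_trans AP1 _.
  have h1 : r * ta <= L ^+ 2 by rewrite expr2; nra.
  have h2 : - L ^+ 2 <= r * ta by rewrite expr2; nra.
  have h3 : s * (al + r * ta) <= L + L ^+ 2.
    by move: (r * ta) (L ^+ 2) h1 h2 (sqr_ge0 L) => x y *; nra.
  have h4 : K1 * s ^+ 2 <= K1 by rewrite ler_piMr.
  lra.
have AP0 : 0 <= A * P by rewrite mulr_ge0.
apply: le_trans (ler_wpM2l AP0 HD) _; rewrite mulrDr mulr1.
have : A * P * (C * s ^+ 2) <= C * (2 * L + L ^+ 2 + K1) * s ^+ 2.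
  by rewrite mulrA ler_wpM2r// mulrC ler_wpM2l.
move: AP1; rewrite [(K1 + _) * _]mulrDl; lra.
Qed.

Lemma norm_row_mx (R : realType) a b (u : 'rV[R]_a) (v : 'rV[R]_b) : `|row_mx u v| = Num.max `|u| `|v|.
Proof.
apply/eqP; rewrite eq_le; apply/andP; split.
  apply: norm_le => [|i]; first by rewrite le_max normr_ge0.
  rewrite mxE; case: (fintype.split i) => k; apply: le_trans (norm_coord _ k) _; rewrite le_max lexx ?orbT//.
rewrite ge_max; apply/andP; split; apply: norm_le => // k.
  by rewrite -(row_mxEl u v); exact: norm_coord.
by rewrite -(row_mxEr u v); exact: norm_coord.
Qed.

Lemma norm_scalar1 (R : realType) (s : R) : `|(s%:M : 'M[R]_1)| = `|s|.
Proof.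
apply/eqP; rewrite eq_le; apply/andP; split.
  by apply: (@norm_le R 1) => // i; rewrite mxE ord1 eqxx.
by have := @norm_coord R 1 (s%:M) 0; rewrite mxE eqxx.
Qed.

Lemma bounded_near_ex (R : realType) (W : normedModType R) (T : topologicalType) (f : T -> W) (x : T) :
  {for x, continuous f} -> exists2 K, 0 <= K & \forall y \near x, `|f y| <= K.
Proof. by move=> /bounded_near_point H; exists (`|f x| + 1) => //; rewrite addr_ge0. Qed.

Lemma taylor_upper (R : realType) (a b D L C : R) : L <= C -> a - b - D <= L -> a <= b + D + C.
Proof. by move=> *; lra. Qed.

Lemma lip_continuous (R : realType) (V W : normedModType R) (f : V -> W) (L : R) : 0 < L ->
  (forall x y, `|f x - f y| <= L * `|x - y|) -> continuous f.
Proof.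
move=> L0 H x; apply/(@cvgrPdist_lt _ _ _ (nbhs x) _ f) => e e0; have e2 : 0 < e / L by rewrite divr_gt0.
have : nbhs x (ball x (e / L)) by exact: nbhsx_ballx.
apply: filterS => y; rewrite -ball_normE /= => xy.
by apply: le_lt_trans (H x y) _; rewrite mulrC -ltr_pdivlMr.
Qed.

Section local_flow.
Context {R : realType} {n : nat}.
Local Notation V := 'rV[R]_n.
Variables (X : V -> V) (rho : V -> R) (T0 : set V) (c0 : V).
Hypotheses (oT : open T0) (Tc : T0 c0) (cX : forall k, ck k T0 X) (cr : forall k, ck k T0 rho)
  (r0 : forall u, T0 u -> 0 <= rho u).

Lemma ck_lie (f : V -> R) k : (forall k, ck k T0 f) -> ck k T0 (fun u => 'D_(X u) f u).
Proof.
move=> cf; apply: (@ck_ext _ _ _ k T0 (fun u => \sum_i X u 0 i * 'D_(delta_mx 0 i) f u)) => //.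
  move=> u Tu; rewrite [RHS](derive_sum_coord _ (ck_diff (cf 0) Tu)); apply: eq_bigr => i _.
  by [].
apply: ck_sum => // i; apply: ckM => //; first exact: ck_entry.
exact: ck_derive.
Qed.

(** Time and position are taken together so that bounds on the inverse and on the second time
    derivative of the determinant hold uniformly near [(0, c0)] by continuity. *)
Let lin_det (w : 'rV[R]_(1 + n)) : 'M[R]_n := 1%:M + (w 0 0)%:M *m 'J X (rsubmx w).
Let Om := [set w : 'rV[R]_(1 + n) | T0 (rsubmx w)].
Let oOm : open Om.
Proof.
have c : continuous (fun w : 'rV[R]_(1 + n) => rsubmx w).
  move=> w; apply: differentiable_continuous; apply: differentiable_rsubmx.
  exact: (ck_diff (ck_id 0 openT)).
by move/continuousP: c; apply.
Qed.
Let ck_lin k : ck k Om lin_det.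
Proof.
apply: ckD => //; first exact: ck_cst.
apply: ck_mulmx => //.
  apply: ck_mx => // i j; apply: (@ck_ext _ _ _ k Om (fun w => w 0 0 * (i == j)%:R)) => //.
    by move=> w _; rewrite mxE mulr_natr.
  by apply: ckM => //; [exact: ck_coord|exact: ck_cst].
apply: (ck_comp_mx oOm oT _ _ (ck_jacobian oT (cX k.+1))) => //.
by apply: ck_rsubmx => //; exact: ck_id.
Qed.
Let e1 : 'rV[R]_(1 + n) := row_mx (1%:M : 'M[R]_1) 0.
Let pt (u : V) : 'rV[R]_(1 + n) := row_mx 0 u.
Let lineE s u : pt u + s *: e1 = row_mx (s%:M : 'M[R]_1) u.
Proof. by rewrite scale_row_mx scaler0 add_row_mx add0r addr0 scalemx1. Qed.
Let line_lin s u : lin_det (pt u + s *: e1) = 1%:M + s *: 'J X u.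
Proof.
rewrite lineE /lin_det row_mxKr mul_scalar_mx; congr (_ + _ *: _).
transitivity (row_mx (s%:M : 'M[R]_1) u 0 (lshift n 0)); first by congr (row_mx _ _ _ _); exact: val_inj.
by rewrite row_mxEl mxE eqxx.
Qed.

Let dlin u : T0 u -> 'D_e1 (fun w => \det (lin_det w)) (pt u) = \tr ('J X u).
Proof.
move=> Tu; have Ow : Om (pt u) by rewrite /Om /= row_mxKr.
have dl := ck_diff (ck_lin 0) Ow; have l0 : lin_det (pt u) = 1%:M.
  by have := line_lin 0 u; rewrite !scale0r !addr0.
rewrite (derive_det _ dl) l0 adj1 mul1mx; congr (\tr _).
have := @is_derive_line R _ _ lin_det (pt u) e1 0; rewrite scale0r addr0 => /(_ (diff_derivable dl))[_ <-].
rewrite (_ : (fun s : R => _) = cst 1%:M + *:%R^~ ('J X u)); last by apply/funext => s; rewrite line_lin.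
rewrite deriveD; [|exact: derivable_cst|].
  by rewrite derive_cst add0r deriveE//= diff_val scale1r.
exact/diff_derivable.
Qed.

(** One radius and one constant [L] for all bounds. The factor [n%:R] in front of the inverse is the
    one lost in [mulmx_norm_le]. *)
Let local_constants : exists r L, [/\ 0 < r, 1 <= L, ball c0 r `<=` T0 &
  [/\ forall x y, ball c0 r x -> ball c0 r y -> `|X x - X y| <= L * `|x - y|,
  forall x, ball c0 r x -> `|X x| <= L,
  forall x y, ball c0 r x -> ball c0 r y -> `|X x *m 'J X x - X y *m 'J X y| <= L * `|x - y|,
  (forall x, ball c0 r x -> [/\ `|rho x| <= L, `|'D_(X x) rho x| <= L,
     `|'D_(X x) (fun u => 'D_(X u) rho u) x| <= L & `|\tr ('J X x)| <= L]) &
  forall s x, `|s| < r -> ball c0 r x ->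
   [/\ 0 <= \det (1%:M + s *: 'J X x), 1%:M + s *: 'J X x \in unitmx,
       `|'D_e1 (fun w => 'D_e1 (fun w => \det (lin_det w)) w) (pt x + s *: e1)| <= L
     & n%:R * `|invmx (1%:M + s *: 'J X x)| <= L]]].
Proof.
have [r1 [L1 [r10 L10 rT1 [lip1 b1]]]] := lipschitz_near oT (cX 1) Tc.
have cW : ck 1 T0 (fun u => X u *m 'J X u) by apply: ck_mulmx => //; exact: ck_jacobian.
have [r2 [L2 [r20 L20 rT2 [lip2 b2]]]] := lipschitz_near oT cW Tc.
have [K1 K10 B1] := bounded_near_ex (ck_cont (cr 0) Tc).
have cD1 := fun k => @ck_lie rho k cr.
have [K2 K20 B2] := bounded_near_ex (ck_cont (cD1 0%N) Tc).
have [K3 K30 B3] := bounded_near_ex (ck_cont (ck_lie 0 cD1) Tc).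
have ctr : ck 0 T0 (fun u => \tr ('J X u)).
  by apply: ck_sum => // i; apply: ck_entry => //; exact: ck_jacobian.
have [K4 K40 B4] := bounded_near_ex (ck_cont ctr Tc).
have Oc : Om (pt c0) by rewrite /Om /= row_mxKr.
have cdet k : ck k Om (fun w => \det (lin_det w)) by exact: ck_det.
have [K5 K50 B5] := bounded_near_ex (ck_cont (ck_derive e1 (ck_derive e1 (cdet 2%N))) Oc).
have l0 : lin_det (pt c0) = 1%:M by have := line_lin 0 c0; rewrite !scale0r !addr0.
have P6 : \forall w \near pt c0, 0 < \det (lin_det w).
  have /cvgrPdist_lt/(_ _ ltr01) := ck_cont (cdet 0%N) Oc; apply: filterS => w.
  rewrite l0 det1 ltr_norml => /andP[_]; lra.
have [K7 K70 B7] : exists2 K, 0 <= K & \forall w \near pt c0, `|invmx (lin_det w)| <= K.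
  pose O' := [set w | Om w /\ 0 < \det (lin_det w)].
  have oO' : open O'.
    rewrite (_ : O' = Om `&` (fun w => \det (lin_det w)) @^-1` [set x | 0 < x]) //.
    apply: open_preimage; [exact: oOm| |exact: open_gt].
    by move=> w Ow; exact: (ck_cont (cdet 0%N) Ow).
  have O'c : O' (pt c0) by split => //; rewrite l0 det1.
  apply: bounded_near_ex; apply: (ck_cont (k := 0) (U := O')) => //.
  apply: ck_invmx => // [w [_ h]|]; first by rewrite unitmxE unitfE gt_eqF.
  by apply: (ck_sub _ (ck_lin 0)) => w [].
have N5 : \forall w \near pt c0, 0 < \det (lin_det w) /\ (`|invmx (lin_det w)| <= K7 /\
     `|'D_e1 (fun w => 'D_e1 (fun w => \det (lin_det w)) w) w| <= K5).
  exact: filterI P6 (filterI B7 B5).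
move/nbhs_ballP : N5 => [r5 /= r50 H5].
have N4 : \forall x \near c0, (`|rho x| <= K1 /\ `|'D_(X x) rho x| <= K2) /\
   (`|'D_(X x) (fun u => 'D_(X u) rho u) x| <= K3 /\ `|\tr ('J X x)| <= K4).
  exact: filterI (filterI B1 B2) (filterI B3 B4).
move/nbhs_ballP : N4 => [r4 /= r40 H4].
pose r := Num.min (Num.min r1 r2) (Num.min r4 r5).
have rr : 0 < r by rewrite !lt_min r10 r20 r40 r50.
have [rr1 rr2 rr4 rr5] : [/\ r <= r1, r <= r2, r <= r4 & r <= r5] by rewrite /r !ge_min !lexx ?orbT.
have nn : 0 <= n%:R * K7 by rewrite mulr_ge0.
pose L := 1 + L1 + L2 + K1 + K2 + K3 + K4 + K5 + n%:R * K7.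
have sub r' x : r <= r' -> ball c0 r x -> ball c0 r' x by move=> h; exact: le_ball.
exists r, L; split => //; first by rewrite /L; lra.
  by move=> x /(sub _ _ rr1)/rT1.
split.
- move=> x y xB yB; apply: le_trans (lip1 _ _ (sub _ _ rr1 xB) (sub _ _ rr1 yB)) _.
  by rewrite ler_wpM2r// /L; lra.
- move=> x xB; apply: le_trans (b1 _ (sub _ _ rr1 xB)) _; rewrite /L; lra.
- move=> x y xB yB; apply: le_trans (lip2 _ _ (sub _ _ rr2 xB) (sub _ _ rr2 yB)) _.
  by rewrite ler_wpM2r// /L; lra.
- by move=> x xB; have [[h1 h2] [h3 h4]] := H4 _ (sub _ _ rr4 xB); split;
    [apply: le_trans h1 _|apply: le_trans h2 _|apply: le_trans h3 _|apply: le_trans h4 _]; rewrite /L; lra.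
move=> s x sr xB.
have wB : ball (pt c0) r5 (pt x + s *: e1).
  rewrite lineE /pt -ball_normE /= opp_row_mx add_row_mx add0r.
  have h : `|c0 - x| < r5 by have := sub _ _ rr5 xB; rewrite -ball_normE.
  by rewrite norm_row_mx gt_max h normrN norm_scalar1 (lt_le_trans sr rr5).
have [h1 [h2 h3]] := H5 _ wB; rewrite line_lin in h1 h2; split.
- exact: ltW.
- by rewrite unitmxE unitfE gt_eqF.
- by apply: le_trans h3 _; rewrite /L; lra.
- by apply: le_trans (ler_wpM2l _ h2) _ => //; rewrite /L; lra.
Qed.

(** The coordinate divergence of [rho] times [X], that is, the Lie derivative along [X] of the
    density [rho]. *)
Definition fdiv u := 'D_(X u) rho u + rho u * \tr ('J X u).

(** For the volume estimate, [ode_second] shows that time [s] of the flow differs from its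
    linearisation [1 + s * DX] by a relative error [kap] of order [s ^+ 2]; [cov_upper] accepts
    this. The resulting factor is the density along the flow times [\det (1%:M + s *: 'J X u)] times
    [(1 + 2 * kap) ^+ n], and [three_bounds] expands it. *)
Theorem local_flow (R1 : R) : 0 < R1 -> exists (r d M C : R) (psi : R -> V -> V),
  [/\ 0 < r <= R1, 0 < d, 0 <= M, 0 <= C & [/\ ball c0 r `<=` T0, M * d <= r / 2,
  forall c : V, psi 0 c = c,
  forall (c : V) (s : R), `|s| < d -> psi (- s) (psi s c) = c &
  [/\ forall (c : V) (s : R), `|s| < d -> `|psi s c - c| <= M * `|s|,
   forall (c : V) (s : R), `|s| < d -> ball c0 (r / 2) c -> ball c0 r (psi s c) /\ is_derive s (1 : R) (psi ^~ c) (X (psi s c)),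
   forall (u v : V) (s : R), `|s| < d -> `|psi s u - psi s v| <= 2 * `|u - v|,
   forall (y : R -> V) (d' : R), d' <= d -> (forall s : R, `|s| < d' -> ball c0 r (y s) /\ is_derive s (1 : R) y (X (y s))) ->
     forall s : R, `|s| < d' -> y s = psi s (y 0) &
   forall (B : set V) (s : R) (F : V -> \bar R), open B -> B `<=` ball c0 (r / 2) -> `|s| < d ->
     measurable_fun setT (F : Borel V -> \bar R) -> (forall v, 0 <= F v)%E ->
     (\int[lam R n]_(v in [set v | B (psi (- s)%R v)]) (F v * (rho v)%:E)
      <= \int[lam R n]_(u in B) (F (psi s u) * (rho u + s * fdiv u + C * s ^+ 2)%R%:E))%E]]].
Proof.
move=> R10; have [r1 [L [r10 L1 rT [lipX bX lipW bnd Bnd]]]] := local_constants.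
have L0 : 0 < L by lra.
have LL0 : 0 <= 2 * (L * (2 * L)) by rewrite !mulr_ge0// ltW.
have [K K0 HK] := @pow_bound R n _ LL0.
pose C1 := L + K * (2 * (L * (2 * L))) + L.
have KL0 : 0 <= K * (2 * (L * (2 * L))) by rewrite mulr_ge0.
have [C10 C1L C1K] : [/\ 0 <= C1, L <= C1 & K * (2 * (L * (2 * L))) <= C1] by rewrite /C1; split; lra.
have [K3 K30 H3] := @three_bounds R L C1 C10 (ltW L0).
pose r := Num.min (r1 / 2) R1; have rr : 0 < r by rewrite lt_min R10 divr_gt0.
have rr1 : r < r1 by rewrite /r gt_min; apply/orP; left; lra.
have rR1 : r <= R1 by rewrite /r ge_min lexx orbT.
pose Z u := X (clampV c0 r u).
have clB u : ball c0 r1 (clampV c0 r u).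
  by rewrite -ball_normE /= distrC; apply: le_lt_trans rr1; exact: clampV_near.
have ZX u : ball c0 r u -> Z u = X u.
  by rewrite -ball_normE /= distrC => h; rewrite /Z clampV_id// ltW.
have lipZ x y : `|Z x - Z y| <= L * `|x - y|.
  apply: le_trans (lipX _ _ (clB _) (clB _)) _; apply: (ler_wpM2l (ltW L0)); exact: clampV_lip.
have bZ x : `|Z x| <= L by exact: bX.
(* The four bounds give in turn [d < 1] for the Picard iteration, the contraction condition, a time
   range where the local constants hold, and trajectories that move by at most [r / 2]. *)
pose d := Num.min (1 / 2) (Num.min (1 / (2 * L)) (Num.min r1 (r / (2 * L)))).
have d0 : 0 < d.
  by rewrite !lt_min; apply/and4P; split => //; rewrite ?divr_gt0// ?mulr_gt0.
have [dd1 dd2 dd3 dd4] : [/\ d <= 1 / 2, d <= 1 / (2 * L), d <= r1 & d <= r / (2 * L)].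
  by rewrite /d !ge_min !lexx ?orbT.
have Ld : L * d <= 1 / 2.
  by move: dd2; rewrite ler_pdivlMr ?mulr_gt0//; lra.
have Ldr : L * d <= r / 2.
  by move: dd4; rewrite ler_pdivlMr ?mulr_gt0//; lra.
have d1 : d < 1 by lra.
have [psi [p0 dp pinv [pM plip]]] := @global_flow R n Z L L d (ltW L0) (ltW L0) d0 d1 Ld lipZ bZ.
have d4 : 0 < d / 4 by rewrite divr_gt0.
have in2 s : `|s| < d / 4 -> - (d / 2) < s < d / 2 by rewrite ltr_norml; lra.
have in4 s : `|s| < d / 4 -> - (d / 4) < s < d / 4 by rewrite ltr_norml.
have pB c s : `|s| < d / 4 -> ball c0 (r / 2) c -> ball c0 r (psi s c).
  move=> sd; rewrite -!ball_normE /= => cB.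
  have := ler_distD c c0 (psi s c); have := pM c s (in2 s sd); rewrite [`|psi s c - c|]distrC.
  have : L * `|s| <= L * (d / 4) by apply: (ler_wpM2l (ltW L0)); rewrite ltW.
  lra.
have Ld4 : L * (d / 4) <= 1 / 2 by have : 0 <= L * d; [rewrite mulr_ge0// ltW|lra].
exists r, (d / 4), L, K3, psi; split => //; [by rewrite rr|exact: ltW|].
split => //.
- by move=> u /(le_ball (ltW rr1))/rT.
- by have : 0 <= L * d; [rewrite mulr_ge0// ltW|lra].
- by move=> c s /in4; exact: pinv.
split.
- by move=> c s /in2; exact: pM.
- move=> c s sd cB; have pr := pB c s sd cB; split => //.
  by rewrite -(ZX _ pr); apply: dp; exact: in2.
- by move=> u v s /in2; exact: plip.
- move=> y d' d'd Hy s sd'; apply/eqP; rewrite -subr_eq0 -normr_le0.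
  have dy t : - d' < t < d' -> is_derive t (1 : R) y (Z (y t)).
    move=> td; have /Hy[yB Dy] : `|t| < d' by rewrite ltr_norml. by rewrite (ZX _ yB).
  have dps t : - d' < t < d' -> is_derive t (1 : R) (psi ^~ (y 0)) (Z (psi t (y 0))).
    by move=> td; apply: dp; lra.
  have Ld' : L * d' <= 1 / 2 by apply: le_trans Ld4; exact: (ler_wpM2l (ltW L0)).
  have sd2 : - d' < s < d' by rewrite -ltr_norml.
  have := @ode_stable R n y (psi ^~ (y 0)) _ _ L L d' (ltW L0) (ltW L0) Ld' dy dps (fun s _ => bZ _)
    (fun s _ => bZ _) (fun s _ => lipZ _ _) s sd2.
  by rewrite p0 subrr normr0 mulr0.
move=> B s F oB Br sd mF F0.
have cpsi t : `|t| < d / 4 -> continuous (psi t).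
  by move=> td; apply: (@lip_continuous _ _ _ _ 2) => // x y; exact/plip/in2.
have sN : `|- s| < d / 4 by rewrite normrN.
pose Vs := [set v | B (psi (- s) v)].
have oVs : open Vs by move/continuousP : (cpsi _ sN); apply.
have pinv' c : psi s (psi (- s) c) = c by have := pinv c (- s) (in4 _ sN); rewrite opprK.
have s1 : `|s| <= 1 by lra.
have sr1 : `|s| < r1 by lra.
have inr1 u : B u -> ball c0 r1 u by move=> /Br; apply: le_ball; lra.
have BT u : B u -> T0 u by move=> /inr1/rT.
pose Bm u := invmx (1%:M + s *: 'J X u).
(* The factor [2 * L] comes from [ode_second], with [L] the Lipschitz constant of the acceleration;
   the other [L] bounds multiplication by [Bm u]. *)
pose kap := L * (2 * L) * s ^+ 2.
have L0' := ltW L0.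
have d4r1 : d / 4 <= r1 by lra.
have LC : L * s ^+ 2 <= C1 * s ^+ 2 by apply: ler_wpM2r; [exact: sqr_ge0|].
have s21 : s ^+ 2 <= 1 by rewrite -[s ^+ 2]real_normK ?num_real// exprn_ile1.
have kap0 : 0 <= kap by rewrite /kap mulr_ge0 ?sqr_ge0// !mulr_ge0.
pose rh u := `|\det (Bm u)|^-1 * (1 + 2 * kap) ^+ n.
have rhE u : B u -> rh u = \det (1%:M + s *: 'J X u) * (1 + 2 * kap) ^+ n.
  move=> Bu; have [dt0 _ _ _] := Bnd s u sr1 (inr1 u Bu).
  by rewrite /rh /Bm det_inv normfV invrK ger0_norm.
have VT v : Vs v -> T0 v.
  move=> Bv; rewrite -(pinv' v); apply: rT; apply: (le_ball (ltW rr1)); exact: pB sd (Br _ Bv).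
have cdet : ck 0 T0 (fun u => \det (1%:M + s *: 'J X u)).
  apply: ck_det => //; apply: (@ckD _ _ _ 0 T0 (cst 1%:M) (fun u => s *: 'J X u)) => //.
  by apply: ckZ => //; exact: ck_jacobian.
have crh : ck 0 B rh.
  apply: (@ck_ext _ _ _ 0 B (fun u => (1 + 2 * kap) ^+ n *: \det (1%:M + s *: 'J X u))) => //.
    by move=> u Bu; rewrite rhE//; exact: mulrC.
  by apply: ckZ => //; exact: ck_sub BT cdet.
have lipW' x y : ball c0 r x -> ball c0 r y -> `|X x *m 'J X x - X y *m 'J X y| <= L * `|x - y|.
  by move=> xB yB; apply: lipW; exact: (le_ball (ltW rr1)).
have dW (y : R -> V) t : ball c0 r (y t) -> is_derive t (1 : R) y (Z (y t)) -> is_derive t (1 : R) (Z \o y) (X (y t) *m 'J X (y t)).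
  move=> yB Dy; have nZ : \forall x \near y t, X x = Z x.
    have : nbhs (y t) (ball c0 r) by apply: open_nbhs_nbhs; split => //; exact: ball_open.
    by apply: filterS => x /ZX.
  have dX : differentiable X (y t) by apply: (ck_diff (cX 0)); apply: rT; exact: (le_ball (ltW rr1)).
  have dZ : differentiable Z (y t) by exact: differentiable_near nZ dX.
  rewrite -(deriveEjacobian _ dX) (diff_near_eq _ nZ) -(ZX _ yB); exact: is_derive_chain.
have Ld4' : L * (d / 4) <= 1 / 2 by [].
have locB u (e : R) : B u -> 0 < e -> exists2 r, 0 < r & forall v, B v -> `|v - u| < r ->
    `|(psi s v - psi s u) *m Bm u - (v - u)| <= (kap + e) * `|v - u|.
  move=> Bu e0; have uB := inr1 u Bu; have [_ ut _ nB] := Bnd s u sr1 uB.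
  have eL : 0 < e / L by rewrite divr_gt0.
  have [rj rj0 Hj] := jacobian_eps (ck_diff (cX 0) (BT u Bu)) eL; exists rj => // v Bv vr.
  have := @ode_second R n Z (fun x => X x *m 'J X x) (ball c0 r) L L L (d / 4) psi (ltW L0) (ltW L0) (ltW L0) Ld4'
    lipZ bZ lipW' p0 _ dW u v _ _ s (in4 _ sd).
  have h1 c t : - (d / 4) < t < d / 4 -> is_derive t (1 : R) (psi ^~ c) (Z (psi t c)).
    by move=> td; apply: dp; lra.
  have h2 w : B w -> forall t, - (d / 4) < t < d / 4 -> ball c0 r (psi t w).
    by move=> Bw t td; apply: pB (Br w Bw); rewrite ltr_norml.
  move=> /(_ h1 (h2 u Bu) (h2 v Bv)).
  have br x : B x -> ball c0 r x by move=> /Br; apply: le_ball; lra.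
  rewrite (ZX _ (br u Bu)) (ZX _ (br v Bv)) => H.
  have E : (psi s v - psi s u) *m Bm u - (v - u) =
     ((psi s v - psi s u - (v - u) - s *: (X v - X u)) + s *: (X v - X u - (v - u) *m 'J X u)) *m Bm u.
    have -> : psi s v - psi s u - (v - u) - s *: (X v - X u) + s *: (X v - X u - (v - u) *m 'J X u) =
       psi s v - psi s u - (v - u) *m (1%:M + s *: 'J X u).
      rewrite mulmxDr mulmx1 -scalemxAr [s *: (X v - X u - _)]scalerBr.
      by move: (psi s v - psi s u) (v - u) (s *: (X v - X u)) (s *: _) => a b c e'; rewrite addrA subrK opprD addrA.
    by rewrite [RHS]mulmxBl -[in RHS]mulmxA mulmxV// mulmx1.
  rewrite E; apply: le_trans (mulmx_norm_le _ _) _.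
  apply: (@le_trans _ _ (L * ((2 * L * `|v - u|) * s ^+ 2 + e / L * `|v - u|))).
    apply: ler_pM; [by rewrite mulr_ge0|by []|exact: nB|].
    apply: le_trans (ler_normD _ _) _; apply: lerD => //; rewrite normrZ.
    have := Hj v vr; apply: le_trans; exact: ler_piMl.
  rewrite /kap le_eqVlt; apply/orP; left; apply/eqP; field; exact: lt0r_neq0.
have Hcov : (\int[lam R n]_(v in Vs) (F v * (rho v)%:E) <= \int[lam R n]_(u in B) (F (psi s u) * (rho (psi s u))%:E * (rh u)%:E))%E.
  apply: (@cov_upper R n B Vs (psi s) (psi (- s)) Bm kap rh oB oVs) => //.
  - by move=> u _; exact: cpsi.
  - by move=> u _; exact: cpsi.
  - by move=> u Bu; rewrite /Vs /= pinv//; exact: in4.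
  - by move=> u Bu; rewrite unitmx_inv; have [] := Bnd s u sr1 (inr1 u Bu).
  - by move=> u Bu; exact: (ck_cont crh Bu).
  - move=> u Bu e e0; exact: locB.
  - by apply: emeasurable_funM; [exact: measurable_funS mF|apply/measurable_EFinP; apply: continuous_BorelR => // v Vv; exact: (ck_cont (cr 0) (VT v Vv))].
  - by move=> v Vv; rewrite mule_ge0// lee_fin r0//; exact: VT.
apply: le_trans Hcov _.
have mFp : measurable_fun (Bset B) (fun u => F (psi s u)).
  by apply: measurableT_comp mF _; apply: continuous_Borel => // u _; exact: cpsi.
have pT u : B u -> T0 (psi s u) by move=> Bu; apply: VT; rewrite /Vs /= pinv//; exact: in4.
apply: ge0_le_integral => //.
- exact: open_Borel.
- move=> u Bu; have rh0 : 0 <= rh u.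
    rewrite rhE// mulr_ge0//; first by have [] := Bnd s u sr1 (inr1 u Bu).
    by rewrite exprn_ge0// addr_ge0// mulr_ge0.
  by rewrite !mule_ge0// lee_fin// r0//; exact: pT.
- apply: emeasurable_funM; last by apply/measurable_EFinP; apply: continuous_BorelR => // u Bu; exact: (ck_cont crh Bu).
  apply: emeasurable_funM => //; apply/measurable_EFinP; apply: continuous_BorelR => // u Bu.
  by apply: continuous_comp; [exact: cpsi|exact: ck_cont (cr 0) (pT u Bu)].
- apply: emeasurable_funM => //; apply/measurable_EFinP; apply: continuous_BorelR => // u Bu.
  apply: (ck_cont (k := 0) (U := B)) => //.
  apply: (@ckD _ _ _ 0 B (fun x => rho x + s * fdiv x) (cst _)) => //.
  apply: (@ckD _ _ _ 0 B rho (fun x => s * fdiv x)) => //; first exact: ck_sub BT (cr 0).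
  apply: (@ck_ext _ _ _ 0 B (fun u => s *: fdiv u)) => //; apply: ckZ => //.
  apply: ckD => //; first exact: ck_sub BT (ck_lie 0 cr).
  apply: ckM => //; first exact: ck_sub BT (cr 0).
  apply: ck_sub BT _; apply: ck_sum => // i; apply: ck_entry => //; exact: ck_jacobian.
- move=> u Bu; rewrite -muleA -EFinM lee_wpmul2l// lee_fin.
  have uB := inr1 u Bu; have [h1 h2 h3 h4] := bnd u uB.
  have [dt0 ut Bd _] := Bnd s u sr1 uB.
  rewrite rhE// mulrA; apply: (H3 (rho u) ('D_(X u) rho u) (\tr ('J X u))) => //.
  + by apply: r0; exact: pT.
  + by rewrite exprn_ge0// addr_ge0// mulr_ge0.
  + have dps t : - (d / 4) < t < d / 4 -> ball c0 r (psi t u) /\ is_derive t (1 : R) (psi ^~ u) (X (psi t u)).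
      move=> td; have td' : `|t| < d / 4 by rewrite ltr_norml.
      by have pr := pB u t td' (Br u Bu); split => //; rewrite -(ZX _ pr); apply: dp; exact: in2.
    have rT0 x : ball c0 r x -> T0 x by move=> /(le_ball (ltW rr1))/rT.
    have D1 t : - (d / 4) < t < d / 4 -> is_derive t (1 : R) (fun t => rho (psi t u)) ('D_(X (psi t u)) rho (psi t u)).
      by move=> /dps[/rT0 h Dt]; apply: (is_derive_chain Dt (ck_diff (cr 0) h)).
    have D2 t : - (d / 4) < t < d / 4 -> is_derive t (1 : R) (fun t => 'D_(X (psi t u)) rho (psi t u))
       ('D_(X (psi t u)) (fun u => 'D_(X u) rho u) (psi t u)).
      by move=> /dps[/rT0 h Dt]; apply: (is_derive_chain Dt (ck_diff (ck_lie 0 cr) h)).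
    have B2 t : - (d / 4) < t < d / 4 -> `|'D_(X (psi t u)) (fun u => 'D_(X u) rho u) (psi t u)| <= L.
      by move=> /dps[h _]; have [] := bnd _ (le_ball (ltW rr1) h).
    have := taylor2R (ltW L0) D1 D2 B2 (in4 _ sd); rewrite p0 ler_norml => /andP[_].
    exact: taylor_upper LC.
  + have Ol t : Om (pt u + t *: e1) by rewrite lineE /Om /= row_mxKr; exact: rT.
    have cdl k : ck k Om (fun w => \det (lin_det w)) by exact: ck_det.
    have D1 t : - (d / 4) < t < d / 4 -> is_derive t (1 : R) (fun t => \det (lin_det (pt u + t *: e1)))
       ('D_e1 (fun w => \det (lin_det w)) (pt u + t *: e1)).
      by move=> _; apply: (@is_derive_line R _ _ (fun w => \det (lin_det w))); exact/diff_derivable/(ck_diff (cdl 0%N)).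
    have D2 t : - (d / 4) < t < d / 4 -> is_derive t (1 : R) (fun t => 'D_e1 (fun w => \det (lin_det w)) (pt u + t *: e1))
       ('D_e1 (fun w => 'D_e1 (fun w => \det (lin_det w)) w) (pt u + t *: e1)).
      move=> _; apply: (@is_derive_line R _ _ (fun w => 'D_e1 (fun w => \det (lin_det w)) w)).
      exact/diff_derivable/(ck_diff (ck_derive e1 (cdl 1%N))).
    have B2 t : - (d / 4) < t < d / 4 -> `|'D_e1 (fun w => 'D_e1 (fun w => \det (lin_det w)) w) (pt u + t *: e1)| <= L.
      move=> td; have tr1 : `|t| < r1 by apply: lt_le_trans d4r1; rewrite ltr_norml.
      by have [] := Bnd t u tr1 uB.
    have := taylor2R (ltW L0) D1 D2 B2 (in4 _ sd); rewrite !line_lin !scale0r !addr0 (dlin (BT u Bu)) det1 ler_norml => /andP[_].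
    exact: taylor_upper LC.
  + have k2 : 0 <= 2 * kap <= 2 * (L * (2 * L)).
      rewrite mulr_ge0//=; rewrite /kap ler_pM2l// ler_piMr// mulr_ge0// ?ltW// mulr_gt0//.
    apply: le_trans (HK _ k2) _; rewrite lerD2l /kap.
    rewrite (_ : K * _ = K * (2 * (L * (2 * L))) * s ^+ 2); last by ring.
    by apply: ler_wpM2r; [exact: sqr_ge0|].
Qed.

End local_flow.

(** * Mass transport *)

Section pmp.
Context (R : realType) (d : measure_display) (T : measurableType d) (nu : {measure set T -> \bar R}).
Implicit Types (D : set T) (h : T -> T).

(** A partial measure-preserving bijection with its inverse. Domains are part of the data because
    compositions live on the natural domain, where [pmp_comp] shows that words in such maps are of
    the same kind. *)
Record pmp D D' h h' : Prop := Pmp {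
  pmp_mD : measurable D; pmp_mD' : measurable D';
  pmp_mh : measurable_fun D h; pmp_mh' : measurable_fun D' h';
  pmp_im : forall c, D c -> D' (h c); pmp_im' : forall c, D' c -> D (h' c);
  pmpK : forall c, D c -> h' (h c) = c; pmpK' : forall c, D' c -> h (h' c) = c;
  pmp_int : forall f : T -> \bar R, measurable_fun D' f -> (forall c, 0 <= f c)%E ->
    (\int[nu]_(c in D) f (h c) = \int[nu]_(c in D') f c)%E }.

Lemma pmp_id : pmp setT setT id id.
Proof. by split. Qed.

Lemma pmp_sub D D' h h' A : pmp D D' h h' -> measurable A -> A `<=` D ->
  pmp A (D' `&` h' @^-1` A) h h'.
Proof.
move=> [mD mD' mh mh' im im' K K' I] mA AD.
have mA' : measurable (D' `&` h' @^-1` A) by exact: mh'.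
split => //.
- exact: measurable_funS mh.
- by apply: measurable_funS mh' => // c [].
- by move=> c Ac; split; [exact/im/AD|rewrite /= K//; exact: AD].
- by move=> c [].
- by move=> c /AD /K.
- by move=> c [/K'].
move=> f mf f0; have E : D `&` h @^-1` (D' `&` h' @^-1` A) = A.
  apply/seteqP; split => c; first by move=> [Dc [_]]; rewrite /= K.
  by move=> Ac; have Dc := AD _ Ac; split => //; split; [exact: im|rewrite /= K].
rewrite -{1}E -[in RHS](setIidr (@subIsetl _ D' (h' @^-1` A))) !integral_mkcondr -I.
- by apply: eq_integral => c _; rewrite !patchE.
- by apply/measurable_restrict => //; apply: measurable_funS mf => // c [].
- by move=> c; rewrite patchE; case: ifP.
Qed.

Lemma pmp_comp D1 D1' h1 h1' D2 D2' h2 h2' : pmp D1 D1' h1 h1' -> pmp D2 D2' h2 h2' ->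
  pmp (D1 `&` h1 @^-1` D2) (D2' `&` h2' @^-1` D1') (h2 \o h1) (h1' \o h2').
Proof.
move=> W1 W2; have mA : measurable (D1 `&` h1 @^-1` D2) by apply: (pmp_mh W1); [exact: pmp_mD W1|exact: pmp_mD W2].
have mB : measurable (D1' `&` D2) by apply: measurableI; [exact: pmp_mD' W1|exact: pmp_mD W2].
have : pmp (D1 `&` h1 @^-1` D2) (D1' `&` D2) h1 h1'.
  rewrite -(_ : D1' `&` h1' @^-1` (D1 `&` h1 @^-1` D2) = D1' `&` D2); first exact: pmp_sub W1 mA (@subIsetl _ _ _).
  apply/seteqP; split => c [Dc]; rewrite /= (pmpK' W1 Dc) => H; split => //; first by case: H.
  by split => //; exact: pmp_im' W1 _ Dc.
have : pmp (D1' `&` D2) (D2' `&` h2' @^-1` D1') h2 h2'.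
  rewrite -(_ : D2' `&` h2' @^-1` (D1' `&` D2) = D2' `&` h2' @^-1` D1'); first exact: pmp_sub W2 mB (@subIsetr _ _ _).
  by apply/seteqP; split => c [Dc H]; split => //; [case: H|split => //; exact: pmp_im' W2 _ Dc].
move=> [_ mD2 m2 m2' i2 i2' K2 K2' I2] [_ _ m1 m1' i1 i1' K1 K1' I1]; split => //.
- by apply: (@measurable_comp _ _ _ _ _ _ (D1' `&` D2)) => // _ [c Dc <-]; exact: i1.
- by apply: (@measurable_comp _ _ _ _ _ _ (D1' `&` D2)) => // _ [c Dc <-]; exact: i2'.
- by move=> c /i1/i2.
- by move=> c /i2'/i1'.
- by move=> c Dc; rewrite /= K2 ?K1//; exact: i1.
- by move=> c Dc; rewrite /= K1' ?K2'//; exact: i2'.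
move=> f mf f0; rewrite -I2// -(I1 (f \o h2)) => [//||c]; last exact: f0.
by apply: (@measurable_comp _ _ _ _ _ _ (D2' `&` h2' @^-1` D1')) => // _ [c Dc <-]; exact: i2.
Qed.

Section transport.
Variables (D D' : nat -> set T) (h h' : nat -> T -> T).
Hypothesis W : forall k, pmp (D k) (D' k) (h k) (h' k).

Definition reach c : set T := [set e | exists2 k, D k c & h k c = e].

(** Different [k] may carry [c] to the same point; the smallest one is kept, so that [k] enumerates
    [reach c] without repetition. Measurability of [E k] rests on [mdiag]. *)
Let E k := D k `&` [set c | forall j, (j < k)%N -> D j c -> h j c != h k c].
Hypothesis mdiag : forall A (f g : T -> T), measurable A -> measurable_fun A f -> measurable_fun A g ->
  measurable (A `&` [set c | f c = g c]).

Let mE k : measurable (E k).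
Proof.
have -> : E k = D k `&` \bigcap_(j in `I_k) (D k `&` ~` [set c | D j c /\ h j c = h k c]).
  apply/seteqP; split => c [Dc H]; split => //.
    by move=> j /= jk; split => // -[Dj] /eqP; apply/negP; exact: H.
  by move=> j jk Dj; apply/eqP => hE; have [_] := H j jk; apply; split.
apply: measurableI; first exact: pmp_mD (W k).
apply: bigcap_measurableType => j _.
have -> : D k `&` ~` [set c | D j c /\ h j c = h k c] =
    D k `\` (D j `&` D k `&` [set c | h j c = h k c]).
  apply/seteqP; split => c [Dc H]; split => //.
    by move=> [[Dj _] /= hE]; apply: H.
  by move=> [Dj hE]; apply: H.
apply: measurableD; first exact: pmp_mD (W k).
have mDD : measurable (D j `&` D k) by apply: measurableI; [exact: pmp_mD (W j)|exact: pmp_mD (W k)].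
apply: mdiag => //.
  by apply: measurable_funS (pmp_mh (W j)) => [|c []//]; exact: pmp_mD (W j).
by apply: measurable_funS (pmp_mh (W k)) => [|c []//]; exact: pmp_mD (W k).
Qed.

Let E' k := D' k `&` h' k @^-1` E k.
Let WE k : pmp (E k) (E' k) (h k) (h' k).
Proof. by apply: pmp_sub; [exact: W|exact: mE|move=> c []]. Qed.

Let reachE c e : reach c e -> exists2 k, E k c & h k c = e.
Proof.
move=> [k Dk hk].
have ex : exists k, `[< D k c /\ h k c = e >] by exists k; apply/asboolP.
exists (ex_minn ex); case: ex_minnP => m /asboolP[Dm hm] mmin //.
split => // j jm Dj; rewrite hm; apply/eqP => hj.
by move: jm; rewrite ltnNge mmin//; apply/asboolP.
Qed.

Let E_uniq c j k : E j c -> E k c -> h j c = h k c -> j = k.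
Proof.
move=> [Dj Hj] [Dk Hk] hE; case: (ltngtP j k) => // jk.
  by have := Hk j jk Dj; rewrite hE eqxx.
by have := Hj k jk Dk; rewrite hE eqxx.
Qed.

Lemma reach_enum c : exists P : set nat, set_bij P (reach c) (h ^~ c).
Proof.
exists [set k | E k c]; split; [by move=> k [Dk _]; exists k|
  by move=> j k /set_mem Ej /set_mem Ek; exact: E_uniq|by move=> e /reachE[k Ek <-]; exists k].
Qed.

Lemma esum_reach (b : T -> \bar R) c : (forall e, 0 <= b e)%E ->
  (\esum_(e in reach c) b e = \sum_(0 <= k <oo) ((fun c => b (h k c)) \_ (E k)) c)%E.
Proof.
move=> b0; rewrite (@reindex_esum _ _ _ [set k | E k c] (reach c) (h ^~ c)); last first.
- by split; [move=> k [Dk _]; exists k|move=> j k /set_mem Ej /set_mem Ek; exact: E_uniq|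
    move=> e /reachE[k Ek <-]; exists k].
rewrite esum_mkcond nneseries_esumT; last by move=> k; rewrite patchE; case: ifP.
apply: eq_esum => k _; rewrite patchE (_ : (k \in _) = (c \in E k))//.
Qed.

Lemma esum_reach' (b : T -> \bar R) e : (forall c, 0 <= b c)%E ->
  (\esum_(c in [set c | reach c e]) b c = \sum_(0 <= k <oo) ((fun c => b (h' k c)) \_ (E' k)) e)%E.
Proof.
move=> b0; rewrite (@reindex_esum _ _ _ [set k | E' k e] [set c | reach c e] (h' ^~ e)); last first.
- split.
  + by move=> k [Dk [Ek _]]; exists k => //; exact: (pmpK' (W k)).
  + move=> j k /set_mem Ej /set_mem Ek hE; have [Dj Ej'] := Ej; have [Dk Ek'] := Ek.
    apply: (@E_uniq (h' j e)) => //; first by rewrite hE.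
    by rewrite (pmpK' (W j))// hE (pmpK' (W k)).
  + move=> c /reachE[k Ek hk]; exists k; last by rewrite -hk; apply: (pmpK (W k)); case: Ek.
    by rewrite -hk; apply: (pmp_im (WE k)).
rewrite esum_mkcond nneseries_esumT; last by move=> k; rewrite patchE; case: ifP.
apply: eq_esum => k _; rewrite patchE (_ : (k \in _) = (e \in E' k))//.
Qed.

Let mterm (b : T -> \bar R) k : measurable_fun setT b -> measurable_fun setT ((fun c => b (h k c)) \_ (E k)).
Proof.
move=> mb; apply/(measurable_restrictT _ _).1; first exact: mE.
by apply: (@measurable_comp _ _ _ _ _ _ setT) => //; exact: pmp_mh (WE k).
Qed.
Let mterm' (b : T -> \bar R) k : measurable_fun setT b -> measurable_fun setT ((fun c => b (h' k c)) \_ (E' k)).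
Proof.
move=> mb; apply/(measurable_restrictT _ _).1; first exact: pmp_mD' (WE k).
by apply: (@measurable_comp _ _ _ _ _ _ setT) => //; exact: pmp_mh' (WE k).
Qed.

Lemma measurable_esum_reach (b : T -> \bar R) : measurable_fun setT b -> (forall e, 0 <= b e)%E ->
  measurable_fun setT (fun c => \esum_(e in reach c) b e)%E.
Proof.
move=> mb b0; rewrite (_ : (fun c => _) = fun c => \sum_(0 <= k <oo) ((fun c => b (h k c)) \_ (E k)) c)%E.
  by apply: ge0_emeasurable_sum => [k x _ _|k _]; [rewrite patchE; case: ifP|exact: mterm].
by apply/funext => c; exact: esum_reach.
Qed.

(** Both sides become series over [k]. The [k]-th terms agree because [h k] preserves [nu] between
    [E k] and [E' k], and it exchanges the roles of source and target. *)
Lemma mass_transport (a b : T -> R) : measurable_fun setT a -> measurable_fun setT b ->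
  (forall c, 0 <= a c) -> (forall c, 0 <= b c) ->
  (\int[nu]_c ((a c)%:E * \esum_(e in reach c) (b e)%:E) = \int[nu]_e ((b e)%:E * \esum_(c in [set c | reach c e]) (a c)%:E))%E.
Proof.
move=> /measurable_EFinP ma /measurable_EFinP mb a0 b0.
have t0 (f : T -> R) (g : T -> T) A x : (forall c, 0 <= f c) -> (0 <= ((fun c => (f (g c))%:E) \_ A) x)%E.
  by move=> f0; rewrite patchE; case: ifP => // _; rewrite lee_fin.
transitivity (\int[nu]_c \sum_(0 <= k <oo) ((a c)%:E * ((fun c => (b (h k c))%:E) \_ (E k)) c))%E.
  by apply: eq_integral => c _; rewrite (@esum_reach (EFin \o b))// nneseriesZl// => k _; exact: t0.
transitivity (\int[nu]_c \sum_(0 <= k <oo) ((b c)%:E * ((fun c => (a (h' k c))%:E) \_ (E' k)) c))%E; last first.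
  by apply: eq_integral => c _; rewrite (@esum_reach' (EFin \o a))// nneseriesZl// => k _; exact: t0.
pose A k c := ((a c)%:E * ((fun c => (b (h k c))%:E) \_ (E k)) c)%E.
pose B k c := ((b c)%:E * ((fun c => (a (h' k c))%:E) \_ (E' k)) c)%E.
have mA k : measurable_fun setT (A k) by apply: emeasurable_funM => //; exact: (@mterm (EFin \o b)).
have mB k : measurable_fun setT (B k) by apply: emeasurable_funM => //; exact: (@mterm' (EFin \o a)).
have A0 k c : setT c -> (0 <= A k c)%E by move=> _; apply: mule_ge0; [rewrite lee_fin|exact: t0].
have B0 k c : setT c -> (0 <= B k c)%E by move=> _; apply: mule_ge0; [rewrite lee_fin|exact: t0].
apply: etrans (integral_nneseries nu measurableT mA A0) _.
apply: etrans _ (esym (integral_nneseries nu measurableT mB B0)).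
apply: eq_eseriesr => k _; rewrite /A /B.
pose F e := ((b e)%:E * ((fun c => (a (h' k c))%:E) \_ (E' k)) e)%E.
have mF : measurable_fun setT F by apply: emeasurable_funM => //; exact: (@mterm' (EFin \o a)).
have F0 e : (0 <= F e)%E by apply: mule_ge0; [rewrite lee_fin|exact: t0].
have := pmp_int (WE k) (measurable_funTS mF) F0; rewrite [LHS]integral_mkcond [RHS]integral_mkcond.
rewrite (_ : F \_ (E' k) = F); last first.
  by apply/funext => e; rewrite patchE /F patchE; case: (e \in E' k); rewrite ?mule0.
move=> <-; apply: eq_integral => c _; rewrite !patchE /F; case: ifPn => [/set_mem Ek|]; last by rewrite mule0.
rewrite patchE mem_set; last exact: (pmp_im (WE k)).
by rewrite (pmpK (WE k))// muleC.
Qed.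

End transport.
End pmp.

Section transversal.
Context {R : realType} {q : nat}.
Local Notation V := 'rV[R]_q.
Variables (Tn : nat -> set V) (rho : nat -> V -> R).
Hypotheses (oT : forall n, open (Tn n)) (crho : forall n c, Tn n c -> {for c, continuous (rho n)})
  (rho0 : forall n c, Tn n c -> 0 <= rho n c).

(** The disjoint union of the transversals, the first component numbering the sheet. Points outside
    [Tn n] stay in the type; [tmeasure] gives them no mass. *)
Definition tspace : measurableType _ := (nat * Borel V)%type.

Let rh n := (rho n \* \1_(Tn n) : V -> R).
Let mrh n : measurable_fun setT (rh n : Borel V -> R).
Proof. by apply: measurable_indicR => // u; exact: crho. Qed.
Let rh0 n u : 0 <= rh n u.
Proof. by rewrite /rh /= indicE; case: (boolP (_ \in _)) => [/set_mem/rho0|_]; rewrite ?mulr1 ?mulr0. Qed.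

Let mpair (n : nat) : measurable_fun setT (fun c : Borel V => (n, c) : tspace).
Proof. exact: pair1_measurable. Qed.

Definition tmeasure : {measure set tspace -> \bar R} :=
  mseries (fun n => pushm (mdens (lam R q) (@mrh n) (@rh0 n)) (mpair n)) 0.

Lemma integral_tmeasure (F : tspace -> \bar R) : measurable_fun setT F -> (forall z, 0 <= F z)%E ->
  (\int[tmeasure]_z F z = \sum_(0 <= n <oo) \int[lam R q]_(c in Tn n) (F (n, c) * (rho n c)%:E))%E.
Proof.
move=> mF F0; rewrite /tmeasure ge0_integral_measure_series//; apply: eq_eseriesr => n _.
rewrite ge0_integral_pushm// integral_mdens//; last exact: measurableT_comp mF (mpair n).
rewrite [RHS]integral_mkcond; apply: eq_integral => c _; rewrite patchE /rh /= indicE.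
by case: ifPn => [cT|cT]; rewrite ?mulr1// mulr0 mule0.
Qed.

Lemma measurable_sheet n (D : set V) : borel D -> measurable ([set n] `*` D : set tspace).
Proof. by move=> mD; apply: measurableX. Qed.

Lemma integral_sheet n (D : set V) (F : tspace -> \bar R) : borel D -> D `<=` Tn n ->
  measurable_fun ([set n] `*` D : set tspace) F -> (forall z, 0 <= F z)%E ->
  (\int[tmeasure]_(z in [set n] `*` D) F z = \int[lam R q]_(c in D) (F (n, c) * (rho n c)%:E))%E.
Proof.
move=> mD DT mF F0; rewrite integral_mkcond integral_tmeasure; first last.
- by move=> z; rewrite patchE; case: ifP.
- by apply/(measurable_restrictT _ _).1 => //; exact: measurable_sheet.
rewrite (@nneseriesD1 _ _ n)//; last by move=> k _; apply: integral_ge0 => c Tc; rewrite patchE; case: ifP; rewrite ?mul0e// mule_ge0// lee_fin rho0.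
rewrite eseries0 ?adde0.
  rewrite integral_mkcond [RHS]integral_mkcond; apply: eq_integral => c _; rewrite !patchE.
  have -> : ((n, c) \in [set n] `*` D) = (c \in D).
    by apply/idP/idP => /set_mem; [move=> [_ Dc]; apply/mem_set|move=> Dc; apply/mem_set; split].
  case: (boolP (c \in D)) => [/set_mem/DT/mem_set ->//|_]; rewrite mul0e; by case: ifP.
move=> k _ kn; apply: integral0_eq => c _; rewrite patchE ifF ?mul0e//.
by apply/negP => /set_mem[/= kE _]; move: kn; rewrite kE eqxx.
Qed.

Lemma tspace_diag (A : set tspace) (f g : tspace -> tspace) : measurable A -> measurable_fun A f -> measurable_fun A g ->
  measurable (A `&` [set c | f c = g c]).
Proof.
move=> mA mf mg.
have mfst (h : tspace -> tspace) : measurable_fun A h -> measurable_fun A (fst \o h).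
  by move=> mh; apply: measurableT_comp mh; exact: measurable_fst.
have msnd (h : tspace -> tspace) i : measurable_fun A h -> measurable_fun A (fun c => ((h c).2 0 i)%:E).
  move=> mh; apply/measurable_EFinP; apply: measurableT_comp (measurable_coord i) _.
  by apply: measurableT_comp mh; exact: measurable_snd.
rewrite (_ : _ `&` _ = (\bigcup_n ((A `&` (fst \o f) @^-1` [set n]) `&` (A `&` (fst \o g) @^-1` [set n]))) `&`
   \bigcap_(i in [set: 'I_q]) (A `&` [set c | ((f c).2 0 i)%:E = ((g c).2 0 i)%:E])).
  apply: measurableI.
    by apply: bigcupT_measurable => n; apply: measurableI; [exact: (mfst _ mf)|exact: (mfst _ mg)].
  apply: fin_bigcap_measurable => [|i _]; first exact: finite_finset.
  by apply: emeasurable_fun_eq => //; exact: msnd.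
apply/seteqP; split => [c [Ac fg]|c [[n _ [[Ac fn] [_ gn]]] H]].
  by split; [exists (f c).1 => //; split; split => //=; rewrite fg|move=> i _; split => //=; rewrite fg].
split => //=; rewrite (surjective_pairing (f c)) (surjective_pairing (g c)); congr pair; first exact: etrans fn (esym gn).
by apply/rowP => i; have [_ []] := H i I.
Qed.

(** The change of variables formula: the relation between the densities is exactly what cancels the
    Jacobian. *)
Lemma pmp_diffeo n m (D D' : set V) h h' : diffeo D D' h h' -> D `<=` Tn n -> D' `<=` Tn m ->
  (forall c, D c -> rho n c = `|\det ('J h c)| * rho m (h c)) ->
  @pmp R _ tspace tmeasure ([set n] `*` D) ([set m] `*` D') (fun z => (m, h z.2)) (fun z => (n, h' z.2)).
Proof.
move=> dfg DT DT' hr; have [oD oD' ch ch' [hD hD' hK hK']] := dfg.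
have ms k l (E : set V) (f : V -> V) : open E -> ck 1 E f -> measurable_fun ([set k] `*` E : set tspace) (fun z => (l, f z.2) : tspace).
  move=> oE cf; apply: measurableT_comp (mpair l) _.
  apply: (@measurable_comp _ _ _ tspace (Borel V) (Borel V) (Bset E) (f : Borel V -> Borel V) _ (snd : tspace -> Borel V)).
  - exact: open_Borel.
  - by move=> _ [z [_ Ez] <-].
  - by apply: continuous_Borel => // u Eu; exact: ck_cont cf Eu.
  - exact: measurable_funTS measurable_snd.
have mD := measurable_sheet n (open_Borel oD); have mD' := measurable_sheet m (open_Borel oD').
split => //; [exact: ms|exact: ms| | | | |].
- by move=> [k c] [/= _ Dc]; split => //; exact: hD.
- by move=> [k c] [/= _ Dc]; split => //; exact: hD'.
- by move=> [k c] [/= -> Dc]; rewrite hK.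
- by move=> [k c] [/= -> Dc]; rewrite hK'.
move=> f mf f0.
rewrite !integral_sheet//; last 3 first.
- exact: open_Borel.
- exact: open_Borel.
- by apply: (measurable_comp mD' _ mf) => [_ [[k c] [/= _ Dc] <-]|]; [split => //; exact: hD|exact: ms].
rewrite (diffeo_cov dfg).
- by apply: eq_integral => c /set_mem Dc /=; rewrite hr// EFinM -muleA; congr mule; exact: muleC.
- apply: emeasurable_funM.
    by apply: (measurable_comp mD' _ mf) => [_ [c Dc <-]//|]; exact: measurable_funTS.
  by apply/measurable_EFinP; apply: continuous_BorelR => // c Dc; apply: crho; exact: DT'.
- by move=> c Dc; rewrite mule_ge0// lee_fin rho0//; exact: DT'.
Qed.

End transversal.

(** * Foliated charts and holonomy *)

Section manifold.
Context {R : realType} {p q : nat} (M : foliatedManifold R p q).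
Local Notation V := 'rV[R]_(p + q).
Implicit Types (i j : chart M) (u v : V).

Definition tdom i j : set V := [set u | cod M i u /\ dom M j (icoord M i u)].
Definition tran i j : V -> V := coord M j \o icoord M i.

Lemma open_cod i : open (cod M i). Proof. exact: cod_open. Qed.

Lemma icoord_dom i u : cod M i u -> dom M i (icoord M i u).
Proof. by move=> [x Dx <-]; rewrite coordK. Qed.

Lemma icoordK i u : cod M i u -> coord M i (icoord M i u) = u.
Proof. by move=> [x Dx <-]; rewrite coordK. Qed.

Lemma coord_cod i x : dom M i x -> cod M i (coord M i x).
Proof. by move=> Dx; exists x. Qed.

Lemma icoord_inj i u v : cod M i u -> cod M i v -> icoord M i u = icoord M i v -> u = v.
Proof. by move=> Cu Cv uv; rewrite -(icoordK Cu) -(icoordK Cv) uv. Qed.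

Lemma icoord_preimage i (O : set M) : open O -> open (cod M i `&` icoord M i @^-1` O).
Proof. by move=> oO; apply: open_preimage => //; [exact: open_cod|move=> u Cu; exact: icoord_continuous]. Qed.

Lemma coord_preimage i (O : set V) : open O -> open (dom M i `&` coord M i @^-1` O).
Proof. by move=> oO; apply: open_preimage => //; [exact: dom_open|move=> u Cu; exact: coord_continuous]. Qed.

Lemma icoord_open i (O : set V) : open O -> O `<=` cod M i -> open (icoord M i @` O).
Proof.
move=> oO OC; rewrite (_ : _ @` _ = dom M i `&` coord M i @^-1` O); first exact: coord_preimage.
apply/seteqP; split => [_ [u Ou <-]|x [Dx Ox]]; first by split; [exact/icoord_dom/OC|rewrite /= icoordK//; exact: OC].
by exists (coord M i x) => //; rewrite coordK.
Qed.

Lemma open_tdom i j : open (tdom i j).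
Proof. exact: icoord_preimage (@dom_open _ _ _ M j). Qed.

Lemma ck_tran i j k : ck k (tdom i j) (tran i j).
Proof. apply: smooth_ck; exact: transition_smooth. Qed.

Lemma fol_tran i j : fol (tdom i j) (tran i j).
Proof. by move=> u v [Cu Du]; exact: transition_foliated. Qed.

Lemma tran_cod i j u : tdom i j u -> cod M j (tran i j u).
Proof. by move=> [Cu Du]; exact: coord_cod. Qed.

Lemma icoord_tran i j u : tdom i j u -> icoord M j (tran i j u) = icoord M i u.
Proof. by move=> [Cu Du]; exact: coordK. Qed.

Lemma tranK i j u : tdom i j u -> tran j i (tran i j u) = u.
Proof. by move=> Tu; rewrite {1}/tran /= icoord_tran//; case: Tu => Cu _; exact: icoordK. Qed.

Lemma tran_plaque i j (u0 : V) (r : R) u v : ball u0 r `<=` tdom i j -> ball u0 r u -> ball u0 r v ->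
  rsubmx u = rsubmx v -> rsubmx (tran i j u) = rsubmx (tran i j v).
Proof.
move=> BT uB vB uv; apply/rowP => k.
have dt w : ball u0 r w -> differentiable (tran i j) w by move=> /BT; exact: ck_diff (ck_tran i j 0).
apply: (@plaque_const R p q R (fun w => rsubmx (tran i j w) 0 k) u0 r) uv => // w.
  by move=> /dt dw; apply: differentiable_entry; exact: differentiable_rsubmx.
move=> z wB z0; rewrite -(derive_entry _ _ _ (differentiable_rsubmx (dt w wB))) derive_rsubmx; last exact: dt.
by rewrite fol_tran ?mxE//; exact: BT.
Qed.

Section plaque_const.
Variables (X : Type) (f : M -> X).

(** Leafwise local constancy at [x]: in every chart around [x], [f] is constant on a small plaque.
    Quantifying over all charts makes the notion usable on any plaque, and [llc_local] shows that
    one chart suffices to verify it. *)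
Definition llc x := forall i, dom M i x -> exists2 r : R, 0 < r & forall v, ball (coord M i x) r v ->
  rsubmx v = rsubmx (coord M i x) -> f (icoord M i v) = f x.

Lemma llc_local i x (W : set M) (F : 'rV[R]_q -> X) : open W -> W x -> W `<=` dom M i ->
  (forall z, W z -> f z = F (rsubmx (coord M i z))) -> llc x.
Proof.
move=> oW Wx WD fF j Dx; pose u := coord M j x.
have Cu : cod M j u by exact: coord_cod.
have uE : icoord M j u = x by exact: coordK.
have N : nbhs u (cod M j `&` icoord M j @^-1` W).
  by apply: open_nbhs_nbhs; split; [exact: icoord_preimage|split => //=; rewrite uE].
move/nbhs_ballP : N => [r /= r0 rN]; exists r => // v vB vu.
have [Cv Wv] := rN v vB; rewrite !fF//; congr F.
rewrite -/u in vB vu; rewrite -[x in RHS]uE.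
apply: (@tran_plaque j i u r) => //; last exact: ballxx.
by move=> w /rN[Cw Ww]; split => //; exact: WD.
Qed.

(** On the connected set [C] of the plaque, the level set of [f] through [x] is both relatively open
    and relatively closed. *)
Lemma same_plaque_const x y : same_plaque x y -> (forall z, same_plaque x z -> llc z) -> f y = f x.
Proof.
move=> [i [c [C [Dx Dy cC CC [Cc Cx Cy]]]]] H.
have Hz u : C u -> same_plaque x (icoord M i u).
  move=> Cu; exists i, c, C; split => //; first exact/icoord_dom/CC.
  by split => //; rewrite icoordK//; exact: CC.
have Hb u : C u -> exists2 r : R, 0 < r & forall v, ball u r v -> C v -> f (icoord M i v) = f (icoord M i u).
  move=> Cu; have [r r0 Hr] := H _ (Hz u Cu) i (icoord_dom (CC _ Cu)); exists r => // v vB Cv.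
  by rewrite icoordK in Hr; [apply: Hr => //; rewrite !Cc|exact: CC].
pose B := [set u | C u /\ f (icoord M i u) = f x].
(* A property that depends only on the value of [f] cuts out a relatively open subset of [C]: the
   required open set is a union of balls on whose trace in [C] the property holds. It is used for
   the level set and for its complement. *)
have gen (P : set V) : (forall u v, C u -> P u -> C v -> f (icoord M i v) = f (icoord M i u) -> P v) ->
    exists2 O, open O & C `&` P = C `&` O.
  move=> HP; exists (\bigcup_(w in [set w : V * R | [/\ C w.1, P w.1, 0 < w.2 & forall v, ball w.1 w.2 v -> C v -> P v]])
     ball w.1 w.2).
    by apply: bigcup_open => w _; exact: ball_open.
  apply/seteqP; split => [u [Cu Pu]|u [Cu [w [_ _ _ Hw] wu]]]; last by split => //; exact: Hw.
  have [r r0 Hr] := Hb u Cu; split => //; exists (u, r); last exact: ballxx.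
  by split => //= v vB Cv; apply: (HP u v) => //; exact: Hr.
suff : B = C by move=> BC; have [] : B (coord M i y) by [rewrite BC]; rewrite coordK.
apply: cC; first by exists (coord M i x); split => //; rewrite coordK.
  have [|O oO E] := gen [set u | f (icoord M i u) = f x]; first by move=> u v _ /= <- _.
  by exists O.
have [|O oO E] := gen [set u | f (icoord M i u) <> f x]; first by move=> u v _ /= h _ ->.
exists (~` O); first exact: open_closedC.
apply/seteqP; split => [u [Cu Hu]|u [Cu nO]].
  by split => // Ou; have [] : (C `&` [set u | f (icoord M i u) <> f x]) u by rewrite E.
split => //; apply: contrapT => nf; apply: nO.
by have [] : (C `&` O) u by rewrite -E.
Qed.

End plaque_const.

Lemma same_plaque_sym (x y : M) : same_plaque x y -> same_plaque y x.
Proof. by move=> [i [c [C [Dx Dy cC CC [Cc Cx Cy]]]]]; exists i, c, C. Qed.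

Lemma leaf_refl (x : M) : leaf x x.
Proof. exact: Relation_Operators.rt_refl. Qed.
Lemma leaf_trans (x y z : M) : leaf x y -> leaf y z -> leaf x z.
Proof. exact: Relation_Operators.rt_trans. Qed.
Lemma leaf_plaque (x y : M) : same_plaque x y -> leaf x y.
Proof. exact: Relation_Operators.rt_step. Qed.
Lemma leaf_sym (x y : M) : leaf x y -> leaf y x.
Proof.
elim => [a b /same_plaque_sym/leaf_plaque//|a|a b c _ ba _ cb]; first exact: leaf_refl.
exact: leaf_trans cb ba.
Qed.

Lemma leaf_const (X : Type) (f : M -> X) x y : (forall z, leaf x z -> llc f z) -> leaf x y -> f y = f x.
Proof.
move=> H xy; move: H; elim: xy => [a b ab H|//|a b c ab IH1 bc IH2 H].
  by apply: same_plaque_const ab _ => z /leaf_plaque; exact: H.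
rewrite IH2 ?IH1// => z bz; apply: H; exact: leaf_trans ab bz.
Qed.

(** The segment between the two points is connected, stays in the ball and keeps its transverse
    coordinate. *)
Lemma ball_plaque i u0 (r : R) u v : ball u0 r `<=` cod M i -> ball u0 r u -> ball u0 r v ->
  rsubmx u = rsubmx v -> leaf (icoord M i u) (icoord M i v).
Proof.
move=> BC uB vB uv; apply: leaf_plaque.
pose C := (fun s : R => u + s *: (v - u)) @` [set` `[(0 : R), 1]].
have CB w : C w -> ball u0 r w.
  by move=> [s /= sI <-]; apply: ball_segment => //; move: sI; rewrite in_itv.
exists i, (rsubmx u), C; split; [exact/icoord_dom/BC|exact/icoord_dom/BC| |by move=> w /CB/BC|split].
- apply: connected_continuous_connected; first exact: segment_connected.
  apply: continuous_subspaceT => s; apply: differentiable_continuous.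
  have [d _] := @is_derive_line R _ _ id u (v - u) s (@derivable_id _ _ _ _).
  by apply/derivable1_diffP.
- by move=> _ [s _ <-]; rewrite linearD linearZ linearB /= uv subrr scaler0 addr0.
- by rewrite icoordK; [exists 0 => /=; [rewrite in_itv /= lexx ler01|rewrite scale0r addr0]|exact: BC].
- rewrite icoordK; last exact: BC.
  by exists 1 => /=; [rewrite in_itv /= lexx ler01|rewrite scale1r addrC subrK].
Qed.

Lemma ball_row_mx (u0 : V) (r : R) (a : 'rV[R]_p) (c : 'rV[R]_q) :
  ball u0 r (row_mx a c) <-> ball (lsubmx u0) r a /\ ball (rsubmx u0) r c.
Proof.
rewrite -!ball_normE /= -{1}(hsubmxK u0) opp_row_mx add_row_mx norm_row_mx gt_max.
by split => [/andP//|[-> ->]].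
Qed.

Lemma ball_pt (u0 : V) (r : R) u : ball u0 r u <-> ball (lsubmx u0) r (lsubmx u) /\ ball (rsubmx u0) r (rsubmx u).
Proof. by rewrite -ball_row_mx hsubmxK. Qed.

End manifold.

(** For each basic open set contained in some [O j] one such index is chosen; a countable base
    leaves countably many. *)
Lemma lindelof (T : topologicalType) (I : Type) (i0 : I) (O : I -> set T) : @second_countable T ->
  (forall i, open (O i)) -> (forall x, exists i, O i x) -> exists s : nat -> I, forall x, exists n, O (s n) x.
Proof.
move=> [B cB [_ bB]] oO cov; have [g gB] := countable_injP _ cB.
have /choice[s sP] n : exists i, (exists j b, [/\ B b, g b = n & b `<=` O j]) ->
    exists b, [/\ B b, g b = n & b `<=` O i].
  by have [[j Hj]|nH] := pselect (exists j b, [/\ B b, g b = n & b `<=` O j]); [exists j|exists i0].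
exists s => x; have [i Oix] := cov x.
have [b [Bb bx] bO] : filter_from [set U | B U /\ U x] id (O i).
  by apply: bB; exact: open_nbhs_nbhs.
have [|b' [Bb' gb bO']] := sP (g b); first by exists i, b.
by exists (g b); apply: bO'; rewrite (gB b' b) ?mem_set.
Qed.

Lemma finite_subcover (T : ptopologicalType) (K : set T) (O : nat -> set T) : compact K -> (forall n, open (O n)) ->
  (forall x, K x -> exists n, O n x) -> exists N, forall x, K x -> exists2 n, (n < N)%N & O n x.
Proof.
rewrite compact_cover => cK oO cov.
have [D' _ KD] := cK nat setT O (fun n _ => oO n) (fun x Kx => let: ex_intro n On := cov x Kx in ex_intro2 _ _ n I On).
exists (\max_(n <- finmap.enum_fset D') n).+1 => x /KD[n /= nD On]; exists n => //.
by rewrite ltnS; exact: leq_bigmax_seq.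
Qed.

Definition ratv {R : realType} {p} (z : 'rV[rat]_p) : 'rV[R]_p := map_mx ratr z.

Lemma ratv_dense (R : realType) p (a : 'rV[R]_p) (e : R) : 0 < e -> exists z, ball a e (ratv z).
Proof.
move=> e0; have e2 : 0 < e / 2 by rewrite divr_gt0.
have /choice[z zP] : forall i, exists z : rat, `|a 0 i - ratr z| < e / 2.
  move=> i; have [||x [+ [z _ zx]]] := @dense_rat R (ball (a 0 i) (e / 2)); rewrite -?zx.
  - by exists (a 0 i); exact: ballxx.
  - exact: ball_open.
  by exists z.
exists (\row_i z i); rewrite -ball_normE /=; apply: (@le_lt_trans _ _ (e / 2)); last by lra.
by apply: norm_le => [|i]; [exact: ltW|rewrite !mxE; apply: ltW; exact: zP].
Qed.

Section metric_facts.
Context {R : realType} {p q : nat} (M : foliatedManifold R p q) (g : bundleLikeMetric M).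
Implicit Types i j : chart M.

Lemma ck_gmx i k : ck k (cod M i) (g i). Proof. apply: smooth_ck; exact: gmx_smooth. Qed.
Lemma posdef_gmx i u : cod M i u -> posdef (g i u).
Proof. by move=> Cu; split; [exact: gmx_sym|move=> v v0; exact: gmx_pos]. Qed.
Lemma gam_leaf i u v : cod M i u -> rsubmx v = 0 -> 'D_v (gam (g i)) u = 0.
Proof.
apply: (@bundle_like_gam R p q (cod M i) (g i)); [exact: open_cod|by move=> k; exact: ck_gmx|by move=> w; exact: posdef_gmx|exact: gmx_bundle_like].
Qed.
Lemma gmx_tran i j u v w : tdom i j u ->
  gdot (g i) u v w = gdot (g j) (tran i j u) ('D_v (tran i j) u) ('D_w (tran i j) u).
Proof. by move=> [Cu Du]; exact: gmx_transition. Qed.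
Lemma gam_plaque i (u0 : 'rV[R]_(p + q)) (r : R) u v : ball u0 r `<=` cod M i -> ball u0 r u -> ball u0 r v ->
  rsubmx u = rsubmx v -> gam (g i) u = gam (g i) v.
Proof.
move=> BC uB vB uv; apply/matrixP => a b.
have dg w : ball u0 r w -> differentiable (gam (g i)) w.
  by move=> /BC; apply: dgam; [exact: open_cod|exact: ck_gmx|exact: posdef_gmx].
apply: (@plaque_const R p q R (fun w => gam (g i) w a b) u0 r) uv => // w.
  by move=> /dg dw; apply: differentiable_entry.
by move=> z wB z0; rewrite -(derive_entry _ _ _ (dg w wB)) gam_leaf ?mxE//; exact: BC.
Qed.

Lemma gam_tran (i j : chart M) u : tdom i j u ->
  gam (g i) u = TJ (tran i j) u *m gam (g j) (tran i j u) *m (TJ (tran i j) u)^T.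
Proof.
apply: (@gam_transition R p q (tdom i j) (cod M j) (g i) (g j) (tran i j)).
- by move=> w [Cw _]; exact: posdef_gmx.
- by move=> w; exact: posdef_gmx.
- by move=> k; exact: ck_tran.
- exact: fol_tran.
- by move=> w; exact: tran_cod.
- by move=> w v v' Tw; exact: gmx_tran.
Qed.

Lemma det_gam_tran i j u : tdom i j u ->
  Num.sqrt (\det (gam (g i) u)) = `|\det (TJ (tran i j) u)| * Num.sqrt (\det (gam (g j) (tran i j u))).
Proof. by move=> Tu; rewrite (gam_tran Tu) sqrt_det_congr. Qed.

End metric_facts.

Section holonomy.
Context {R : realType} {p q : nat} (M : foliatedManifold R p q) (g : bundleLikeMetric M).
Local Notation V := 'rV[R]_(p + q).
Local Notation Q := 'rV[R]_q.
Variables (i_ : nat -> chart M) (u_ : nat -> V) (r_ : nat -> R).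
Hypotheses (r0 : forall n, 0 < r_ n) (BC : forall n, ball (u_ n) (r_ n) `<=` cod M (i_ n)).

Definition obox n : set M := icoord M (i_ n) @` ball (u_ n) (r_ n).
Definition Tn n : set Q := ball (rsubmx (u_ n)) (r_ n).
Definition pt n (c : Q) : V := row_mx (lsubmx (u_ n)) c.
Definition rho n (c : Q) : R := Num.sqrt (\det (gam (g (i_ n)) (pt n c))).
Definition trv n (x : M) : Q := rsubmx (coord M (i_ n) x).
Hypothesis cov : forall x, exists n, obox n x.

Let B n := ball (u_ n) (r_ n).
Let tr n m := @tran R p q M (i_ n) (i_ m).

Lemma oboxP n x : obox n x <-> dom M (i_ n) x /\ ball (u_ n) (r_ n) (coord M (i_ n) x).
Proof.
split; first by move=> [u Bu <-]; split; [exact/icoord_dom/BC|rewrite icoordK//; exact: BC].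
by move=> [Dx Bx]; exists (coord M (i_ n) x) => //; exact: coordK.
Qed.

Lemma obox_open n : open (obox n).
Proof. by apply: icoord_open; [exact: ball_open|exact: BC]. Qed.

Lemma open_Tn n : open (Tn n). Proof. exact: ball_open. Qed.

Lemma ball_Tn n u : B n u -> Tn n (rsubmx u).
Proof. by move=> /ball_pt[]. Qed.

Lemma pt_ball n c : Tn n c -> B n (pt n c).
Proof. by move=> Tc; apply/ball_row_mx; split => //; exact: ballxx. Qed.

Lemma gam_pt n u : B n u -> gam (g (i_ n)) u = gam (g (i_ n)) (pt n (rsubmx u)).
Proof.
move=> Bu; apply: (@gam_plaque R p q M g (i_ n) (u_ n) (r_ n) u (pt n (rsubmx u)) (@BC n) Bu); last by rewrite row_mxKr.
exact/pt_ball/ball_Tn.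
Qed.

Lemma ck_pt k n : ck k setT (pt n).
Proof. by apply: ck_row_mx; [exact: openT|exact: ck_cst|apply: ck_id; exact: openT]. Qed.

Lemma gam_pt_pos n c : Tn n c -> posdef (gam (g (i_ n)) (pt n c)).
Proof.
by move=> /pt_ball/BC; apply: gam_pos => w; exact: posdef_gmx.
Qed.

Lemma ck_gam_pt k n : ck k (Tn n) (fun c => gam (g (i_ n)) (pt n c)).
Proof.
apply: (ck_comp_mx (V := cod M (i_ n))).
- exact: open_Tn.
- exact: open_cod.
- by move=> c /pt_ball/BC.
- by apply: ck_sub (ck_pt k n).
- by apply: ck_gam; [exact: open_cod|exact: ck_gmx|exact: posdef_gmx].
Qed.

Lemma ck_rho k n : ck k (Tn n) (rho n).
Proof.
apply: ck_sqrt; [exact: open_Tn|by move=> c /gam_pt_pos/posdef_det|].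
by apply: ck_det; [exact: open_Tn|exact: ck_gam_pt].
Qed.

Lemma rho_gt0 n c : Tn n c -> 0 < rho n c.
Proof. by move=> /gam_pt_pos/posdef_det; rewrite sqrtr_gt0. Qed.

Let O n m := [set u | [/\ B n u, tdom (i_ n) (i_ m) u & B m (tr n m u)]].
Let oO n m : open (O n m).
Proof.
have -> : O n m = (B n `&` tdom (i_ n) (i_ m)) `&` tr n m @^-1` B m.
  by apply/seteqP; split => [u []|u [[]]].
apply: open_preimage; last exact: ball_open.
  by apply: openI; [exact: ball_open|exact: open_tdom].
by move=> u [_ Tu]; exact: ck_cont (ck_tran _ _ 0) Tu.
Qed.

(** Slides along the plaque from the central transversal of box [n] to leaf coordinate [z], changes
    chart, and projects to the transversal of box [m]. Rational [z] keeps the family countable. *)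
Definition hol n m (z : 'rV[rat]_p) (c : Q) : Q := rsubmx (tr n m (row_mx (ratv z) c)).
Let hd n m z := [set c : Q | O n m (row_mx (ratv z) c)].
Let ohd n m z : open (hd n m z).
Proof.
have -> : hd n m z = setT `&` (fun c : Q => row_mx (ratv z) c) @^-1` O n m by rewrite setTI.
by apply: open_preimage => //; [exact: openT|move=> c _; exact: continuous_row_mxr].
Qed.

Let ck_hol k n m z : ck k (hd n m z) (hol n m z).
Proof.
apply: (ck_comp_mx (V := O n m) (f := fun c : Q => row_mx (ratv z) c) (g := fun u => rsubmx (tr n m u))) => //.
  by apply: ck_row_mx => //; [exact: ck_cst|exact: ck_id].
apply: ck_rsubmx => //; apply: ck_sub (ck_tran _ _ k); by move=> u [].
Qed.

Let jac_hol n m z c : hd n m z c -> 'J (hol n m z) c = TJ (tr n m) (row_mx (ratv z) c).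
Proof.
move=> Hc; have [_ Tu _] := Hc; apply: mulmx_inj => w.
have dh := ck_diff (ck_hol 0 n m z) Hc; have dt := ck_diff (ck_tran _ _ 0) Tu.
rewrite (mul_TJ w dt) -(deriveEjacobian w dh).
have L1 : is_derive (0 : R) (1 : R) (fun s : R => hol n m z (c + s *: w)) ('D_w (hol n m z) c).
  by have := @is_derive_line R _ _ (hol n m z) c w 0; rewrite scale0r addr0; apply; exact/diff_derivable.
have L2 : is_derive (0 : R) (1 : R) (fun s : R => hol n m z (c + s *: w))
    (rsubmx ('D_(row_mx 0 w) (tr n m) (row_mx (ratv z) c))).
  have dr := differentiable_rsubmx dt.
  have := @is_derive_line R _ _ (fun u => rsubmx (tr n m u)) (row_mx (ratv z) c) (row_mx 0 w) 0.
  rewrite scale0r addr0 => /(_ (diff_derivable dr)); rewrite (derive_rsubmx _ dt).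
  congr is_derive; apply/funext => s; rewrite /hol; congr (rsubmx (tr n m _)).
  by rewrite scale_row_mx scaler0 add_row_mx addr0.
by case: L1 => _ <-; case: L2 => _ <-.
Qed.

Let K : countType := (nat * nat * 'rV[rat]_p * 'rV[rat]_p)%type.
Let inv (k : K) : K := (k.1.1.2, k.1.1.1, k.2, k.1.2).
Let hm (k : K) := hol k.1.1.1 k.1.1.2 k.1.2.
(** Going back requires a leaf coordinate in the second box, carried as [k.2]. The interior makes
    the domain open, and [D] shrinks it once more so that [hm k] and [hm (inv k)] are inverse
    diffeomorphisms between [D k] and [D (inv k)]. *)
Let E (k : K) : set Q := [set c | [/\ hd k.1.1.1 k.1.1.2 k.1.2 c, hd k.1.1.2 k.1.1.1 k.2 (hm k c)
  & hm (inv k) (hm k c) = c]]^°.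
Let D (k : K) := E k `&` hm k @^-1` E (inv k).

Let EP k c : E k c -> [/\ hd k.1.1.1 k.1.1.2 k.1.2 c, hd k.1.1.2 k.1.1.1 k.2 (hm k c) & hm (inv k) (hm k c) = c].
Proof. exact: interior_subset. Qed.
Let Ehd k c : E k c -> hd k.1.1.1 k.1.1.2 k.1.2 c. Proof. by case/EP. Qed.
Let oD k : open (D k).
Proof.
apply: open_preimage; [exact: open_interior| |exact: open_interior].
by move=> c /Ehd; exact: ck_cont (ck_hol 0 _ _ _).
Qed.
Let invK k : inv (inv k) = k. Proof. by case: k => [[[n m] a] b]. Qed.
Let DK k c : D k c -> hm (inv k) (hm k c) = c. Proof. by move=> [/EP[]]. Qed.
Let Dinv k c : D k c -> D (inv k) (hm k c).
Proof. by move=> Dc; have [Ec Ec'] := Dc; split => //=; rewrite invK DK. Qed.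

Let diffeo_hol k : diffeo (D k) (D (inv k)) (hm k) (hm (inv k)).
Proof.
split => //.
- by apply: ck_sub (ck_hol 1 k.1.1.1 k.1.1.2 k.1.2) => c [/Ehd].
- by apply: ck_sub (ck_hol 1 k.1.1.2 k.1.1.1 k.2) => c [/Ehd].
- split => [c|c|c|c]; [exact: Dinv|by rewrite -{2}(invK k); exact: Dinv|exact: DK|by rewrite -{2}(invK k); exact: DK].
Qed.

Let D_Tn k : D k `<=` Tn k.1.1.1.
Proof. by move=> c [/Ehd[/ball_row_mx[]]]. Qed.

(** The transverse metric is constant on plaques, so its density on the transversal equals the one
    at the point where the chart is changed, and there it transforms by the transverse Jacobian. *)
Let rho_hol k c : D k c -> rho k.1.1.1 c = `|\det ('J (hm k) c)| * rho k.1.1.2 (hm k c).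
Proof.
move=> [/Ehd Hc _]; have [Bu Tu Bv] := Hc; rewrite jac_hol// /rho.
transitivity (Num.sqrt (\det (gam (g (i_ k.1.1.1)) (row_mx (ratv k.1.2) c)))); first by rewrite (gam_pt Bu) row_mxKr.
by rewrite (det_gam_tran g Tu); congr (_ * Num.sqrt (\det _)); exact: gam_pt Bv.
Qed.

Definition transv := @tspace R q.
Definition tnu : {measure set transv -> \bar R} := tmeasure open_Tn (fun n c Tc => ck_cont (ck_rho 0 n) Tc)
  (fun n c Tc => ltW (rho_gt0 Tc)).

Let sh (k : K) : set transv := [set k.1.1.1] `*` D k.
Let shm (k : K) (z : transv) : transv := (k.1.1.2, hm k z.2).

Let pmp_hol k : pmp tnu (sh k) (sh (inv k)) (shm k) (shm (inv k)).
Proof. exact: (pmp_diffeo _ _ _ (diffeo_hol k) (@D_Tn k) (@D_Tn (inv k)) (@rho_hol k)). Qed.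

Fixpoint wD (s : seq K) : set transv := if s is k :: s' then sh k `&` shm k @^-1` wD s' else setT.
Fixpoint wh (s : seq K) (z : transv) : transv := if s is k :: s' then wh s' (shm k z) else z.
Fixpoint wh' (s : seq K) (z : transv) : transv := if s is k :: s' then shm (inv k) (wh' s' z) else z.
Fixpoint wD' (s : seq K) : set transv := if s is k :: s' then wD' s' `&` wh' s' @^-1` sh (inv k) else setT.

Let pmp_word s : pmp tnu (wD s) (wD' s) (wh s) (wh' s).
Proof. by elim: s => [|k s IH]; [exact: pmp_id|exact: (pmp_comp (pmp_hol k) IH)]. Qed.

Let word (n : nat) : seq K := odflt [::] (unpickle n).
(** The orbit relation of the holonomy pseudogroup. Words in the countably many elementary maps are
    numbered, so that it becomes an instance of [reach]. *)
Definition hreach : transv -> set transv := reach (fun n => wD (word n)) (fun n => wh (word n)).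

Lemma hreachP c e : hreach c e <-> exists2 s, wD s c & wh s c = e.
Proof.
split; first by move=> [n Dn hn]; exists (word n).
by move=> [s Ds hs]; exists (pickle s); rewrite /word pickleK.
Qed.

Lemma hreach_enum c : exists (P : set nat) (f : nat -> transv), set_bij P (hreach c) f.
Proof.
have [P HP] := reach_enum (fun n => wD (word n)) (fun n => wh (word n)) c.
by exists P, (fun n => wh (word n) c).
Qed.

Lemma measurable_hsum (b : transv -> \bar R) : measurable_fun setT b -> (forall e, 0 <= b e)%E ->
  measurable_fun setT (fun c => \esum_(e in hreach c) b e)%E.
Proof. exact: (measurable_esum_reach (fun n => pmp_word (word n)) (@tspace_diag R q)). Qed.

Lemma hreach_transport (a b : transv -> R) : measurable_fun setT a -> measurable_fun setT b ->
  (forall c, 0 <= a c) -> (forall c, 0 <= b c) ->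
  (\int[tnu]_c ((a c)%:E * \esum_(e in hreach c) (b e)%:E) =
   \int[tnu]_e ((b e)%:E * \esum_(c in [set c | hreach c e]) (a c)%:E))%E.
Proof. exact: (mass_transport (fun n => pmp_word (word n)) (@tspace_diag R q)). Qed.

Lemma measurable_hsat (A : set transv) : measurable A -> measurable [set c | exists2 e, hreach c e & A e].
Proof.
move=> mA; rewrite (_ : [set c | _] = \bigcup_n (wD (word n) `&` wh (word n) @^-1` A)).
  by apply: bigcupT_measurable => n; apply: (pmp_mh (pmp_word (word n))) => //; exact: pmp_mD (pmp_word _).
apply/seteqP; split => [c [e [n Dn hn] Ae]|c [n _ [Dn An]]]; first by exists n => //; split => //=; rewrite hn.
by exists (wh (word n) c) => //; exists n.
Qed.

Lemma hreach_refl c : hreach c c.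
Proof. by apply/hreachP; exists [::]. Qed.

Lemma hreach_trans c e f : hreach c e -> hreach e f -> hreach c f.
Proof.
move=> /hreachP[s + +] /hreachP[s' + +] => sc se se' sf; apply/hreachP; exists (s ++ s').
  by elim: s c sc se => [c _ /= -> //|k s IH c [/= sk sD] sE]; split => //; exact: IH.
by elim: s c sc se => [c _ /= -> //|k s IH c [/= sk sD] sE]; exact: IH.
Qed.

Let shE k z : sh k z -> [/\ hreach z (shm k z), sh (inv k) (shm k z) & shm (inv k) (shm k z) = z].
Proof.
case: z => n c [/= nk Dc]; split; first by apply/hreachP; exists [:: k].
  by split => //=; exact: Dinv.
by rewrite /shm /= DK// nk.
Qed.

Lemma hreach_sym c e : hreach c e -> hreach e c.
Proof.
move=> /hreachP[s + +]; elim: s c => [c _ <-|k s IH c [/= sk sD] sE]; first exact: hreach_refl.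
have [_ sk' kK] := shE sk; apply: hreach_trans (IH _ sD sE) _.
by rewrite -{2}kK; have [] := shE sk'.
Qed.

Definition valid (z : transv) := Tn z.1 z.2.
Definition tpt (z : transv) : M := icoord M (i_ z.1) (pt z.1 z.2).

Lemma obox_tpt z : valid z -> obox z.1 (tpt z).
Proof. by move=> vz; exists (pt z.1 z.2) => //; exact: pt_ball. Qed.

Lemma trv_tpt z : valid z -> trv z.1 (tpt z) = z.2.
Proof. by move=> vz; rewrite /trv icoordK ?row_mxKr//; exact/BC/pt_ball. Qed.

Lemma trv_valid n x : obox n x -> valid (n, trv n x).
Proof. by move=> /oboxP[_ /ball_Tn]. Qed.

Lemma leaf_trv n x : obox n x -> leaf x (tpt (n, trv n x)).
Proof.
move=> ox; have [Dx Bx] := (oboxP n x).1 ox.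
rewrite -{1}(coordK Dx); apply: (ball_plaque (@BC n)) => //; last by rewrite row_mxKr.
by apply: pt_ball; exact: ball_Tn.
Qed.

Let hreach_step k z : sh k z -> valid z /\ leaf (tpt z) (tpt (shm k z)).
Proof.
case: z => n c [/= -> Dc]; split; first exact: D_Tn.
have [Bu Tu Bv] := Ehd (proj1 Dc).
have l1 : leaf (tpt (k.1.1.1, c)) (icoord M (i_ k.1.1.1) (row_mx (ratv k.1.2) c)).
  by apply: (ball_plaque (@BC k.1.1.1)) => //; [apply: pt_ball; exact: D_Tn|rewrite !row_mxKr].
apply: leaf_trans l1 _; rewrite -(icoord_tran Tu).
apply: (ball_plaque (@BC k.1.1.2)) => //; last by rewrite row_mxKr.
by apply: pt_ball; exact: ball_Tn.
Qed.

Lemma hreach_valid c e : hreach c e -> valid c -> valid e.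
Proof.
move=> /hreachP[s + +]; elim: s c => [c _ <-//|k s IH c [/= sk sD] sE] _; apply: (IH _ sD sE).
by have [_ /hreach_step[]] := shE sk.
Qed.

Lemma hreach_leaf c e : hreach c e -> leaf (tpt c) (tpt e).
Proof.
move=> /hreachP[s + +]; elim: s c => [c _ <-|k s IH c [/= sk sD] sE]; first exact: leaf_refl.
by have [_ h] := hreach_step sk; apply: leaf_trans h (IH _ sD sE).
Qed.

(* At a common point of two boxes, an elementary holonomy map based at nearby rational leaf coordinates relates the plaques. *)
Lemma hreach_cross n m x : obox n x -> obox m x -> hreach (n, trv n x) (m, trv m x).
Proof.
move=> /oboxP[Dx Bx] /oboxP[Dx' Bx']; rewrite /trv; set u := coord M (i_ n) x; set v := coord M (i_ m) x.
have uv : tr n m u = v by rewrite /tr /tran /= coordK.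
have vu : tr m n v = u by rewrite /tr /tran /= coordK.
have Tu : tdom (i_ n) (i_ m) u by split; [exact: coord_cod|rewrite coordK].
have Tv : tdom (i_ m) (i_ n) v by split; [exact: coord_cod|rewrite coordK].
have Ou : O n m u by split => //; rewrite uv.
have Ov : O m n v by split => //; rewrite vu.
have [r1 /= r10 H1] : exists2 r : R, 0 < r & ball u r `<=` O n m.
  by apply/nbhs_ballP; exact: open_nbhs_nbhs.
have [r2 /= r20 H2] : exists2 r : R, 0 < r & ball v r `<=` O m n `&` tr m n @^-1` ball u r1.
  apply/nbhs_ballP; apply: open_nbhs_nbhs; split; last by split => //=; rewrite vu; exact: ballxx.
  by apply: open_preimage; [exact: oO|move=> w [_ Tw _]; exact: ck_cont (ck_tran _ _ 0) Tw|exact: ball_open].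
have [r3 /= r30 H3] : exists2 r : R, 0 < r & ball u r `<=` ball u r1 `&` tr n m @^-1` ball v r2.
  apply/nbhs_ballP; apply: open_nbhs_nbhs; split; last by split => /=; [|rewrite uv]; exact: ballxx.
  by apply: open_preimage; [exact: ball_open|move=> w /H1[_ Tw _]; exact: ck_cont (ck_tran _ _ 0) Tw|exact: ball_open].
have [a aB] := ratv_dense (lsubmx u) r30; have [b bB] := ratv_dense (lsubmx v) r20.
have aB1 : ball (lsubmx u) r1 (ratv a).
  by have [] := H3 (row_mx (ratv a) (rsubmx u)) (proj2 (ball_row_mx _ _ _ _) (conj aB (ballxx _ r30))) => /ball_row_mx[].
pose k : K := (n, m, a, b).
have P1 w w' : ball u r1 w -> ball u r1 w' -> rsubmx w = rsubmx w' -> rsubmx (tr n m w) = rsubmx (tr n m w').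
  by apply: tran_plaque => w'' /H1[].
have P2 w w' : ball v r2 w -> ball v r2 w' -> rsubmx w = rsubmx w' -> rsubmx (tr m n w) = rsubmx (tr m n w').
  by apply: tran_plaque => w'' /H2[[]].
have G1 c : ball (rsubmx u) r3 c -> [/\ hd n m a c, hd m n b (hm k c) & hm (inv k) (hm k c) = c].
  move=> cB; have /H3[w1 w2] : ball u r3 (row_mx (ratv a) c) by apply/ball_row_mx.
  have w3 : ball v r2 (row_mx (ratv b) (hm k c)) by apply/ball_row_mx; split => //; have /ball_pt[] := w2.
  split; [exact: H1|by have [] := H2 _ w3|].
  rewrite {1}/hm /= /hol (P2 _ _ w3 w2); last by rewrite row_mxKr.
  by rewrite /tr tranK ?row_mxKr//; have [] := H1 _ w1.
have G2 c : ball (rsubmx v) r2 c -> [/\ hd m n b c, hd n m a (hm (inv k) c) & hm k (hm (inv k) c) = c].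
  move=> cB; have wB : ball v r2 (row_mx (ratv b) c) by apply/ball_row_mx.
  have [w1 w2] := H2 _ wB.
  have w3 : ball u r1 (row_mx (ratv a) (hm (inv k) c)) by apply/ball_row_mx; split => //; have /ball_pt[] := w2.
  split; [exact: w1|exact: H1|].
  rewrite {1}/hm /= /hol (P1 _ _ w3 w2); last by rewrite row_mxKr.
  by rewrite /tr tranK ?row_mxKr//; case: w1.
have hmu : hm k (rsubmx u) = rsubmx v.
  rewrite /hm /= /hol -uv; apply: P1; [|exact: ballxx|by rewrite row_mxKr].
  by apply/ball_row_mx; split => //; exact: ballxx.
have Dk : D k (rsubmx u).
  split; first by apply/nbhs_ballP; exists r3 => // c /G1.
  by rewrite /= hmu; apply/nbhs_ballP; exists r2 => // c /G2.
rewrite -hmu; apply/hreachP; exists [:: k] => //; by split.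
Qed.

(** To a point of M corresponds the orbit of its plaque. It is independent of the box by
    [hreach_cross] and locally constant along leaves, hence constant on each leaf. *)
Lemma leaf_hreach c e : valid c -> valid e -> leaf (tpt c) (tpt e) -> hreach c e.
Proof.
move=> vc ve ce; pose f z := [set d | exists2 n, obox n z & hreach (n, trv n z) d].
have fE n z : obox n z -> f z = hreach (n, trv n z).
  move=> oz; apply/seteqP; split => [d [m om H]|d H]; last by exists n.
  exact: hreach_trans (hreach_cross oz om) H.
have Hf z : leaf (tpt c) z -> llc f z.
  move=> _; have [n oz] := cov z; apply: (@llc_local _ _ _ _ _ _ (i_ n) z (obox n) (fun c => hreach (n, c))) => //.
  - exact: obox_open.
  - by move=> y /oboxP[].
  - by move=> y /fE.
have := leaf_const Hf ce; rewrite (fE _ _ (obox_tpt vc)) (fE _ _ (obox_tpt ve)) !trv_tpt//.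
rewrite -!surjective_pairing => H; have := hreach_refl e; by rewrite H.
Qed.

End holonomy.

(** * Leaf volumes *)

Section leaf_charts.
Context {R : realType} {p q : nat} (M : foliatedManifold R p q) (g : bundleLikeMetric M).
Local Notation V := 'rV[R]_(p + q).
Local Notation J := (chart M * 'rV[R]_q)%type.

Definition lden (i : chart M) (u : V) : R := Num.sqrt (\det (ulsubmx (g i u))).

Lemma posdef_ul_gmx i u : cod M i u -> posdef (ulsubmx (g i u)).
Proof. by move=> Cu; apply: posdef_ul; exact: posdef_gmx. Qed.

Lemma lden_gt0 i u : cod M i u -> 0 < lden i u.
Proof. by move=> Cu; rewrite sqrtr_gt0; exact/posdef_det/posdef_ul_gmx. Qed.

Lemma ck_lden k i : ck k (cod M i) (lden i).
Proof.
apply: ck_sqrt; [exact: open_cod|by move=> u /posdef_ul_gmx/posdef_det|].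
apply: ck_det; [exact: open_cod|].
apply: (ck_lsubmx (f := fun u => usubmx (g i u))); first exact: open_cod.
by apply: ck_usubmx; [exact: open_cod|exact: ck_gmx].
Qed.

Let D (ic : J) : set 'rV[R]_p := [set a | cod M ic.1 (row_mx a ic.2)].
Let e (ic : J) (a : 'rV[R]_p) : M := icoord M ic.1 (row_mx a ic.2).
Let h (ic : J) (a : 'rV[R]_p) : R := Num.sqrt (\det (ulsubmx (g ic.1 (row_mx a ic.2)))).
Let t (j l : J) (a : 'rV[R]_p) : 'rV[R]_p := lsubmx (tran j.1 l.1 (row_mx a j.2)).
Let O j l := [set a | D j a /\ (e l @` D l) (e j a)].

Let OE j l a : O j l a <-> tdom j.1 l.1 (row_mx a j.2) /\ rsubmx (tran j.1 l.1 (row_mx a j.2)) = l.2.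
Proof.
split=> [[Da [b Db ba]]|[Ta Hr]].
  have Ta : tdom j.1 l.1 (row_mx a j.2) by split => //; rewrite -[icoord _ _ _]ba; exact: icoord_dom.
  by split => //; rewrite /tran /= -[icoord _ j.1 _]ba icoordK// row_mxKr.
split; first by case: Ta.
have tE : row_mx (t j l a) l.2 = tran j.1 l.1 (row_mx a j.2) by rewrite -Hr hsubmxK.
exists (t j l a); rewrite /D /e /= tE; [exact: tran_cod|exact: icoord_tran].
Qed.

Let oD j : open (D j).
Proof.
rewrite (_ : D j = setT `&` (fun a => row_mx a j.2) @^-1` cod M j.1); last by rewrite setTI.
by apply: open_preimage; [exact: openT|move=> a _; exact: continuous_row_mxl|exact: open_cod].
Qed.

(** Along a slice the transverse coordinate after a change of chart is locally constant, so lying on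
    the slice of [l] is an open condition there. *)
Let oO j l : open (O j l).
Proof.
rewrite openE => a /OE[Ta Hr].
have [r /= r0 rT] : exists2 r : R, 0 < r & ball (row_mx a j.2) r `<=` tdom j.1 l.1.
  by apply/nbhs_ballP; apply: open_nbhs_nbhs; split => //; exact: open_tdom.
apply/nbhs_ballP; exists r => // b ab; apply/OE.
have bB : ball (row_mx a j.2) r (row_mx b j.2).
  by apply/ball_row_mx; rewrite row_mxKl row_mxKr; split => //; exact: ballxx.
split; first exact: rT.
by rewrite -Hr; apply: (tran_plaque rT) => //; [exact: ballxx|rewrite !row_mxKr].
Qed.

Let ct k j l : ck k (O j l) (t j l).
Proof.
apply: (ck_comp_mx (V := tdom j.1 l.1) (f := fun a => row_mx a j.2) (g := fun u => lsubmx (tran j.1 l.1 u))) => //.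
- exact: open_tdom.
- by move=> a /OE[].
- by apply: ck_row_mx => //; [exact: ck_id|exact: ck_cst].
- by apply: ck_lsubmx; [exact: open_tdom|exact: ck_tran].
Qed.

Let tD j l a : O j l a -> D l (t j l a).
Proof. by move=> /OE[Ta Hr]; rewrite /D /t /= -Hr hsubmxK; exact: tran_cod. Qed.

Let tE j l a : O j l a -> e l (t j l a) = e j a.
Proof. by move=> /OE[Ta Hr]; rewrite /e /t /= -Hr hsubmxK; exact: icoord_tran. Qed.

Let e_inj j a b : D j a -> D j b -> e j a = e j b -> a = b.
Proof. by move=> Da Db /(icoord_inj Da Db)/eq_row_mx[]. Qed.

Let ch j a : D j a -> {for a, continuous (h j)}.
Proof.
move=> Da; apply: (continuous_comp (f := fun a => row_mx a j.2) (g := lden j.1)).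
  exact: continuous_row_mxl.
exact: (ck_cont (ck_lden 0 j.1) Da).
Qed.

Let h0 j a : D j a -> 0 <= h j a. Proof. by move=> _; exact: sqrtr_ge0. Qed.

Let jac_t j l a : O j l a -> 'J (t j l) a = ulsubmx ('J (tran j.1 l.1) (row_mx a j.2)).
Proof.
move=> Oa; have [Ta Hr] := (OE _ _ _).1 Oa; apply: mulmx_inj => w.
have dh := ck_diff (ct 0 j l) Oa; have dt := ck_diff (ck_tran _ _ 0) Ta.
rewrite -(deriveEjacobian w dh).
have dl : differentiable (fun u => lsubmx (tran j.1 l.1 u)) (row_mx a j.2).
  by apply: (ck_diff (k := 0)) Ta; apply: ck_lsubmx; [exact: open_tdom|exact: ck_tran].
have L1 : is_derive (0 : R) (1 : R) (fun s : R => t j l (a + s *: w)) ('D_w (t j l) a).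
  by have := @is_derive_line R _ _ (t j l) a w 0; rewrite scale0r addr0; apply; exact/diff_derivable.
have L2 : is_derive (0 : R) (1 : R) (fun s : R => t j l (a + s *: w))
    ('D_(row_mx w 0) (fun u => lsubmx (tran j.1 l.1 u)) (row_mx a j.2)).
  have := @is_derive_line R _ _ (fun u => lsubmx (tran j.1 l.1 u)) (row_mx a j.2) (row_mx w 0) 0.
  rewrite scale0r addr0 => /(_ (diff_derivable dl)).
  congr is_derive; apply/funext => s; rewrite /t; congr (lsubmx (tran _ _ _)).
  by rewrite scale_row_mx scaler0 add_row_mx addr0.
case: L1 => _ <-; case: L2 => _ ->.
rewrite (_ : (fun u => lsubmx (tran j.1 l.1 u)) = (fun u => mxsub id (lshift q) (tran j.1 l.1 u))); last first.
  by apply/funext => u; rewrite lsubmxEsub.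
have [_ ->] := derive_mxsub (id : 'I_1 -> 'I_1) (@lshift p q) (row_mx w 0) dt; rewrite -lsubmxEsub.
rewrite (deriveEjacobian _ dt) -{1}(submxK ('J (tran j.1 l.1) (row_mx a j.2))).
by rewrite mul_row_block !mul0mx !addr0 row_mxKl.
Qed.

Let ht j l a : O j l a -> h j a = `|\det ('J (t j l) a)| * h l (t j l a).
Proof.
move=> Oa; have [Ta Hr] := (OE _ _ _).1 Oa; rewrite jac_t// /h /t /= -Hr hsubmxK.
have -> : ulsubmx (g j.1 (row_mx a j.2)) = ulsubmx ('J (tran j.1 l.1) (row_mx a j.2)) *m
   ulsubmx (g l.1 (tran j.1 l.1 (row_mx a j.2))) *m (ulsubmx ('J (tran j.1 l.1) (row_mx a j.2)))^T.
  apply: (@ul_transition R p q (tdom j.1 l.1) (g j.1) (g l.1) (tran j.1 l.1)) Ta.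
  - by move=> k; exact: ck_tran.
  - exact: fol_tran.
  - by move=> u v w; exact: gmx_tran.
exact: sqrt_det_congr.
Qed.

Lemma vol_L_pieces (x : M) (j_ : nat -> J) (A_ : nat -> set 'rV[R]_p) :
  (forall m, borel (A_ m)) -> (forall m a, A_ m a -> cod M (j_ m).1 (row_mx a (j_ m).2)) ->
  leaf x = \bigcup_m (e (j_ m) @` A_ m) -> trivIset setT (fun m => e (j_ m) @` A_ m) ->
  vol_L g x = (\sum_(0 <= m <oo) \int[lam R p]_(a in A_ m) (lden (j_ m).1 (row_mx a (j_ m).2))%:E)%E.
Proof.
move=> mA AD LE tA.
exact: (atlas_volume oD ch h0 e_inj oO (fun j l => @ct 1 j l) tD tE ht mA AD LE tA).
Qed.

Lemma vol_L_ge (x : M) (n : nat) (j : 'I_n -> J) (A : 'I_n -> set 'rV[R]_p) :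
  (forall k, borel (A k)) -> (forall k a, A k a -> cod M (j k).1 (row_mx a (j k).2)) ->
  (forall k, e (j k) @` A k `<=` leaf x) -> trivIset setT (fun k => e (j k) @` A k) ->
  (\sum_(k < n) \int[lam R p]_(a in A k) (lden (j k).1 (row_mx a (j k).2))%:E <= vol_L g x)%E.
Proof.
move=> mA AD AL tA; apply: ereal_sup_ubound; exists n, j, A; split => //; apply: eq_bigr => k _.
rewrite (chart_volE oD ch h0 (mA k) (AD k)); apply: eq_integral => a /set_mem Aa.
by rewrite /= indicE mem_set ?mulr1//; exact: AD.
Qed.

Lemma vol_L_leaf (x y : M) : leaf x y -> vol_L g x = vol_L g y.
Proof.
move=> xy; rewrite /vol_L; congr riemannian_volume; apply/seteqP; split => z; last exact: leaf_trans.
by apply: leaf_trans; exact: leaf_sym.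
Qed.

End leaf_charts.

Section lebesgue_balls.
Context (R : realType) (n : nat).

Lemma lam_ball_lty (c : 'rV[R]_n) r : 0 <= r -> (lam R n (ball c r) < +oo)%E.
Proof.
move=> r0; apply: (@le_lt_trans _ _ (lam R n (cube (\row_i (c 0 i - r)) (2 * r)))).
  apply: le_measure; rewrite ?inE; [apply: open_Borel; exact: ball_open|exact: measurable_cube|].
  move=> u; rewrite -ball_normE /= => cu i; rewrite mxE.
  by have := le_lt_trans (norm_coord (c - u) i) cu; rewrite !mxE ltr_norml; lra.
by rewrite lam_cube ?ltry// mulr_ge0.
Qed.

Lemma lam_ball_gt0 (c : 'rV[R]_n) r : 0 < r -> (0 < lam R n (ball c r))%E.
Proof.
move=> r0; apply: (@lt_le_trans _ _ (lam R n (cube c (r / 2)))).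
  have r2 : 0 < r / 2 by rewrite divr_gt0.
  by rewrite lam_cube ?lte_fin ?exprn_gt0// ltW.
apply: le_measure; rewrite ?inE; [exact: measurable_cube|apply: open_Borel; exact: ball_open|].
move=> u H; rewrite -ball_normE /=; apply: (@le_lt_trans _ _ (r / 2)); last by lra.
apply: norm_le => [|i]; first by rewrite divr_ge0// ltW.
by have := H i; rewrite !mxE ler_norml; lra.
Qed.
End lebesgue_balls.

Lemma measurable_sheets (R : realType) q (f : @tspace R q -> \bar R) :
  (forall n, measurable_fun setT (fun c : Borel 'rV[R]_q => f (n, c))) -> measurable_fun setT f.
Proof.
move=> mf _ Y mY; rewrite setTI (_ : f @^-1` Y = \bigcup_n ([set n] `*` ((fun c => f (n, c)) @^-1` Y))).
  by apply: bigcupT_measurable => n; apply: measurable_sheet; rewrite -[X in measurable X]setTI; exact: mf.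
by apply/seteqP; split => [[n c] /= H|[n c] [m _ /= [-> H]]//]; exists n.
Qed.

(** * Volume of M in foliated charts *)

Section chart_volume.
Context {R : realType} {p q : nat} (M : foliatedManifold R p q) (g : bundleLikeMetric M).
Local Notation V := 'rV[R]_(p + q).

Definition mden (i : chart M) (u : V) : R := Num.sqrt (\det (g i u)).

Lemma ck_mden k i : ck k (cod M i) (mden i).
Proof.
apply: ck_sqrt; [exact: open_cod|by move=> u /(posdef_gmx g)/posdef_det|].
by apply: ck_det; [exact: open_cod|exact: ck_gmx].
Qed.

Lemma mden_split i u : cod M i u -> mden i u = lden g i u * Num.sqrt (\det (gam (g i) u)).
Proof.
move=> Cu; have pu := posdef_gmx g Cu; have pul := posdef_ul_gmx g Cu.
rewrite /mden /lden (det_schur pu (posdef_unit pul)) sqrtrM//; exact/ltW/posdef_det.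
Qed.

Let O (i j : chart M) := [set u | cod M i u /\ (icoord M j @` cod M j) (icoord M i u)].
Let OE i j : O i j = tdom i j.
Proof.
apply/seteqP; split => u [Cu H]; split => //.
  by case: H => v Cv <-; exact: icoord_dom.
by exists (coord M j (icoord M i u)); [exact: coord_cod|exact: coordK].
Qed.

Lemma mu_M_pieces (B : set M) (j_ : nat -> chart M) (A_ : nat -> set V) :
  (forall m, borel (A_ m)) -> (forall m, A_ m `<=` cod M (j_ m)) ->
  B = \bigcup_m (icoord M (j_ m) @` A_ m) -> trivIset setT (fun m => icoord M (j_ m) @` A_ m) ->
  mu_M g B = (\sum_(0 <= m <oo) \int[lam R (p + q)]_(u in A_ m) (mden (j_ m) u)%:E)%E.
Proof.
move=> mA AD BE tA; apply: (@atlas_volume R M (chart M) (p + q) (cod M) (icoord M) mden (fun i j => tran i j)) => //.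
- exact: open_cod.
- by move=> j u Cu; exact: ck_cont (ck_mden 0 j) Cu.
- by move=> j u _; exact: sqrtr_ge0.
- exact: icoord_inj.
- by move=> j l; rewrite -/(O j l) OE; exact: open_tdom.
- by move=> j l; rewrite -/(O j l) OE; exact: ck_tran.
- by move=> j l u; rewrite -/(O j l u) OE; exact: tran_cod.
- by move=> j l u; rewrite -/(O j l u) OE; exact: icoord_tran.
- move=> j l u; rewrite -/(O j l u) OE => Tu; rewrite /mden.
  have -> : g j u = 'J (tran j l) u *m g l (tran j l u) *m ('J (tran j l) u)^T.
    apply: (@GHJ R p q (tdom j l) (g j) (g l) (tran j l)) Tu; first by move=> k; exact: ck_tran.
    by move=> w v v'; exact: gmx_tran.
  exact: sqrt_det_congr.
Qed.

End chart_volume.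

Section volumes.
Context {R : realType} {p q : nat} (M : foliatedManifold R p q) (g : bundleLikeMetric M).
Local Notation V := 'rV[R]_(p + q).
Local Notation Q := 'rV[R]_q.
Variables (i_ : nat -> chart M) (u_ : nat -> V) (r_ : nat -> R).
Hypotheses (r0 : forall n, 0 < r_ n) (BC : forall n, ball (u_ n) (r_ n) `<=` cod M (i_ n)).
Variable cell : nat -> set M.
Hypotheses (mcell : forall n, borel (cell n)) (cellO : forall n, cell n `<=` obox i_ u_ r_ n)
  (tcell : trivIset setT cell) (ccell : forall x, exists n, cell n x).
Hypothesis lbd : forall n, exists2 C : R, 0 < C & forall u, ball (u_ n) (r_ n) u -> C^-1 <= lden g (i_ n) u <= C.

Let B n : set V := ball (u_ n) (r_ n).
Let cov x : exists n, obox i_ u_ r_ n x.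
Proof. by have [n /cellO] := ccell x; exists n. Qed.
Local Notation tpt := (tpt i_ u_).
Local Notation trv := (trv i_).
Local Notation valid := (valid u_ r_).
Local Notation hreach := (hreach i_ u_ r_).
Local Notation tnu := (tnu g r0 BC).
Local Notation transv := (@transv R q).

Let cellu n := B n `&` icoord M (i_ n) @^-1` cell n.
Let mico n : measurable_fun (B n : set (Borel V)) (icoord M (i_ n) : Borel V -> Borel M).
Proof. by apply: continuous_Borel; [exact: ball_open|move=> u /BC; exact: icoord_continuous]. Qed.
Let mB n : borel (B n). Proof. by apply: open_Borel; exact: ball_open. Qed.
Let mcellu n : borel (cellu n).
Proof. exact: mico. Qed.

Let sl (z : transv) : set 'rV[R]_p := [set a | cellu z.1 (row_mx a z.2)].
Let msl z : borel (sl z).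
Proof.
have mr : measurable_fun setT ((fun a => row_mx a z.2) : Borel 'rV[R]_p -> Borel V).
  by apply: continuous_Borel; [exact: openT|move=> a _; exact: continuous_row_mxl].
by rewrite -[X in measurable X]setTI; exact: mr.
Qed.

(** The leaf volume of the part of a plaque inside the cell of its box. Cutting down to disjoint
    cells makes these parts tile the leaf. *)
Definition wt (z : transv) : \bar R := (\int[lam R p]_(a in sl z) (lden g (i_ z.1) (row_mx a z.2))%:E)%E.

Let lden0 i u : 0 <= lden g i u. Proof. exact: sqrtr_ge0. Qed.

Lemma wt_ge0 z : (0 <= wt z)%E.
Proof. by apply: integral_ge0 => a _; rewrite lee_fin. Qed.

Let slB z a : sl z a -> ball (lsubmx (u_ z.1)) (r_ z.1) a.
Proof. by move=> [/ball_row_mx[]]. Qed.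

Let ldB n := (fun u => (lden g (i_ n) u)%:E) \_ (cellu n).
Let bldB n : bfun (ldB n).
Proof.
split; last by move=> u; rewrite /ldB patchE; case: ifP => // _; rewrite lee_fin.
apply/(measurable_restrictT _ _).1; first exact: mcellu.
apply: (@measurable_funS _ _ _ _ (B n : set (Borel V))) => //; first by move=> u [].
apply/measurable_EFinP; apply: continuous_BorelR; first exact: ball_open.
by move=> u /BC Cu; exact: ck_cont (ck_lden g 0 (i_ n)) Cu.
Qed.

Let wtE n c : wt (n, c) = (\int[lam R p]_a ldB n (row_mx a c))%E.
Proof.
rewrite /wt integral_mkcond; apply: eq_integral => a _; rewrite /ldB !patchE /=.
have -> : (row_mx a c \in cellu n) = (a \in sl (n, c)) by apply/idP/idP => /set_mem H; exact/mem_set.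
by case: ifP.
Qed.

Lemma measurable_wt : measurable_fun setT wt.
Proof.
apply: measurable_sheets => n; have [[+ _] _] := lam_split (bldB n).
by congr measurable_fun; apply/funext => c; rewrite wtE.
Qed.

Let mlden z (A : set 'rV[R]_p) : borel A -> (forall a, A a -> B z.1 (row_mx a z.2)) ->
  measurable_fun (Bset A) (fun a => (lden g (i_ z.1) (row_mx a z.2))%:E).
Proof.
move=> mA AB; pose O := setT `&` (fun a : 'rV[R]_p => row_mx a z.2) @^-1` cod M (i_ z.1).
have oO : open O by apply: open_preimage; [exact: openT|move=> a _; exact: continuous_row_mxl|exact: open_cod].
apply: (@measurable_funS _ _ _ _ (Bset O)); [exact: open_Borel|by move=> a /AB/BC|].
apply/measurable_EFinP; apply: continuous_BorelR => // a [_ Oa].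
by apply: (continuous_comp (f := fun a => row_mx a z.2)); [exact: continuous_row_mxl|exact: ck_cont (ck_lden g 0 _) Oa].
Qed.

Let mball (a : 'rV[R]_p) r : borel (ball a r).
Proof. by apply: open_Borel; exact: ball_open. Qed.

Lemma wt_bound n : exists W : R, forall c, (wt (n, c) <= W%:E)%E.
Proof.
have [C C0 HC] := lbd n; pose A := ball (lsubmx (u_ n)) (r_ n).
have Lf : lam R p A \is a fin_num by rewrite ge0_fin_numE//; apply: lam_ball_lty; exact: ltW.
exists (C * fine (lam R p A)) => c; apply: (@le_trans _ _ (\int[lam R p]_(a in sl (n, c)) C%:E)%E).
  apply: ge0_le_integral => //; first by move=> a _; rewrite lee_fin.
    by apply: mlden => // a [].
  by move=> a [/HC/andP[_ h] _]; rewrite lee_fin.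
rewrite integral_cst// EFinM fineK//; apply: lee_wpmul2l; first by rewrite lee_fin ltW.
by apply: le_measure; rewrite ?inE; [exact: msl|exact: mball|move=> a; exact: slB].
Qed.

(** Every point of the leaf lies in exactly one cell, hence on the plaque of exactly one point of
    the holonomy orbit; an enumeration of the orbit gives a countable decomposition for
    [vol_L_pieces]. *)
Lemma vol_L_wt c : valid c -> vol_L g (tpt c) = (\esum_(e in hreach c) wt e)%E.
Proof.
move=> vc; have [P [f hb]] := hreach_enum i_ u_ r_ c; have [fP finj fsurj] := hb.
have fv m : P m -> valid (f m) by move=> /fP H; exact: (hreach_valid r0 BC H vc).
pose j_ m := (i_ (f m).1, (f m).2); pose A_ m := [set a | P m /\ sl (f m) a].
have AE m : A_ m = if m \in P then sl (f m) else set0.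
  by case: (boolP (m \in P)) => [/set_mem Pm|/negP nP]; apply/seteqP; split => // a [] // Pm; case: nP; exact/mem_set.
rewrite (@vol_L_pieces _ _ _ _ g (tpt c) j_ A_).
- rewrite (reindex_esum _ _ _ _ hb) esum_mkcond nneseries_esumT; last by move=> m; apply: integral_ge0 => a _; rewrite lee_fin.
  apply: eq_esum => m _; rewrite AE; case: ifP => // _; exact: integral_set0.
- by move=> m; rewrite AE; case: ifP.
- by move=> m a [_ [/BC]].
- apply/seteqP; split => [y cy|_ [m _ [a [Pm [Ba _]] <-]]].
    have [n yn] := ccell y; have on := cellO yn; have [Dy By] := (oboxP BC n y).1 on.
    have vy := trv_valid BC on.
    have : hreach c (n, trv n y).
      by apply: (leaf_hreach r0 BC cov) => //; apply: leaf_trans cy _; exact: (leaf_trv r0 BC).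
    move=> /fsurj[m Pm fm]; exists m => //; exists (lsubmx (coord M (i_ n) y)).
      by split => //; rewrite fm /sl /= hsubmxK; split => //=; rewrite coordK.
    by rewrite /j_ fm /= hsubmxK coordK.
  have H := fP _ Pm; apply: leaf_trans (hreach_leaf r0 BC H) _.
  apply: (ball_plaque (@BC (f m).1)) => //; last by rewrite !row_mxKr.
  exact: (pt_ball r0 (fv m Pm)).
- apply/trivIsetP => m m' _ _ mm'; apply/seteqP; split => // y [[a [Pm [Ba Ca]] ay] [a' [Pm' [Ba' Ca']] ay']].
  move/eqP: mm'; apply; apply: finj; rewrite ?mem_set//.
  have nn : (f m).1 = (f m').1.
    by apply: tcell => //; exists y; split; [rewrite -ay|rewrite -ay'].
  rewrite (surjective_pairing (f m)) (surjective_pairing (f m')) nn; congr pair.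
  have : icoord M (i_ (f m').1) (row_mx a (f m).2) = icoord M (i_ (f m').1) (row_mx a' (f m').2).
    by rewrite -[RHS]/(icoord M (j_ m').1 _) ay' -ay /j_ /= nn.
  move=> /icoord_inj H; have E : row_mx a (f m).2 = row_mx a' (f m').2.
    by apply: H; apply: BC => //; rewrite -nn.
  by have /eq_row_mx[] := E.
Qed.

(* Disjoint plaques of a box in one leaf each contribute a fixed amount of volume. *)
Lemma vol_L_plaques n : exists2 e : R, 0 < e & forall x k (c : 'I_k -> Q), injective c ->
  (forall l, valid (n, c l) /\ leaf x (tpt (n, c l))) -> ((k%:R * e)%:E <= vol_L g x)%E.
Proof.
have [C C0 HC] := lbd n; pose A := ball (lsubmx (u_ n)) (r_ n).
have Lf : lam R p A \is a fin_num by rewrite ge0_fin_numE// lam_ball_lty// ltW.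
have mA : borel A by exact: mball.
exists (C^-1 * fine (lam R p A)); first by rewrite mulr_gt0 ?invr_gt0// fine_gt0// lam_ball_gt0//= -ge0_fin_numE.
move=> x k c cinj H.
have AB l a : A a -> B n (row_mx a (c l)) by move=> Aa; apply/ball_row_mx; split => //; have [] := H l.
apply: le_trans (vol_L_ge g (j := fun l => (i_ n, c l)) (A := fun=> A) _ _ _ _).
- rewrite (_ : k%:R * _ = \sum_(l < k) (C^-1 * fine (lam R p A))); last by rewrite sumr_const card_ord mulr_natl.
  rewrite -sumEFin; apply: lee_sum => l _; rewrite EFinM fineK// -integral_cst//.
  apply: ge0_le_integral => //; first by move=> a _; rewrite /= lee_fin invr_ge0 ltW.
    by apply: (mlden (z := (n, c l))) => // a; exact: AB.
  by move=> a Aa; rewrite lee_fin; have /andP[] := HC _ (AB l a Aa).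
- by move=> _; exact: mA.
- by move=> l a Aa; exact/BC/(AB l).
- move=> l _ [a Aa <-]; have [v xl] := H l; apply: leaf_trans xl _.
  apply: (ball_plaque (@BC n)) => //=; [exact: (pt_ball r0)|exact: AB|by rewrite !row_mxKr].
- apply/trivIsetP => l l' _ _ ll'; apply/seteqP; split => // y [[a Aa ay] [a' Aa' ay']].
  move/eqP: ll'; apply; apply: cinj; move: ay'; rewrite -ay /= => /icoord_inj E.
  by have /eq_row_mx[_ ->//] : row_mx a' (c l') = row_mx a (c l) by apply: E; exact/BC/AB.
Qed.

Let dn n := (mden g (i_ n) \* \1_(B n)) \* \1_(cellu n).
Let mdn n : measurable_fun setT (dn n : Borel V -> R).
Proof.
apply: measurable_funM; last exact: measurable_indic.
by apply: measurable_indicR; [exact: ball_open|move=> u /BC Cu; exact: ck_cont (ck_mden g 0 _) Cu].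
Qed.
Let dn0 n u : 0 <= dn n u.
Proof. by rewrite /dn /= !mulr_ge0// ?sqrtr_ge0// indicE. Qed.
Let mf n : measurable_fun setT (icoord M (i_ n) \_ (B n) : Borel V -> Borel M).
Proof. by apply/(measurable_restrictT _ _).1 => //; exact: mico. Qed.

(** A measure by construction, assembled from the cells, which agrees with [mu_M] on Borel sets and
    to which the integration theorems apply. *)
Definition muM : {measure set (Borel M) -> \bar R} := mseries (fun n => pushm (mdens (lam R (p + q)) (@mdn n) (@dn0 n)) (mf n)) 0.

Lemma integral_muM (F : M -> \bar R) : measurable_fun setT (F : Borel M -> \bar R) -> (forall x, 0 <= F x)%E ->
  (\int[muM]_x F x = \sum_(0 <= n <oo) \int[lam R (p + q)]_(u in cellu n) (F (icoord M (i_ n) u) * (mden g (i_ n) u)%:E))%E.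
Proof.
move=> mF F0; rewrite /muM ge0_integral_measure_series//; apply: eq_eseriesr => n _.
rewrite ge0_integral_pushm// integral_mdens//; last exact: measurableT_comp mF (mf n).
rewrite [RHS]integral_mkcond; apply: eq_integral => u _; rewrite [in RHS]patchE /dn /= !indicE.
case: (boolP (u \in cellu n)) => [uc|_]; last by rewrite mulr0 mule0.
have uB : u \in B n by apply/mem_set; case/set_mem: uc.
by rewrite uB !mulr1 patchE uB.
Qed.

Lemma mu_MeM A : borel A -> mu_M g A = muM A.
Proof.
move=> mA; rewrite -[RHS]mul1e -integral_cst// integral_mkcond integral_muM; first last.
- by move=> x; rewrite patchE; case: ifP.
- exact/(measurable_restrictT _ _).1.
pose A_ n := cellu n `&` icoord M (i_ n) @^-1` A.
rewrite (@mu_M_pieces _ _ _ _ g A i_ A_).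
- apply: eq_eseriesr => n _; rewrite integral_mkcond [RHS]integral_mkcond; apply: eq_integral => u _.
  rewrite !patchE; case: (boolP (u \in cellu n)) => uc; last first.
    by rewrite ifF//; apply/negP => /set_mem[uc' _]; move: uc; rewrite mem_set.
  have -> : (u \in A_ n) = (icoord M (i_ n) u \in A).
    by apply/idP/idP => /set_mem; [move=> [_ ?]; exact/mem_set|move=> ?; apply/mem_set; split => //; exact: set_mem].
  by case: ifP; rewrite ?mul1e ?mul0e.
- move=> n; rewrite (_ : A_ n = cellu n `&` (B n `&` icoord M (i_ n) @^-1` A)).
    by apply: (@measurableI _ (Borel V)) => //; exact: mico.
  by apply/seteqP; split => u; rewrite /A_ /cellu /=; tauto.
- by move=> n u [[/BC]].
- apply/seteqP; split => [y Ay|_ [n _ [u [_ Au] <-]]//].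
  have [n yn] := ccell y; have [Dy By] := (oboxP BC n y).1 (cellO yn).
  by exists n => //; exists (coord M (i_ n) y); [split; [split|]; rewrite //= coordK|rewrite coordK].
- apply/trivIsetP => a b _ _ ab; apply/seteqP; split => // y [[u [[_ Cu] _] uy] [v [[_ Cv] _] vy]].
  by move/eqP: ab; apply; apply: tcell => //; exists y; split; [rewrite -uy|rewrite -vy].
Qed.

(** In a box the volume density is leaf density times transverse density, and [F] depends on the
    transverse coordinate alone; integrating out the leaf coordinate leaves the factor [wt]. *)
Lemma integral_basic (f : transv -> \bar R) (F : M -> \bar R) : measurable_fun setT f -> (forall z, 0 <= f z)%E ->
  measurable_fun setT (F : Borel M -> \bar R) -> (forall n x, cell n x -> F x = f (n, trv n x)) ->
  (\int[muM]_x F x = \int[tnu]_z (f z * wt z))%E.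
Proof.
move=> mf' f0 mF Ff; have F0 x : (0 <= F x)%E by have [n xn] := ccell x; rewrite (Ff n).
rewrite integral_muM// integral_tmeasure; last 2 first.
- by apply: emeasurable_funM => //; exact: measurable_wt.
- by move=> z; rewrite mule_ge0// wt_ge0.
apply: eq_eseriesr => n _.
pose fr c := (f (n, c) * (rho g i_ u_ n c)%:E)%E.
pose G := (fun u => fr (rsubmx u) * ldB n u)%E \_ (B n).
have rsc : continuous (fun u : V => rsubmx u).
  move=> u; apply: differentiable_continuous; apply: differentiable_rsubmx; exact: (ck_diff (ck_id 0 openT)).
have mrs : measurable_fun setT ((fun u => rsubmx u) : Borel V -> Borel Q) by apply: continuous_Borel; [exact: openT|move=> u _; exact: rsc].
have G0 u : B n u -> (0 <= fr (rsubmx u))%E by move=> Bu; rewrite mule_ge0// lee_fin sqrtr_ge0.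
have bG : bfun G.
  split; last by move=> u; rewrite /G patchE; case: ifP => // /set_mem/G0 h; rewrite mule_ge0// (bldB n).2.
  apply/(measurable_restrictT _ _).1 => //; apply: emeasurable_funM; last exact: measurable_funTS (bldB n).1.
  apply: emeasurable_funM.
    apply: measurable_funTS; apply: measurableT_comp mf' _; apply: measurableT_comp mrs; exact: pair1_measurable.
  apply/measurable_EFinP; apply: continuous_BorelR => [|u Bu]; first exact: ball_open.
  apply: (continuous_comp (f := fun u : V => rsubmx u)); first exact: rsc.
  exact: (ck_cont (ck_rho g r0 BC 0 n) (ball_Tn Bu)).
transitivity (\int[lam R (p + q)]_u G u)%E.
  rewrite integral_mkcond; apply: eq_integral => u _; rewrite /G !patchE /ldB.
  case: (boolP (u \in cellu n)) => [/set_mem[Bu Cu]|nu]; last by rewrite patchE (negPf nu) mule0; case: ifP.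
  rewrite mem_set// patchE mem_set//.
  rewrite (Ff n)// /trv icoordK; last exact: BC.
  rewrite (mden_split g (BC Bu)) /fr /rho -(gam_pt g r0 BC Bu) -muleA -EFinM; congr (_ * _%:E)%E; exact: mulrC.
have [_ ->] := lam_split bG; rewrite [RHS]integral_mkcond; apply: eq_integral => c _; rewrite patchE.
case: (boolP (c \in Tn u_ r_ n)) => [/set_mem Tc|nTc]; last first.
  apply: integral0_eq => a _; rewrite /G patchE; case: ifP => // /set_mem/ball_row_mx[_ ?].
  by move: nTc; rewrite mem_set.
transitivity (\int[lam R p]_a (fr c * ldB n (row_mx a c)))%E.
  apply: eq_integral => a _; rewrite /G patchE row_mxKr; case: ifP => // /negbT nB.
  rewrite /ldB patchE ifF ?mule0//; apply/negP => /set_mem[Ba _]; by move: nB; rewrite mem_set.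
rewrite ge0_integralZl//.
- by rewrite -wtE /fr muleAC.
- apply: measurableT_comp (bldB n).1 _; apply: continuous_Borel; [exact: openT|move=> a _; exact: continuous_row_mxl].
- by move=> a _; exact: (bldB n).2.
- by rewrite mule_ge0// lee_fin sqrtr_ge0.
Qed.

End volumes.

Section metric_transition.
Context {R : realType} {p q : nat} (M : foliatedManifold R p q) (g : bundleLikeMetric M).
Lemma TJ_tran_unit (i j : chart M) u : tdom i j u -> TJ (tran i j) u \in unitmx.
Proof.
apply: (@TJ_unit R p q (tdom i j) (g i) (g j) (tran i j)).
- by move=> w [Cw _]; exact: posdef_gmx.
- by move=> k; exact: ck_tran.
- exact: fol_tran.
- by move=> w v v' Tw; exact: gmx_tran.
Qed.
Lemma gam_unit i u : cod M i u -> gam (g i) u \in unitmx.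
Proof.
move=> Cu; apply: posdef_unit; apply: (@gam_pos R p q (cod M i)) Cu => w; exact: posdef_gmx.
Qed.
End metric_transition.

(** * Divergence on the transversals *)

Section transverse_divergence.
Context {R : realType} {p q : nat}.
Local Notation V := 'rV[R]_(p + q).
Local Notation Q := 'rV[R]_q.

Lemma ck_rsub k (U : set V) : open U -> ck k U (fun u => rsubmx u).
Proof. by move=> oU; apply: ck_rsubmx => //; exact: ck_id. Qed.

Lemma derive_comp_rsub (Y : normedModType R) (B : set V) (F : V -> Y) (X : Q -> Y) u v : open B -> B u ->
  (forall w, B w -> F w = X (rsubmx w)) -> differentiable X (rsubmx u) -> 'D_v F u = 'D_(rsubmx v) X (rsubmx u).
Proof.
move=> oB Bu FX dX; rewrite (derive_open_eq v oB Bu FX).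
have dr : differentiable (fun w : V => rsubmx w) u by exact: ck_diff (ck_rsub 0 openT) I.
by rewrite (derive_chain v dr dX) (derive_rsubmx (A := id)) ?derive_id.
Qed.

(* Jacobi's formula for the density of the transverse metric *)
Lemma fdiv_tdiv (B : set V) (G : V -> 'M[R]_(p + q)) (F : V -> Q) (X : Q -> Q) (Gam : Q -> 'M[R]_q) u :
  open B -> B u -> (forall w, B w -> F w = X (rsubmx w)) -> (forall w, B w -> gam G w = Gam (rsubmx w)) ->
  differentiable X (rsubmx u) -> differentiable Gam (rsubmx u) -> posdef (Gam (rsubmx u)) ->
  differentiable (fun c => Num.sqrt (\det (Gam c))) (rsubmx u) -> (\forall c \near rsubmx u, 0 <= \det (Gam c)) ->
  fdiv X (fun c => Num.sqrt (\det (Gam c))) (rsubmx u) = Num.sqrt (\det (Gam (rsubmx u))) * tdiv G F u.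
Proof.
move=> oB Bu FX GG dX dG pG dr Ng; set c := rsubmx u in dX dG pG dr Ng *.
have J1 : dsubmx ('J F u) = 'J X c.
  apply: mulmx_inj => w; rewrite -(deriveEjacobian w dX).
  have dF : differentiable F u.
    apply: (differentiable_open_eq oB Bu (f := X \o (fun w => rsubmx w))) => [z Bz|]; first by rewrite FX.
    by apply: differentiable_comp => //; exact: ck_diff (ck_rsub 0 openT) I.
  have := derive_comp_rsub (row_mx 0 w) oB Bu FX dX; rewrite row_mxKr => <-.
  by rewrite (deriveEjacobian _ dF) -[in RHS](vsubmxK ('J F u)) mul_row_col mul0mx add0r.
have J2 : 'D_(F u *m hl G u) (gam G) u = 'D_(X c) Gam c.
  by rewrite (derive_comp_rsub _ oB Bu GG dG) /hl rsubmx_hlift FX.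
rewrite /tdiv J1 J2 GG// -/c /fdiv mulrDr addrC; congr (_ + _).
set r := fun c => Num.sqrt (\det (Gam c)); rewrite -/(r c).
have rc : 0 < r c by rewrite sqrtr_gt0; exact: posdef_det.
have dd : differentiable (fun c => \det (Gam c)) c.
  have E : \forall c' \near c, r c' * r c' = \det (Gam c').
    by apply: filterS Ng => z Hz; rewrite -expr2 sqr_sqrtr.
  apply: (differentiable_near E); exact: differentiableM.
have K : 2 * r c * 'D_(X c) r c = \det (Gam c) * \tr (invmx (Gam c) *m 'D_(X c) Gam c).
  have E : \forall c' \near c, r c' * r c' = \det (Gam c').
    by apply: filterS Ng => z Hz; rewrite -expr2 sqr_sqrtr.
  transitivity ('D_(X c) (fun c' => \det (Gam c')) c).
    rewrite -(diff_near_eq (X c) E) deriveM; [|exact/diff_derivable..].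
    by rewrite -mulrA mulr_natl -mulr2n.
  rewrite (derive_det _ dG) /invmx posdef_unit// -scalemxAl mxtraceZ mulrA divff ?mul1r//.
  by rewrite gt_eqF// posdef_det.
have r2 : \det (Gam c) = r c * r c by rewrite -expr2 sqr_sqrtr// ltW// posdef_det.
rewrite r2 in K; move: K; move: (\tr _) ('D_(X c) r c) (r c) rc => t dr' rr rr0 K.
have : 2 * rr * (dr' - rr * (2^-1 * t)) = 0 by lra.
by move=> /eqP; rewrite mulf_eq0 mulf_eq0 pnatr_eq0 (gt_eqF rr0) /= subr_eq0 => /eqP.
Qed.

End transverse_divergence.

Lemma ck_fdiv (R : realType) n k (U : set 'rV[R]_n) (X : 'rV[R]_n -> 'rV[R]_n) (rho : 'rV[R]_n -> R) : open U ->
  (forall k, ck k U X) -> (forall k, ck k U rho) -> ck k U (fdiv X rho).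
Proof.
move=> oU cX cr; apply: ckD => //; first exact: ck_lie.
apply: ckM => //; apply: ck_sum => // i; apply: ck_entry => //; exact: ck_jacobian.
Qed.

Lemma ball_half (R : realType) n (c : 'rV[R]_n) r : 0 < r -> ball c (r / 2) `<=` ball c r.
Proof. by move=> r0; apply: le_ball; lra. Qed.

Lemma fdiv_near0 (R : realType) n (X : 'rV[R]_n -> 'rV[R]_n) (rho : 'rV[R]_n -> R) c :
  (\forall c' \near c, X c' = 0) -> differentiable rho c -> fdiv X rho c = 0.
Proof.
move=> X0 dr; have X0' : \forall c' \near c, X c' = cst 0 c' by [].
have J0 : 'J X c = 0.
  have dz : differentiable (cst 0 : 'rV[R]_n -> 'rV[R]_n) c by exact: differentiable_cst.
  have dX : differentiable X c by apply: differentiable_near dz; apply: filterS X0' => c' ->.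
  rewrite (jacobian_near X0')//.
  by apply: (@jacobian_unique R n n (cst 0) c 0 dz) => v; rewrite derive_cst mulmx0.
by rewrite /fdiv J0 (nbhs_singleton X0) mxtrace0 mulr0 addr0 derive_dir0.
Qed.

(* Vectors are row vectors, so a leafwise-constant push-forward acts by right multiplication. *)
Lemma derive_transverse (R : realType) p q p' q' (f : 'rV[R]_(p + q) -> 'rV[R]_(p' + q')) (a : 'rV[R]_p) c (w : 'rV[R]_q) :
  differentiable f (row_mx a c) -> differentiable (fun c => rsubmx (f (row_mx a c))) c /\
  'D_w (fun c => rsubmx (f (row_mx a c))) c = w *m TJ f (row_mx a c).
Proof.
move=> df; have dr := differentiable_rsubmx df.
have da : differentiable (fun c : 'rV[R]_q => row_mx a c) c.
  by apply: (ck_diff (k := 0) (U := setT)) I; apply: ck_row_mx; [exact: openT|exact: ck_cst|apply: ck_id; exact: openT].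
split; first exact: (differentiable_comp da dr).
rewrite (mul_TJ w df) -(derive_rsubmx _ df) -(derive_row_mxr a c w).
exact: (derive_chain w da dr).
Qed.

Lemma finite_pos_min (R : realType) (P : nat -> R -> Prop) N : (forall n d d', P n d -> 0 < d' <= d -> P n d') ->
  (forall n, exists2 d, 0 < d & P n d) -> exists2 d, 0 < d & forall n, (n < N)%N -> P n d.
Proof.
move=> mP hP; elim: N => [|N [d d0 IH]]; first by exists 1.
have [d' d'0 Hd'] := hP N; exists (Num.min d d'); first by rewrite lt_min d0.
move=> n; rewrite ltnS leq_eqVlt => /predU1P[->|nN]; first by apply: mP Hd' _; rewrite lt_min d0 d'0 ge_min lexx orbT.
by apply: mP (IH n nN) _; rewrite lt_min d0 d'0 ge_min lexx.
Qed.

Lemma compact_image_box (R : realType) p q (M : foliatedManifold R p q) (i : chart M) u (r r' : R) : 0 <= r -> r < r' ->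
  ball u r' `<=` cod M i -> closed (icoord M i @` [set v | `|v - u| <= r]).
Proof.
move=> r0 rr BC; apply: compact_closed; first exact: carrier_hausdorff.
apply: continuous_compact.
  apply: continuous_in_subspaceT => v; rewrite inE /= => vr.
  by apply: icoord_continuous; apply: BC; rewrite -ball_normE /= distrC; exact: le_lt_trans rr.
apply: bounded_closed_compact.
  exists (`|u| + r); split; first exact: num_real.
  move=> K hK v /= vr; apply: le_trans (ltW hK); rewrite -[v](subrK u) addrC.
  by apply: le_trans (ler_normD _ _) _; rewrite lerD2l.
have -> : [set v | `|v - u| <= r] = (fun v => `|v - u|) @^-1` [set x | x <= r] by [].
apply: closed_comp; last exact: closed_le.
move=> v _; apply: continuous_comp; last exact: norm_continuous.
apply: continuousB; [exact: id|exact: cst_continuous].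
Qed.

Lemma esumZl (R : realType) (T : choiceType) (A : set T) (k : R) (b : T -> \bar R) : 0 <= k -> (forall x, 0 <= b x)%E ->
  (\esum_(x in A) (k%:E * b x) = k%:E * \esum_(x in A) b x)%E.
Proof.
rewrite le_eqVlt => /predU1P[<-|k0] b0.
  by rewrite mul0e esum1// => x _; rewrite mul0e.
have LE (c : R) (f : T -> \bar R) : 0 < c -> (forall x, 0 <= f x)%E ->
    (\esum_(x in A) (c%:E * f x) <= c%:E * \esum_(x in A) f x)%E.
  move=> c0 f0; apply: ge_ereal_sup => _ [X [fX XA] <-].
  rewrite -ge0_mule_fsumr//.
  by apply: lee_wpmul2l; [rewrite lee_fin ltW|apply: esum_ge; exists X].
apply/eqP; rewrite eq_le LE//=.
have kf0 x : (0 <= k%:E * b x)%E by rewrite mule_ge0// lee_fin ltW.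
have := LE k^-1 (fun x => k%:E * b x)%E; rewrite invr_gt0 => /(_ k0 kf0).
under [in X in (X <= _)%E]eq_esum => x _ do rewrite muleA -EFinM mulVf ?gt_eqF// mul1e.
by rewrite lee_pdivlMl.
Qed.

(** Used by contradiction: a leaf of finite volume cannot have arbitrarily many plaques in one
    box. *)
Lemma finite_set_inj (T : Type) (A : set T) : infinite_set A -> forall k, exists2 c : 'I_k -> T, injective c & forall l, A (c l).
Proof.
move=> /infiniteP/card_leP[f] k; have lA (l : 'I_k) : (l : nat) \in [set: nat] by exact: mem_set.
exists (fun l : 'I_k => val (f (SigSub (lA l)))); last by move=> l; exact: set_valP.
move=> l l' /val_inj/(@inj _ _ _ f) E.
by have := E (mem_set I) (mem_set I) => -[] /val_inj.
Qed.

Lemma measurable_invr (R : realType) : measurable_fun setT (fun x : R => x^-1).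
Proof.
have oN : open [set x : R | x != 0].
  rewrite (_ : [set x : R | x != 0] = ~` [set 0]); first exact/closed_openC/closed_eq.
  by apply/seteqP; split => x /= /eqP.
rewrite (_ : setT = [set x : R | x != 0] `|` [set 0]); last first.
  by apply/seteqP; split => // x _ /=; case: (eqVneq x 0) => [->|]; [right|left].
apply/measurable_funU; [exact: open_measurable|exact: measurable_set1|split].
  by apply: open_continuous_measurable_fun => // x; rewrite inE /= => x0; exact: inv_continuous.
exact: measurable_fun_set1.
Qed.

Lemma split_algebra (R : comRingType) (a b c : R) : a * b = 1 * b * (c + a) - c * (1 * b * 1).
Proof. by ring. Qed.

Lemma eq_lee (R : realDomainType) (x y : \bar R) : x = y -> (x <= y)%E. Proof. by move=> ->. Qed.

Lemma finite_ub (R : realType) N (f : nat -> R) : exists2 K, 0 < K & forall n, (n < N)%N -> f n <= K.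
Proof.
elim: N => [|N [K K0 IH]]; first by exists 1.
exists (Num.max K (f N)); first by rewrite lt_max K0.
by move=> n; rewrite ltnS leq_eqVlt le_max => /predU1P[->|/IH->//]; rewrite lexx orbT.
Qed.

Lemma integral_supp d (T : measurableType d) (R : realType) (mu : {measure set T -> \bar R}) (A B : set T) (f : T -> \bar R) :
  A `<=` B -> (forall x, B x -> ~ A x -> f x = 0%E) -> integral mu A f = integral mu B f.
Proof.
move=> AB f0; rewrite integral_mkcond [RHS]integral_mkcond; apply: eq_integral => x _; rewrite !patchE.
case: ifPn => [/set_mem/AB/mem_set->//|/negP nA]; case: ifP => // /set_mem Bx.
by rewrite f0// => /mem_set.
Qed.

#[local] Opaque fdiv.

(** * The first variation *)

Section family_of_maps.
Context {R : realType} {p q p' q' : nat} (M : foliatedManifold R p q) (M' : foliatedManifold R p' q').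
Variables (g : bundleLikeMetric M) (g' : bundleLikeMetric M') (eps : R) (Phi : R -> M -> M').
Hypotheses (eps0 : 0 < eps) (sF : smooth_family eps Phi) (fF : forall t, `|t| < eps -> foliated_map (Phi t)).
Local Notation V := 'rV[R]_(p + q).
Local Notation W := 'rV[R]_(1 + (p + q)).
Local Notation Q := 'rV[R]_q.
Implicit Types (i : chart M) (j : chart M') (t : R) (u : V) (w : W).

Definition fdom i j : set W := [set w | [/\ `|lsubmx w 0 0| < eps, cod M i (rsubmx w)
  & dom M' j (Phi (lsubmx w 0 0) (icoord M i (rsubmx w)))]].
Definition fexpr i j : W -> 'rV[R]_(p' + q') := fun w => coord M' j (Phi (lsubmx w 0 0) (icoord M i (rsubmx w))).

Lemma lsub_tp t u : lsubmx (tp t u) 0 0 = t.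
Proof. by rewrite /tp row_mxKl mxE eqxx. Qed.
Lemma rsub_tp t u : rsubmx (tp t u) = u.
Proof. by rewrite /tp row_mxKr. Qed.
Lemma tp_hsub w : tp (lsubmx w 0 0) (rsubmx w) = w.
Proof.
rewrite /tp -[RHS](hsubmxK w); congr row_mx.
by apply/matrixP => a b; rewrite !ord1 [LHS]mxE eqxx mulr1n.
Qed.

Lemma fdom_tp i j t u : fdom i j (tp t u) <-> [/\ `|t| < eps, cod M i u & dom M' j (Phi t (icoord M i u))].
Proof. by rewrite /fdom /= lsub_tp rsub_tp. Qed.

Let lsub_cont : continuous (fun w => lsubmx w 0 0).
Proof.
move=> w; rewrite (_ : (fun w => _) = (fun w : W => w 0 (lshift _ 0))); first exact: coord_cont.
by apply/funext => x; rewrite lsubmxEsub mxE.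
Qed.
Let rsub_cont : continuous (fun w : W => rsubmx w).
Proof.
move=> w; apply: differentiable_continuous; apply: differentiable_rsubmx; exact: (ck_diff (ck_id 0 openT)).
Qed.

Lemma open_fdom i j : open (fdom i j).
Proof.
pose A := [set w : W | `|lsubmx w 0 0| < eps] `&` (fun w => rsubmx w) @^-1` cod M i.
have oA : open A.
  apply: openI; last by move/continuousP: rsub_cont; apply; exact: open_cod.
  rewrite (_ : [set w | _] = setT `&` (fun w => `|lsubmx w 0 0|) @^-1` [set x | x < eps]); last by rewrite setTI.
  apply: open_preimage; [exact: openT| |exact: open_lt].
  by move=> w _; apply: continuous_comp; [exact: lsub_cont|exact: norm_continuous].
rewrite (_ : fdom i j = A `&` (fun w => Phi (lsubmx w 0 0) (icoord M i (rsubmx w))) @^-1` dom M' j); last first.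
  by apply/seteqP; split => w; [move=> []|move=> [[]]].
apply: open_preimage => //; last exact: dom_open.
move=> w [wt wc].
apply: (@continuous_comp _ _ _ (fun w => (lsubmx w 0 0, icoord M i (rsubmx w))) (fun z : R * M => Phi z.1 z.2)).
  have c2 : {for w, continuous (fun w : W => icoord M i (rsubmx w))}.
    by apply: (continuous_comp (f := fun w : W => rsubmx w)); [exact: rsub_cont|exact: icoord_continuous].
  exact: (@cvg_pair W R M (nbhs w) _ _ _ _ _ (fun w => lsubmx w 0 0) (fun w => icoord M i (rsubmx w)) (@lsub_cont w) c2).
by apply: sF.1.
Qed.

Lemma ck_fexpr i j k : ck k (fdom i j) (fexpr i j).
Proof. exact: (smooth_ck (sF.2 i j)). Qed.

Lemma fdom_cod i j w : fdom i j w -> cod M i (rsubmx w). Proof. by case. Qed.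
Lemma fexpr_cod i j w : fdom i j w -> cod M' j (fexpr i j w).
Proof. by move=> [_ _ Dj]; exact: coord_cod. Qed.

Definition fsl i j t : set V := [set u | fdom i j (tp t u)].
Lemma open_fsl i j t : open (fsl i j t).
Proof.
rewrite (_ : fsl i j t = setT `&` (tp t) @^-1` fdom i j); last by rewrite setTI.
apply: open_preimage; [exact: openT| |exact: open_fdom].
by move=> u _; exact: (ck_cont (ck_tp 0 t openT) I).
Qed.

Lemma fsl_cod i j t u : fsl i j t u -> cod M i u.
Proof. by move=> /fdom_cod; rewrite rsub_tp. Qed.

Lemma slice_fexpr i j t : slice (fexpr i j) t = local_expr (Phi t) i j.
Proof. by apply/funext => u; rewrite /slice /fexpr lsub_tp rsub_tp. Qed.

Lemma ck_slice_fexpr i j t k : ck k (fsl i j t) (slice (fexpr i j) t).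
Proof.
exact: (@ck_slice R p q p' q' (fdom i j) (@open_fdom i j) k (fexpr i j) (fsl i j t) t (@open_fsl i j t) (fun u Ou => Ou) (ck_fexpr i j k)).
Qed.

Lemma fol_slice i j t : fol (fsl i j t) (slice (fexpr i j) t).
Proof. by move=> u v /fdom_tp[te Cu Dj]; rewrite slice_fexpr; exact: fF. Qed.

Lemma fol_fexpr i j w v : fdom i j w -> rsubmx v = 0 -> rsubmx ('D_(row_mx 0 v) (fexpr i j) w) = 0.
Proof.
move=> Ow v0; rewrite -(tp_hsub w) -derive_slice; last by rewrite tp_hsub; exact: ck_diff (ck_fexpr i j 0) Ow.
by apply: fol_slice => //; rewrite /fsl /= tp_hsub.
Qed.

Lemma fol_vel i j t : fol (fsl i j t) (velocity (fexpr i j) t).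
Proof.
apply: (@fol_velocity _ _ _ _ _ (fdom i j)) => //; [exact: open_fdom|by move=> k; exact: ck_fexpr|exact: open_fsl|].
exact: fol_fexpr.
Qed.

Lemma ck_vel i j t k : ck k (fsl i j t) (velocity (fexpr i j) t).
Proof.
exact: (@ck_slice R p q p' q' (fdom i j) (@open_fdom i j) k ('D_ddt (fexpr i j)) (fsl i j t) t (@open_fsl i j t) (fun u Ou => Ou) (ck_derive ddt (ck_fexpr i j k.+1))).
Qed.

Let tpE t u : tp t u = tp 0 u + t *: (ddt : W).
Proof. by rewrite /tp /ddt scale_row_mx scaler0 add_row_mx addr0 scalemx1 -rmorphD/= add0r. Qed.

Let near_tp i j t u : fdom i j (tp t u) -> \forall s \near t, fdom i j (tp s u).
Proof.
move=> Ow; have c : {for t, continuous (fun s => tp s u)}.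
  rewrite (_ : (fun s => tp s u) = (fun s : R => s *: (ddt : W) + tp 0 u)).
    by apply: (@continuous_comp _ _ _ (fun s : R => s *: (ddt : W)) (fun y : W => y + tp 0 u)); [exact: scalel_continuous|exact: addr_cont].
  by apply/funext => s; rewrite tpE addrC.
by apply: (c (fdom i j)); apply: open_nbhs_nbhs; split => //; exact: open_fdom.
Qed.

Lemma is_derive_tp (Y : normedModType R) (F : W -> Y) t u : differentiable F (tp t u) ->
  is_derive t (1 : R) (fun s : R => F (tp s u)) ('D_ddt F (tp t u)).
Proof.
move=> dF; have := @is_derive_line R W Y F (tp 0 u) ddt t; rewrite -tpE => /(_ (diff_derivable dF)).
by have <- : (fun s : R => F (tp s u)) = (fun s : R => F (tp 0 u + s *: ddt)) by apply/funext => s; rewrite tpE.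
Qed.

Lemma derive_fexpr i j t u : fdom i j (tp t u) -> is_derive t (1 : R) (fun s : R => fexpr i j (tp s u)) (velocity (fexpr i j) t u).
Proof. by move=> Ow; apply: is_derive_tp; exact: ck_diff (ck_fexpr i j 0) Ow. Qed.

Definition fX i j : V -> 'rV[R]_q :=
  xfield (g i) (g' j) (slice (fexpr i j) 0) (velocity (fexpr i j) 0).

Let fsl_gmx i j t k : ck k (fsl i j t) (g i).
Proof. by apply: ck_sub (ck_gmx g i k) => u /fsl_cod. Qed.
Let fsl_posdef i j t u : fsl i j t u -> posdef (g i u).
Proof. by move=> /fsl_cod; exact: posdef_gmx. Qed.
Let fsl_leaf i j t u v : fsl i j t u -> rsubmx v = 0 -> 'D_v (gam (g i)) u = 0.
Proof. by move=> /fsl_cod; exact: gam_leaf. Qed.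
Let slice_cod i j t u : fsl i j t u -> cod M' j (slice (fexpr i j) t u).
Proof. exact: fexpr_cod. Qed.
Hint Resolve open_cod ck_gmx posdef_gmx gam_leaf open_fsl ck_slice_fexpr fol_slice ck_vel fol_vel
  fsl_gmx fsl_posdef fsl_leaf slice_cod open_fdom ck_fexpr fdom_cod fexpr_cod : fam.

Lemma ck_fX i j k : ck k (fsl i j 0) (fX i j).
Proof. by apply: (@ck_xfield R p q p' q' (fsl i j 0) (g i) (cod M' j) (g' j)); eauto with fam. Qed.

Lemma fX_leaf i j u v : fsl i j 0 u -> rsubmx v = 0 -> 'D_v (fX i j) u = 0.
Proof. by apply: (@xfield_leaf R p q p' q' (fsl i j 0) (g i) (cod M' j) (g' j)); eauto with fam. Qed.

Lemma derive_fX i j u v : fsl i j 0 u -> 'D_v (fX i j) u = rsubmx v *m dsubmx ('J (fX i j) u).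
Proof. by apply: (@derive_xfield R p q p' q' (fsl i j 0) (g i) (cod M' j) (g' j)); eauto with fam. Qed.

Lemma first_variation_at i j E u : fsl i j 0 u -> basic_frame (g i) (cod M i) u E ->
  edens1 (g i) (g' j) (slice (fexpr i j) 0) (velocity (fexpr i j) 0) u
  + (rsubmx (velocity (fexpr i j) 0 u) *m gam (g' j) (slice (fexpr i j) 0 u)
     *m (tension_in (g i) (g' j) (slice (fexpr i j) 0) E u)^T) 0 0 = tdiv (g i) (fX i j) u.
Proof.
by move=> Ou /basic_frameP[dE oE]; apply: (@first_variation R p q p' q' (fsl i j 0) (g i) (cod M' j) (g' j)); eauto with fam.
Qed.

Section change_of_charts.
Variables (i i2 : chart M) (j j2 : chart M') (t : R) (u : V).
Hypotheses (Ou : fdom i j (tp t u)) (Di2 : dom M i2 (icoord M i u)) (Dj2 : dom M' j2 (Phi t (icoord M i u))).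

Let Tu : tdom i i2 u. Proof. by split => //; move/fdom_cod: Ou; rewrite rsub_tp. Qed.
Let f := slice (fexpr i j) t.
Let f2 := slice (fexpr i2 j2) t.
Let u2 := tran i i2 u.

Lemma fdom_tran : fdom i2 j2 (tp t u2).
Proof. by have /fdom_tp[te _ _] := Ou; apply/fdom_tp; split => //; [exact: tran_cod|rewrite icoord_tran]. Qed.

Lemma fexpr_tdom : tdom j j2 (f u).
Proof.
have /fdom_tp[_ _ Dj] := Ou.
by split; [exact: fexpr_cod|rewrite /f /slice /fexpr lsub_tp rsub_tp coordK].
Qed.

Let fexpr_tran s : fdom i j (tp s u) -> fexpr i2 j2 (tp s u2) = tran j j2 (fexpr i j (tp s u)).
Proof.
move=> /fdom_tp[_ _ Dj]; rewrite /fexpr !lsub_tp !rsub_tp icoord_tran// /tran /= coordK//.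
Qed.

Let df : differentiable f u. Proof. exact: (ck_diff (ck_slice_fexpr i j t 0)). Qed.
Let df2 : differentiable f2 u2. Proof. apply: (ck_diff (ck_slice_fexpr i2 j2 t 0)); exact: fdom_tran. Qed.

Lemma TJ_slice_tran : TJ f u *m TJ (tran j j2) (f u) = TJ (tran i i2) u *m TJ f2 u2.
Proof.
have dt := ck_diff (ck_tran i i2 0) Tu; have dt' := ck_diff (ck_tran j j2 0) fexpr_tdom.
rewrite -(TJ_comp df dt' (@fol_tran _ _ _ _ j j2) fexpr_tdom) -(TJ_comp dt df2 (@fol_slice i2 j2 t) fdom_tran).
have N : \forall v \near u, (tran j j2 \o f) v = (f2 \o tran i i2) v.
  have : nbhs u (tdom i i2 `&` fsl i j t).
    apply: open_nbhs_nbhs; split; last by split.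
    by apply: openI; [exact: open_tdom|exact: open_fsl].
  apply: filterS => v [Tv Ov]; rewrite /f /f2 /= !slice_fexpr /local_expr /= icoord_tran//.
  by have /fdom_tp[_ _ Dj] := Ov; rewrite /tran /= coordK.
by rewrite /TJ (jacobian_near N (differentiable_comp df dt')).
Qed.

Lemma edens_tran : edens (g i) (g' j) f u = edens (g i2) (g' j2) f2 u2.
Proof.
rewrite /edens (gam_tran g Tu) (gam_tran g' fexpr_tdom).
have -> : tran j j2 (f u) = f2 u2 by rewrite /f2 /slice fexpr_tran.
by apply: edens_algebra TJ_slice_tran; [exact: (TJ_tran_unit g)|apply: gam_unit; exact: tran_cod].
Qed.

Lemma velocity_tran : rsubmx (velocity (fexpr i2 j2) t u2) = rsubmx (velocity (fexpr i j) t u) *m TJ (tran j j2) (f u).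
Proof.
have dt' := ck_diff (ck_tran j j2 0) fexpr_tdom.
have [_ <-] := derive_fexpr fdom_tran; have D1 := derive_fexpr Ou.
have N : \forall s \near t, tran j j2 (fexpr i j (tp s u)) = fexpr i2 j2 (tp s u2).
  by apply: filterS (near_tp Ou) => s Os; rewrite fexpr_tran.
rewrite -(diff_near_eq (1 : R) N).
have [_ ->] := is_derive_chain D1 dt'.
by rewrite (rsub_derive _ (@fol_tran _ _ _ _ j j2) fexpr_tdom dt').
Qed.

End change_of_charts.

(** The dual field pairs target vectors away, so it transforms by the transverse Jacobian of the
    source charts and does not see the target charts. *)
Lemma fX_tran i i2 j j2 u : fsl i j 0 u -> dom M i2 (icoord M i u) -> dom M' j2 (Phi 0 (icoord M i u)) ->
  fX i2 j2 (tran i i2 u) = fX i j u *m TJ (tran i i2) u.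
Proof.
move=> Ou Di2 Dj2; have Tu : tdom i i2 u by split => //; exact: fsl_cod Ou.
have Tf := fexpr_tdom Ou Dj2; have TT := TJ_slice_tran Ou Di2 Dj2.
have fE : tran j j2 (slice (fexpr i j) 0 u) = slice (fexpr i2 j2) 0 (tran i i2 u).
  have /fdom_tp[_ _ Dj] := Ou.
  by rewrite !slice_fexpr /local_expr icoord_tran// /tran /= coordK.
have := xfield_algebra (gam (g' j2) (slice (fexpr i2 j2) 0 (tran i i2 u))) (rsubmx (velocity (fexpr i j) 0 u))
  (TJ_tran_unit g Tu) (gam_unit g (tran_cod Tu)) TT.
rewrite -{1}fE -(gam_tran g Tu) -(gam_tran g' Tf) -(velocity_tran Ou Di2 Dj2) => H.
exact: esym H.
Qed.

Definition DD (x : M) : R := tdiv (g (chart_at M x)) (fX (chart_at M x) (chart_at M' (Phi 0 x))) (coord M (chart_at M x) x).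

(** [DD] is read in the charts selected at each point. On the overlap [A], where the local fields of
    both pairs of charts are defined, [tdiv_transition] makes the selection irrelevant. *)
Lemma DD_loc i j u : fsl i j 0 u -> DD (icoord M i u) = tdiv (g i) (fX i j) u.
Proof.
move=> Ou; have Cu := fsl_cod Ou; set x := icoord M i u.
set i2 := chart_at M x; set j2 := chart_at M' (Phi 0 x).
have Di2 : dom M i2 x by exact: dom_chart_at.
have Dj2 : dom M' j2 (Phi 0 x) by exact: dom_chart_at.
pose A := (tdom i i2 `&` fsl i j 0) `&` tran i i2 @^-1` fsl i2 j2 0.
have oA : open A.
  apply: open_preimage; last exact: open_fsl.
    by apply: openI; [exact: open_tdom|exact: open_fsl].
  by move=> v [Tv _]; exact: ck_cont (ck_tran _ _ 0) Tv.
have Au : A u by split; [split|exact: (fdom_tran Ou Di2 Dj2)].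
apply: esym; apply: (@tdiv_transition R p q A (fsl i2 j2 0) (g i) (g i2) (tran i i2)) Au.
- exact: oA.
- by move=> k; apply: ck_sub (ck_gmx g i k) => v [[[]]].
- by move=> v [[[Cv _] _] _]; exact: posdef_gmx.
- exact: open_fsl.
- by move=> k; apply: ck_sub (ck_gmx g i2 k) => v /fsl_cod.
- by move=> v /fsl_cod; exact: posdef_gmx.
- by move=> k; apply: ck_sub (ck_tran i i2 k) => v [[]].
- by move=> v w [[Tv _] _]; exact: fol_tran.
- by move=> v [].
- by move=> v w w' [[Tv _] _]; exact: gmx_tran.
- by move=> v w [[[Cv _] _] _]; exact: gam_leaf.
- by move=> v w /fsl_cod; exact: gam_leaf.
- by move=> v [[_ Ov] _]; exact: ck_diff (ck_fX i j 0) Ov.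
- by move=> v Ov; exact: ck_diff (ck_fX i2 j2 0) Ov.
- by move=> v w [[_ Ov] _]; exact: derive_fX.
- by move=> v w Ov; exact: derive_fX.
- move=> v [[Tv Ov] Ov2]; apply: fX_tran => //; first by case: Tv.
  by have /fdom_tp[_ _] := Ov2; rewrite icoord_tran.
Qed.

Lemma frame_basic (x : M) : basic_frame (g (chart_at M x)) (cod M (chart_at M x)) (coord M (chart_at M x) x) (frame g x).
Proof.
apply: getPex; apply: basic_frame_exists.
- exact: open_cod.
- exact: ck_gmx.
- by move=> u; exact: posdef_gmx.
- by move=> u v; exact: gam_leaf.
- exact/coord_cod/dom_chart_at.
Qed.

Definition EN (t : R) (x : M) : R := dT_sqnorm g g' (Phi t) x.

Lemma EN_loc i j t u : fdom i j (tp t u) -> EN t (icoord M i u) = ef (g i) (g' j) (fexpr i j) (tp t u).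
Proof.
move=> Ou; have /fdom_tp[te Cu Dj] := Ou; set x := icoord M i u.
set i2 := chart_at M x; set j2 := chart_at M' (Phi t x).
have Di2 : dom M i2 x by exact: dom_chart_at.
have Dj2 : dom M' j2 (Phi t x) by exact: dom_chart_at.
have O2 := fdom_tran Ou Di2 Dj2.
rewrite /EN /dT_sqnorm -/i2 -/j2 -(slice_fexpr i2 j2 t).
have [_ oE] := basic_frameP (frame_basic x).
rewrite (@dT_sqnorm_inE R p q p' q' (fsl i2 j2 t)) //.
- by rewrite (ef_slice (g i) (g' j) (ck_fexpr i j) Ou) (edens_tran Ou Di2 Dj2).
- by move=> v /fsl_cod; exact: posdef_gmx.
- by move=> k; exact: ck_slice_fexpr.
- exact: fol_slice.
Qed.

Lemma ck_ef_loc i j k : ck k (fdom i j) (ef (g i) (g' j) (fexpr i j)).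
Proof. by apply: (@ck_ef R p q p' q' (cod M i) (g i) (cod M' j) (g' j)); eauto with fam. Qed.

Lemma derive_ef_loc i j u : fsl i j 0 u -> 'D_ddt (ef (g i) (g' j) (fexpr i j)) (tp 0 u) =
  2 * edens1 (g i) (g' j) (slice (fexpr i j) 0) (velocity (fexpr i j) 0) u.
Proof. by apply: (@derive_ef R p q p' q' (cod M i) (g i) (cod M' j) (g' j) (fdom i j) (fexpr i j)); eauto with fam. Qed.

Lemma derive_ef_t i j t u : fdom i j (tp t u) ->
  is_derive t (1 : R) (fun s : R => ef (g i) (g' j) (fexpr i j) (tp s u)) ('D_ddt (ef (g i) (g' j) (fexpr i j)) (tp t u)).
Proof.
by move=> Ow; apply: is_derive_tp; exact: ck_diff (ck_ef_loc i j 0) Ow.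
Qed.

Definition E1 (x : M) : R := 'D_(1 : R) (fun t => EN t x) 0.

Lemma E1_loc i j u : fsl i j 0 u -> E1 (icoord M i u) = 'D_ddt (ef (g i) (g' j) (fexpr i j)) (tp 0 u).
Proof.
move=> Ou; have [_ <-] := derive_ef_t Ou; rewrite /E1; apply: diff_near_eq.
by apply: filterS (near_tp Ou) => s Os; rewrite (EN_loc Os).
Qed.

Variable Vf : M -> 'rV[R]_q'.
Hypothesis HV : forall x, is_derive (0 : R) 1 (fun t => coord M' (chart_at M' (Phi 0 x)) (Phi t x))
  (sigma (g' (chart_at M' (Phi 0 x))) (coord M' (chart_at M' (Phi 0 x)) (Phi 0 x)) (Vf x)).

Lemma E1E x : E1 x = 2 * (DD x - pb_metric g' (Phi 0) x (Vf x) (tau_b g g' (Phi 0) x)).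
Proof.
set i := chart_at M x; set j := chart_at M' (Phi 0 x); set u := coord M i x.
have Di : dom M i x by exact: dom_chart_at.
have Dj : dom M' j (Phi 0 x) by exact: dom_chart_at.
have xE : icoord M i u = x by exact: coordK.
have Ou : fsl i j 0 u by apply/fdom_tp; rewrite normr0 xE; split => //; exact: coord_cod.
rewrite -{1}xE (E1_loc Ou) (derive_ef_loc Ou); congr (2 * _).
have := first_variation_at Ou (frame_basic x); rewrite -/(DD x) => <-.
rewrite /pb_metric /tau_b -/i -/j -/u -(slice_fexpr i j 0).
have fE : coord M' j (Phi 0 x) = slice (fexpr i j) 0 u by rewrite slice_fexpr /local_expr xE.
rewrite (@gQE R p' q' (g' j)) fE.
(* The variation is prescribed as the lift of [Vf x] in the chart selected at [Phi 0 x]; its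
   transverse part recovers [Vf x]. *)
have -> : Vf x = rsubmx (velocity (fexpr i j) 0 u).
  have [_ <-] := derive_fexpr Ou; have [_] := HV x; rewrite -/j => H.
  have -> : (fun s : R => fexpr i j (tp s u)) = (fun t => coord M' j (Phi t x)).
    by apply/funext => s; rewrite /fexpr lsub_tp rsub_tp xE.
  by rewrite H rsubmx_sigma.
by rewrite addrK.
Qed.

(** Smoothness is joint in time and position, so the second time derivative of the density is
    bounded near [(0, u0)] and the remainder is uniform in the point. *)
Lemma EN_taylor i j u0 : fsl i j 0 u0 -> exists r C : R, [/\ 0 < r, 0 <= C, ball u0 r `<=` fsl i j 0 &
  forall u t, ball u0 r u -> `|t| < r -> fdom i j (tp t u) /\
    `|EN t (icoord M i u) - EN 0 (icoord M i u) - t * E1 (icoord M i u)| <= C * t ^+ 2].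
Proof.
move=> Ou0; pose F := ef (g i) (g' j) (fexpr i j).
have [C C0 BC] := bounded_near_ex (ck_cont (ck_derive ddt (ck_derive ddt (ck_ef_loc i j 2))) Ou0).
have N : nbhs (tp 0 u0) (fdom i j) by apply: open_nbhs_nbhs; split => //; exact: open_fdom.
have NN : nbhs (tp 0 u0) (fun w => fdom i j w /\ `|'D_ddt ('D_ddt (ef (g i) (g' j) (fexpr i j))) w| <= C)  by exact: filterI N BC.
move/nbhs_ballP : NN => [r /= r0 rH].
have inB t u : ball u0 r u -> `|t| < r -> ball (tp 0 u0) r (tp t u).
  rewrite -!ball_normE /= => uB tr; rewrite /tp opp_row_mx add_row_mx norm_row_mx gt_max uB andbT.
  by rewrite -rmorphB /= sub0r norm_scalar1 normrN.
exists r, C; split => //; first by move=> u uB; have [] := rH _ (inB 0 u uB (ltac:(by rewrite normr0))).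
move=> u t uB tr; have O s : `|s| < r -> fdom i j (tp s u) by move=> sr; have [] := rH _ (inB s u uB sr).
split; first exact: O.
rewrite !(EN_loc (O _ _))// ?normr0// (E1_loc (O 0 _)) ?normr0//.
have tr' : - r < t < r by rewrite -ltr_norml.
apply: (@taylor2R R (fun s => F (tp s u)) (fun s => 'D_ddt F (tp s u)) (fun s => 'D_ddt ('D_ddt F) (tp s u)) C r C0) tr'.
- by move=> s; rewrite -ltr_norml => sr; apply: derive_ef_t; exact: O.
- move=> s; rewrite -ltr_norml => sr; have Ow := O s sr.
  by apply: is_derive_tp; exact: ck_diff (ck_derive ddt (ck_ef_loc i j 1)) Ow.
- by move=> s; rewrite -ltr_norml => sr; have [_] := rH _ (inB s u uB sr).
Qed.

(** The selected charts and frames need not vary continuously. Continuity comes from a local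
    expression in one fixed pair of charts, valid at all nearby points. *)
Lemma continuous_slice (F : M -> R) (H : chart M -> chart M' -> 'rV[R]_(1 + (p + q)) -> R) (t : R) : `|t| < eps ->
  (forall (i : chart M) (j : chart M'), ck 0 (fdom i j) (H i j)) ->
  (forall i j u, fsl i j t u -> F (icoord M i u) = H i j (tp t u)) -> continuous F.
Proof.
move=> te cH FH x; pose i := chart_at M x; pose j := chart_at M' (Phi t x).
have Di : dom M i x by exact: dom_chart_at.
have Ou : fsl i j t (coord M i x).
  by apply/fdom_tp; rewrite coordK//; split => //; [exact: coord_cod|exact: dom_chart_at].
have N : nbhs x (dom M i `&` coord M i @^-1` fsl i j t).
  by apply: open_nbhs_nbhs; split => //; apply: coord_preimage; exact: open_fsl.
have E : \forall y \near x, H i j (tp t (coord M i y)) = F y.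
  by apply: filterS N => y [Dy Uy]; rewrite -(FH _ _ _ Uy) coordK.
have ck0 : ck 0 (fsl i j t) (fun u => H i j (tp t u)).
  by apply: (ck_comp (V := fdom i j)); [exact: open_fsl|by move=> u|apply: ck_tp; exact: open_fsl|exact: cH].
rewrite /continuous_at -(nbhs_singleton E); apply: cvg_trans; first exact: (near_eq_cvg E).
apply: (continuous_comp (f := coord M i) (g := fun u => H i j (tp t u))); first exact: coord_continuous.
exact: ck_cont ck0 Ou.
Qed.

Lemma continuous_EN t : `|t| < eps -> continuous (EN t).
Proof.
move=> te; apply: (continuous_slice (H := fun i j => ef (g i) (g' j) (fexpr i j)) te) => [i j|i j u Ou].
  exact: ck_ef_loc.
exact: (EN_loc Ou).
Qed.

Lemma continuous_E1 : continuous (E1).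
Proof.
have te : `|0 : R| < eps by rewrite normr0.
apply: (continuous_slice (H := fun i j => 'D_ddt (ef (g i) (g' j) (fexpr i j))) te) => [i j|i j u Ou].
  by apply: (ck_derive (k := 0) ddt); exact: ck_ef_loc.
exact: (E1_loc Ou).
Qed.

(** A foliated box with its data: chart, centre and radius, target chart, admissible flow time [bd],
    speed bound [bM], common bound [bC], second-order constant [bK] of the volume estimate, and
    transverse flow [bpsi]. *)
Record box := Box { bi : chart M; bu : V; br : R; bj : chart M'; bd : R; bM : R; bC : R; bK : R; bpsi : R -> Q -> Q }.

Definition bpt b (c : Q) : V := row_mx (lsubmx (bu b)) c.
Definition bX b (c : Q) : Q := fX (bi b) (bj b) (bpt b c).
Definition bG b (c : Q) : 'M[R]_q := gam (g (bi b)) (bpt b c).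
Definition brho b (c : Q) : R := Num.sqrt (\det (bG b c)).

Record good b : Prop := Good {
  good_r : 0 < br b; good_d : 0 < bd b; good_M : 0 <= bM b; good_C : 0 < bC b; good_K : 0 <= bK b;
  good_dom : ball (bu b) (br b) `<=` fsl (bi b) (bj b) 0;
  good_lden : forall u, ball (bu b) (br b) u -> (bC b)^-1 <= lden g (bi b) u <= bC b;
  good_mden : forall u, ball (bu b) (br b) u -> mden g (bi b) u <= bC b;
  good_rho : forall c, ball (rsubmx (bu b)) (br b) c -> (bC b)^-1 <= brho b c;
  good_DD : forall u, ball (bu b) (br b) u -> `|DD (icoord M (bi b) u)| <= bC b;
  good_EN : forall u t, ball (bu b) (br b) u -> `|t| < br b -> fdom (bi b) (bj b) (tp t u) /\
    `|EN t (icoord M (bi b) u) - EN 0 (icoord M (bi b) u) - t * E1 (icoord M (bi b) u)| <= bC b * t ^+ 2;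
  good_psi0 : forall c, bpsi b 0 c = c;
  good_psiK : forall c (s : R), `|s| < bd b -> bpsi b (- s) (bpsi b s c) = c;
  good_psiM : forall c (s : R), `|s| < bd b -> `|bpsi b s c - c| <= bM b * `|s|;
  good_psid : forall c (s : R), `|s| < bd b -> ball (rsubmx (bu b)) (br b / 2) c ->
    ball (rsubmx (bu b)) (br b) (bpsi b s c) /\ is_derive s (1 : R) (bpsi b ^~ c) (bX b (bpsi b s c));
  good_psiL : forall (u v : Q) (s : R), `|s| < bd b -> `|bpsi b s u - bpsi b s v| <= 2 * `|u - v|;
  good_psiu : forall (y : R -> Q) (d' : R), d' <= bd b ->
    (forall s : R, `|s| < d' -> ball (rsubmx (bu b)) (br b) (y s) /\ is_derive s (1 : R) y (bX b (y s))) ->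
    forall s : R, `|s| < d' -> y s = bpsi b s (y 0);
  good_cov : forall (B : set Q) (s : R) (F : Q -> \bar R), open B -> B `<=` ball (rsubmx (bu b)) (br b / 2) -> `|s| < bd b ->
    measurable_fun setT (F : Borel Q -> \bar R) -> (forall v, 0 <= F v)%E ->
    (\int[lam R q]_(v in [set v | B (bpsi b (- s)%R v)]) (F v * (brho b v)%:E)
     <= \int[lam R q]_(u in B) (F (bpsi b s u) * (brho b u + s * fdiv (bX b) (brho b) u + bK b * s ^+ 2)%R%:E))%E }.

Section plaques.
Variables (b : box) (r : R).
Hypotheses (r0 : 0 < r) (rD : ball (bu b) r `<=` fsl (bi b) (bj b) 0).
Let T := ball (rsubmx (bu b)) r.
Let c0 := rsubmx (bu b).

Lemma bpt_ball c : T c -> ball (bu b) r (bpt b c).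
Proof. by move=> Tc; apply/ball_row_mx; split => //; exact: ballxx. Qed.

Lemma fX_plaque u v : ball (bu b) r u -> ball (bu b) r v -> rsubmx u = rsubmx v -> fX (bi b) (bj b) u = fX (bi b) (bj b) v.
Proof.
move=> uB vB uv; apply/rowP => k.
have dX (w : V) : ball (bu b) r w -> differentiable (fX (bi b) (bj b)) w.
  by move=> /rD Ow; exact: ck_diff (ck_fX _ _ 0) Ow.
apply: (@plaque_const R p q R (fun w : V => fX (bi b) (bj b) w 0 k) (bu b) r) uv => // w.
  by move=> /dX dw; apply: differentiable_entry.
by move=> z wB z0; rewrite -(derive_entry _ _ _ (dX w wB)) (fX_leaf (rD wB) z0) mxE.
Qed.

Lemma fX_bX u : ball (bu b) r u -> fX (bi b) (bj b) u = bX b (rsubmx u).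
Proof.
move=> uB; apply: fX_plaque => //; last by rewrite row_mxKr.
by apply: bpt_ball; case/ball_pt: uB.
Qed.

Lemma gam_bG u : ball (bu b) r u -> gam (g (bi b)) u = bG b (rsubmx u).
Proof.
move=> uB; apply: (@gam_plaque R p q M g (bi b) (bu b) r) => //; last by rewrite row_mxKr.
  by move=> w /rD/fsl_cod.
by apply: bpt_ball; case/ball_pt: uB.
Qed.

Let oT : open T. Proof. exact: ball_open. Qed.
Let ck_bpt k : ck k T (bpt b).
Proof. by apply: ck_row_mx => //; [exact: ck_cst|exact: ck_id]. Qed.

Lemma ck_bX k : ck k T (bX b).
Proof.
apply: (ck_comp_mx (V := fsl (bi b) (bj b) 0) oT _ _ (ck_bpt k)); [exact: open_fsl|by move=> c /bpt_ball/rD|].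
exact: ck_fX.
Qed.

Lemma ck_bG k : ck k T (bG b).
Proof.
apply: (ck_comp_mx (V := cod M (bi b)) oT _ _ (ck_bpt k)); [exact: open_cod|by move=> c /bpt_ball/rD/fsl_cod|].
by apply: ck_gam; [exact: open_cod|exact: ck_gmx|exact: posdef_gmx].
Qed.

Lemma bG_pos c : T c -> posdef (bG b c).
Proof. by move=> /bpt_ball/rD/fsl_cod; apply: gam_pos => w; exact: posdef_gmx. Qed.

Lemma ck_brho k : ck k T (brho b).
Proof.
apply: ck_sqrt => //; first by move=> c /bG_pos/posdef_det.
by apply: ck_det => //; exact: ck_bG.
Qed.

Lemma brho_gt0 c : T c -> 0 < brho b c.
Proof. by move=> /bG_pos/posdef_det; rewrite sqrtr_gt0. Qed.

Lemma fdiv_DD u : ball (bu b) r u -> fdiv (bX b) (brho b) (rsubmx u) = brho b (rsubmx u) * DD (icoord M (bi b) u).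
Proof.
move=> uB; have Tu : T (rsubmx u) by case/ball_pt: uB.
rewrite (DD_loc (rD uB)).
apply: (@fdiv_tdiv R p q (ball (bu b) r) (g (bi b)) (fX (bi b) (bj b)) (bX b) (bG b)).
- exact: ball_open.
- exact: uB.
- exact: fX_bX.
- exact: gam_bG.
- exact: ck_diff (ck_bX 0) Tu.
- exact: ck_diff (ck_bG 0) Tu.
- exact: bG_pos.
- exact: ck_diff (ck_brho 0) Tu.
- have : nbhs (rsubmx u) T by exact: open_nbhs_nbhs.
  by apply: filterS => c /bG_pos/posdef_det/ltW.
Qed.

End plaques.

Lemma good_box x : exists b, [/\ good b, cod M (bi b) (bu b) & icoord M (bi b) (bu b) = x].
Proof.
pose i := chart_at M x; pose j := chart_at M' (Phi 0 x); pose u0 := coord M i x.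
have Di : dom M i x by exact: dom_chart_at.
have xE : icoord M i u0 = x by exact: coordK.
have Cu : cod M i u0 by exact: coord_cod.
have Ou : fsl i j 0 u0 by apply/fdom_tp; rewrite normr0 xE; split => //; exact: dom_chart_at.
have [r1 [C1 [r10 C10 rD1 EN1]]] := EN_taylor Ou.
(* A provisional box with a dummy flow: [bX] and [brho] depend only on the charts and the centre, so
   facts about them carry over when radius, time and flow are chosen. *)
pose b0 := Box i u0 r1 j 1 1 1 1 (fun _ c => c); pose c0 := rsubmx u0; pose T := ball c0 r1.
have Tc : T c0 by exact: ballxx.
have oT : open T by exact: ball_open.
have cX k : ck k T (bX b0) by exact: (@ck_bX b0 r1 r10 rD1).
have crh k : ck k T (brho b0) by exact: (@ck_brho b0 r1 r10 rD1).
have rh0 c : T c -> 0 < brho b0 c by exact: (@brho_gt0 b0 r1 r10 rD1).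
have [K1 K10 B1] := bounded_near_ex (ck_cont (ck_lden g 0 i) Cu).
have cl : ck 0 (cod M i) (fun u => (lden g i u)^-1).
  by apply: ckV; [exact: open_cod|move=> u /(lden_gt0 g)/lt0r_neq0|exact: ck_lden].
have [K2 K20 B2] := bounded_near_ex (ck_cont cl Cu).
have [K3 K30 B3] := bounded_near_ex (ck_cont (ck_mden g 0 i) Cu).
have cr : ck 0 T (fun c => (brho b0 c)^-1).
  by apply: ckV => // c /rh0/lt0r_neq0.
have [K4 K40 B4] := bounded_near_ex (ck_cont cr Tc).
have cf : ck 0 T (fun c => fdiv (bX b0) (brho b0) c).
  by apply: ck_fdiv.
have [K5 K50 B5] := bounded_near_ex (ck_cont cf Tc).
have N1 : nbhs u0 (fun u => `|lden g i u| <= K1 /\ (`|(lden g i u)^-1| <= K2 /\ `|mden g i u| <= K3)).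
  exact: filterI B1 (filterI B2 B3).
have N2 : nbhs c0 (fun c => `|(brho b0 c)^-1| <= K4 /\ `|fdiv (bX b0) (brho b0) c| <= K5).
  exact: filterI B4 B5.
move/nbhs_ballP : N1 => [r2 /= r20 H2]; move/nbhs_ballP : N2 => [r3 /= r30 H3].
pose R1 := Num.min r1 (Num.min r2 r3).
have R10 : 0 < R1 by rewrite !lt_min r10 r20 r30.
have [r [d [Mc [Cf [psi [/andP[rr rR] d0 M0 Cf0 [rT Md p0 pK [pM pd pL pu pc]]]]]]]] :=
  local_flow oT Tc cX crh (fun c Tc => ltW (rh0 c Tc)) R10.
have [rr1 rr2 rr3] : [/\ r <= r1, r <= r2 & r <= r3] by move: rR; rewrite !le_min => /and3P[].
(* One constant for all bounds. The product [K4 * K5] controls [DD], which is [fdiv] divided by the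
   transverse density. *)
pose C := 1 + C1 + K1 + K2 + K3 + K4 + K4 * K5 + Cf.
have K45 : 0 <= K4 * K5 by rewrite mulr_ge0.
have C0 : 0 < C by rewrite /C; lra.
exists (Box i u0 r j d Mc C Cf psi); split => //.
have sub n (c : 'rV[R]_n) (a a' : R) : a <= a' -> ball c a `<=` ball c a' by move=> h; exact: le_ball.
have inv (a K : R) : 0 < a -> `|a^-1| <= K -> K <= C -> C^-1 <= a.
  move=> a0 h1 h2; rewrite -[a]invrK lef_pV2 ?posrE ?invr_gt0//.
  by apply: le_trans h2; apply: le_trans h1; exact: ler_norm.
split => //=.
- by move=> u /(sub _ _ _ _ rr1)/rD1.
- move=> u uB; have [h1 [h2 h3]] := H2 _ (sub _ _ _ _ rr2 _ uB).
  have Cu' : cod M i u by have /rD1/fsl_cod := sub _ _ _ _ rr1 _ uB.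
  apply/andP; split; first by apply: inv h2 _; [exact: lden_gt0|rewrite /C; lra].
  by apply: le_trans (ler_norm _) _; apply: le_trans h1 _; rewrite /C; lra.
- move=> u uB; have [h1 [h2 h3]] := H2 _ (sub _ _ _ _ rr2 _ uB).
  by apply: le_trans (ler_norm _) _; apply: le_trans h3 _; rewrite /C; lra.
- move=> c cB; have [h1 h2] := H3 _ (sub _ _ _ _ rr3 _ cB).
  by apply: inv h1 _; [apply: rh0; exact: sub cB|rewrite /C; lra].
- move=> u uB; have uB1 := sub _ _ _ _ rr1 _ uB.
  have cB : ball c0 r (rsubmx u) by case/ball_pt: uB.
  have [h1 h2] := H3 _ (sub _ _ _ _ rr3 _ cB).
  have := @fdiv_DD b0 r1 r10 rD1 u uB1; rewrite /= => E.
  have rp : 0 < brho b0 (rsubmx u) by apply: rh0; exact: sub cB.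
  have -> : DD (icoord M i u) = (brho b0 (rsubmx u))^-1 * fdiv (bX b0) (brho b0) (rsubmx u).
    by rewrite E mulrA mulVf ?mul1r// gt_eqF.
  rewrite normrM; apply: le_trans (ler_pM _ _ h1 h2) _ => //; rewrite /C; lra.
- move=> u t uB tr; have [h1 h2] := EN1 u t (sub _ _ _ _ rr1 _ uB) (lt_le_trans tr rr1).
  by split => //; apply: le_trans h2 _; apply: ler_wpM2r; [exact: sqr_ge0|rewrite /C; lra].
Qed.

#[local] Opaque DD EN E1.

(** * Flows on a countable cover by boxes *)

Section box_cover.
Variable b_ : nat -> box.
Hypothesis gb : forall n, good (b_ n).
Local Notation bi_ k := (bi (b_ k)).
Local Notation bu_ k := (bu (b_ k)).
Local Notation br_ k := (br (b_ k)).
Local Notation bd_ k := (bd (b_ k)).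
Local Notation bC_ k := (bC (b_ k)).
Local Notation bK_ k := (bK (b_ k)).
Local Notation bX_ k := (bX (b_ k)).
Local Notation brho_ k := (brho (b_ k)).
Local Notation bpsi_ k := (bpsi (b_ k)).
Local Notation i_ := (fun n => bi_ n).
Local Notation u_ := (fun n => bu_ n).
Local Notation r_ := (fun n => br_ n).
Local Notation mid := (obox i_ u_ (fun n => br_ n / 2)).
(** Three concentric sizes: the cores cover M, a short flow takes a core into the middle box, and
    trajectories from the middle box stay in the full box. *)
Definition core := (obox i_ u_ (fun n => br_ n / 4)).
Local Notation obox := (obox i_ u_ r_).
Local Notation trv := (trv i_).
Local Notation hreach := (hreach i_ u_ r_).
Local Notation valid := (valid u_ r_).
Local Notation tpt := (tpt i_ u_).
Local Notation transv := (@transv R q).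

Lemma box_r n : 0 < br_ n. Proof. exact: good_r (gb n). Qed.
Lemma box_cod n : ball (bu_ n) (br_ n) `<=` cod M (bi_ n).
Proof. by move=> u /(good_dom (gb n))/fsl_cod. Qed.
Lemma midC n : ball (bu_ n) (br_ n / 2) `<=` cod M (bi_ n).
Proof. by move=> u /(ball_half (box_r n))/(@box_cod n). Qed.
Lemma mid_obox n : mid n `<=` obox n.
Proof. by move=> _ [u uB <-]; exists u => //; exact: ball_half (box_r n) _ uB. Qed.

Lemma obox_dom' n x : obox n x -> dom M' (bj (b_ n)) (Phi 0 x).
Proof. by move=> [u /(good_dom (gb n))/fdom_tp[_ _ D] <-]. Qed.

Lemma bX_cross n m x : obox n x -> obox m x ->
  bX_ m (trv m x) = bX_ n (trv n x) *m TJ (tran (bi_ n) (bi_ m)) (coord M (bi_ n) x).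
Proof.
move=> On Om; have [Dn Bn] := (oboxP box_cod n x).1 On; have [Dm Bm] := (oboxP box_cod m x).1 Om.
rewrite -(fX_bX (box_r n) (good_dom (gb n)) Bn) -(fX_bX (box_r m) (good_dom (gb m)) Bm).
have xE : icoord M (bi_ n) (coord M (bi_ n) x) = x by exact: coordK.
rewrite -(fX_tran (i := bi_ n) (j := bj (b_ n)) (j2 := bj (b_ m))).
- by rewrite /tran /= xE.
- exact: good_dom (gb n) _ Bn.
- by rewrite xE.
- by rewrite xE; exact: obox_dom'.
Qed.

(* The flows of two overlapping boxes are conjugate under the change of plaques, by uniqueness of integral curves. *)
Lemma flow_cross n m x : obox n x -> obox m x -> exists W : set M, exists d : R, [/\ open W, W x, 0 < d &
  forall y (s : R), W y -> mid n y -> `|s| < d -> hreach (n, bpsi_ n s (trv n y)) (m, bpsi_ m s (trv m y))].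
Proof.
move=> On Om; pose i := bi_ n; pose j := bi_ m; pose u := coord M i x.
have [Dn Bn] := (oboxP box_cod n x).1 On.
pose O := (ball (bu_ n) (br_ n) : set V) `&` (cod M i `&` icoord M i @^-1` obox m).
have oO : open O by apply: openI; [exact: ball_open|apply: icoord_preimage; exact: obox_open box_cod m].
have Ou : O u by split => //; split; [exact: coord_cod|rewrite /= coordK].
have OT v : O v -> tdom i j v /\ ball (bu_ m) (br_ m) (tran i j v).
  by move=> [_ [Cv /= /(oboxP box_cod)[Dv Bv]]].
have : nbhs u O by exact: open_nbhs_nbhs.
move/nbhs_ballP => [e /= e0 eO]; have e2 : 0 < e / 2 by lra.
have M0 := good_M (gb n); have M1 : 0 < bM (b_ n) + 1 by lra.
pose d := Num.min (Num.min (bd_ n) (bd_ m)) (e / 2 / (bM (b_ n) + 1)).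
have d0 : 0 < d by rewrite !lt_min (good_d (gb n)) (good_d (gb m)) divr_gt0.
exists (icoord M i @` ball u (e / 2)), d; split => //.
- apply: icoord_open; first exact: ball_open.
  by move=> v vB; have [_ []] := eO v (ball_half e0 vB).
- by exists u; [exact: ballxx|exact: coordK].
move=> y s [v vB <-] my sd; pose a := lsubmx v; pose c := rsubmx v.
have Cv : cod M i v by have [_ []] := eO v (ball_half e0 vB).
have trc : trv n (icoord M i v) = c by rewrite /trv icoordK.
have vm : ball (rsubmx (bu_ n)) (br_ n / 2) c.
  by have [_] := (oboxP midC n _).1 my; rewrite icoordK// => /ball_pt[].
have dn : d <= bd_ n by rewrite !ge_min lexx.
have dm : d <= bd_ m by rewrite !ge_min lexx orbT.
have ps (t : R) : `|t| < d -> O (row_mx a (bpsi_ n t c)).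
  move=> td; apply: eO; apply/ball_row_mx.
  have [v1 v2] := (ball_pt _ _ _).1 vB; split; first exact: ball_half e0 _ v1.
  have -> : e = e / 2 + e / 2 by lra.
  apply: ball_triangle v2 _; rewrite -ball_normE /= distrC.
  apply: le_lt_trans (good_psiM (gb n) c (lt_le_trans td dn)) _.
  have : `|t| < e / 2 / (bM (b_ n) + 1) by apply: lt_le_trans td _; rewrite !ge_min lexx !orbT.
  rewrite ltr_pdivlMr// mulrC => h; apply: le_lt_trans h.
  by apply: ler_wpM2r => //; lra.
pose Y (t : R) := rsubmx (tran i j (row_mx a (bpsi_ n t c))).
have Y0 : Y 0 = trv m (icoord M i v) by rewrite /Y (good_psi0 (gb n)) hsubmxK.
have box_n t : `|t| < d -> obox n (icoord M i (row_mx a (bpsi_ n t c))).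
  by move=> /ps[Bt _]; exists (row_mx a (bpsi_ n t c)).
have box_m t : `|t| < d -> obox m (icoord M i (row_mx a (bpsi_ n t c))).
  by move=> /ps[_ []].
have trn t : `|t| < d -> trv n (icoord M i (row_mx a (bpsi_ n t c))) = bpsi_ n t c.
  by move=> /ps[_ [Ct _]]; rewrite /trv icoordK// row_mxKr.
have YE : forall t : R, `|t| < d -> Y t = bpsi_ m t (Y 0).
  apply: (good_psiu (gb m) dm) => t td.
  have [Tt Bt] := OT _ (ps t td); split; first by case/ball_pt: Bt.
  have [_ dpsi] := good_psid (gb n) (lt_le_trans td dn) vm.
  have [dF DF] := derive_transverse (bX_ n (bpsi_ n t c)) (ck_diff (ck_tran _ _ 0) Tt).
  have -> : bX_ m (Y t) = 'D_(bX_ n (bpsi_ n t c)) (fun c => rsubmx (tran i j (row_mx a c))) (bpsi_ n t c).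
    apply: etrans _ (esym DF); have Ct : cod M i (row_mx a (bpsi_ n t c)) by case: Tt.
    have := bX_cross (box_n t td) (box_m t td); rewrite (trn t td) (icoordK Ct) => <-.
    by congr (bX_ m _); rewrite /Y /tran.
  exact: (is_derive_chain (f := fun c => rsubmx (tran i j (row_mx a c))) dpsi dF).
rewrite trc -Y0 -YE//.
have := hreach_cross box_cod (box_n s sd) (box_m s sd); rewrite trn//.
Qed.

Variables (Omega : set M) (N : nat).
Hypotheses (cO : compact Omega) (offO : forall t x, `|t| < eps -> ~ Omega x -> Phi t x = Phi 0 x).

Let clO : closed Omega. Proof. by apply: compact_closed => //; exact: carrier_hausdorff. Qed.
Local Notation cross n m s y := (mid n y -> mid m y -> hreach (n, bpsi_ n s (trv n y)) (m, bpsi_ m s (trv m y))).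

(** [flow_cross] needs [x] in both boxes. Otherwise [x] is outside the image of a closed half-size
    ball; this image is closed, and on its complement the assertion is void. *)
Lemma flow_local n m x : exists W : set M, exists d : R, [/\ open W, W x, 0 < d &
  forall y (s : R), W y -> `|s| < d -> cross n m s y].
Proof.
pose K n := icoord M (bi_ n) @` [set v | `|v - bu_ n| <= br_ n / 2].
have Kc k : closed (K k).
  have r0 := box_r k; apply: (compact_image_box (r' := br_ k)); [lra|lra|exact: box_cod].
have mK k y : mid k y -> K k y.
  by move=> [v vB <-]; exists v => //=; apply: ltW; move: vB; rewrite -ball_normE /= distrC.
have Ko k y : K k y -> obox k y.
  move=> [v /= vB <-]; exists v => //; rewrite -ball_normE /= distrC.
  by apply: le_lt_trans vB _; have := box_r k; lra.
have [Kn|Kn] := pselect (K n x); last first.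
  exists (~` K n), 1; split => //; first exact: closed_openC.
  by move=> y s nK _ /mK.
have [Km|Km] := pselect (K m x); last first.
  exists (~` K m), 1; split => //; first exact: closed_openC.
  by move=> y s nK _ _ /mK.
have [W [d [oW Wx d0 H]]] := flow_cross (Ko _ _ Kn) (Ko _ _ Km).
by exists W, d; split => // y s Wy sd mn _; exact: H.
Qed.

(** Compactness of [Omega], in its near-covering form, makes the local times of [flow_local] uniform
    for one pair of boxes; finitely many pairs are involved. *)
Lemma flow_hreach : exists2 d : R, 0 < d & forall n m, (n < N)%N -> (m < N)%N -> forall y (s : R), Omega y -> `|s| < d ->
  cross n m s y.
Proof.
have H n m : exists2 d : R, 0 < d & forall y (s : R), Omega y -> `|s| < d ->
    cross n m s y.
  have nc := (compact_near_coveringP Omega).1 cO R (nbhs (0 : R)) (fun s y => cross n m s y) _.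
  have : \forall s \near (0 : R), Omega `<=` (fun y => cross n m s y).
    apply: nc => x _; have [W [d [oW Wx d0 HW]]] := flow_local n m x.
    exists (W, ball (0 : R) d) => /=.
      by split; [exact: open_nbhs_nbhs|exact: nbhsx_ballx].
    move=> [y s] /= [Wy]; rewrite -ball_normE /= sub0r normrN => sd mn mm; exact: HW.
  move/nbhs_ballP => [d /= d0 Hd]; exists d => // y s Oy sd; apply: Hd => //.
  by rewrite -ball_normE /= sub0r normrN.
have Hn n : exists2 d : R, 0 < d & forall m, (m < N)%N -> forall y (s : R), Omega y -> `|s| < d ->
    cross n m s y.
  apply: finite_pos_min (H n) => m d d' h /andP[_ dd] y s Oy sd; apply: h => //; exact: lt_le_trans dd.
have [d d0 Hd] := finite_pos_min N (P := fun n d => forall m, (m < N)%N -> forall y (s : R), Omega y -> `|s| < d ->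
    cross n m s y)
  (fun n d d' h dd m mN y s Oy sd => h m mN y s Oy (lt_le_trans sd (andP dd).2)) Hn.
by exists d => // n m nN mN; exact: Hd.
Qed.

Hypotheses (covC : forall x, exists n, core n x) (covN : forall x, Omega x -> exists2 n, (n < N)%N & core n x).
Local Notation r0 := box_r.
Local Notation BC := box_cod.
Local Notation tnu := (tnu g r0 BC).

Lemma core_ball n : ball (bu_ n) (br_ n / 4) `<=` ball (bu_ n) (br_ n / 2).
Proof. by apply: le_ball; have := r0 n; lra. Qed.
Lemma core_mid n : core n `<=` mid n.
Proof. by move=> _ [u uB <-]; exists u => //; exact: core_ball. Qed.
Lemma core_obox n : core n `<=` obox n.
Proof. by move=> x /core_mid/(mid_obox). Qed.
Lemma coreC n : ball (bu_ n) (br_ n / 4) `<=` cod M (bi_ n).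
Proof. by move=> u /core_ball/(midC). Qed.

Lemma box_cover x : exists n, obox n x.
Proof. by have [n /core_obox] := covC x; exists n. Qed.
Lemma mid_cover x : Omega x -> exists2 n, (n < N)%N & mid n x.
Proof. by move=> /covN[n nN /core_mid]; exists n. Qed.

Lemma llc_intro (X : Type) (f : M -> X) (W : set M) n x : open W -> W x -> obox n x ->
  (forall y, W y -> leaf x y -> obox n y -> trv n y = trv n x -> f y = f x) -> llc f x.
Proof.
move=> oW Wx Ox H i Di; pose u := coord M i x.
have uE : icoord M i u = x by exact: coordK.
have oO : open (cod M i `&` icoord M i @^-1` (W `&` obox n)).
  by apply: icoord_preimage; apply: openI => //; exact: obox_open box_cod n.
have : nbhs u (cod M i `&` icoord M i @^-1` (W `&` obox n)).
  by apply: open_nbhs_nbhs; split => //; split; [exact: coord_cod|rewrite /= uE].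
move/nbhs_ballP => [r /= r0 rO]; exists r => // v vB vu.
have [Cv [Wv Ov]] := rO v vB; have uB : ball u r u by exact: ballxx.
apply: H => //; first by rewrite -[x]uE; apply: (ball_plaque (u0 := u) (r := r)) => // w /rO[].
rewrite -[x in RHS]uE; apply: (@tran_plaque R p q M i (bi_ n) u r) => //.
by move=> w /rO[Cw [_ /(oboxP box_cod)[Dw _]]].
Qed.

Local Notation coreT z := (ball (rsubmx (bu_ z.1)) (br_ z.1 / 4) z.2).
Definition midT (z : transv) := ball (rsubmx (bu_ z.1)) (br_ z.1 / 2) z.2.
Definition psis (s : R) (z : transv) : transv := (z.1, bpsi_ z.1 s z.2).

Lemma midT_tpt z : midT z -> mid z.1 (tpt z).
Proof.
move=> Bz; exists (row_mx (lsubmx (bu_ z.1)) z.2) => //.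
by apply/ball_row_mx; split => //; apply: ballxx; have := box_r z.1; lra.
Qed.

Lemma midT_valid z : midT z -> valid z.
Proof. exact: ball_half (box_r z.1) _. Qed.

(** The orbit of the flowed plaque is a function on the leaf: independent of the box by
    [flow_hreach], and locally constant along the leaf. The leaf must stay in [Omega], where the
    first [N] boxes suffice. *)
Lemma flow_leaf : exists2 d : R, 0 < d & forall (s : R) (z1 z2 : transv), `|s| < d -> (z1.1 < N)%N -> (z2.1 < N)%N ->
  midT z1 -> midT z2 -> leaf (tpt z1) `<=` Omega -> leaf (tpt z1) (tpt z2) -> hreach (psis s z1) (psis s z2).
Proof.
have [d d0 Hd] := flow_hreach; exists d => // s z1 z2 sd z1N z2N m1 m2 LO L.
pose f z := [set e | exists n, [/\ (n < N)%N, mid n z & hreach (n, bpsi_ n s (trv n z)) e]].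
have fE n z : Omega z -> (n < N)%N -> mid n z -> f z = hreach (n, bpsi_ n s (trv n z)).
  move=> Oz nN mz; apply/seteqP; split => e /=; last by exists n.
  by move=> [m [mN mmz]]; apply: hreach_trans; exact: Hd.
have ff : f (tpt z2) = f (tpt z1).
  apply: (leaf_const (f := f)) L => z Lz; have Oz : Omega z by exact: LO.
  have [n nN mz] := mid_cover Oz.
  apply: (llc_intro (W := mid n) (n := n)) => //; [exact: obox_open midC n|exact: mid_obox|].
  move=> y my Ly _ ty; have Oy : Omega y by apply: LO; exact: leaf_trans Ly.
  by rewrite (fE n y)// (fE n z)// ty.
have O1 : Omega (tpt z1) by apply: LO; exact: leaf_refl.
have O2 : Omega (tpt z2) by exact: LO.
have E1 : trv z1.1 (tpt z1) = z1.2 by apply: (trv_tpt (i_ := i_) (r_ := r_) box_r box_cod); exact: midT_valid.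
have E2 : trv z2.1 (tpt z2) = z2.2 by apply: (trv_tpt (i_ := i_) (r_ := r_) box_r box_cod); exact: midT_valid.
have F1 := fE _ _ O1 z1N (midT_tpt m1); have F2 := fE _ _ O2 z2N (midT_tpt m2).
rewrite E1 in F1; rewrite E2 in F2; rewrite /psis -F1 -ff F2.
exact: hreach_refl.
Qed.

Lemma box_rho n x : obox n x -> 0 < brho_ n (trv n x).
Proof.
move=> /(oboxP box_cod)[Dx /ball_pt[_ Bx]].
exact: (brho_gt0 (box_r n) (good_dom (gb n)) Bx).
Qed.

Lemma box_DD n x : obox n x -> fdiv (bX_ n) (brho_ n) (trv n x) = brho_ n (trv n x) * DD x.
Proof.
move=> /(oboxP box_cod)[Dx Bx]; have := fdiv_DD (box_r n) (good_dom (gb n)) Bx.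
by rewrite (coordK Dx).
Qed.

Lemma DD_trv n x y : obox n x -> obox n y -> trv n y = trv n x -> DD y = DD x.
Proof.
move=> Ox Oy t; have := box_DD Oy; rewrite t (box_DD Ox) => /mulfI E; apply/esym/E.
by rewrite (gt_eqF (box_rho Ox)).
Qed.

(** In a box [DD] is the quotient of [fdiv] by the transverse density, both functions of the
    transverse coordinate. *)
Lemma DD_leaf x y : leaf x y -> DD y = DD x.
Proof.
apply: leaf_const => z _; have [n Oz] := box_cover z.
apply: (llc_intro (W := obox n) (n := n) (obox_open box_cod n) Oz Oz).
by move=> w _ _ Ow; exact: DD_trv.
Qed.

Lemma bX_off n x : obox n x -> ~ Omega x -> bX_ n (trv n x) = 0.
Proof.
move=> /(oboxP box_cod)[Dx Bx] nO.
rewrite -(fX_bX (box_r n) (good_dom (gb n)) Bx) /fX /xfield.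
have [h1 h2] := derive_fexpr (good_dom (gb n) Bx).
suff -> : velocity (fexpr (bi_ n) (bj (b_ n))) 0 (coord M (bi_ n) x) = 0 by rewrite linear0 !mul0mx.
rewrite -h2.
have E : \forall s \near (0 : R), fexpr (bi_ n) (bj (b_ n)) (tp s (coord M (bi_ n) x)) =
    cst (coord M' (bj (b_ n)) (Phi 0 x)) s.
  have : nbhs (0 : R) (ball 0 eps) by exact: nbhsx_ballx.
  apply: filterS => s; rewrite -ball_normE /= sub0r normrN => se.
  by rewrite /fexpr lsub_tp rsub_tp coordK// offO.
by rewrite (diff_near_eq (1 : R) E) derive_cst.
Qed.

(** Between boxes the field changes by multiplication with a matrix, and within a box it depends on
    the transverse coordinate only; vanishing is therefore constant along leaves. *)
Lemma bX_leaf n m x y : obox n x -> obox m y -> leaf x y -> bX_ n (trv n x) = 0 -> bX_ m (trv m y) = 0.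
Proof.
pose f z := exists k, obox k z /\ bX_ k (trv k z) = 0.
have fE k z : obox k z -> f z -> bX_ k (trv k z) = 0.
  by move=> Ok [l [Ol E]]; rewrite (bX_cross Ol Ok) E mul0mx.
move=> On Om L E; apply: (fE) => //; rewrite (_ : f y = f x); first by exists n.
apply: leaf_const L => z _; have [k Oz] := box_cover z.
apply: (llc_intro (W := obox k) (n := k) (obox_open box_cod k) Oz Oz).
move=> w _ _ Ow t; apply/propext; split => h; exists k; split => //; first by rewrite -t; exact: fE.
by rewrite t; exact: fE.
Qed.

(** The open complement of [Omega] projects to an open set of transverse coordinates. There the
    field vanishes identically, and with it the divergence. *)
Lemma DD_off x : ~ Omega x -> DD x = 0.
Proof.
move=> nO; have [n On] := box_cover x; have [Dx Bx] := (oboxP box_cod n x).1 On.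
pose u := coord M (bi_ n) x; pose c := rsubmx u.
have oO : open ((ball (bu_ n) (br_ n) : set V) `&` (cod M (bi_ n) `&` icoord M (bi_ n) @^-1` (~` Omega))).
  by apply: openI; [exact: ball_open|apply: icoord_preimage; exact: closed_openC].
have : nbhs u ((ball (bu_ n) (br_ n) : set V) `&` (cod M (bi_ n) `&` icoord M (bi_ n) @^-1` (~` Omega))).
  apply: open_nbhs_nbhs; split => //; split => //; split; first exact: coord_cod.
  by rewrite /= coordK.
move/nbhs_ballP => [e /= e0 eO].
have X0 : \forall c' \near c, bX_ n c' = 0.
  have : nbhs c (ball c e) by exact: nbhsx_ballx.
  apply: filterS => c' cB; have vB : ball u e (row_mx (lsubmx u) c') by apply/ball_row_mx; split => //; exact: ballxx.
  have [Bv [Cv nv]] := eO _ vB.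
  have Ov : obox n (icoord M (bi_ n) (row_mx (lsubmx u) c')) by exists (row_mx (lsubmx u) c').
  by have := bX_off Ov nv; rewrite /trv icoordK// row_mxKr.
have := box_DD On; rewrite fdiv_near0//.
  by move=> /esym/eqP; rewrite mulf_eq0 (gt_eqF (box_rho On)) /= => /eqP.
apply: (ck_diff (ck_brho (box_r n) (good_dom (gb n)) 0)).
by case/ball_pt: Bx.
Qed.

(** A single point outside [Omega] carries both vanishing statements to its whole leaf, so only
    leaves inside [Omega] remain to be moved. *)
Lemma off_leaf x : ~ (leaf x `<=` Omega) -> DD x = 0 /\ forall n, obox n x -> bX_ n (trv n x) = 0.
Proof.
move=> /existsNP[y /not_implyP[L nO]]; split; first by rewrite -(DD_leaf L) DD_off.
move=> n On; have [m Om] := box_cover y; apply: (bX_leaf Om On); first exact: leaf_sym.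
exact: bX_off.
Qed.

Lemma psis_fix (s : R) z : midT z -> `|s| < bd_ z.1 -> bX_ z.1 z.2 = 0 -> psis s z = z.
Proof.
case: z => n c /= mz sd X0; congr (_, _).
rewrite -(good_psiu (gb n) (lexx _) (y := fun=> c))// => t td; split; first exact: ball_half (box_r n) _ mz.
by rewrite X0; exact: is_derive_cst.
Qed.

(** * Weights on the transversals and their transport by the flow *)

Definition cell : nat -> set M := seqDU core.
Lemma measurable_cell n : borel (cell n).
Proof. by apply: (@seqDU_measurable _ (Borel M)) => k; apply: open_Borel; exact: obox_open coreC k. Qed.
Lemma cell_core n : cell n `<=` core n. Proof. exact: subset_seqDU. Qed.
Lemma cell_obox n : cell n `<=` obox n. Proof. by move=> x /cell_core/core_obox. Qed.
Lemma trivIset_cell : trivIset setT cell. Proof. exact: trivIset_seqDU. Qed.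
Lemma cell_cover x : exists n, cell n x.
Proof.
have [n cn] := covC x; have : (\bigcup_k core k) x by exists n.
by rewrite seqDU_bigcup_eq => -[k _ ck]; exists k.
Qed.
(** Disjointification assigns a point to the first core containing it, and points of [Omega] lie in
    one of the first [N] cores. *)
Lemma cell_N n x : cell n x -> Omega x -> (n < N)%N.
Proof.
move=> [cn nc] /covN[m mN cm]; rewrite ltnNge; apply/negP => Nn; apply: nc.
by rewrite -bigcup_mkord; exists m => //=; exact: leq_trans Nn.
Qed.
Lemma box_lden n : exists2 C : R, 0 < C & forall u, ball (bu_ n) (br_ n) u -> C^-1 <= lden g (bi_ n) u <= C.
Proof. by exists (bC_ n); [exact: good_C (gb n)|exact: good_lden (gb n)]. Qed.

Local Notation wt := (wt g i_ u_ r_ cell).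
Local Notation muM := (muM g BC measurable_cell).

Definition SS : set transv := [set z | valid z /\ leaf (tpt z) `<=` Omega].
Definition hwt (z : transv) : \bar R := (\esum_(e in hreach z) wt e)%E.
Definition kk (z : transv) : R := (fine (hwt z))^-1.
(** The plaque is cut down to its cell, so that the weights over one holonomy orbit add up
    correctly, and the weight is restricted to leaves inside [Omega]. *)
Definition aa (z : transv) : R := \1_SS z * (fine (wt z) * kk z).

Lemma wt_fin z : wt z \is a fin_num.
Proof.
case: z => n c; have [W HW] := wt_bound r0 BC measurable_cell box_lden n.
by rewrite ge0_fin_numE ?wt_ge0//; apply: le_lt_trans (HW c) _; exact: ltry.
Qed.

Lemma hwt_ge0 z : (0 <= hwt z)%E. Proof. by apply: esum_ge0 => e _; exact: wt_ge0. Qed.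
Lemma kk_ge0 z : 0 <= kk z. Proof. by rewrite invr_ge0 fine_ge0// hwt_ge0. Qed.
Lemma aa_ge0 z : 0 <= aa z.
Proof. by rewrite mulr_ge0 ?indicE// mulr_ge0 ?kk_ge0// fine_ge0// wt_ge0. Qed.

Lemma hwt_vol z : valid z -> hwt z = vol_L g (tpt z).
Proof. by move=> vz; rewrite (vol_L_wt g r0 BC measurable_cell cell_obox trivIset_cell cell_cover vz). Qed.

Lemma kkE n x : obox n x -> kk (n, trv n x) = (fine (vol_L g x))^-1.
Proof.
move=> On; rewrite /kk hwt_vol; last exact: (trv_valid BC On).
by rewrite (vol_L_leaf g (leaf_trv r0 BC On)).
Qed.

Lemma hwt_gt0 z : valid z -> (0 < hwt z)%E.
Proof.
move=> vz; rewrite hwt_vol//; have [e e0 He] := vol_L_plaques r0 BC box_lden z.1.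
apply: (@lt_le_trans _ _ e%:E); first by rewrite lte_fin.
rewrite -[e]mul1r; apply: (He (tpt z) 1%N (fun=> z.2)); first by move=> a b _; rewrite [a]ord1 [b]ord1.
by move=> _; rewrite -surjective_pairing; split => //; exact: leaf_refl.
Qed.

Lemma wt_neq0 z : valid z -> wt z != 0%E -> exists a, [/\ ball (bu_ z.1) (br_ z.1) (row_mx a z.2),
  cell z.1 (icoord M (bi_ z.1) (row_mx a z.2)) & leaf (tpt z) (icoord M (bi_ z.1) (row_mx a z.2))].
Proof.
move=> vz w0; apply: contrapT => H; move/eqP: w0; apply; rewrite /wt.
rewrite (_ : [set a | _] = set0) ?integral_set0//; apply/seteqP; split => // a [Ba Ca]; apply: H; exists a; split => //.
by apply: (ball_plaque (@BC z.1)) => //; [exact: (pt_ball r0)|rewrite !row_mxKr].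
Qed.

Lemma SS_supp z : SS z -> wt z != 0%E -> (z.1 < N)%N /\ coreT z.
Proof.
move=> [vz LO] /(wt_neq0 vz)[a [Ba Ca La]]; split; first exact: (cell_N Ca (LO _ La)).
have [u uB uE] := cell_core Ca.
have E : u = row_mx a z.2 by apply: icoord_inj uE; [exact: coreC|exact: BC].
by move: uB; rewrite E => /ball_row_mx[].
Qed.

Lemma aa_supp z : aa z != 0 -> [/\ SS z, (z.1 < N)%N, coreT z & (hwt z < +oo)%E].
Proof.
rewrite /aa indicE; case: (boolP (z \in SS)) => [/set_mem Sz|_]; last by rewrite mul0r eqxx.
rewrite mul1r mulf_eq0 negb_or => /andP[w0 k0].
have [z1 z2] : (z.1 < N)%N /\ coreT z.
  by apply: SS_supp => //; apply: contraNneq w0 => ->.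
split => //; move: k0; rewrite /kk ltey; apply: contraNneq => ->; by rewrite /= invr0.
Qed.

Lemma hreach_SS z e : hreach z e -> SS z -> SS e.
Proof.
move=> H [vz LO]; split; first exact: (hreach_valid r0 BC H vz).
by move=> y Ly; apply: LO; apply: leaf_trans Ly; exact: (hreach_leaf r0 BC H).
Qed.

Lemma hreach_class z e : hreach z e -> hreach z = hreach e.
Proof.
move=> H; apply/seteqP; split => f Hf; last exact: hreach_trans Hf.
by apply: hreach_trans Hf; exact: hreach_sym.
Qed.

Lemma aa_sum z : (\esum_(e in hreach z) (aa e)%:E = (\1_SS z * kk z)%:E * hwt z)%E.
Proof.
rewrite /hwt -esumZl; last 2 first.
- by rewrite mulr_ge0 ?indicE ?kk_ge0.
- by move=> e; exact: wt_ge0.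
apply: eq_esum => e H; rewrite -(fineK (wt_fin e)) -EFinM /aa; congr EFin.
have -> : kk e = kk z by rewrite /kk /hwt (hreach_class H).
have -> : \1_SS e = \1_SS z :> R.
  rewrite !indicE; congr (_%:R); congr nat_of_bool; apply/idP/idP => /set_mem h; apply/mem_set.
    by apply: hreach_SS h; exact: hreach_sym.
  exact: hreach_SS h.
by rewrite -!mulrA [kk z * _]mulrC.
Qed.

Lemma aa_sum_le1 z : (\esum_(e in hreach z) (aa e)%:E <= 1)%E.
Proof.
rewrite aa_sum indicE; case: (boolP (z \in SS)) => [/set_mem[vz _]|_]; last by rewrite mul0r mul0e lee01.
rewrite mul1r; have [E|h] := eqVneq (hwt z) +oo%E; first by rewrite /kk E /= invr0 mul0e lee01.
have hf : hwt z \is a fin_num by rewrite ge0_fin_numE ?hwt_ge0// ltey.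
by rewrite /kk -{2}(fineK hf) -EFinM mulVf// gt_eqF// fine_gt0// hwt_gt0//= -ge0_fin_numE// hwt_ge0.
Qed.

Lemma aa_sum1 z : SS z -> (hwt z < +oo)%E -> (\esum_(e in hreach z) (aa e)%:E = 1)%E.
Proof.
move=> Sz h; have [vz _] := Sz; rewrite aa_sum indicE mem_set// mul1r.
have hf : hwt z \is a fin_num by rewrite ge0_fin_numE ?hwt_ge0.
by rewrite /kk -{2}(fineK hf) -EFinM mulVf// gt_eqF// fine_gt0// hwt_gt0.
Qed.

(** Each plaque of the box in the leaf contributes at least a fixed volume [e], so finite volume
    bounds their number. *)
Lemma hreach_finite z n : valid z -> (hwt z < +oo)%E -> finite_set [set c | hreach z (n, c)].
Proof.
move=> vz hz; apply: contrapT => inf; have [e e0 He] := vol_L_plaques r0 BC box_lden n.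
have hf : hwt z \is a fin_num by rewrite ge0_fin_numE ?hwt_ge0.
pose k := Num.bound (fine (hwt z) / e).
have [c cinj cH] := finite_set_inj inf k.
have := He (tpt z) k c cinj; rewrite -(hwt_vol vz) -(fineK hf) lee_fin => H.
have : k%:R * e <= fine (hwt z).
  apply: H => l; split; first exact: (hreach_valid r0 BC (cH l) vz).
  exact: (hreach_leaf r0 BC (cH l)).
have : fine (hwt z) / e < k%:R by apply: archi_boundP; apply: divr_ge0 (ltW e0); exact: fine_ge0 (hwt_ge0 _).
by rewrite ltr_pdivrMr// => h1 h2; have := lt_le_trans h1 h2; rewrite ltxx.
Qed.

Lemma core_midT (z : transv) : coreT z -> midT z.
Proof. by apply: le_ball; have := r0 z.1; lra. Qed.

(** Times short enough for the first [N] boxes together: the flow respects leaves, and a point of a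
    core moves by less than a quarter of the radius. *)
Definition flows (s : R) := (forall z1 z2 : transv, (z1.1 < N)%N -> (z2.1 < N)%N -> midT z1 -> midT z2 ->
    leaf (tpt z1) `<=` Omega -> leaf (tpt z1) (tpt z2) -> hreach (psis s z1) (psis s z2)) /\
  forall n, (n < N)%N -> `|s| < bd_ n /\ bM (b_ n) * `|s| < br_ n / 4.

Lemma near_flows : exists2 d : R, 0 < d & forall s : R, `|s| < d -> flows s.
Proof.
have [d1 d10 H1] := flow_leaf.
have [d2 d20 H2] : exists2 d : R, 0 < d & forall n, (n < N)%N -> forall s : R, `|s| < d ->
    `|s| < bd_ n /\ bM (b_ n) * `|s| < br_ n / 4.
  apply: (@finite_pos_min R (fun n d => forall s : R, `|s| < d -> `|s| < bd_ n /\ bM (b_ n) * `|s| < br_ n / 4)).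
    by move=> n d d' H /andP[_ dd] s sd; apply: H; exact: lt_le_trans dd.
  move=> n; have M0 := good_M (gb n); have M1 : 0 < bM (b_ n) + 1 by lra.
  exists (Num.min (bd_ n) (br_ n / 4 / (bM (b_ n) + 1))).
    by rewrite lt_min (good_d (gb n)) divr_gt0//; have := r0 n; lra.
  move=> s; rewrite lt_min => /andP[sd]; rewrite ltr_pdivlMr// mulrC => h; split => //.
  by apply: le_lt_trans h; apply: ler_wpM2r => //; lra.
exists (Num.min d1 d2); first by rewrite lt_min d10.
move=> s; rewrite lt_min => /andP[s1 s2]; split; last by move=> n /H2; exact.
by move=> z1 z2; exact: H1.
Qed.

Lemma psis_mid s (z : transv) : flows s -> (z.1 < N)%N -> coreT z -> midT (psis s z).
Proof.
move=> [_ fs] zN zB; have [sd sM] := fs _ zN; rewrite /midT /=.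
have -> : br_ z.1 / 2 = br_ z.1 / 4 + br_ z.1 / 4 by lra.
apply: ball_triangle zB _; rewrite -ball_normE /= distrC.
by apply: le_lt_trans sM; exact: (good_psiM (gb z.1)).
Qed.

Lemma psisK s (z : transv) : flows s -> (z.1 < N)%N -> psis (- s) (psis s z) = z.
Proof.
case: z => n c [_ fs] /= zN; have [sd _] := fs _ zN.
by rewrite /psis /= (good_psiK (gb n)).
Qed.

Lemma psis_inj s (z1 z2 : transv) : flows s -> (z1.1 < N)%N -> (z2.1 < N)%N -> psis s z1 = psis s z2 -> z1 = z2.
Proof. by move=> fs n1 n2 E; rewrite -(psisK fs n1) -(psisK fs n2) E. Qed.

(* The flow moves the points of one transversal section of a leaf injectively into the section of the image leaf. *)
Lemma hwt_flow s z : flows s -> SS z -> (z.1 < N)%N -> midT z -> valid (psis s z) -> (hwt (psis s z) < +oo)%E -> (hwt z < +oo)%E.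
Proof.
move=> fs Sz zN mz vz hz; pose H := [set e | hreach z e /\ wt e != 0%E].
have HP e : H e -> [/\ hreach z e, (e.1 < N)%N & coreT e].
  by move=> [ze we]; have [eN eB] := SS_supp (hreach_SS ze Sz) we.
have fH : finite_set H.
  pose A := \bigcup_(n in `I_N) ([set n] `*` [set c | hreach (psis s z) (n, c)] : set transv).
  have fA : finite_set A.
    apply: bigcup_finite; first exact: finite_II.
    move=> n _; apply: finite_setX; first exact: finite_set1.
    exact: hreach_finite.
  apply: (sub_finite_set _ (finite_image (psis (- s)) fA)) => e He.
  have [ze eN eB] := HP e He; exists (psis s e); last exact: psisK.
  exists e.1 => //; split => //=; rewrite -[(e.1, _)]/(psis s e).
  have [_ LO] := Sz; apply: fs.1 => //; [exact: core_midT|exact: (hreach_leaf r0 BC ze)].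
rewrite (_ : hwt z = \esum_(e in H) wt e)%E.
  rewrite esum_fset//; last by move=> e _; exact: wt_ge0.
  rewrite (eq_fsbigr (fun e => (fine (wt e))%:E)); last by move=> e _; rewrite fineK// wt_fin.
  by rewrite fsumEFin// ltry.
rewrite (_ : H = hreach z `&` [set e | wt e != 0%E])// esum_mkcondr; apply: eq_esum => e _.
by case: ifPn => // /negP h; apply: contrapT => w; apply: h; apply/mem_set/eqP => E; apply: w; rewrite E.
Qed.

(** If the image lay on a leaf that leaves [Omega], the field would vanish there and the image would
    be fixed by the reverse flow; then it equals [z], whose leaf is inside [Omega]. *)
Lemma SS_flow s z : flows s -> SS z -> (z.1 < N)%N -> coreT z ->
  flows (- s) -> SS (psis s z).
Proof.
move=> fs Sz zN zB fs'; have mz := psis_mid fs zN zB.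
have vz : valid (psis s z) by exact: (midT_valid mz).
split => //; apply: contrapT => nL.
have [_ X0] := off_leaf nL.
have [sd' _] := fs'.2 _ zN.
have E : psis (- s) (psis s z) = psis s z.
  apply: (psis_fix) => //.
  by have := X0 _ (obox_tpt i_ r0 vz); rewrite (trv_tpt r0 BC vz).
by apply: nL; rewrite -E psisK//; case: Sz.
Qed.

(** Put [z] for the point flowed back from [c]. The weights on the orbit of [z] add up to 1, since
    its leaf has finite volume by [hwt_flow], and the flow sends their support injectively into the
    orbit of [c]. *)
Lemma aa_flow s c : flows s -> flows (- s) -> aa c != 0 -> (1 <= \esum_(e in hreach c) (aa (psis (- s) e))%:E)%E.
Proof.
move=> fs fs' /aa_supp[Sc cN cB hc]; have fss : flows (- - s) by rewrite opprK.
pose z := psis (- s) c; have zN : (z.1 < N)%N by [].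
have zE : psis s z = c by rewrite -{1}(opprK s) /z psisK.
have mz : midT z by exact: psis_mid.
have Sz : SS z by exact: SS_flow.
have hz : (hwt z < +oo)%E by apply: (hwt_flow fs) => //; rewrite zE//; case: Sc.
pose H := [set e | hreach z e /\ aa e != 0].
have HP e : H e -> [/\ hreach z e, (e.1 < N)%N & midT e].
  by move=> [ze /aa_supp[_ eN eB _]]; split => //; exact: core_midT.
have Hinj : {in H &, injective (psis s)}.
  by move=> e f /set_mem/HP[_ eN _] /set_mem/HP[_ fN _]; exact: psis_inj.
have Hc : psis s @` H `<=` hreach c.
  move=> _ [e He <-]; have [ze eN me] := HP e He; rewrite -zE; have [_ LO] := Sz.
  by apply: fs.1 => //; exact: (hreach_leaf r0 BC ze).
have a0 e : (0 <= (aa e)%:E)%E by rewrite lee_fin aa_ge0.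
rewrite (esumID (psis s @` H))//; apply: le_trans (leeDl _ (esum_ge0 _)) => //.
have -> : hreach c `&` psis s @` H = psis s @` H by apply/seteqP; split => [e []//|e He]; split => //; exact: Hc.
rewrite (reindex_esum _ _ _ _ (inj_bij Hinj)).
rewrite -(aa_sum1 Sz hz) (esumID [set e | aa e != 0])// [X in (_ + X)%E]esum1 ?adde0.
  apply: le_esum => e He; have [_ eN _] := HP e He; by rewrite psisK.
by move=> e [_ /= /negP]; rewrite negbK => /eqP->.
Qed.

Lemma measurable_valid : measurable (valid : set transv).
Proof.
rewrite (_ : (valid : set transv) = \bigcup_n ([set n] `*` Tn u_ r_ n)).
  apply: bigcupT_measurable => n; apply: measurable_sheet; apply: open_Borel; exact: open_Tn.
by apply/seteqP; split => [[n c] vz|[n c] [m _ /= [-> H]]//]; exists n.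
Qed.

(** Within a box the points outside [Omega] project to an open set of transverse coordinates; [SS]
    is the complement of its saturation under countably many holonomy words. *)
Lemma measurable_SS : measurable SS.
Proof.
pose O n := (ball (bu_ n) (br_ n) : set V) `&` (cod M (bi_ n) `&` icoord M (bi_ n) @^-1` (~` Omega)).
have oO n : open (O n).
  by apply: openI; [exact: ball_open|apply: icoord_preimage; exact: closed_openC].
pose A : set transv := \bigcup_n ([set n] `*` ((fun u : V => rsubmx u) @` O n)).
have mA : measurable A.
  apply: bigcupT_measurable => n; apply: measurable_sheet; apply: open_Borel; rewrite openE => _ [u Ou <-].
  have : nbhs u (O n) by exact: open_nbhs_nbhs.
  move/nbhs_ballP => [e /= e0 eO]; apply/nbhs_ballP; exists e => // c cB.
  exists (row_mx (lsubmx u) c); last by rewrite row_mxKr.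
  by apply: eO; apply/ball_row_mx; split => //; exact: ballxx.
rewrite (_ : SS = (valid : set transv) `\` [set c | exists2 e, hreach c e & A e]).
  by apply: measurableD; [exact: measurable_valid|exact: (measurable_hsat g r0 BC)].
apply/seteqP; split => [z [vz LO]|z [vz H]]; split => //.
  move=> [[m v] ze [n _ /= [nE [u [Bu [Cu nO]] uv]]]]; rewrite -nE in Bu Cu nO; apply: nO; apply: LO.
  have ve := hreach_valid r0 BC ze vz; apply: leaf_trans (hreach_leaf r0 BC ze) _.
  by apply: (ball_plaque (@BC m)) => //; [exact: (pt_ball r0)|rewrite row_mxKr].
move=> y Ly; apply: contrapT => nO; apply: H; have [m Om] := box_cover y.
exists (m, trv m y).
  apply: (leaf_hreach r0 BC box_cover vz (trv_valid BC Om)).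
  by apply: leaf_trans Ly _; exact: (leaf_trv r0 BC Om).
have [Dy By] := (oboxP BC m y).1 Om.
exists m => //; split => //=; exists (coord M (bi_ m) y) => //; split => //; split; first exact: coord_cod.
by rewrite /= coordK.
Qed.

Lemma measurable_kk : measurable_fun setT kk.
Proof.
have mh : measurable_fun setT hwt.
  by apply: (measurable_hsum g r0 BC); [exact: (measurable_wt g BC measurable_cell)|move=> e; exact: wt_ge0].
apply: measurableT_comp; first exact: measurable_invr.
by apply: measurableT_comp mh; exact: fine_measurable.
Qed.

Lemma measurable_aa : measurable_fun setT aa.
Proof.
apply: measurable_funM; first exact: measurable_indic measurable_SS.
apply: measurable_funM measurable_kk; apply: measurableT_comp; first exact: fine_measurable.
exact: (measurable_wt g BC measurable_cell).
Qed.

Definition dd (z : transv) : R := if z \in (valid : set transv) then DD (tpt z) else 0.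

Lemma ddE n c : ball (rsubmx (bu_ n)) (br_ n) c ->
  fdiv (bX_ n) (brho_ n) c = brho_ n c * dd (n, c).
Proof.
move=> Bc; have vz : valid (n, c) by []; rewrite /dd mem_set//.
have On := obox_tpt i_ r0 vz.
by have := box_DD On; rewrite (trv_tpt r0 BC vz).
Qed.

Lemma dd_trv n x : obox n x -> dd (n, trv n x) = DD x.
Proof.
move=> On; rewrite /dd mem_set; last exact: (trv_valid BC On).
exact: (DD_leaf (leaf_trv r0 BC On)).
Qed.

Lemma measurable_dd : measurable_fun setT dd.
Proof.
apply/measurable_EFinP; apply: measurable_sheets => n; apply/measurable_EFinP.
pose T := ball (rsubmx (bu_ n)) (br_ n).
have oT : open T by exact: ball_open.
have mT : borel T by exact: open_Borel.
have rD := good_dom (gb n); have r0n := r0 n.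
rewrite [X in measurable_fun _ X](_ : _ =
    (fun c => (brho_ n c)^-1 * fdiv (bX_ n) (brho_ n) c) \_ T).
  apply/(measurable_restrictT _ _).1 => //; apply: continuous_BorelR => // c Tc.
  have c0 : ck 0 T (fun c => (brho_ n c)^-1 * fdiv (bX_ n) (brho_ n) c).
    apply: ckM => //.
      apply: ckV => //; last exact: (ck_brho r0n rD).
      by move=> c' /(brho_gt0 r0n rD)/lt0r_neq0.
    by apply: ck_fdiv => // k; [exact: (ck_bX r0n rD)|exact: (ck_brho r0n rD)].
  exact: ck_cont c0 Tc.
apply/funext => c; rewrite patchE; case: ifPn => [/set_mem Tc|nT].
  rewrite (ddE Tc).
  by rewrite mulrA mulVf ?mul1r// gt_eqF// (brho_gt0 r0n rD).
by rewrite /dd ifF//; apply/negP => /set_mem vz; move/negP: nT; apply; exact/mem_set.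
Qed.

Lemma measurable_basic (f : transv -> \bar R) (F : M -> \bar R) : measurable_fun setT f ->
  (forall n x, cell n x -> F x = f (n, trv n x)) -> measurable_fun setT (F : Borel M -> \bar R).
Proof.
move=> mf Ff _ Y mY; rewrite setTI.
rewrite (_ : F @^-1` Y = \bigcup_n (cell n `&` (obox n `&` trv n @^-1` [set c | Y (f (n, c))]))).
  apply: (@bigcupT_measurable _ (Borel M)) => n; apply: (@measurableI _ (Borel M)); first exact: measurable_cell.
  have mt : measurable_fun (Bset (obox n)) (trv n : Borel M -> Borel Q).
    apply: continuous_Borel; first exact: obox_open BC n.
    move=> x /(oboxP BC)[Dx _]; apply: (continuous_comp (f := coord M (bi_ n))); first exact: coord_continuous.
    by apply: differentiable_continuous; apply: differentiable_rsubmx; exact: (ck_diff (ck_id 0 openT)).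
  apply: mt; first by apply: open_Borel; exact: obox_open BC n.
  have mfn : measurable_fun setT (fun c : Borel Q => f (n, c)) by apply: measurableT_comp mf _; exact: pair1_measurable.
  by rewrite -[X in measurable X]setTI; exact: mfn.
apply/seteqP; split => [x Yx|x [n _ [cx [_ /= H]]]]; last by rewrite /= (Ff n).
have [n cx] := cell_cover x; exists n => //; split => //; split; first exact: cell_obox.
by rewrite /= -(Ff n).
Qed.

Lemma aa_out n c : (N <= n)%N -> aa (n, c) = 0.
Proof. by move=> Nn; apply/eqP; apply: contraT => /aa_supp[_ /=]; rewrite ltnNge Nn. Qed.

Lemma measurable_psi s n : flows s -> (n < N)%N -> measurable_fun setT (bpsi_ n s : Borel Q -> Borel Q).
Proof.
move=> fs nN; have [sd _] := fs.2 _ nN; apply: continuous_Borel; first exact: openT.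
by move=> c _; apply: (lip_continuous (L := 2)) => // x y; exact: (good_psiL (gb n)).
Qed.

Lemma measurable_aa_psis s : flows s -> measurable_fun setT (fun z => aa (psis s z)).
Proof.
move=> fs; apply/measurable_EFinP; apply: measurable_sheets => n; apply/measurable_EFinP.
have [Nn|nN] := leqP N n.
  rewrite [X in measurable_fun _ X](_ : _ = cst 0)//; apply/funext => c; exact: aa_out.
apply: (measurableT_comp measurable_aa); apply: (measurableT_comp (pair1_measurable n)).
exact: measurable_psi.
Qed.

(** Insert the sum from [aa_flow], which is at least 1 where the weight is nonzero; exchange source
    and target by mass transport; then bound the sum of weights over an orbit by 1. *)
Lemma integral_aa_le s : flows s -> flows (- s) ->
  (\int[tnu]_z (aa z)%:E <= \int[tnu]_z (aa (psis (- s) z))%:E)%E.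
Proof.
move=> fs fs'; have ma := measurable_aa; have mb := measurable_aa_psis fs'.
have mh (b : transv -> R) : measurable_fun setT b -> (forall e, 0 <= b e) ->
    measurable_fun setT (fun c => \esum_(e in hreach c) (b e)%:E)%E.
  by move=> mb' b0; apply: (measurable_hsum g r0 BC); [exact/measurable_EFinP|move=> e; rewrite lee_fin].
apply: (@le_trans _ _ (\int[tnu]_c ((aa c)%:E * \esum_(e in hreach c) (aa (psis (- s) e))%:E))%E).
  apply: ge0_le_integral => //.
  - by move=> z _; rewrite lee_fin aa_ge0.
  - exact/measurable_EFinP.
  - apply: emeasurable_funM; first exact/measurable_EFinP.
    by apply: mh => // e; exact: aa_ge0.
  - move=> z _; have [->|az] := eqVneq (aa z) 0; first by rewrite mul0e.
    by rewrite lee_pemulr ?lee_fin ?aa_ge0//; exact: aa_flow.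
rewrite (hreach_transport g r0 BC ma mb); [|by move=> c; exact: aa_ge0|by move=> c; exact: aa_ge0].
have E e : [set c | hreach c e] = hreach e by apply/seteqP; split => c; exact: hreach_sym.
apply: ge0_le_integral => //.
- by move=> z _; rewrite mule_ge0 ?lee_fin ?aa_ge0//; apply: esum_ge0 => c _; rewrite lee_fin aa_ge0.
- apply: emeasurable_funM; first exact/measurable_EFinP.
  rewrite [X in measurable_fun _ X](_ : _ = fun c => (\esum_(e in hreach c) (aa e)%:E)%E).
    by apply: mh => // e; exact: aa_ge0.
  by apply/funext => e; rewrite E.
- exact/measurable_EFinP.
- by move=> z _; rewrite E -[leRHS]mule1; apply: lee_wpmul2l; [rewrite lee_fin aa_ge0|exact: aa_sum_le1].
Qed.

Lemma dd_bound n c : (n < N)%N -> ball (rsubmx (bu_ n)) (br_ n) c -> `|dd (n, c)| <= bC_ n.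
Proof.
move=> nN Bc; have vz : valid (n, c) by []; rewrite /dd mem_set//.
apply: (good_DD (gb n)); exact: (pt_ball (u_ := u_) (r_ := r_) r0 (n := n) Bc).
Qed.

Lemma flow_factor_ge0 s K z : 0 <= K -> (forall n, (n < N)%N -> `|s| * bC_ n <= 1) -> aa z != 0 ->
  0 <= 1 + s * dd z /\ 0 <= 1 + s * dd z + K * s ^+ 2.
Proof.
move=> K0 sC /aa_supp[_ zN zB _]; case: z zN zB => n c /= nN cB.
have h1 := dd_bound nN (midT_valid (@core_midT (n, c) cB)); have h2 := sC _ nN.
have h3 : `|s * dd (n, c)| <= 1 by rewrite normrM; apply: le_trans h2; exact: ler_wpM2l.
have h4 := mulr_ge0 K0 (sqr_ge0 s).
by move: h3; rewrite ler_norml => /andP[h3 _]; split; lra.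
Qed.

(** Sheet by sheet this is [good_cov] for the weight composed with the reverse flow, which the
    forward flow turns back into the weight itself. *)
Lemma integral_flow_le s K : flows s -> flows (- s) -> 0 <= K -> (forall n, (n < N)%N -> bK_ n * bC_ n <= K) ->
  (forall n, (n < N)%N -> `|s| * bC_ n <= 1) ->
  (\int[tnu]_z (aa (psis (- s) z))%:E <= \int[tnu]_z (aa z * (1 + s * dd z + K * s ^+ 2))%:E)%E.
Proof.
move=> fs fs' K0 HK sC; have ma := measurable_aa; have mb := measurable_aa_psis fs'.
have f0 z : 0 <= aa z * (1 + s * dd z + K * s ^+ 2).
  have [->|az] := eqVneq (aa z) 0; first by rewrite mul0r.
  by apply: mulr_ge0; [exact: aa_ge0|have [] := flow_factor_ge0 K0 sC az].
have mf : measurable_fun setT (fun z => aa z * (1 + s * dd z + K * s ^+ 2)).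
  apply: measurable_funM => //; apply: measurable_funD; last exact: measurable_cst.
  by apply: measurable_funD; [exact: measurable_cst|apply: measurable_funM; [exact: measurable_cst|exact: measurable_dd]].
rewrite integral_tmeasure; [|exact/measurable_EFinP|by move=> z; rewrite lee_fin aa_ge0].
rewrite integral_tmeasure; [|exact/measurable_EFinP|by move=> z; rewrite lee_fin].
apply: lee_nneseries => [n _ _|n _].
  by apply: integral_ge0 => c Tc; rewrite mule_ge0 ?lee_fin ?aa_ge0//; exact: ltW (rho_gt0 g r0 BC Tc).
have [Nn|nN] := leqP N n.
  rewrite integral0_eq; last by move=> c _; rewrite aa_out// mul0e.
  by apply: integral_ge0 => c Tc; rewrite aa_out// mul0r mul0e.
have [sd sM] := fs.2 _ nN; have [sd' sM'] := fs'.2 _ nN.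
pose B := ball (rsubmx (bu_ n)) (br_ n / 4); pose T := ball (rsubmx (bu_ n)) (br_ n).
pose F (v : Q) := (aa (n, bpsi_ n (- s) v))%:E.
have BT c : B c -> T c by move=> Bc; exact: (midT_valid (@core_midT (n, c) Bc)).
have a0 c : ~ B c -> aa (n, c) = 0.
  by move=> nB; apply/eqP; apply: contraT => /aa_supp[].
have psiK c : bpsi_ n s (bpsi_ n (- s) c) = c by rewrite -{1}(opprK s) (good_psiK (gb n)).
have BT' c : B (bpsi_ n (- s) c) -> T c.
  move=> Bc; rewrite -(psiK c); exact: (midT_valid (@psis_mid s (n, bpsi_ n (- s) c) fs nN Bc)).
(* The integrand vanishes unless the reverse flow lands in the core, so the domain is cut down to
   the set on which [good_cov] applies. *)
rewrite -(@integral_supp _ _ _ (lam R q) [set v | B (bpsi_ n (- s) v)]) => [|c|c _ nB]; [|exact: BT'|by rewrite [aa _]a0 ?mul0e].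
apply: (le_trans (good_cov (gb n) (F := F) _ _ sd _ _)).
- exact: ball_open.
- by apply: le_ball; have := r0 n; lra.
- apply/measurable_EFinP; apply: (measurableT_comp measurable_aa); apply: (measurableT_comp (pair1_measurable n)).
  exact: measurable_psi.
- by move=> v; rewrite lee_fin aa_ge0.
apply: (@le_trans _ _ (\int[lam R q]_(u in T) ((aa (n, u))%:E *
    (brho_ n u + s * fdiv (bX_ n) (brho_ n) u + bK_ n * s ^+ 2)%R%:E))%E).
  rewrite -(@integral_supp _ _ _ (lam R q) B T) => [|c|c _ nB]; [|exact: BT|by rewrite a0 ?mul0e].
  by apply: eq_lee; apply: eq_integral => u _; rewrite /F (good_psiK (gb n)).
have oT : open T by exact: ball_open.
have mT : borel T by exact: open_Borel.
have rD := good_dom (gb n); have r0n := r0 n.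
have rh0 c : T c -> 0 < brho_ n c by exact: (brho_gt0 r0n rD).
have man : measurable_fun setT (fun c : Borel Q => aa (n, c)).
  by apply: (measurableT_comp ma); exact: pair1_measurable.
have mrh : measurable_fun (Bset T) (brho_ n : Borel Q -> R).
  by apply: continuous_BorelR => // c Tc; exact: ck_cont (ck_brho r0n rD 0) Tc.
have P1 c : T c -> brho_ n c + s * fdiv (bX_ n) (brho_ n) c + bK_ n * s ^+ 2 =
    brho_ n c * (1 + s * dd (n, c)) + bK_ n * s ^+ 2.
  by move=> Tc; rewrite (ddE Tc); ring.
have K1 := mulr_ge0 (good_K (gb n)) (sqr_ge0 s).
apply: ge0_le_integral => //.
- move=> c Tc; rewrite -EFinM lee_fin P1//.
  have [->|az] := eqVneq (aa (n, c)) 0; first by rewrite mul0r.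
  have [h1 _] := flow_factor_ge0 K0 sC az.
  by apply: mulr_ge0; [exact: aa_ge0|apply: addr_ge0 => //; apply: mulr_ge0 => //; exact/ltW/rh0].
- apply: emeasurable_funM; first by apply: measurable_funTS; exact/measurable_EFinP.
  apply/measurable_EFinP; apply: continuous_BorelR => // c Tc.
  have cf : ck 0 T (fun u : Q => brho_ n u + s * fdiv (bX_ n) (brho_ n) u + bK_ n * s ^+ 2).
    have cc (x : R) : ck 0 T (fun=> x) by exact: ck_cst.
    apply: ckD => //; apply: ckD => //; first exact: (ck_brho r0n rD).
    apply: ckM => //.
    by apply: ck_fdiv => // k; [exact: (ck_bX r0n rD)|exact: (ck_brho r0n rD)].
  exact: ck_cont cf Tc.
- apply: emeasurable_funM; last exact/measurable_EFinP.
  apply: measurable_funTS; apply/measurable_EFinP; apply: (measurableT_comp mf); exact: pair1_measurable.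
- move=> c Tc; rewrite -!EFinM lee_fin P1//.
  rewrite -[leRHS]mulrA; apply: ler_wpM2l; first exact: aa_ge0.
  rewrite mulrC [X in _ <= X]mulrDl; apply: lerD; first by rewrite mulrC.
  (* The transverse density is at least [1 / bC], so the absolute error [bK * s ^+ 2] becomes
     relative to the density at the price of a factor [bC]; hence the condition on [K]. *)
  have C0 := good_C (gb n); have := good_rho (gb n) Tc; rewrite -[(bC _)^-1]mul1r ler_pdivrMr// => h.
  rewrite [leRHS]mulrAC; apply: ler_wpM2r; first exact: sqr_ge0.
  apply: (@le_trans _ _ (bK_ n * (brho_ n c * bC_ n))).
    by rewrite -{1}[bK _]mulr1; apply: ler_wpM2l => //; exact: good_K.
  rewrite mulrCA mulrC; apply: ler_wpM2r; [exact/ltW/rh0|exact: HK].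
Qed.

Lemma measurable_Omega : borel Omega.
Proof.
rewrite -(setCK Omega); apply: (@measurableC _ (Borel M)); apply: open_Borel; exact: closed_openC.
Qed.

Lemma muM_Omega : (muM Omega < +oo)%E.
Proof.
have mO := measurable_Omega.
rewrite -[X in muM X]setIT -(integral_indic muM measurableT mO).
rewrite integral_muM; last 2 first.
- by apply/measurable_EFinP; exact: measurable_indic.
- by move=> x; rewrite lee_fin.
rewrite (nneseries_split 0 N); last first.
  move=> k _; apply: integral_ge0 => u _; rewrite mule_ge0 ?lee_fin// ?indicE//; exact: sqrtr_ge0.
rewrite [X in (_ + X)%E]eseries0 ?adde0; last first.
  move=> n Nn _; apply: integral0_eq => u [_ Cu]; rewrite indicE; case: (boolP (_ \in _)) => [/set_mem Ou|_]; last by rewrite mul0e.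
  by have := cell_N Cu Ou; rewrite ltnNge -[N]add0n Nn.
apply: lte_sum_pinfty => n _; pose B := ball (bu_ n) (br_ n); pose C := B `&` icoord M (bi_ n) @^-1` cell n.
have mB : borel B by apply: open_Borel; exact: ball_open.
have mi : measurable_fun (Bset B) (icoord M (bi_ n) : Borel V -> Borel M).
  by apply: continuous_Borel; [exact: ball_open|move=> u /BC; exact: icoord_continuous].
have mC : borel C by apply: mi => //; exact: measurable_cell.
have CB : C `<=` B by move=> u [].
apply: (@le_lt_trans _ _ (\int[lam R (p + q)]_(u in C) (bC_ n)%:E)%E).
  apply: ge0_le_integral => //.
  - by move=> u _; rewrite mule_ge0 ?lee_fin// ?indicE//; exact: sqrtr_ge0.
  - apply: emeasurable_funM.
      apply: (measurable_funS mB CB).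
      by apply/measurable_EFinP; apply: (measurable_comp (F := setT)) mi => //; exact: measurable_indic.
    apply: (measurable_funS mB CB).
    apply/measurable_EFinP; apply: continuous_BorelR; first exact: ball_open.
    by move=> u /BC Cu; exact: ck_cont (ck_mden g 0 _) Cu.
  - move=> u [Bu _]; rewrite -EFinM lee_fin; apply: le_trans (good_mden (gb n) Bu).
    by rewrite ler_piMl ?sqrtr_ge0// indicE; case: (_ \in _).
rewrite integral_cst// lte_mul_pinfty ?lee_fin//; first exact: ltW (good_C (gb n)).
apply: le_lt_trans (lam_ball_lty (bu_ n) (ltW (r0 n))).
by apply: le_measure; rewrite ?inE//; move=> u [].
Qed.

Definition kx (x : M) : R := (fine (vol_L g x))^-1.

Lemma vol_L_ge0 x : (0 <= vol_L g x)%E.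
Proof.
have [n On] := box_cover x; rewrite (vol_L_leaf g (leaf_trv r0 BC On)) -hwt_vol; last exact: (trv_valid BC On).
exact: hwt_ge0.
Qed.

Lemma kx_ge0 x : 0 <= kx x. Proof. by rewrite invr_ge0 fine_ge0// vol_L_ge0. Qed.

Lemma kx_bound : exists2 K, 0 < K & forall x, Omega x -> kx x <= K.
Proof.
have /choice[f Hf] : forall n, exists K, forall x, obox n x -> kx x <= K.
  move=> n; have [e e0 He] := vol_L_plaques r0 BC box_lden n; exists e^-1 => x On.
  have Ve : (e%:E <= vol_L g x)%E.
    rewrite -[e]mul1r; apply: (He x 1%N (fun=> trv n x)); first by move=> a b _; rewrite [a]ord1 [b]ord1.
    by move=> _; split; [exact: (trv_valid BC On)|exact: (leaf_trv r0 BC On)].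
  (* On a leaf of infinite volume the inverse takes its default value 0, which satisfies the
     bound. *)
  rewrite /kx; case: (vol_L g x) Ve => [v|_|]; [|by rewrite /= invr0 invr_ge0 ltW|by rewrite leeNy_eq].
  by rewrite lee_fin => ev; rewrite lef_pV2 ?posrE//; exact: lt_le_trans ev.
have [K K0 HK] := finite_ub N f.
by exists K => // x /covN[n nN /core_obox /Hf h]; exact: le_trans h (HK n nN).
Qed.

Definition SL : set M := [set x | leaf x `<=` Omega].

Lemma SL_trv n x : obox n x -> \1_SL x = \1_SS (n, trv n x) :> R.
Proof.
move=> On; have L := leaf_trv r0 BC On.
rewrite !indicE; congr (_%:R); congr nat_of_bool; apply/idP/idP => /set_mem h; apply/mem_set.
  by split; [exact: (trv_valid BC On)|move=> y Ly; apply: h; exact: leaf_trans Ly].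
by case: h => _ h y Ly; apply: h; apply: leaf_trans Ly; exact: leaf_sym.
Qed.

(** The dictionary between M and the transversals: the inverse leaf volume times the volume of the
    plaque piece is the weight [aa]. *)
Lemma leafwise_fun (h : transv -> R) (H : M -> R) : measurable_fun setT h -> (forall z, 0 <= h z) ->
  (forall n x, obox n x -> H x = h (n, trv n x)) ->
  measurable_fun setT ((fun x => \1_SL x * kx x * H x) : Borel M -> R) /\
  (\int[muM]_x (\1_SL x * kx x * H x)%:E = \int[tnu]_z (aa z * h z)%:E)%E.
Proof.
move=> mh h0 Hh.
have mf : measurable_fun setT (fun z : transv => (\1_SS z * kk z * h z)%:E).
  apply/measurable_EFinP; apply: measurable_funM => //.
  by apply: measurable_funM measurable_kk; exact: measurable_indic measurable_SS.
have Ff n x : cell n x -> (\1_SL x * kx x * H x)%:E = (\1_SS (n, trv n x) * kk (n, trv n x) * h (n, trv n x))%:E.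
  by move=> /cell_obox On; rewrite (SL_trv On) (kkE On) (Hh n).
have mF := measurable_basic mf Ff; split; first exact/measurable_EFinP.
rewrite (integral_basic g r0 BC measurable_cell cell_cover mf _ mF Ff); last first.
  by move=> z; rewrite lee_fin !mulr_ge0 ?kk_ge0 ?indicE.
apply: eq_integral => z _; rewrite -[wt z]fineK ?wt_fin// -EFinM; congr EFin; rewrite /aa; ring.
Qed.

Lemma integral_aa_lty : (\int[tnu]_z (aa z)%:E < +oo)%E.
Proof.
have [mF E] := leafwise_fun (h := fun=> 1) (H := fun=> 1) (measurable_cst _) (fun=> ler01) (fun _ _ _ => erefl).
have -> : (\int[tnu]_z (aa z)%:E = \int[tnu]_z (aa z * 1)%:E)%E by apply: eq_integral => z _; rewrite mulr1.
rewrite -E; have [K K0 HK] := kx_bound.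
apply: (@le_lt_trans _ _ (\int[muM]_x (K%:E * (\1_Omega x)%:E))%E).
  apply: ge0_le_integral => //.
  - by move=> x _; rewrite lee_fin mulr1 mulr_ge0 ?kx_ge0 ?indicE.
  - exact/measurable_EFinP.
  - apply: emeasurable_funM; first exact: measurable_cst.
    by apply/measurable_EFinP; exact: measurable_indic measurable_Omega.
  - move=> x _; rewrite -EFinM lee_fin mulr1 !indicE.
    case: (boolP (x \in SL)) => [/set_mem Sx|_]; last by rewrite mul0r mulr_ge0// ltW.
    have Ox : Omega x by apply: Sx; exact: leaf_refl.
    by rewrite mem_set// mul1r mulr1 HK.
rewrite ge0_integralZl//; [|by apply/measurable_EFinP; exact: measurable_indic measurable_Omega|by rewrite lee_fin ltW].
by rewrite integral_indic//; [rewrite setIT lte_mul_pinfty ?muM_Omega ?lee_fin// ltW|exact: measurable_Omega].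
Qed.

(** The integral of [aa * dd] is 0: comparing both bounds gives [0 <= s * j + K * s ^+ 2 * i] for
    all small [s] of either sign. The shift by [CB] makes the integrand nonnegative on the support
    of the weight, as the passage to M by [leafwise_fun] requires. *)
Lemma integral_aa_dd CB : (forall n, (n < N)%N -> bC_ n <= CB) ->
  (\int[tnu]_z (aa z * `|CB + dd z|)%:E = CB%:E * \int[tnu]_z (aa z)%:E)%E.
Proof.
move=> HC; have ma := measurable_aa; have md := measurable_dd; have mT := @measurableT _ transv.
have maE : measurable_fun setT (EFin \o aa) by exact/measurable_EFinP.
have ia : tnu.-integrable setT (EFin \o aa).
  apply/integrableP; split => //; apply: le_lt_trans integral_aa_lty.
  by under eq_integral => z _ do rewrite gee0_abs ?lee_fin ?aa_ge0//.
have ddB z : `|aa z * dd z| <= CB * aa z.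
  have [->|az] := eqVneq (aa z) 0; first by rewrite mul0r normr0 mulr0.
  rewrite normrM ger0_norm ?aa_ge0// mulrC; apply: ler_wpM2r; first exact: aa_ge0.
  case: z az => n c /aa_supp[_ /= nN cB _]; apply: le_trans (HC _ nN).
  by apply: dd_bound => //; exact: (midT_valid (@core_midT (n, c) cB)).
have iad : tnu.-integrable setT (EFin \o (fun z => aa z * dd z)).
  apply: (le_integrable mT _ _ (integrableZl mT CB ia)); first by apply/measurable_EFinP; exact: measurable_funM.
  by move=> z _ /=; rewrite lee_fin; apply: le_trans (ddB z) _; rewrite ler_norm.
pose i := (\int[tnu]_z aa z)%R; pose j := (\int[tnu]_z (aa z * dd z))%R.
have [K K0 HK] := finite_ub N (fun n => bK_ n * bC_ n).
have [d d0 Hd] := near_flows; have C1 : 0 < `|CB| + 1 by have := normr_ge0 CB; lra.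
have st (s : R) : `|s| < d -> `|s| * (`|CB| + 1) <= 1 -> 0 <= s * j + K * s ^+ 2 * i.
  move=> sd sC; have sC' n : (n < N)%N -> `|s| * bC_ n <= 1.
    move=> nN; apply: le_trans sC; apply: ler_wpM2l => //; have := HC n nN; have := ler_norm CB; lra.
  have fs : flows s by exact: Hd.
  have fs' : flows (- s) by apply: Hd; rewrite normrN.
  have L := le_trans (integral_aa_le fs fs') (integral_flow_le fs fs' (ltW K0) HK sC').
  have iE : tnu.-integrable setT (EFin \o (fun z => s * (aa z * dd z) + K * s ^+ 2 * aa z)).
    by apply: (integrableD mT (integrableZl mT s iad) (integrableZl mT (K * s ^+ 2) ia)).
  have E : (\int[tnu]_z (aa z * (1 + s * dd z + K * s ^+ 2)) = i + (s * j + K * s ^+ 2 * i))%R.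
    rewrite /i /j -RintegralZl// -[X in _ = _ + (_ + X)]RintegralZl// -RintegralD//; last 2 first.
    - exact: (integrableZl mT s iad).
    - exact: (integrableZl mT (K * s ^+ 2) ia).
    by rewrite -RintegralD//; apply: eq_Rintegral => z _; ring.
  rewrite -(lerD2l i) addr0 -E; apply: fine_le => //; first exact: integrable_fin_num.
  by apply: integrable_fin_num => //; have := integrableD mT ia iE; congr (_.-integrable _ _);
    apply/funext => z /=; rewrite -EFinD; congr EFin; ring.
have i0 : 0 <= i by apply: Rintegral_ge0 => z _; exact: aa_ge0.
have j0 : j = 0.
  apply/eqP; apply: contraT => jn; have J0 : 0 < `|j| by rewrite normr_gt0.
  have Ki : 0 <= K * i by rewrite mulr_ge0// ltW.
  (* The size of [s]: the first two bounds make it admissible, and the third keeps the quadratic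
     term below [|j|]. With the sign opposite to that of [j] the inequality [st] then fails. *)
  pose X := Num.min (d / 2) (Num.min (`|CB| + 1)^-1 (`|j| / (K * i + 1))).
  have X0 : 0 < X by rewrite !lt_min divr_gt0// invr_gt0 C1 divr_gt0//; lra.
  have X1 : X < d by apply: (@le_lt_trans _ _ (d / 2)); [rewrite ge_min lexx|lra].
  have X2 : X * (`|CB| + 1) <= 1 by rewrite -ler_pdivlMr// mul1r !ge_min lexx !orbT.
  have X3 : X * (K * i + 1) <= `|j| by rewrite -ler_pdivlMr ?ge_min ?lexx ?orbT//; lra.
  pose s := - Num.sg j * X; have ns : `|s| = X by rewrite normrM normrN normr_sg jn mul1r gtr0_norm.
  have sj : s * j = - (X * `|j|) by rewrite (normrEsg j) /s; ring.
  have s2 : s ^+ 2 = X * X by rewrite -[s ^+ 2]ger0_norm ?sqr_ge0// normrX ns expr2.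
  have := st s; rewrite ns sj s2 => /(_ X1 X2) h.
  have : X * (X * (K * i + 1)) <= X * `|j| by rewrite ler_pM2l.
  have : 0 < X * X by rewrite mulr_gt0.
  lra.
transitivity ((\int[tnu]_z (CB * aa z + aa z * dd z))%R)%:E.
  have iS : tnu.-integrable setT (EFin \o (fun z => CB * aa z + aa z * dd z)).
    exact: (integrableD mT (integrableZl mT CB ia) iad).
  rewrite /Rintegral fineK; last exact: integrable_fin_num.
  apply: eq_integral => z _; congr EFin; have := ddB z; rewrite ler_norml => /andP[h _].
  by rewrite -{1}(ger0_norm (aa_ge0 z)) -normrM ger0_norm mulrDr [aa z * CB]mulrC//; lra.
rewrite RintegralD//; last exact: (integrableZl mT CB ia).
by rewrite RintegralZl// -/j j0 addr0 EFinM /Rintegral fineK//; exact: integrable_fin_num.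
Qed.

Lemma measurable_kx : measurable_fun setT (kx : Borel M -> R).
Proof.
apply/measurable_EFinP; apply: (measurable_basic (f := fun z => (kk z)%:E)).
  by apply/measurable_EFinP; exact: measurable_kk.
by move=> n x /cell_obox On; rewrite (kkE On).
Qed.

(** The divergence is written as a difference of two nonnegative leafwise constant functions, whose
    integrals are known to be equal and finite. *)
Lemma integral_DD : muM.-integrable setT (fun x => (DD x * kx x)%:E) /\ (\int[muM]_x (DD x * kx x)%:E = 0)%E.
Proof.
have [CB CB0 HC] := finite_ub N (fun n => bC_ n).
have [mF1 E1] := leafwise_fun (h := fun=> 1) (H := fun=> 1) (measurable_cst _) (fun=> ler01) (fun _ _ _ => erefl).
have mh : measurable_fun setT (fun z => `|CB + dd z|).
  apply: measurableT_comp; first exact: normr_measurable.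
  by apply: measurable_funD; [exact: measurable_cst|exact: measurable_dd].
have Hh n x : obox n x -> `|CB + DD x| = `|CB + dd (n, trv n x)| by move=> On; rewrite (dd_trv On).
have [mF2 E2] := leafwise_fun mh (fun=> normr_ge0 _) Hh.
have E1' : (\int[tnu]_z (aa z * 1)%:E = \int[tnu]_z (aa z)%:E)%E by apply: eq_integral => z _; rewrite mulr1.
rewrite E1' in E1; rewrite (integral_aa_dd HC) -E1 in E2.
have L := integral_aa_lty; rewrite -E1 in L.
pose F1 x := \1_SL x * kx x * 1; pose F2 x := \1_SL x * kx x * `|CB + DD x|.
have F10 x : 0 <= F1 x by rewrite !mulr_ge0 ?kx_ge0// indicE.
have F20 x : 0 <= F2 x by rewrite !mulr_ge0 ?kx_ge0// indicE.
have I1f : (\int[muM]_x (F1 x)%:E)%E \is a fin_num by rewrite ge0_fin_numE//; apply: integral_ge0 => x _; rewrite lee_fin.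
have int1 : muM.-integrable setT (fun x => (F1 x)%:E).
  apply/integrableP; split; first exact/measurable_EFinP.
  by under eq_integral => x _ do rewrite gee0_abs ?lee_fin//.
have int2 : muM.-integrable setT (fun x => (F2 x)%:E).
  apply/integrableP; split; first exact/measurable_EFinP.
  under eq_integral => x _ do rewrite gee0_abs ?lee_fin//.
  by rewrite E2 lte_mul_pinfty// lee_fin ltW.
(* On leaves that leave [Omega] both sides are 0; on the others [CB + DD x] is nonnegative, so the
   absolute value may be dropped. *)
have FE x : (DD x * kx x)%:E = ((F2 x)%:E - CB%:E * (F1 x)%:E)%E.
  rewrite -EFinM -EFinB; congr EFin; rewrite /F1 /F2 indicE.
  case: (boolP (x \in SL)) => [/set_mem Sx|/negP nS]; last first.
    have [-> _] := off_leaf (fun h => nS (mem_set h)).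
    by rewrite /= !mul0r mulr0 subr0.
  have Ox : Omega x by apply: Sx; exact: leaf_refl.
  have [n nN /core_obox On] := covN Ox.
  have := dd_bound nN (trv_valid BC On); rewrite (dd_trv On) => h; have := le_trans h (HC _ nN).
  rewrite ler_norml => /andP[h1 _]; rewrite ger0_norm /=; last lra.
  exact: split_algebra.
have int1' : muM.-integrable setT (fun x => CB%:E * (F1 x)%:E)%E by exact: integrableZl.
rewrite (_ : (fun x => _) = fun x => ((F2 x)%:E - CB%:E * (F1 x)%:E)%E); last by apply/funext => x; exact: FE.
split; first exact: integrableB.
rewrite integralB// integralZl// E2 subee// fin_numM//.
Qed.

End box_cover.

End family_of_maps.

(** * Differentiation under the integral and conclusion *)

Lemma derive_quadratic (R : realType) (f : R -> R) (l C r : R) : 0 < r ->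
  (forall t : R, `|t| < r -> `|f t - f 0 - t * l| <= C * t ^+ 2) -> is_derive (0 : R) (1 : R) f l.
Proof.
move=> r0 H; suff cl : h^-1 *: ((f \o shift 0) (h *: (1 : R)) - f 0) @[h --> 0^'] --> l.
  by split; [apply/cvg_ex; exists l|exact: cvg_lim].
apply/cvgrPdist_le => e e0; have C1 : 0 < `|C| + 1 by have := normr_ge0 C; lra.
have d0 : 0 < Num.min r (e / (`|C| + 1)) by rewrite lt_min r0 divr_gt0.
rewrite near_withinE; apply/nbhs_ballP; exists (Num.min r (e / (`|C| + 1))) => //= h.
rewrite -ball_normE /= sub0r normrN lt_min => /andP[hr he] h0.
have n0 : 0 < `|h| by rewrite normr_gt0.
rewrite /shift /= addr0 [h *: 1]mulr1 -[_ *: _]/(h^-1 * (f h - f 0)).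
have -> : l - h^-1 * (f h - f 0) = - (h^-1 * (f h - f 0 - h * l)).
  by field.
rewrite normrN normrM normfV ler_pdivrMl//; apply: le_trans (H h hr) _.
have -> : C * h ^+ 2 = `|h| * (C * `|h|) by rewrite -real_normK ?num_real// expr2; ring.
apply: ler_wpM2l => //; move: he; rewrite ltr_pdivlMr// => he.
apply: le_trans (ltW he); rewrite mulrC; apply: ler_wpM2l => //; have := ler_norm C; lra.
Qed.

(* [mu_M g] is only a set function, not a measure by construction. *)
Lemma eq_set_integral d (T : measurableType d) (R : realType) (mu nu : set T -> \bar R) D (f : T -> \bar R) :
  (forall A, measurable A -> mu A = nu A) -> integral mu D f = integral nu D f.
Proof.
move=> E; rewrite /integral.
have S (h : @HBNNSimple.NonNegSimpleFun.type _ T R) : sintegral mu h = sintegral nu h.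
  rewrite /sintegral; apply: eq_fsbigr => x _; rewrite E//; exact: measurable_sfunP.
by congr (ereal_sup _ - ereal_sup _)%E; apply/seteqP; split => _ [h Hh <-]; exists h => //; rewrite S.
Qed.

Lemma integrableZl_EFin d (T : measurableType d) (R : realType) (mu : {measure set T -> \bar R}) D (c : R) (f : T -> R) :
  measurable D -> mu.-integrable D (EFin \o f) -> mu.-integrable D (EFin \o (fun x => c * f x)).
Proof. by move=> mD /(integrableZl mD c); congr (_.-integrable _ _). Qed.

Lemma integrableB_EFin d (T : measurableType d) (R : realType) (mu : {measure set T -> \bar R}) D (f h : T -> R) :
  measurable D -> mu.-integrable D (EFin \o f) -> mu.-integrable D (EFin \o h) ->
  mu.-integrable D (EFin \o (fun x => f x - h x)).
Proof. by move=> mD If Ih; have := integrableB mD If Ih; congr (_.-integrable _ _). Qed.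

(** A remainder bounded uniformly on [D] survives integration against the nonnegative function [k];
    this replaces a dominated convergence argument. *)
Lemma Rintegral_quadratic d (T : measurableType d) (R : realType) (mu : {measure set T -> \bar R}) D (f0 ft f1 k : T -> R) (t C : R) :
  measurable D -> mu.-integrable D (EFin \o (fun x => ft x * k x)) -> mu.-integrable D (EFin \o (fun x => f0 x * k x)) ->
  mu.-integrable D (EFin \o (fun x => f1 x * k x)) -> mu.-integrable D (EFin \o k) -> (forall x, 0 <= k x) ->
  (forall x, D x -> `|ft x - f0 x - t * f1 x| <= C * t ^+ 2) ->
  `|(\int[mu]_(x in D) (ft x * k x))%R - (\int[mu]_(x in D) (f0 x * k x))%R - t * (\int[mu]_(x in D) (f1 x * k x))%R| <=
    C * (\int[mu]_(x in D) k x)%R * t ^+ 2.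
Proof.
move=> mD it i0 i1 ik k0 H; have iZ := integrableZl_EFin t mD i1; have iB := integrableB_EFin mD it i0.
have iA := integrableB_EFin mD iB iZ.
rewrite -RintegralZl// -RintegralB// -RintegralB//.
apply: le_trans (le_normr_Rintegral mD iA) _.
rewrite mulrAC -RintegralZl//; apply: le_Rintegral => //.
- exact: integrable_norm.
- exact: integrableZl_EFin.
move=> x Dx; have -> : ft x * k x - f0 x * k x - t * (f1 x * k x) = (ft x - f0 x - t * f1 x) * k x by ring.
by rewrite normrM [`|k x|]ger0_norm//; apply: ler_wpM2r => //; exact: H.
Qed.

Lemma bounded_on (R : realType) (T : topologicalType) (A : set T) (f : T -> R) : compact A -> continuous f ->
  [bounded f x | x in A].
Proof.
move=> cA cf; have : bounded_set (f @` A).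
  by apply: compact_bounded; apply: continuous_compact => //; exact: continuous_subspaceT.
move=> [K [Kr HK]]; exists K; split => // x Kx y Ay /=; apply: (HK x Kx); by exists y.
Qed.

Theorem theorem4p2 (R : realType) (p q p' q' : nat)
  (M : foliatedManifold R p q) (g : bundleLikeMetric M)
  (M' : foliatedManifold R p' q') (g' : bundleLikeMetric M')
  (phi : M -> M') (phi_smooth : smooth_map phi) (phi_foliated : foliated_map phi)
  (compact_leaves : forall x : M, compact (leaf x))
  (Omega : set M) (Omega_compact : compact Omega)
  (V : M -> 'rV[R]_q') (eps : R) (Phi : R -> M -> M')
  (Phi_variation : foliated_variation g' phi V eps Phi)
  (Phi_supported : supported_in phi eps Phi Omega) :
  is_derive (0 : R) (1 : R) (fun t : R => E_B g g' (Phi t) Omega)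
    (- fine (\int[mu_M g]_(x in (Omega : set (borel_of M)))
        (pb_metric g' phi x (V x) (tau_b g g' phi x) * (fine (vol_L g x))^-1)%:E)%E).
Proof.
have [eps0 sF fF P0 HV] := Phi_variation.
have PE : phi = Phi 0 by apply/funext => x; rewrite P0.
rewrite {}PE in Phi_supported HV * => {P0 phi_smooth phi_foliated Phi_variation phi}.
(* Goodness is carried in the index type, so the countable cover extracted below consists of good
   boxes only. *)
pose I := {b : box M M' | good g g' eps Phi b}.
have gbx x : exists b : I, cod M (bi (sval b)) (bu (sval b)) /\ icoord M (bi (sval b)) (bu (sval b)) = x.
  by have [b [gb Cb bx]] := good_box g g' eps0 sF fF x; exists (exist _ b gb).
pose O (b : I) := icoord M (bi (sval b)) @` ball (bu (sval b)) (br (sval b) / 4).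
have bpos (b : I) : 0 < br (sval b) / 4 by have := good_r (svalP b); lra.
have BC (b : I) : ball (bu (sval b)) (br (sval b) / 4) `<=` cod M (bi (sval b)).
  move=> u uB; apply: (fsl_cod (good_dom (svalP b) _)); apply: le_ball uB; have := bpos b; lra.
have oO b : open (O b) by apply: icoord_open; [exact: ball_open|exact: BC].
have Ox x : exists b, O b x.
  by have [b [Cb bx]] := gbx x; exists b; exists (bu (sval b)) => //; exact: ballxx.
have [b0 _] := gbx point; have [s Hs] := lindelof b0 (@carrier_countable _ _ _ M) oO Ox.
pose b_ n := sval (s n); have gb n : good g g' eps Phi (b_ n) := svalP (s n).
have [N HN] := finite_subcover Omega_compact (fun n => oO (s n)) (fun x _ => Hs x).
have covC : forall x, exists n, core b_ n x by exact: Hs.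
have covN : forall x, Omega x -> exists2 n, (n < N)%N & core b_ n x by exact: HN.
have offO t x : `|t| < eps -> ~ Omega x -> Phi t x = Phi 0 x by exact: Phi_supported.
pose mu := muM g (box_cod gb) (measurable_cell gb).
have [iDD zDD] := integral_DD eps0 sF fF gb Omega_compact offO covC covN.
have mO : borel Omega by exact: measurable_Omega.
have muO : (mu Omega < +oo)%E by exact: (muM_Omega gb Omega_compact covN).
have [K K0 HK] := kx_bound gb covN.
have k0 x : 0 <= kx g x by exact: (kx_ge0 gb covC).
have intf (f : M -> R) : continuous f -> mu.-integrable (Bset Omega) (EFin \o (fun x => f x * kx g x)).
  move=> cf; apply: measurable_bounded_integrable => //.
    apply: measurable_funTS; apply: measurable_funM; last exact: (measurable_kx gb covC).
    by apply: continuous_BorelR; [exact: openT|move=> x _; exact: cf].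
  have [B [Br HB]] := bounded_on Omega_compact cf.
  exists ((`|B| + 1) * K); split; first exact: num_real.
  move=> y /ltW By x Ox' /=; apply: le_trans By; rewrite normrM [`|kx g x|]ger0_norm//.
  apply: ler_pM => //; last exact: HK.
  by apply: (HB (`|B| + 1)) => //; have := ler_norm B; lra.
have muE (f : M -> \bar R) : integral (mu_M g) (Bset Omega) f = integral mu (Bset Omega) f.
  apply: eq_set_integral => A mA; apply: (mu_MeM g (box_cod gb) (measurable_cell gb) (cell_obox gb)) => //.
    exact: trivIset_cell.
  exact: cell_cover.
pose F t := (\int[mu]_(x in (Bset Omega)) (EN g g' Phi t x * kx g x))%R.
pose F1 := (\int[mu]_(x in (Bset Omega)) (E1 g g' Phi x * kx g x))%R.
have EB t : E_B g g' (Phi t) Omega = 2^-1 * F t by rewrite /E_B muE.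
pose P x := pb_metric g' (Phi 0) x (V x) (tau_b g g' (Phi 0) x).
have E1P x : E1 g g' Phi x = 2 * (DD g g' Phi x - P x) by exact: (E1E g eps0 sF fF HV).
have i1 := intf _ (continuous_E1 eps0 sF fF (g := g) (g' := g')).
have iD : mu.-integrable (Bset Omega) (EFin \o (fun x => DD g g' Phi x * kx g x)).
  by apply: integrableS iDD => //; exact: measurableT.
have ID : (\int[mu]_(x in (Bset Omega)) (DD g g' Phi x * kx g x))%R = 0.
  rewrite /Rintegral integral_mkcond -[RHS]/(fine (0 : \bar R)) -zDD; congr fine; apply: eq_integral => x _.
  rewrite patchE; case: ifPn => // /negP nO.
  by rewrite (DD_off eps0 sF fF gb Omega_compact offO covC (fun h => nO (mem_set h))) mul0r.
(* The first-order density is [2 * (DD - P)], and the part with [DD] integrates to 0 over [Omega],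
   since [DD] vanishes outside. *)
have -> : - fine (\int[mu_M g]_(x in (Omega : set (borel_of M))) (P x * (fine (vol_L g x))^-1)%:E)%E = 2^-1 * F1.
  rewrite muE -[fine _]/(\int[mu]_(x in (Bset Omega)) (P x * kx g x))%R.
  have -> : (\int[mu]_(x in (Bset Omega)) (P x * kx g x))%R =
      (\int[mu]_(x in (Bset Omega)) (DD g g' Phi x * kx g x - 2^-1 * (E1 g g' Phi x * kx g x)))%R.
    by apply: eq_Rintegral => x _; rewrite E1P; field.
  have iZ : mu.-integrable (Bset Omega) (EFin \o (fun x => 2^-1 * (E1 g g' Phi x * kx g x))).
    exact: integrableZl_EFin.
  by rewrite RintegralB// RintegralZl// ID sub0r opprK.
(* [C] and [r] are common to the finitely many boxes whose cores cover [Omega], so the second-order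
   remainder is uniform there. *)
have [C C0 HC] := finite_ub N (fun n => bC (b_ n)).
have [r r0 Hr] : exists2 r, 0 < r & forall n, (n < N)%N -> r <= br (b_ n).
  apply: finite_pos_min => [n d d' H /andP[_ dd]|n]; first exact: le_trans H.
  by exists (br (b_ n)) => //; exact: good_r (gb n).
have ik : mu.-integrable (Bset Omega) (EFin \o (kx g)).
  by have := intf (cst 1) (fun x => @cst_continuous _ _ _ _); congr (_.-integrable _ _); apply/funext => x /=; rewrite mul1r.
pose k := (\int[mu]_(x in (Bset Omega)) kx g x)%R.
apply: (@derive_quadratic _ _ _ (2^-1 * (C * k)) (Num.min r eps)); first by rewrite lt_min r0.
move=> t; rewrite lt_min => /andP[tr te]; rewrite !EB.
have -> : 2^-1 * F t - 2^-1 * F 0 - t * (2^-1 * F1) = 2^-1 * (F t - F 0 - t * F1).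
  by rewrite -!mulrBr [t * _]mulrCA -mulrBr.
rewrite normrM ger0_norm// -mulrA; apply: ler_wpM2l => //.
have it := intf _ (continuous_EN sF fF te (g := g) (g' := g')).
have i0 : mu.-integrable (Bset Omega) (EFin \o (fun x => EN g g' Phi 0 x * kx g x)).
  by apply: intf; apply: (continuous_EN sF fF); rewrite normr0.
apply: (Rintegral_quadratic mO it i0 i1 ik k0).
move=> x Ox'; have [n nN /(core_obox gb)[u uB ux]] := covN x Ox'.
have [_ H] := good_EN (gb n) uB (lt_le_trans tr (Hr _ nN)).
rewrite ux in H; apply: le_trans H _; apply: ler_wpM2r; [exact: sqr_ge0|exact: HC].
Qed.
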